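(* Let $\beta$ be the constant with $0.4464<\beta<0.4465$ which, together with a constant $\alpha>0$, satisfies $$\alpha=\frac{1-\mathbb E[U_1^\beta]^2-\mathbb E[U_2^\beta]^2}{\mathbb E[U_3^\beta]^2}=\frac{\mathbb E[V_3^\beta]^2}{1-\mathbb E[V_1^\beta]^2-\mathbb E[V_2^\beta]^2},$$ where $(U_1,U_2,U_3)$ and $(V_1,V_2,V_3)$ are the random vectors defined in the context. For each $n\ge 1$ let $T$ and $T'$ be two independent uniform random leaf-labeled binary trees with leaf set $\{1,\ldots,n\}$, and let $\kappa(T,T')$ be the size of their largest common subtree. Then for every $\beta'<\beta$ one has $\mathbb E[\kappa(T,T')]=\Omega(n^{\beta'})$ as $n\to\infty$.
   Context: A binary tree is a finite tree in which every vertex has degree 1 or 3 (a single vertex is allowed as the tree with one leaf). Vertices of degree 1 are leaves; the others are branch points. If $T$ is a binary tree and $B$ is a subset of its leaves, $T|_B$ denotes the induced binary tree with leaf set $B$: take the subtree spanned by $B$ and suppress the vertices of degree two. Two binary trees with common leaf set $A$ are equivalent if there is a graph isomorphism between them that is the identity on $A$. A (non-rooted) leaf-labeled binary tree with leaf set $A$ is an equivalence class; there are finitely many, and a uniform random one is chosen uniformly from this finite set. For two leaf-labeled binary trees $T,T'$ with leaf set $\{1,\ldots,n\}$, $\kappa(T,T')$ is the largest cardinality of a subset $B\subseteq\{1,\ldots,n\}$ such that $T|_B$ and $T'|_B$ are equivalent. Dirichlet distributions: for a subset $E$ of the simplex $\{(x_1,x_2,x_3): x_i\ge 0,\ \sum_i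 x_i=1\}$ and $a_1,a_2,a_3\in\mathbb R$ (possibly negative), the Dirichlet$(a_1,a_2,a_3)$ distribution on $E$ is the probability measure on $E$ with density (with respect to two-dimensional Lebesgue measure on the simplex) proportional to $\prod_i x_i^{a_i-1}$, assuming the integral over $E$ is finite. $(U_1,U_2,U_3)$ has the Dirichlet$(-1/2,-1/2,1/2)$ distribution on the subset of the simplex given by $x_1\le x_2\le \frac12$ and $x_3\le\frac12$. $(V_1,V_2,V_3)$ has the Dirichlet$(1/2,1/2,-1/2)$ distribution on the subset of the simplex given by $x_1\le\frac12$ and $x_2\le\frac12$. The notation $\mathbb E[X]^2$ means $(\mathbb E[X])^2$. The value of $\beta$ solving the equation in the claim is unique. *)

(* Defs.v *)
From HB Require Import structures.
From mathcomp Require Import all_boot all_order all_algebra.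
From mathcomp Require Import all_classical all_reals all_analysis.
From mathcomp Require Import measurable_realfun.

Set Implicit Arguments.
Unset Strict Implicit.
Unset Printing Implicit Defensive.

Import Order.TTheory GRing.Theory Num.Theory.
Import numFieldNormedType.Exports.

Local Open Scope ring_scope.

(** * Leaf-labeled binary trees *)

(* A finite graph some of whose vertices carry a label in [A]. In a
   leaf-labeled tree the labeled vertices are exactly the leaves. *)
Record lgraph (A : finType) := LGraph {
  vertex : finType;
  adj : rel vertex;
  label : vertex -> option A
}.

Section LabeledTrees.
Variable A : finType.
Implicit Types (G H : lgraph A) (B : {set A}).

Definition degree G (x : vertex G) : nat := #|[set y | adj x y]%SET|.

Definition is_tree G : Prop :=
  [/\ (0 < #|vertex G|)%N, symmetric (@adj A G), irreflexive (@adj A G),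
      forall x y : vertex G, connect (@adj A G) x y
    & forall p : seq (vertex G), (2 < size p)%N -> ~ ucycle (@adj A G) p].

Definition is_binary_tree G : Prop :=
  is_tree G /\
  (#|vertex G| = 1%N \/
   forall x : vertex G, degree x = 1%N \/ degree x = 3%N).

(* The only vertex of degree 0 in a tree is that of the one-vertex tree, which
   is a leaf as well. *)
Definition is_leaf G (x : vertex G) : Prop := (degree x <= 1)%N.

Definition is_leaf_labeled_binary_tree G B : Prop :=
  [/\ is_binary_tree G,
      forall x : vertex G, is_leaf x <-> label x <> None,
      forall (x : vertex G) a, label x = Some a -> a \in B
    & forall a, a \in B -> exists! x : vertex G, label x = Some a].

(* Label preserving graph isomorphism. *)
Definition equivalent G H : Prop :=
  exists f : vertex G -> vertex H,
    [/\ bijective f, forall x y, adj (f x) (f y) = adj x y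
      & forall x, label (f x) = label x].

Section Restriction.
Variables (G : lgraph A) (B : {set A}).

Definition labeled_in (x : vertex G) : Prop :=
  exists2 a, a \in B & label x = Some a.

(* The vertices of the subtree spanned by [B]: those lying on a simple path
   between two (possibly equal) leaves with labels in [B]. *)
Definition span : {set vertex G} :=
  [set z | `[< exists x p, [/\ labeled_in x, labeled_in (last x p),
      path (@adj A G) x p, uniq (x :: p) & z \in x :: p] >]]%SET.

Definition span_degree (x : vertex G) : nat :=
  #|[set y in span | adj x y]%SET|.

Definition kept : {set vertex G} := [set x in span | span_degree x != 2]%SET.

Definition suppressed : {set vertex G} :=
  [set x in span | span_degree x == 2]%SET.

(* After suppression, two kept vertices are adjacent when they are the ends of
   a simple path, of at least one edge, all of whose interior vertices are
   suppressed. *)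
Definition suppressed_adj : rel {x : vertex G | x \in kept} :=
  fun x y => `[< exists p : seq (vertex G),
    [/\ path (@adj A G) (val x) (rcons p (val y)),
        uniq (val x :: rcons p (val y)) & all [in suppressed] p] >].

(* The induced tree T|_B. *)
Definition restrict : lgraph A :=
  @LGraph A {x : vertex G | x \in kept} suppressed_adj (fun x => label (val x)).

End Restriction.

Definition kappa G H : nat :=
  (\max_(B : {set A} | `[< equivalent (restrict G B) (restrict H B) >]) #|B|)%N.

End LabeledTrees.

(** * Uniform random leaf-labeled binary trees with [n] leaves *)

(* A binary tree with n >= 2 leaves has n - 2 branch points (and 0 = 1 - 2
   branch points for n = 1), so up to equivalence its vertex set is
   'I_n + 'I_(n - 2), with the leaf of label i at [inl i]. The leaf set
   {1, ..., n} is represented by 'I_n. *)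
Definition tree_vertex (n : nat) : finType := ('I_n + 'I_(n - 2))%type.

Definition graph_of (n : nat) (E : {set tree_vertex n * tree_vertex n}) :
    lgraph 'I_n :=
  @LGraph 'I_n (tree_vertex n) (fun x y => (x, y) \in E)
    (fun x => if x is inl i then Some i else None).

Definition binary_trees (n : nat) : {set {set tree_vertex n * tree_vertex n}} :=
  [set E | `[< is_leaf_labeled_binary_tree (graph_of E) [set: 'I_n]%SET >]]%SET.

Definition tree_classes (n : nat) :
    {set {set {set tree_vertex n * tree_vertex n}}} :=
  equivalence_partition
    (fun E E' => `[< equivalent (graph_of E) (graph_of E') >])
    (binary_trees n).

(* [kappa] is invariant under equivalence, so the maximum is over equal
   values. *)
Definition kappa_class (n : nat)
    (c c' : {set {set tree_vertex n * tree_vertex n}}) : nat :=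
  (\max_(E in c) \max_(E' in c') kappa (graph_of E) (graph_of E'))%N.

(* The expectation of kappa(T, T') for T, T' independent and uniform over
   [tree_classes n], i.e., for (T, T') uniform over pairs of classes. *)
Definition expected_kappa (R : realType) (n : nat) : R :=
  (\sum_(c in tree_classes n) \sum_(c' in tree_classes n)
     (kappa_class c c')%:R) / (#|tree_classes n| ^ 2)%:R.

(** * Dirichlet distributions on subsets of the simplex *)

Local Open Scope classical_set_scope.

Section Dirichlet.
Variable R : realType.

Definition real_triple : Type :=
  (measurableTypeR R * measurableTypeR R * measurableTypeR R)%type.
HB.instance Definition _ := Measurable.on real_triple.

Definition coord1 (x : real_triple) : R := x.1.1.
Definition coord2 (x : real_triple) : R := x.1.2.
Definition coord3 (x : real_triple) : R := x.2.

Definition simplex : set real_triple :=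
  [set x | [/\ 0 <= coord1 x, 0 <= coord2 x, 0 <= coord3 x
             & coord1 x + coord2 x + coord3 x = 1]].

(* The chart (x1, x2) |-> (x1, x2, 1 - x1 - x2) of the plane containing the
   simplex. *)
Definition chart (x : measurableTypeR R * measurableTypeR R) : real_triple :=
  (x.1, x.2, 1 - x.1 - x.2).

Lemma measurable_chart : measurable_fun setT chart.
Proof.
apply: measurable_fun_pair; last first.
  apply: measurable_funB; last exact: measurable_snd.
  by apply: measurable_funB => //; exact: measurable_fst.
by apply: measurable_fun_pair; [exact: measurable_fst|exact: measurable_snd].
Qed.

(* Two-dimensional Lebesgue measure on the plane x1 + x2 + x3 = 1, up to a
   constant factor (sqrt 3) which normalization cancels. *)
Definition plane_lebesgue : set real_triple -> \bar R :=
  pushforward (lebesgue_measure \x lebesgue_measure)%E chart.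

Section PlaneLebesgueMeasure.

Let mchart : measurable_fun setT chart := measurable_chart.

Let plane_lebesgue0 : plane_lebesgue set0 = 0%E.
Proof. exact: measure0. Qed.

Let plane_lebesgue_ge0 A : (0 <= plane_lebesgue A)%E.
Proof. exact: measure_ge0. Qed.

Let plane_lebesgue_sigma_additive : semi_sigma_additive plane_lebesgue.
Proof. exact: measure_semi_sigma_additive. Qed.

HB.instance Definition _ := isMeasure.Build _ _ _ plane_lebesgue
  plane_lebesgue0 plane_lebesgue_ge0 plane_lebesgue_sigma_additive.

End PlaneLebesgueMeasure.

(* For a negative exponent, [powR] takes the default value 0 at 0; this only
   concerns the boundary of the simplex, which has measure zero. *)
Definition dirichlet_density (a1 a2 a3 : R) (x : real_triple) : R :=
  coord1 x `^ (a1 - 1) * coord2 x `^ (a2 - 1) * coord3 x `^ (a3 - 1).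

Lemma measurable_coord1 : measurable_fun setT coord1.
Proof. by apply: measurableT_comp; [exact: measurable_fst|exact: measurable_fst]. Qed.

Lemma measurable_coord2 : measurable_fun setT coord2.
Proof. by apply: measurableT_comp; [exact: measurable_snd|exact: measurable_fst]. Qed.

Lemma measurable_coord3 : measurable_fun setT coord3.
Proof. exact: measurable_snd. Qed.

Lemma measurable_dirichlet_density a1 a2 a3 :
  measurable_fun setT (dirichlet_density a1 a2 a3).
Proof.
have mp a (f : real_triple -> R) : measurable_fun setT f ->
    measurable_fun setT (fun x => f x `^ a).
  exact: measurableT_comp (@measurable_powR R a).
apply: measurable_funM; last by apply: mp; exact: measurable_coord3.
apply: measurable_funM; first by apply: mp; exact: measurable_coord1.
by apply: mp; exact: measurable_coord2.
Qed.

Section Distribution.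
Variables (E : set real_triple) (mE : measurable E) (a1 a2 a3 : R).
Local Open Scope ereal_scope.

(* The measurability proof is an argument only so that the measure structure
   below can be inferred. *)
Definition dirichlet_weight (mE : measurable E) (A : set real_triple) :
    \bar R :=
  \int[plane_lebesgue]_(x in A `&` E) (dirichlet_density a1 a2 a3 x)%:E.

Let density_ge0 (x : real_triple) : 0 <= (dirichlet_density a1 a2 a3 x)%:E.
Proof. by rewrite lee_fin !mulr_ge0 ?powR_ge0. Qed.

Let weight0 : dirichlet_weight mE set0 = 0.
Proof. by rewrite /dirichlet_weight set0I integral_set0. Qed.

Let weight_ge0 A : 0 <= dirichlet_weight mE A.
Proof. exact: integral_ge0. Qed.

Let weight_sigma_additive : semi_sigma_additive (dirichlet_weight mE).
Proof.
move=> F mF tF mUF; rewrite /dirichlet_weight; apply: cvg_toP.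
  apply: ereal_nondecreasing_is_cvgn => m n mn.
  by apply: lee_sum_nneg_natr => // k _ _; exact: integral_ge0.
rewrite setI_bigcupl ge0_integral_bigcup//=.
- by move=> k; exact: measurableI.
- apply/measurable_funTS/measurableT_comp => //.
  exact: measurable_dirichlet_density.
- by apply: trivIset_setIr tF.
Qed.

HB.instance Definition _ := isMeasure.Build _ _ _ (dirichlet_weight mE)
  weight0 weight_ge0 weight_sigma_additive.

(* [mnormalize] divides by the total mass; the Dirac mass is only a default
   value for when that mass is zero or infinite. *)
Definition dirichlet : probability real_triple R :=
  mnormalize (dirichlet_weight mE) (dirac ((0, 0, 1)%R : real_triple)).

End Distribution.

Definition U_domain : set real_triple :=
  simplex `&` [set x | [/\ coord1 x <= coord2 x, coord2 x <= 2^-1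
                         & coord3 x <= 2^-1]].

Definition V_domain : set real_triple :=
  simplex `&` [set x | coord1 x <= 2^-1 /\ coord2 x <= 2^-1].

Let measurable_le (f g : real_triple -> R) :
  measurable_fun setT f -> measurable_fun setT g ->
  measurable [set x | f x <= g x].
Proof.
move=> mf mg; rewrite -[X in measurable X]setTI.
exact: measurable_fun_le.
Qed.

Let measurable_simplex : measurable simplex.
Proof.
have m1 := measurable_coord1; have m2 := measurable_coord2.
have m3 := measurable_coord3.
have ms : measurable_fun setT (fun x => coord1 x + coord2 x + coord3 x).
  by apply: measurable_funD m3; apply: measurable_funD.
have mc r : measurable_fun setT (fun _ : real_triple => r : R) by [].
rewrite (_ : simplex =
    ([set x | 0 <= coord1 x] `&` [set x | 0 <= coord2 x]) `&`
    ([set x | 0 <= coord3 x] `&`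
     ([set x | coord1 x + coord2 x + coord3 x <= 1] `&`
      [set x | 1 <= coord1 x + coord2 x + coord3 x]))); last first.
  apply/seteqP; split => x /=.
    by case=> x1 x2 x3 ->.
  case=> -[x1 x2] [x3 [sle sge]]; split => //.
  by apply/eqP; rewrite eq_le sle.
by do ![apply: measurableI]; exact: measurable_le.
Qed.

Lemma measurable_U_domain : measurable U_domain.
Proof.
have m1 := measurable_coord1; have m2 := measurable_coord2.
have m3 := measurable_coord3.
have mc r : measurable_fun setT (fun _ : real_triple => r : R) by [].
apply: measurableI => //.
rewrite (_ : [set x | _] = [set x | coord1 x <= coord2 x] `&`
    ([set x | coord2 x <= 2^-1] `&` [set x | coord3 x <= 2^-1])); last first.
  by apply/seteqP; split => x /= [] // ? [].
by do ![apply: measurableI]; exact: measurable_le.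
Qed.

Lemma measurable_V_domain : measurable V_domain.
Proof.
have m1 := measurable_coord1; have m2 := measurable_coord2.
have mc r : measurable_fun setT (fun _ : real_triple => r : R) by [].
apply: measurableI => //.
rewrite (_ : [set x | _] =
    [set x | coord1 x <= 2^-1] `&` [set x | coord2 x <= 2^-1]) //.
by apply: measurableI; exact: measurable_le.
Qed.

Definition U_law : probability real_triple R :=
  dirichlet measurable_U_domain (- 2^-1) (- 2^-1) 2^-1.

Definition V_law : probability real_triple R :=
  dirichlet measurable_V_domain 2^-1 2^-1 (- 2^-1).

(* E[X^b], for X a coordinate of a random vector of law P. *)
Definition moment (P : probability real_triple R) (X : real_triple -> R)
    (b : R) : R := fine 'E_P[fun x => X x `^ b].

End Dirichlet.

(* Main.v *)
From HB Require Import structures.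
From mathcomp Require Import all_boot.
From mathcomp Require Import boolp.
From mathcomp Require Import zify.
Require Import Defs.

Set Implicit Arguments.
Unset Strict Implicit.
Unset Printing Implicit Defensive.

(** Both trees are rooted at the same leaf [rho]. A leaf-labeled tree is then
    determined by its hierarchy, the family of the label sets (clusters) below
    its vertices other than the root, and two trees induce the same tree on
    [rho] and a set [B] of other labels when their clusters have the same traces
    on [B] ([restrict_equivalent]). So kappa is at least the [agreement], the
    largest size of such a [B]. Every hierarchy is read by exactly 2 ^ (n - 2)
    plane trees ([realization], [count_same_clusters]), so uniform random classes
    can be replaced by uniform random plane trees, which grow by inserting the
    leaves one by one; in particular the tree induced by such a tree on a subset
    of the leaves is uniform again ([big_trees_restrict]).

    A common subtree is built recursively. Let F and G be the expected agreements
    of two random trees with n leaves besides the root, or besides two roots that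
    both have to be in the common subtree. A tree with one root is cut at the vertex
    all three branches of which have at most n / 2 leaves ([central_sum]); two of
    the branches have one root, the vertex, and the branch of the old root has two.
    A tree with two roots is cut at the vertex of the path between them where the
    number of leaves behind falls below n / 2 ([spinal_sum]); two of the branches have
    two roots and the branch at the side has one. When two trees are cut, common
    subtrees of corresponding branches can be glued ([agreement_central],
    [agreement_spinal]). Corresponding branches, on X and X', only share the leaves
    of the intersection of X and X', on which they induce independent uniform trees.
    So F (n) is at least the average over two independent random splits of
    F (|X1 & X1'|) + F (|X2 & X2'|) + G (|X3 & X3'|), and similarly for G
    ([central_recursion], [spinal_recursion]).

    Given the sizes k and k' of two branches, the size of their intersection is
    hypergeometric, of mean k k' / n and variance at most the mean
    ([variance_bound]). So if F and G are at least C n^b and C alpha n^b for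
    smaller sizes, the recursion gives for n the lower bounds, up to a factor that
    tends to 1,
      C n^b (u1^2 + u2^2 + alpha u3^2)
    and
      C n^b (alpha v1^2 + alpha v2^2 + v3^2),
    where u and v are the b-th moments of the relative sizes of the branches
    ([central_step], [spinal_step]). The split probabilities are products of central
    binomial ratios, and converge to the Dirichlet densities of the random vectors
    U and V; the convergence is dominated, so u and v converge to the moments of U
    and V, the normalizing constant being obtained from the total mass
    ([U_moment_cvg], [V_moment_cvg]).

    At the exponent beta the limits of the two parentheses are 1 and alpha. For a
    positive exponent b < beta the moments of V do not decrease, and those of U grow by a
    factor 2^(beta - b) at least, since the coordinates of U are at most 1/2.
    So after lowering alpha slightly both limits are strictly larger than needed
    ([fixed_point_gap]), and the bounds hold for all n by induction
    ([agreement_lower_bound]). *)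

Local Open Scope nat_scope.

(** * Plane binary trees and their clusters *)

(** A rooted tree all of whose branch points have two children, drawn in the
    plane. The root itself is not a node: it is the other end of the edge
    above the top node, so that [Leaf a] stands for a tree with a single edge.
    The order of the two branches is extra information, which multiplies all
    counts by the same power of 2 and makes structural recursion possible. *)
Inductive btree (T : Type) := Leaf of T | Node of btree T & btree T.

Section BtreeEq.
Variable T : eqType.

Fixpoint btree_eqb (t u : btree T) : bool :=
  match t, u with
  | Leaf a, Leaf b => a == b
  | Node t1 t2, Node u1 u2 => btree_eqb t1 u1 && btree_eqb t2 u2
  | _, _ => false
  end.

Lemma btree_eqP : Equality.axiom btree_eqb.
Proof.
elim=> [a|t1 IH1 t2 IH2] [b|u1 u2] /=; try by constructor.
  by apply: (iffP eqP) => [->|[]].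
by apply: (iffP andP) => [[/IH1-> /IH2->]|[<- <-]] //; split; [apply/IH1|apply/IH2].
Qed.

HB.instance Definition _ := hasDecEq.Build (btree T) btree_eqP.

End BtreeEq.

Section Clusters.
Variable T : finType.
Implicit Types (t u C : btree T) (a b s x : T) (A B D I X Y : {set T}).

Fixpoint leaves t : seq T :=
  match t with Leaf a => [:: a] | Node l r => leaves l ++ leaves r end.

Definition support t : {set T} := [set x in leaves t].

Fixpoint clusters t : {set {set T}} :=
  match t with
  | Leaf a => [set [set a]]
  | Node l r => support (Node l r) |: (clusters l :|: clusters r)
  end.

(** The empty trace is always included: otherwise the presence of a leaf
    outside [B] could be detected by it. *)
Definition restrict_family B (F : {set {set T}}) : {set {set T}} :=
  set0 |: [set X :&: B | X in F].

(** For the families of clusters of two rooted trees this means that they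
    induce the same rooted tree on [B]: the clusters of an induced tree are
    the nonempty traces of clusters, and a rooted tree is determined by its
    clusters. *)
Definition agree B (F G : {set {set T}}) : bool :=
  restrict_family B F == restrict_family B G.

Lemma support_Leaf a : support (Leaf a) = [set a].
Proof. by apply/setP=> x; rewrite !inE. Qed.

Lemma support_Node t u : support (Node t u) = support t :|: support u.
Proof. by apply/setP=> x; rewrite !inE /= mem_cat. Qed.

Lemma size_leaves_gt0 t : 0 < size (leaves t).
Proof. by elim: t => //= l + r _; rewrite size_cat; case: (size (leaves l)). Qed.

Lemma support_neq0 t : support t != set0.
Proof.
apply/set0Pn; have := size_leaves_gt0 t; rewrite /support.
by case: (leaves t) => // a s _; exists a; rewrite !inE eqxx.
Qed.

Lemma mem_support t x : (x \in support t) = (x \in leaves t).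
Proof. by rewrite inE. Qed.

Lemma card_support t : uniq (leaves t) -> #|support t| = size (leaves t).
Proof. by move=> ut; rewrite cardsE; apply/card_uniqP. Qed.

Lemma support_clusters t : support t \in clusters t.
Proof. by case: t => [a|l r] /=; rewrite ?support_Leaf !inE ?eqxx. Qed.

Lemma clusters_sub t X : X \in clusters t -> X \subset support t.
Proof.
elim: t X => [a|l IHl r IHr] X /=; first by rewrite support_Leaf inE => /eqP->.
rewrite !inE support_Node => /or3P[/eqP->|/IHl XS|/IHr XS].
- exact: subxx.
- exact: subset_trans XS (subsetUl _ _).
- exact: subset_trans XS (subsetUr _ _).
Qed.

Lemma clusters_neq0 t X : X \in clusters t -> X != set0.
Proof.
elim: t X => [a|l IHl r IHr] X /=.
  by rewrite inE => /eqP->; apply/set0Pn; exists a; rewrite inE.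
by rewrite !inE => /or3P[/eqP->|/IHl|/IHr] //; apply: support_neq0.
Qed.

Lemma clusters1 t a : a \in leaves t -> [set a] \in clusters t.
Proof.
elim: t => [b|l IHl r IHr] /=; first by rewrite !inE => /eqP->.
by rewrite mem_cat !inE => /orP[/IHl->|/IHr->]; rewrite ?orbT.
Qed.

(** * Inserting a leaf *)

(** The leaf [a] can be grafted on each of the 2 m - 1 edges of a tree with m
    leaves, the edge above the top node included, on either side. That the
    number of results depends on m only is what makes the tree that remains
    after deleting leaves of a uniform random tree uniform. *)
Fixpoint insertions a t : seq (btree T) :=
  [:: Node (Leaf a) t; Node t (Leaf a)] ++
  match t with
  | Leaf _ => [::]
  | Node l r => [seq Node l' r | l' <- insertions a l] ++
                [seq Node l r' | r' <- insertions a r]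
  end.

(** Inverse of an insertion: the node above the deleted leaf is suppressed. *)
Fixpoint prune a t : option (btree T) :=
  match t with
  | Leaf x => if x == a then None else Some (Leaf x)
  | Node l r =>
    match prune a l, prune a r with
    | Some l', Some r' => Some (Node l' r')
    | Some l', None => Some l'
    | None, r' => r'
    end
  end.

Lemma size_insertions a t :
  size (insertions a t) = 2 * (2 * size (leaves t) - 1).
Proof.
elim: t => [x|l IHl r IHr] //=.
rewrite size_cat !size_map IHl IHr size_cat.
by have := size_leaves_gt0 l; have := size_leaves_gt0 r; lia.
Qed.

Lemma prune_id a t : a \notin leaves t -> prune a t = Some t.
Proof.
elim: t => [x|l IHl r IHr] /=; first by rewrite inE eq_sym => /negbTE->.
by rewrite mem_cat negb_or => /andP[/IHl-> /IHr->].
Qed.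

Lemma leaves_insertions a t u : u \in insertions a t ->
  perm_eq (leaves u) (a :: leaves t).
Proof.
have base (v : btree T) : perm_eq (leaves v ++ [:: a]) (a :: leaves v).
  by rewrite perm_catC.
elim: t u => [x|l IHl r IHr] u /=; rewrite !inE.
  by move=> /orP[] /eqP-> //; exact: (base (Leaf x)).
case/or3P=> [/eqP->|/eqP->|] //; first exact: (base (Node l r)).
rewrite mem_cat => /orP[] /mapP[v /[swap] -> /=].
  by move=> /IHl pv; rewrite -cat_cons perm_cat2r.
by move=> /IHr pv; rewrite perm_sym -cat1s perm_catCA /= perm_cat2l perm_sym.
Qed.

Lemma prune_insertions a t u : a \notin leaves t -> u \in insertions a t ->
  prune a u = Some t.
Proof.
elim: t u => [x|l IHl r IHr] u /=.
  rewrite !inE => ax; have xa : x == a = false by rewrite eq_sym (negbTE ax).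
  by move=> /orP[] /eqP-> /=; rewrite eqxx xa.
rewrite mem_cat negb_or => /andP[al ar]; rewrite !inE.
case/or3P=> [/eqP->|/eqP->|].
- by rewrite /= eqxx (prune_id al) (prune_id ar).
- by rewrite /= eqxx (prune_id al) (prune_id ar).
rewrite mem_cat => /orP[] /mapP[v /[swap] -> /=].
  by move=> vl; rewrite (IHl _ al vl) (prune_id ar).
by move=> vr; rewrite (IHr _ ar vr) (prune_id al).
Qed.

Lemma prune_None a u : prune a u = None -> {subset leaves u <= [:: a]}.
Proof.
elim: u => [x|l IHl r IHr] /=; first by case: eqP => // -> _ y.
case: (prune a l) IHl => [l'|] IHl; case: (prune a r) IHr => [r'|] IHr //.
by move=> _ y; rewrite mem_cat => /orP[/(IHl erefl)|/(IHr erefl)].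
Qed.

(** Together with [prune_insertions]: every tree with the leaf [a] arises from
    exactly one tree without it. *)
Lemma insertions_prune a t u : uniq (leaves u) -> a \in leaves u ->
  prune a u = Some t -> u \in insertions a t.
Proof.
have single v : uniq (leaves v) -> prune a v = None -> v = Leaf a.
  move=> + /prune_None; case: v => [x|l r] /= uv sv.
    by have := sv x; rewrite !inE eqxx => /(_ isT)/eqP->.
  exfalso; move: uv sv; have := size_leaves_gt0 r; have := size_leaves_gt0 l.
  case: (leaves l) => [|x sl] // _; case: (leaves r) => [|y sr] // _ uv sv.
  have := sv x; rewrite !inE eqxx => /(_ isT)/eqP xa.
  have := sv y; rewrite !inE mem_cat !inE eqxx !orbT => /(_ isT)/eqP ya.
  by move: uv; rewrite xa ya /= mem_cat inE eqxx orbT.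
elim: u t => [x|l IHl r IHr] t /=; first by rewrite inE eq_sym => _ ->.
rewrite cat_uniq mem_cat => /and3P[ul /hasPn dlr ur].
case: (boolP (a \in leaves l)) => [al _|al /= ar].
  have ar : a \notin leaves r by apply: contraL al; apply: dlr.
  rewrite (prune_id ar); case E : (prune a l) => [l'|] [<-].
    by rewrite /= !inE mem_cat (map_f (fun l => Node l r)) ?orbT //; apply: IHl.
  by rewrite (single _ ul E); case: (r) => * /=; rewrite !inE eqxx.
rewrite (prune_id al); case E : (prune a r) => [r'|] [<-].
  by rewrite /= !inE mem_cat (map_f (fun r => Node l r)) ?orbT //; apply: IHr.
by rewrite (single _ ur E); case: (l) => * /=; rewrite !inE eqxx ?orbT.
Qed.

(** No two insertions of [a] coincide, since the position of [a] in the result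
    can be recovered: [a] is not a leaf of [t]. *)
Lemma uniq_insertions a t : uniq (a :: leaves t) -> uniq (insertions a t).
Proof.
have nn s (l : btree T) : (Leaf s == l) = false -> Leaf s <> l by move/eqP.
elim: t => [x|l IHl r IHr] /=.
  rewrite !inE !andbT => ax; apply/eqP => -[xa _].
  by rewrite xa eqxx in ax.
rewrite mem_cat negb_or cat_uniq -!andbA.
move=> /and5P[al ar ul dlr ur].
have injl : injective (fun l' => Node l' r) by move=> ? ? [].
have injr : injective (fun r' => Node l r') by move=> ? ? [].
rewrite !inE cat_uniq !map_inj_uniq ?IHl ?IHr /= ?al ?ar //= !andbT !mem_cat.
have ll u : u \in insertions a l -> u <> Leaf a /\ u <> l /\ a \in leaves u.
  move=> ui; have /perm_size := leaves_insertions ui.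
  have := perm_mem (leaves_insertions ui) a; rewrite inE eqxx /= => au.
  have := size_leaves_gt0 l => l0 su; split; last split=> //.
    by move=> uE; move: su l0; rewrite uE /= => -[<-].
  by move=> uE; rewrite -uE au in al.
have rr u : u \in insertions a r -> u <> Leaf a /\ u <> r /\ a \in leaves u.
  move=> ui; have /perm_size := leaves_insertions ui.
  have := perm_mem (leaves_insertions ui) a; rewrite inE eqxx /= => au.
  have := size_leaves_gt0 r => r0 su; split; last split=> //.
    by move=> uE; move: su r0; rewrite uE /= => -[<-].
  by move=> uE; rewrite -uE au in ar.
apply/and3P; split.
- rewrite negb_or; apply/andP; split.
  + by apply/mapP => -[u /ll[uE _] [/esym]].
  + by apply/mapP => -[u _ [lE _]]; move: al; rewrite -lE inE eqxx.
- rewrite negb_or; apply/andP; split.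
  + apply/mapP => -[u /ll[_ [_ au]] [_ rE]].
    by rewrite -rE inE eqxx in ar.
  + by apply/mapP => -[u /rr[uE _]] [_ /esym].
- apply/hasPn=> v /mapP[u /rr[_ [_ au]] ->]; apply/mapP => -[w /ll[_ [wE _]] [/esym]].
  by [].
Qed.

End Clusters.

Section PlaneTrees.
Variable T : finType.
Implicit Types (t u C : btree T) (a b s x : T) (A B D I X Y : {set T}).

(** * All plane trees with given leaves *)

(** Inserting the leaves one after the other produces every tree exactly once,
    because pruning them in the reverse order is deterministic. *)
Fixpoint plane_trees (l : seq T) : seq (btree T) :=
  match l with
  | [::] => [::]
  | a :: l' =>
    if l' is [::] then [:: Leaf a] else flatten [seq insertions a t | t <- plane_trees l']
  end.

Lemma plane_treesE a b l : plane_trees [:: a, b & l] =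
  flatten [seq insertions a t | t <- plane_trees (b :: l)].
Proof. by []. Qed.

(** The number (2 m - 2)! / (m - 1)! of plane trees with m labeled leaves. *)
Fixpoint num_trees (m : nat) : nat :=
  match m with
  | 0 => 0
  | m'.+1 => if m' is 0 then 1 else 2 * (2 * m' - 1) * num_trees m'
  end.

Lemma num_treesS m : 0 < m -> num_trees m.+1 = 2 * (2 * m - 1) * num_trees m.
Proof. by case: m. Qed.

Lemma num_trees_gt0 m : 0 < m -> 0 < num_trees m.
Proof.
elim: m => // -[|m] IH _ //; rewrite num_treesS // !muln_gt0 IH //=; lia.
Qed.

Lemma plane_treesP l t : uniq l -> (t \in plane_trees l) = perm_eq (leaves t) l.
Proof.
elim: l t => [|a l IH] t.
  rewrite in_nil => _; apply/esym/negP => /perm_size t0.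
  by have := size_leaves_gt0 t; rewrite t0.
case: l IH => [|b l] IH.
  move=> _ /=; rewrite inE; apply/eqP/idP => [->//|].
  case: t => [x|u v] /=; first by move=> /perm_mem/(_ x); rewrite !inE eqxx => /esym/eqP->.
  move=> /perm_size; rewrite size_cat /=.
  have := size_leaves_gt0 u; have := size_leaves_gt0 v; lia.
move=> /[dup] ual; rewrite [X in X -> _]/= => /andP[al ul].
apply/flatten_mapP/idP => [[u]|pt].
  rewrite IH // => pu /leaves_insertions tu.
  by rewrite (perm_trans tu) // perm_cons.
have ut : uniq (leaves t) by rewrite (perm_uniq pt).
have at' : a \in leaves t by rewrite (perm_mem pt) inE eqxx.
case E : (prune a t) => [u|]; last first.
  have /(uniq_leq_size ut) := prune_None E.
  by rewrite (perm_size pt) /= ltnS ltn0.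
have ti := insertions_prune ut at' E.
exists u => //; rewrite IH //.
have := leaves_insertions ti; rewrite perm_sym => /perm_trans/(_ pt).
by rewrite perm_cons.
Qed.

Lemma plane_trees_uniq l : uniq l -> uniq (plane_trees l).
Proof.
elim: l => // a [|b l] IH //.
rewrite [uniq (a :: _)]/= => /andP[al ul].
rewrite plane_treesE; have := IH ul.
have : {subset plane_trees (b :: l) <= plane_trees (b :: l)} by [].
move: {1 3 4}(plane_trees (b :: l)) => ts.
have nota t : t \in plane_trees (b :: l) -> a \notin leaves t.
  by rewrite plane_treesP // => /perm_mem->.
elim: ts => [|t ts IHt] // sub; rewrite cons_uniq => /andP[tts uts].
rewrite map_cons [flatten _]/=.
have tp := sub t (mem_head _ _).
rewrite cat_uniq IHt ?andbT //; last first.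
  by move=> x xts; apply: sub; rewrite inE xts orbT.
apply/andP; split.
  apply: uniq_insertions; rewrite cons_uniq nota //=.
  by move: tp; rewrite plane_treesP // => /perm_uniq->.
apply/hasPn=> u /flatten_mapP[v vts vu]; apply/negP => /(prune_insertions (nota _ tp)) ut.
have vp : v \in plane_trees (b :: l) by apply: sub; rewrite inE vts orbT.
move: (prune_insertions (nota _ vp) vu); rewrite ut => -[tv].
by rewrite tv vts in tts.
Qed.

Lemma size_plane_trees l : uniq l -> size (plane_trees l) = num_trees (size l).
Proof.
elim: l => // a [|b l] IH // ul.
have ubl : uniq (b :: l) by move: ul; rewrite cons_uniq => /andP[].
rewrite plane_treesE num_treesS // -IH //.
have : {in plane_trees (b :: l), forall t,
    size (insertions a t) = 2 * (2 * size (b :: l) - 1)}.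
  by move=> t; rewrite plane_treesP // => pt; rewrite size_insertions (perm_size pt).
move: (plane_trees _) (2 * _) => ts k; elim: ts => [|t ts IHt] sk; first by rewrite muln0.
rewrite /= size_cat sk ?mem_head // IHt ?mulnS // => u uts.
by apply: sk; rewrite inE uts orbT.
Qed.

Lemma perm_plane_trees l1 l2 : uniq l1 -> perm_eq l1 l2 ->
  perm_eq (plane_trees l1) (plane_trees l2).
Proof.
move=> u1 p12; have u2 : uniq l2 by rewrite -(perm_uniq p12).
apply: uniq_perm; rewrite ?plane_trees_uniq // => t.
by rewrite !plane_treesP //; exact: permPr.
Qed.

Definition trees_on A := plane_trees (enum A).

Lemma trees_onP A t : (t \in trees_on A) = uniq (leaves t) && (support t == A).
Proof.
rewrite plane_treesP ?enum_uniq //; apply/idP/andP => [pt|[ut /eqP<-]].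
  rewrite (perm_uniq pt) enum_uniq; split=> //; apply/eqP/setP=> x.
  by rewrite inE (perm_mem pt) mem_enum.
by apply: uniq_perm; rewrite ?enum_uniq // => x; rewrite mem_enum inE.
Qed.

Lemma trees_on_uniq A : uniq (trees_on A).
Proof. by rewrite plane_trees_uniq ?enum_uniq. Qed.

Lemma size_trees_on A : size (trees_on A) = num_trees #|A|.
Proof. by rewrite size_plane_trees ?enum_uniq // cardE. Qed.

(** * Traces of clusters *)

Lemma restrict_familyP B (F : {set {set T}}) Y :
  reflect (Y = set0 \/ exists2 X, X \in F & Y = X :&: B) (Y \in restrict_family B F).
Proof.
rewrite !inE; apply: (iffP orP) => [[/eqP|/imsetP]|[->|]]; [by left|by right|left|right] => //.
exact/imsetP.
Qed.

Lemma restrict_familyI B D (F : {set {set T}}) : D \subset B ->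
  restrict_family D (restrict_family B F) = restrict_family D F.
Proof.
move=> DB; have DI X : X :&: B :&: D = X :&: D by rewrite -setIA (setIidPr DB).
apply/setP=> Y; apply/restrict_familyP/restrict_familyP => -[->|[X XF ->]]; try by left.
  case/restrict_familyP: XF => [->|[Z ZF ->]]; first by left; rewrite set0I.
  by right; exists Z.
by right; exists (X :&: B); rewrite ?DI //; apply/restrict_familyP; right; exists X.
Qed.

Lemma agree_restrictl B D (F G : {set {set T}}) : D \subset B ->
  agree D (restrict_family B F) G = agree D F G.
Proof. by move=> DB; rewrite /agree restrict_familyI. Qed.

Lemma agree_restrictr B D (F G : {set {set T}}) : D \subset B ->
  agree D F (restrict_family B G) = agree D F G.
Proof. by move=> DB; rewrite /agree restrict_familyI. Qed.

(** Grafting at the top adds two clusters: the singleton of the new leaf,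
    whose trace is empty, and the whole support, whose trace is that of the
    former support. *)
Lemma restrict_graft a t v w B : a \notin B ->
  (v = Leaf a /\ w = t) \/ (v = t /\ w = Leaf a) ->
  restrict_family B (clusters (Node v w)) = restrict_family B (clusters t).
Proof.
move=> aB vw; have aB0 : [set a] :&: B = set0.
  by apply/setP=> x; rewrite !inE; case: eqP => // ->; rewrite (negbTE aB).
have sE : support (Node v w) :&: B = support t :&: B.
  by case: vw => -[-> ->]; rewrite support_Node setIUl support_Leaf aB0 ?set0U ?setU0.
apply/setP=> Y; apply/restrict_familyP/restrict_familyP => -[->|[X XF ->]]; try by left.
  have [->|XS] := eqVneq X (support (Node v w)).
    by right; exists (support t); rewrite ?support_clusters.
  move: XF; rewrite [clusters _]/= in_setU1 (negbTE XS) => XF.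
  have {XF} : X = [set a] \/ X \in clusters t.
    case: vw XF => -[-> ->]; rewrite /= !inE => /orP[]; auto; by move/eqP; auto.
  by case=> [->|XF]; [left|right; exists X].
right; exists X => //.
by case: vw => -[-> ->]; rewrite /= !inE XF ?orbT.
Qed.

(** The growth of trees by insertion is compatible with inducing subtrees. *)
Lemma restrict_insertions a t u B : a \notin B -> u \in insertions a t ->
  restrict_family B (clusters u) = restrict_family B (clusters t).
Proof.
move=> aB; elim: t u => [x|l IHl r IHr] u /=.
  rewrite !inE => /orP[] /eqP->; [apply: (restrict_graft (t := Leaf x) aB); by left|].
  by apply: (restrict_graft (t := Leaf x) aB); right.
have graft := @restrict_graft a (Node l r) _ _ B aB.
rewrite !inE => /or3P[/eqP->|/eqP->|]; [by apply: graft; left|by apply: graft; right|].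
have U3 (F1 F2 F3 : {set {set T}}) : restrict_family B (F1 :|: (F2 :|: F3)) =
    restrict_family B F1 :|: (restrict_family B F2 :|: restrict_family B F3).
  by rewrite /restrict_family !imsetU; apply/setP=> Y; rewrite !inE; case: (Y == set0).
have sup v w : w \in insertions a v -> support w :&: B = support v :&: B.
  move=> /leaves_insertions/perm_mem wv; apply/setP=> x; rewrite !inE wv !inE.
  by case: eqP => // ->; rewrite (negbTE aB) !andbF.
rewrite mem_cat => /orP[] /mapP[v vi ->] /=; rewrite !U3.
  rewrite (IHl v) //; congr (_ :|: _).
  by rewrite /restrict_family !imset_set1 !support_Node !setIUl (sup _ _ vi).
rewrite (IHr v) //; congr (_ :|: _).
by rewrite /restrict_family !imset_set1 !support_Node !setIUl (sup _ _ vi).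
Qed.

End PlaneTrees.

Arguments num_trees : simpl never.

Section Substitution.
Variable T : finType.
Implicit Types (t u C : btree T) (a b s x : T) (A B D I X Y : {set T}).

(** * Cutting a tree at a cluster *)

(** A cluster of a tree cuts it into the subtree below that cluster and a
    context in which a leaf [s], the hole, takes the place of the subtree.
    Substitution glues the two again, and [plug] below is its effect on the
    clusters of the context. *)
Fixpoint subst s u C : btree T :=
  match C with
  | Leaf a => if a == s then u else Leaf a
  | Node l r => Node (subst s u l) (subst s u r)
  end.

Definition plug s Y X : {set T} := if s \in X then (X :\ s) :|: Y else X.

Fixpoint subtree X t : option (btree T) :=
  if support t == X then Some t else
  match t with
  | Leaf _ => None
  | Node l r => if subtree X l is Some u then Some u else subtree X r
  end.

Fixpoint context s X t : btree T :=
  if support t == X then Leaf s else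
  match t with
  | Leaf a => Leaf a
  | Node l r => Node (context s X l) (context s X r)
  end.

Lemma subst_id s u C : s \notin leaves C -> subst s u C = C.
Proof.
elim: C => [a|l IHl r IHr] /=; first by rewrite inE eq_sym => /negbTE->.
by rewrite mem_cat negb_or => /andP[/IHl-> /IHr->].
Qed.

Lemma plug_id s Y X : s \notin X -> plug s Y X = X.
Proof. by rewrite /plug => /negbTE->. Qed.

Lemma uniq_NodeP t u : uniq (leaves (Node t u)) ->
  [/\ uniq (leaves t), uniq (leaves u) & forall x, x \in leaves t -> x \in leaves u -> False].
Proof.
rewrite /= cat_uniq => /and3P[-> /hasPn d ->]; split=> // x xt /d.
by rewrite /= xt.
Qed.

Lemma leaves_subst s u C : uniq (leaves C) -> s \in leaves C ->
  perm_eq (leaves (subst s u C)) (leaves u ++ [seq x <- leaves C | x != s]).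
Proof.
elim: C => [a|l IHl r IHr].
  by move=> _; rewrite inE => /eqP<- /=; rewrite eqxx /= cats0.
move=> /uniq_NodeP[ul ur dlr] /=; rewrite mem_cat filter_cat.
have ff v : s \notin leaves v -> [seq x <- leaves v | x != s] = leaves v.
  by move=> sv; apply/all_filterP/allP => x xv; apply: contraNneq sv => <-.
case/orP=> sC.
  have sr : s \notin leaves r by apply/negP; apply: dlr.
  by rewrite (subst_id _ sr) (ff r) // catA perm_cat2r IHl.
have sl : s \notin leaves l by apply/negP => /dlr/(_ sC).
by rewrite (subst_id _ sl) (ff l) // perm_sym perm_catCA perm_cat2l perm_sym IHr.
Qed.

Lemma support_subst s u C : uniq (leaves C) -> s \in leaves C ->
  support (subst s u C) = plug s (support u) (support C).
Proof.
move=> uC sC; apply/setP=> x; rewrite /plug (mem_support C) sC !inE.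
by rewrite (perm_mem (leaves_subst u uC sC)) mem_cat mem_filter orbC.
Qed.

Lemma uniq_subst s u C : uniq (leaves C) -> s \in leaves C -> uniq (leaves u) ->
  (forall x, x \in leaves u -> x \in leaves C -> x = s) -> uniq (leaves (subst s u C)).
Proof.
move=> uC sC uu d; rewrite (perm_uniq (leaves_subst u uC sC)) cat_uniq uu filter_uniq //.
rewrite andbT; apply/hasPn => x; rewrite mem_filter => /andP[xs xC].
by apply: contraNN xs => /d/(_ xC)->.
Qed.

Lemma clusters_subst s u C : uniq (leaves C) -> s \in leaves C ->
  clusters (subst s u C) =
  clusters u :|: [set plug s (support u) X | X in clusters C].
Proof.
elim: C => [a|l IHl r IHr].
  move=> _; rewrite inE => /eqP<- /=; rewrite eqxx imset_set1 /plug inE eqxx.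
  by rewrite setDv set0U; apply/esym/setUidPl; rewrite sub1set support_clusters.
move=> uC sC; have [ul ur dlr] := uniq_NodeP uC.
have supE := support_subst u uC sC; rewrite [subst _ _ _]/= in supE.
rewrite [LHS]/= supE [clusters (Node l r)]/= !imsetU imset_set1.
have idv v : s \notin leaves v -> [set plug s (support u) X | X in clusters v] = clusters v.
  move=> sv; rewrite -[RHS]imset_id; apply: eq_in_imset => X /clusters_sub XS.
  by rewrite plug_id //; apply: contra sv => /(subsetP XS); rewrite inE.
move: sC; rewrite /= mem_cat => /orP[sC|sC].
  have sr : s \notin leaves r by apply/negP; apply: dlr.
  rewrite (subst_id _ sr) IHl // (idv r) //.
  by apply/setP=> Z; rewrite !in_setU; do ?case: (Z \in _).
have sl : s \notin leaves l by apply/negP => /dlr/(_ sC).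
rewrite (subst_id _ sl) IHr // (idv l) //.
by apply/setP=> Z; rewrite !in_setU; do ?case: (Z \in _).
Qed.

Lemma subtree_None X t : X \notin clusters t -> subtree X t = None.
Proof.
elim: t => [a|l IHl r IHr].
  by rewrite /= inE support_Leaf eq_sym => /negbTE->.
rewrite [clusters _]/= !in_setU in_set1 !negb_or => /and3P[XS /IHl Xl /IHr Xr].
by rewrite [LHS]/= eq_sym (negbTE XS) Xl.
Qed.

Lemma context_id s X t : X \notin clusters t -> context s X t = t.
Proof.
elim: t => [a|l IHl r IHr].
  by rewrite /= inE support_Leaf eq_sym => /negbTE->.
rewrite [clusters _]/= !in_setU in_set1 !negb_or => /and3P[XS /IHl Xl /IHr Xr].
by rewrite [LHS]/= eq_sym (negbTE XS) Xl Xr.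
Qed.

Lemma clusters_disjoint l r X : uniq (leaves (Node l r)) ->
  X \in clusters l -> X \notin clusters r.
Proof.
move=> /uniq_NodeP[_ _ d] Xl; apply/negP => Xr.
have /set0Pn[x xX] := clusters_neq0 Xl.
have := subsetP (clusters_sub Xl) x xX; have := subsetP (clusters_sub Xr) x xX.
by rewrite !inE => xr /d/(_ xr).
Qed.

(** The hole may carry any label that does not occur elsewhere in the context.
    In particular it may carry a label of the subtree that is cut off: this is
    how the second root of a doubly rooted tree is handed over to the context.
    *)
Lemma subtreeP X t : uniq (leaves t) -> X \in clusters t ->
  exists u, [/\ subtree X t = Some u, support u = X, uniq (leaves u) &
    forall s, s \notin support t :\: X ->
      subst s u (context s X t) = t /\
      perm_eq (leaves (context s X t)) (s :: [seq x <- leaves t | x \notin X])].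
Proof.
have all_in t' : support t' = X -> [seq x <- leaves t' | x \notin X] = [::].
  move=> tX; apply/eqP; rewrite -(negbK (_ == _)) -has_filter.
  by apply/hasPn=> x xt; rewrite negbK -tX inE.
elim: t => [a|l IHl r IHr] ut.
  rewrite /= inE support_Leaf => /eqP->; rewrite eqxx; exists (Leaf a).
  by split; rewrite ?support_Leaf //= => s _; rewrite eqxx inE eqxx.
have [ul ur dlr] := uniq_NodeP ut.
have [sX _|sX] := eqVneq (support (Node l r)) X.
  exists (Node l r); split=> [|//|//|s _]; first by rewrite [LHS]/= sX eqxx.
  by rewrite [context _ _ _]/= sX eqxx /= eqxx -[_ ++ _]/(leaves (Node l r)) all_in.
rewrite [clusters _]/= !in_setU in_set1 eq_sym (negbTE sX) /=.
have nil_in v : (forall x, x \in leaves v -> x \notin X) -> [seq x <- leaves v | x \notin X] = leaves v.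
  by move=> vX; apply/all_filterP/allP.
have sD s v w : support (Node l r) = support v :|: support w ->
   s \notin support (Node l r) :\: X -> (forall x, x \in leaves w -> x \notin X) ->
   s \notin support v :\: X /\ s \notin leaves w.
  move=> -> + wX; rewrite !inE !negb_and !negbK => /orP[sX'|].
    by rewrite sX'; split=> //; apply/negP => /wX; rewrite sX'.
  by rewrite negb_or => /andP[-> ->]; rewrite orbT.
case/orP => Xc.
  have Xr := clusters_disjoint ut Xc.
  have rX x : x \in leaves r -> x \notin X.
    move=> xr; apply/negP => /(subsetP (clusters_sub Xc)); rewrite inE.
    by move=> /dlr/(_ xr).
  have [u [ustl uX uu uC]] := IHl ul Xc.
  exists u; split=> [|//|//|s sN]; first by rewrite [LHS]/= (negbTE sX) ustl.
  have [slN sr] := sD s l r (support_Node _ _) sN rX.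
  have [uCl pCl] := uC s slN.
  rewrite [context _ _ _]/= (negbTE sX) (context_id _ Xr) [subst _ _ _]/= uCl (subst_id _ sr).
  by split=> //=; rewrite filter_cat (nil_in r) // -cat_cons perm_cat2r.
have Xl : X \notin clusters l by apply: contraL Xc; apply: clusters_disjoint.
have lX x : x \in leaves l -> x \notin X.
  move=> xl; apply/negP => /(subsetP (clusters_sub Xc)); rewrite inE.
  exact: dlr xl.
have [u [ustr uX uu uC]] := IHr ur Xc.
exists u; split=> [|//|//|s sN]; first by rewrite [LHS]/= (negbTE sX) (subtree_None Xl) ustr.
have [srN sl] := sD s r l (etrans (support_Node _ _) (setUC _ _)) sN lX.
have [uCr pCr] := uC s srN.
rewrite [context _ _ _]/= (negbTE sX) (context_id _ Xl) [subst _ _ _]/= uCr (subst_id _ sl).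
split=> //=; rewrite filter_cat (nil_in l) // -cat1s perm_sym perm_catCA perm_cat2l perm_sym.
exact: pCr.
Qed.

Lemma subtree_subst s u C : uniq (leaves C) -> s \in leaves C ->
  (forall x, x \in leaves u -> x \in leaves C -> x = s) ->
  subtree (support u) (subst s u C) = Some u /\
  context s (support u) (subst s u C) = C.
Proof.
elim: C => [a|l IHl r IHr].
  move=> _; rewrite inE => /eqP<- _; rewrite /= eqxx.
  by case: u => [b|v w]; rewrite [subtree _ _]/= [context _ _ _]/= eqxx.
move=> uC sC d; have [ul ur dlr] := uniq_NodeP uC.
have dl x : x \in leaves u -> x \in leaves l -> x = s.
  by move=> xu xl; apply: d => //; rewrite /= mem_cat xl.
have dr x : x \in leaves u -> x \in leaves r -> x = s.
  by move=> xu xr; apply: d => //; rewrite /= mem_cat xr orbT.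
have nc v : s \notin leaves v -> (forall x, x \in leaves u -> x \in leaves v -> x = s) ->
    support u \notin clusters v.
  move=> sv dv; apply/negP => /clusters_sub/subsetP sub.
  have /set0Pn[x xu] := support_neq0 u.
  have xv := sub x xu; rewrite !inE in xu xv.
  by have xs := dv x xu xv; move: sv; rewrite -xs xv.
have ns v w : s \notin leaves w -> (forall x, x \in leaves u -> x \in leaves w -> x = s) ->
    support v :|: support w != support u.
  move=> sw dw; apply/eqP => E; have /set0Pn[x xw] := support_neq0 w.
  have : x \in support u by rewrite -E inE xw orbT.
  rewrite !inE in xw * => /dw/(_ xw) xs.
  by rewrite xs (negbTE sw) in xw.
move: sC; rewrite /= mem_cat => /orP[sC|sC].
  have sr : s \notin leaves r by apply/negP; apply: dlr.
  rewrite (subst_id _ sr) support_Node (negbTE (ns _ _ sr dr)).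
  by have [-> ->] := IHl ul sC dl; rewrite (context_id _ (nc _ sr dr)).
have sl : s \notin leaves l by apply/negP => /dlr/(_ sC).
rewrite (subst_id _ sl) support_Node setUC (negbTE (ns _ _ sl dl)).
have [-> ->] := IHr ur sC dr; rewrite (context_id _ (nc _ sl dl)).
by rewrite (subtree_None (nc _ sl dl)).
Qed.

(** By [subtreeP] and [subtree_subst], cutting at the cluster [X] and
    substituting are inverse bijections between the trees that have this
    cluster and the pairs of a subtree and a context. *)
Lemma cut_sum (A X : {set T}) s (f : btree T -> option (btree T) -> nat) :
  X \subset A -> s \notin A :\: X ->
  \sum_(t <- trees_on A | X \in clusters t) f t (subtree X t) =
  \sum_(u <- trees_on X) \sum_(C <- trees_on (s |: (A :\: X))) f (subst s u C) (Some u).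
Proof.
move=> XA sA.
have disj u C : u \in trees_on X -> C \in trees_on (s |: (A :\: X)) ->
   [/\ uniq (leaves u), support u = X, uniq (leaves C), s \in leaves C
     & forall x, x \in leaves u -> x \in leaves C -> x = s].
  rewrite !trees_onP => /andP[uu /eqP uX] /andP[uC /eqP CA]; split=> //.
    by rewrite -mem_support CA !inE eqxx.
  move=> x; rewrite -!mem_support uX CA !inE => ->.
  by case: eqP.
transitivity (\sum_(u <- trees_on X) \sum_(C <- trees_on (s |: (A :\: X)))
    f (subst s u C) (subtree X (subst s u C))); last first.
  rewrite big_seq [RHS]big_seq; apply: eq_bigr => u uX.
  rewrite big_seq [RHS]big_seq; apply: eq_bigr => C CA.
  have [uu <- uC sC d] := disj u C uX CA.
  by have [-> _] := subtree_subst uC sC d.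
rewrite -big_filter -(big_allpairs_dep (h := fun u C => subst s u C) (F := fun t => f t (subtree X t))).
apply: perm_big; apply: uniq_perm.
- by rewrite filter_uniq // trees_on_uniq.
- apply: allpairs_uniq; rewrite ?trees_on_uniq // => -[u C] [v D].
  move=> /allpairsP[[u' C'] [/= uX CA [-> ->]]] /allpairsP[[v' D'] [/= vX DA [-> ->]]].
  have [uu uXE uC sC d] := disj u' C' uX CA.
  have [vv vXE uD sD d'] := disj v' D' vX DA => E.
  have := subtree_subst uC sC d; rewrite E uXE -vXE.
  by have [-> ->] := subtree_subst uD sD d' => -[[->] ->].
move=> t; rewrite mem_filter trees_onP; apply/andP/allpairsP.
  move=> [Xt /andP[ut /eqP tA]].
  have [u [su uX uu /(_ s)]] := subtreeP ut Xt; rewrite tA => /(_ sA)[sub pC].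
  exists (u, context s X t); split=> //=.
    by rewrite trees_onP uu uX eqxx.
  rewrite trees_onP (perm_uniq pC) /= filter_uniq // mem_filter andbT; apply/andP; split.
    by move: sA; rewrite -tA !inE.
  by apply/eqP/setP=> x; rewrite inE (perm_mem pC) !inE mem_filter -tA inE.
move=> [[u C] /= [uX CA ->]].
have [uu uXE uC sC d] := disj u C uX CA.
rewrite clusters_subst // inE -{1}uXE support_clusters; split=> //.
rewrite uniq_subst //= support_subst // uXE.
move: CA; rewrite trees_onP => /andP[_ /eqP->].
rewrite /plug !inE eqxx /=; apply/eqP/setP=> x; rewrite !inE.
case: eqP => [->|_] /=; last by case: (boolP (x \in X)) => [/(subsetP XA)->|]; rewrite ?orbT ?orbF.
by move: sA; rewrite !inE negb_and negbK => /orP[sX|sA']; [rewrite sX (subsetP XA)|case: (boolP (s \in X)) => [/(subsetP XA)|]; rewrite (negbTE sA')].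
Qed.

(** A tree with two leaves or more is a pair of trees on the two parts of an
    ordered partition of its leaves. *)
Lemma node_sum (X : {set T}) (f : btree T -> nat) : 1 < #|X| ->
  \sum_(u <- trees_on X) f u =
  \sum_(p : {set T} * {set T} | [disjoint p.1 & p.2] && (p.1 :|: p.2 == X))
    \sum_(l <- trees_on p.1) \sum_(r <- trees_on p.2) f (Node l r).
Proof.
move=> X1.
transitivity (\sum_(p : {set T} * {set T} | [disjoint p.1 & p.2] && (p.1 :|: p.2 == X))
  \sum_(u <- trees_on X | if u is Node l r then (support l == p.1) && (support r == p.2) else false) f u).
  rewrite (exchange_big_dep predT) //=; rewrite big_seq [RHS]big_seq.
  apply: eq_bigr => -[a|l r]; rewrite trees_onP => /andP[ut /eqP tX].
    by move: X1; rewrite -tX support_Leaf cards1.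
  have [ul ur dlr] := uniq_NodeP ut.
  rewrite (bigD1 (support l, support r)) /= ?big1 ?addn0 //.
    by move=> [A B] /= /andP[/andP[_ /andP[/eqP-> /eqP->]]]; rewrite eqxx.
  rewrite !eqxx -tX support_Node eqxx !andbT.
  by rewrite disjoint_subset; apply/subsetP=> x; rewrite !inE => /dlr H; apply/negP.
apply: eq_bigr => -[A B] /= /andP[dAB /eqP ABX].
rewrite -big_filter -(big_allpairs_dep (h := fun l r => Node l r)).
apply: perm_big; apply: uniq_perm.
- by rewrite filter_uniq // trees_on_uniq.
- by apply: allpairs_uniq; rewrite ?trees_on_uniq // => -[? ?] [? ?] _ _ [-> ->].
move=> t; rewrite mem_filter trees_onP; apply/andP/allpairsP.
  case: t => [a|l r] [] // /andP[/eqP lA /eqP rB] /andP[ut /eqP tX].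
  have [ul ur dlr] := uniq_NodeP ut.
  by exists (l, r); rewrite /= !trees_onP ul ur lA rB !eqxx.
move=> [[l r] /= []]; rewrite !trees_onP => /andP[ul /eqP lA] /andP[ur /eqP rB] ->.
rewrite lA rB !eqxx support_Node lA rB ABX eqxx; split=> //.
rewrite andbT [leaves _]/= cat_uniq ul ur andbT /=; apply/hasPn => x xr /=.
rewrite -mem_support lA; apply: contraL xr; rewrite -mem_support rB => xA.
by rewrite (disjointFr dAB xA).
Qed.

(** The clusters of the two branches form disjoint families, neither of which
    contains the top cluster; this gives inductions over all nodes of a tree.
    *)
Lemma subtree_sum t (g : option (btree T) -> nat) : uniq (leaves t) ->
  \sum_(X in clusters t) g (subtree X t) = g (Some t) +
  if t is Node l r then \sum_(X in clusters l) g (subtree X l) +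
                        \sum_(X in clusters r) g (subtree X r) else 0.
Proof.
case: t => [a|l r] ut; first by rewrite big_set1 /= support_Leaf eqxx addn0.
have [ul ur dlr] := uniq_NodeP ut.
have strict v w : (v = l /\ w = r \/ v = r /\ w = l) -> forall X, X \in clusters v ->
    support (Node l r) == X = false.
  move=> vw X /clusters_sub Xl; apply/eqP=> E.
  have /set0Pn[x xr] := support_neq0 w.
  have : x \in X by rewrite -E support_Node; case: vw => -[_ <-]; rewrite inE xr ?orbT.
  move=> /(subsetP Xl); rewrite !inE in xr *.
  by case: vw => -[vE wE]; rewrite vE wE in xr *; [move=> /dlr/(_ xr)|move=> /(dlr _ xr)].
have st1 := strict l r (or_introl (conj erefl erefl)).
have st2 := strict r l (or_intror (conj erefl erefl)).
rewrite [clusters _]/= big_setU1 /=; last first.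
  rewrite inE; apply/negP => /orP[/st1|/st2]; by rewrite eqxx.
rewrite eqxx; congr (_ + _).
have dis : [disjoint clusters l & clusters r].
  by rewrite disjoint_subset; apply/subsetP=> X; rewrite !inE; apply: clusters_disjoint.
rewrite (eq_bigl [predU clusters l & clusters r]); last by move=> X; rewrite !inE.
rewrite bigU //=.
congr (_ + _); apply: eq_bigr => X Xc.
  rewrite st1 //; have [u [-> _ _ _]] := subtreeP ul Xc; by [].
rewrite st2 // subtree_None //.
by apply: contraL Xc => /(clusters_disjoint ut).
Qed.

End Substitution.

Section Agreement.
Variable T : finType.
Implicit Types (t u C l r : btree T) (a b s x : T) (A B D E I S X Y : {set T}).
Implicit Types (F G : {set {set T}}).

(** * Agreement numbers and gluing *)

(** [S] is the set of leaves that have to be in the common subtree but are not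
    counted. It is empty for trees with one root, and the singleton of the
    second root for trees with two: a common subtree can only be glued to
    others at both of its ends if it contains both roots. *)
Definition agreement D S F G : nat :=
  \max_(B : {set T} | (B \subset D) && agree (B :|: S) F G) #|B|.

Lemma agreement_witness D S F G : agree S F G -> exists B : {set T},
  [/\ B \subset D, agree (B :|: S) F G & agreement D S F G = #|B|].
Proof.
move=> aS; rewrite /agreement (bigmax_eq_arg set0) ?sub0set ?set0U //.
by case: arg_maxnP => [|B /andP[BD aB] _]; [rewrite sub0set set0U|exists B].
Qed.

Lemma leq_agreement D S F G B :
  B \subset D -> agree (B :|: S) F G -> #|B| <= agreement D S F G.
Proof. by move=> BD aB; apply: (leq_bigmax_cond B); rewrite BD. Qed.

Lemma agreement_restrictl D S E F G : D :|: S \subset E ->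
  agreement D S (restrict_family E F) G = agreement D S F G.
Proof.
move=> DE; apply: eq_bigl => B; case: (boolP (B \subset D)) => //= BD.
by rewrite agree_restrictl // (subset_trans _ DE) // setSU.
Qed.

Lemma agreement_restrictr D S E F G : D :|: S \subset E ->
  agreement D S F (restrict_family E G) = agreement D S F G.
Proof.
move=> DE; apply: eq_bigl => B; case: (boolP (B \subset D)) => //= BD.
by rewrite agree_restrictr // (subset_trans _ DE) // setSU.
Qed.

Lemma restrict_familyU B F G :
  restrict_family B (F :|: G) = restrict_family B F :|: restrict_family B G.
Proof.
by rewrite /restrict_family imsetU; apply/setP=> Y; rewrite !inE; case: (Y == set0).
Qed.

Lemma restrict_family_eq B D F : (forall X, X \in F -> X :&: B = X :&: D) ->
  restrict_family B F = restrict_family D F.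
Proof.
move=> BD; rewrite /restrict_family; congr (_ |: _).
by apply: eq_in_imset => X /BD.
Qed.

Lemma restrict_sub_support t B D : B :&: support t = D :&: support t ->
  restrict_family B (clusters t) = restrict_family D (clusters t).
Proof.
move=> BD; apply: restrict_family_eq => X /clusters_sub XS.
by rewrite -(setIidPl XS) -!setIA (setIC _ B) (setIC _ D) BD.
Qed.

(** A trace on [B :|: D] of the glued tree is either a trace on [D] of the
    grafted tree or comes from a trace on [B :|: [set s]] of the context, in
    which [s] is to be replaced by [D]. So the two sides of the cut determine
    all traces. *)
Lemma agree_subst s u u' C C' B D :
  uniq (leaves C) -> uniq (leaves C') -> s \in leaves C -> s \in leaves C' ->
  s \notin B -> D \subset support u -> D \subset support u' ->
  [disjoint B & support u] -> [disjoint B & support u'] ->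
  [disjoint D & support C :\ s] -> [disjoint D & support C' :\ s] ->
  agree (B :|: [set s]) (clusters C) (clusters C') ->
  agree D (clusters u) (clusters u') ->
  agree (B :|: D) (clusters (subst s u C)) (clusters (subst s u' C')).
Proof.
move=> uC uC' sC sC' sB Du Du' Bu Bu' DC DC' aC au.
pose psi Y := (Y :&: B) :|: (if s \in Y then D else set0).
have key v V : uniq (leaves V) -> s \in leaves V -> D \subset support v ->
    [disjoint B & support v] -> [disjoint D & support V :\ s] ->
    restrict_family (B :|: D) (clusters (subst s v V)) =
    restrict_family D (clusters v) :|: [set psi Y | Y in restrict_family (B :|: [set s]) (clusters V)].
  move=> uV sV Dv Bv DV; rewrite clusters_subst // restrict_familyU; congr (_ :|: _).
    apply: restrict_sub_support; rewrite setIUl.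
    by rewrite (disjoint_setI0 Bv) set0U.
  have psiE X : X \in clusters V ->
     plug s (support v) X :&: (B :|: D) = psi (X :&: (B :|: [set s])).
    move=> /clusters_sub XV; rewrite /psi /plug !inE eqxx orbT andbT.
    have BD x : x \in D -> x \in B = false by move=> /(subsetP Dv) xv; apply: disjointFl Bv xv.
    have DX x : x \in D -> x \in X -> x = s.
      move=> xD xX; apply: contraTeq xD => xs.
      by rewrite (disjointFl DV) // !inE xs -mem_support (subsetP XV).
    apply/setP=> x; case: (boolP (s \in X)) => sX; rewrite !inE.
      case: (boolP (x \in D)) => xD.
        by have := subsetP Dv x xD; rewrite inE => ->; rewrite !orbT.
      case: (boolP (x \in B)) => xB; rewrite ?andbF //= !andbT !orbF.
      have := disjointFr Bv xB; rewrite inE => ->; rewrite orbF.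
      by case: eqP => // xs; rewrite xs (negbTE sB) in xB.
    have [->|xs] /= := eqVneq x s; first by rewrite (negbTE sX).
    rewrite !orbF; case: (boolP (x \in X)) => //= xX; case: (boolP (x \in D)) => // xD.
      by rewrite (DX x xD xX) eqxx in xs.
    by rewrite orbF andbb.
  have psi0 : psi set0 = set0 by rewrite /psi set0I set0U inE.
  rewrite /restrict_family imsetU !imset_set1 psi0; congr (_ |: _).
  by rewrite -!imset_comp; apply: eq_in_imset => X /psiE.
by rewrite /agree (key u C) // (key u' C') // (eqP aC) (eqP au).
Qed.

Lemma agree_Node l r l' r' B D :
  B \subset support l -> B \subset support l' ->
  D \subset support r -> D \subset support r' ->
  [disjoint B & support r] -> [disjoint B & support r'] ->
  [disjoint D & support l] -> [disjoint D & support l'] ->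
  agree B (clusters l) (clusters l') -> agree D (clusters r) (clusters r') ->
  agree (B :|: D) (clusters (Node l r)) (clusters (Node l' r')).
Proof.
move=> Bl Bl' Dr Dr' Br Br' Dl Dl' aB aD.
have key v w : B \subset support v -> D \subset support w ->
    [disjoint B & support w] -> [disjoint D & support v] ->
    restrict_family (B :|: D) (clusters (Node v w)) =
    restrict_family (B :|: D) [set B :|: D] :|:
    (restrict_family B (clusters v) :|: restrict_family D (clusters w)).
  move=> Bv Dw Bw Dv; rewrite /= !restrict_familyU; congr (_ :|: (_ :|: _)).
  - rewrite /restrict_family !imset_set1 support_Node setIid; congr (_ |: [set _]).
    by apply/setIidPr; rewrite setUSS.
  - by apply: restrict_sub_support; rewrite setIUl; rewrite (disjoint_setI0 Dv) setU0.
  - by apply: restrict_sub_support; rewrite setIUl; rewrite (disjoint_setI0 Bw) set0U.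
by rewrite /agree !key // (eqP aB) (eqP aD).
Qed.

Lemma clusters_NodeC l r : clusters (Node l r) = clusters (Node r l).
Proof. by rewrite /= !support_Node (setUC (clusters l)) (setUC (support l)). Qed.

Lemma clusters_subst_NodeC s C l r : uniq (leaves C) -> s \in leaves C ->
  clusters (subst s (Node l r) C) = clusters (subst s (Node r l) C).
Proof.
move=> uC sC; rewrite !clusters_subst // clusters_NodeC.
by rewrite !support_Node (setUC (support l)).
Qed.

(** * Total agreement of all pairs of trees *)

(** The expected agreement of two uniform random trees is obtained by dividing
    by the square of the number of trees. As for [agreement], the trees have a
    second root when [S] is a singleton. *)
Definition total_agreement A S : nat :=
  \sum_(t <- trees_on (A :|: S)) \sum_(t' <- trees_on (A :|: S))
    agreement A S (clusters t) (clusters t').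

Lemma big_trees_setU1 a A (f : btree T -> nat) : a \notin A -> A != set0 ->
  \sum_(t <- trees_on (a |: A)) f t =
  \sum_(t <- trees_on A) \sum_(u <- insertions a t) f u.
Proof.
move=> aA A0.
rewrite (perm_big (plane_trees (a :: enum A))); last first.
  apply: perm_plane_trees; rewrite ?enum_uniq //.
  apply: uniq_perm; rewrite ?enum_uniq //= ?mem_enum ?aA ?enum_uniq //.
  by move=> x; rewrite inE !mem_enum !inE.
rewrite /trees_on; case E : (enum A) => [|b l].
  by case/set0Pn: A0 => x; rewrite -mem_enum E.
by rewrite big_flatten big_map.
Qed.

(** The leaves of [A :\: I] are inserted one by one, which leaves the trace on
    [I] unchanged, in a number of ways that is the same for all trees. So the
    tree induced on [I] by a uniform random tree on [A] is uniform. *)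
Lemma big_trees_restrict I A (h : {set {set T}} -> nat) : I \subset A -> I != set0 ->
  num_trees #|I| * \sum_(t <- trees_on A) h (restrict_family I (clusters t)) =
  num_trees #|A| * \sum_(t <- trees_on I) h (restrict_family I (clusters t)).
Proof.
move=> + I0; move: {-1}#|A :\: I| (erefl #|A :\: I|) => n.
elim: n A => [|n IHn] A nA IA.
  suff -> : A = I by [].
  by apply/eqP; rewrite eqEsubset IA andbT -setD_eq0 -cards_eq0 nA.
have /set0Pn[a] : A :\: I != set0 by rewrite -cards_eq0 nA.
rewrite !inE => /andP[aI aA].
have AE := setD1K aA; set A' := A :\ a in AE.
have IA' : I \subset A' by rewrite subsetD1 IA.
have A'0 : A' != set0 by case/set0Pn: I0 => x /(subsetP IA') xA; apply/set0Pn; exists x.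
have aA' : a \notin A' by rewrite !inE eqxx.
have cA' : #|A' :\: I| = n.
  have := cardsD1 a (A :\: I); rewrite !inE aI aA nA add1n => -[->].
  by apply: eq_card => x; rewrite !inE; case: (x == a); rewrite ?andbF.
rewrite -AE big_trees_setU1 // cardsU1 aA' add1n num_treesS ?card_gt0 //.
rewrite -mulnA -(IHn A') // mulnCA; congr (_ * _).
rewrite big_distrr big_seq [RHS]big_seq /=; apply: eq_bigr => t.
rewrite trees_onP => /andP[ut /eqP tA].
rewrite (eq_big_seq (fun=> h (restrict_family I (clusters t)))).
  by rewrite big_const_seq count_predT iter_addn_0 size_insertions mulnC -card_support // tA.
by move=> u ui; rewrite (restrict_insertions aI ui).
Qed.

(** The agreement on [D] and [S] of two trees only depends on the trees that
    they induce on [D :|: S], which are uniform and independent when the trees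
    are. *)
Lemma sum_agreement_restrict D S A A' : D :|: S \subset A -> D :|: S \subset A' ->
  D :|: S != set0 ->
  num_trees #|D :|: S| ^ 2 *
    \sum_(t <- trees_on A) \sum_(t' <- trees_on A') agreement D S (clusters t) (clusters t') =
  num_trees #|A| * num_trees #|A'| * total_agreement D S.
Proof.
move=> DA DA' D0; rewrite /total_agreement.
set I := D :|: S in DA DA' D0 *.
have rE F G : agreement D S F G =
    agreement D S (restrict_family I F) (restrict_family I G).
  by rewrite agreement_restrictl ?agreement_restrictr.
under eq_bigr do under eq_bigr do rewrite rE.
rewrite -mulnn -mulnA.
rewrite (big_trees_restrict (fun F => \sum_(t' <- trees_on A')
   agreement D S F (restrict_family I (clusters t')))) //.
rewrite mulnCA -mulnA; congr (_ * _).
under [X in _ = _ * X]eq_bigr do under eq_bigr do rewrite rE.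
rewrite exchange_big [X in _ = _ * X]exchange_big /=.
exact: (big_trees_restrict (fun G => \sum_(t <- trees_on I)
   agreement D S (restrict_family I (clusters t)) G)).
Qed.

End Agreement.

Section Decomposition.
Variable T : finType.
Implicit Types (t u C l r : btree T) (a b s x : T) (A B D E I S X Y : {set T}).
Implicit Types (F G : {set {set T}}).

(** * Splitting at a central vertex *)

(** When [cen] selects exactly one node in each tree, cutting there is a
    bijection onto triples of two branches below the node and a context. The
    second hypothesis says that the label [s] is available for the hole. *)
Lemma decompose_sum A s (cen : option (btree T) -> bool) (f : btree T -> nat) :
  (forall a, cen (Some (Leaf a)) = false) ->
  (forall X u, X \subset A -> u \in trees_on X -> cen (Some u) -> s \notin A :\: X) ->
  (forall t, t \in trees_on A -> \sum_(X in clusters t) cen (subtree X t) = 1) ->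
  \sum_(t <- trees_on A) f t =
  \sum_(p : {set T} * {set T} | [disjoint p.1 & p.2] && (p.1 :|: p.2 \subset A))
    \sum_(l <- trees_on p.1) \sum_(r <- trees_on p.2)
      cen (Some (Node l r)) * \sum_(C <- trees_on (s |: (A :\: (p.1 :|: p.2)))) f (subst s (Node l r) C).
Proof.
move=> cenL cens cen1.
pose g X u := cen (Some u) * \sum_(C <- trees_on (s |: (A :\: X))) f (subst s u C).
transitivity (\sum_(X : {set T} | X \subset A) \sum_(u <- trees_on X) g X u).
  transitivity (\sum_(t <- trees_on A) \sum_(X : {set T} | (X \subset A) && (X \in clusters t)) cen (subtree X t) * f t).
    rewrite big_seq [RHS]big_seq; apply: eq_bigr => t tA.
    rewrite -[LHS]mul1n -(cen1 t tA) big_distrl /=; apply: eq_bigl => X.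
    case: (boolP (X \in clusters t)); rewrite ?andbF // => /clusters_sub.
    by move: tA; rewrite trees_onP => /andP[_ /eqP->] ->.
  rewrite (exchange_big_dep (fun X : {set T} => X \subset A)) /=; last by move=> ? ? _ /andP[].
  apply: eq_bigr => X XA.
  rewrite (eq_bigl (fun t => X \in clusters t)); last by move=> t; rewrite XA.
  case: (boolP (s \in A :\: X)) => sA; last first.
    rewrite (cut_sum (s := s) (fun t o => cen o * f t)) //; apply: eq_bigr => u _.
    by rewrite /g big_distrr.
  rewrite big_seq_cond big1; last first.
    move=> t /andP[]; rewrite trees_onP => /andP[ut _] Xt.
    have [u [-> uX uu _]] := subtreeP ut Xt.
    case E : (cen _) => //; have /(cens X u XA) := E.
    by rewrite trees_onP uu uX eqxx sA => /(_ isT).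
  rewrite big_seq big1 // => u uX; rewrite /g; case E : (cen _) => //.
  by have := cens X u XA uX E; rewrite sA.
rewrite (partition_big (fun p : {set T} * {set T} => p.1 :|: p.2) (fun X => X \subset A)); last first.
  by move=> p /andP[].
apply: eq_bigr => X XA.
have [X1|X1] := ltnP 1 #|X|.
  rewrite (node_sum (g X)) //; apply: eq_big => [p|p /andP[_ /eqP->]] //.
  by case: eqP => [->|]; rewrite ?andbF // XA !andbT.
rewrite big_seq big1; last first.
  move=> [a|l r]; rewrite /g; first by rewrite cenL.
  rewrite trees_onP => /andP[ut /eqP tX]; move: X1; rewrite -tX card_support //= size_cat.
  by have := size_leaves_gt0 l; have := size_leaves_gt0 r; lia.
rewrite big1 // => p /andP[/andP[dp _] /eqP pX].
rewrite big_seq big1 // => l; rewrite trees_onP => /andP[_ /eqP lp].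
rewrite big_seq big1 // => r; rewrite trees_onP => /andP[_ /eqP rp].
have /eqP cU : #|p.1 :|: p.2| == #|p.1| + #|p.2| by rewrite (leq_card_setU p.1 p.2).2.
move: X1; rewrite -pX cU -lp -rp.
by have := support_neq0 l; have := support_neq0 r; rewrite -!card_gt0; lia.
Qed.

(** The node is the centroid of a tree with [n] leaves: each of its three
    branches contains at most half of them. For the branch of the root this is
    the last condition, which is strict so that the node is unique. *)
Definition central n (o : option (btree T)) : bool :=
  if o is Some (Node l r) then
    [&& 2 * #|support l| <= n, 2 * #|support r| <= n & n < 2 * #|support (Node l r)|]
  else false.

Lemma card_support_Node l r : uniq (leaves (Node l r)) ->
  #|support (Node l r)| = #|support l| + #|support r|.
Proof.
move=> ut; have [ul ur _] := uniq_NodeP ut.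
by rewrite !card_support //= size_cat.
Qed.

(** On the way down from the root, the number of leaves below a node falls
    from more than [n] / 2 to at most [n] / 2 at exactly one node: at most one
    branch at a node contains more than half of the leaves. *)
Lemma central_count n t : 1 < n -> uniq (leaves t) -> #|support t| <= n ->
  \sum_(X in clusters t) central n (subtree X t) = (n < 2 * #|support t|).
Proof.
move=> n1; elim: t => [a|l IHl r IHr] ut tn; rewrite (subtree_sum (fun o => nat_of_bool (central n o))) //.
  by rewrite support_Leaf cards1 /= ltnNge n1.
have [ul ur _] := uniq_NodeP ut.
have := card_support_Node ut => cE; rewrite cE in tn.
rewrite IHl ?IHr //; try lia.
rewrite [central _ _]/= cE.
have := support_neq0 l; have := support_neq0 r; rewrite -!card_gt0; lia.
Qed.

Lemma central_sum A s (f : btree T -> nat) : s \notin A -> 1 < #|A| ->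
  \sum_(t <- trees_on A) f t =
  \sum_(p : {set T} * {set T} | [&& [disjoint p.1 & p.2], p.1 :|: p.2 \subset A,
      2 * #|p.1| <= #|A|, 2 * #|p.2| <= #|A| & #|A| < 2 * #|p.1 :|: p.2|])
    \sum_(l <- trees_on p.1) \sum_(r <- trees_on p.2)
    \sum_(C <- trees_on (s |: (A :\: (p.1 :|: p.2)))) f (subst s (Node l r) C).
Proof.
move=> sA A1; rewrite (@decompose_sum A s (central #|A|)) //.
- rewrite big_mkcondr [RHS]big_mkcond [LHS]big_mkcond; apply: eq_bigr => p _.
  case: ifP => //= _; case: ifP => //= _.
  case: ifP => cp.
    rewrite big_seq [RHS]big_seq; apply: eq_bigr => l; rewrite trees_onP => /andP[_ /eqP lp].
    rewrite big_seq [RHS]big_seq; apply: eq_bigr => r; rewrite trees_onP => /andP[_ /eqP rp].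
    by rewrite support_Node lp rp cp mul1n.
  rewrite big_seq big1 // => l; rewrite trees_onP => /andP[_ /eqP lp].
  rewrite big_seq big1 // => r; rewrite trees_onP => /andP[_ /eqP rp].
  by rewrite support_Node lp rp cp.
- by move=> X u _ _ _; rewrite inE (negbTE sA) andbF.
move=> t; rewrite trees_onP => /andP[ut /eqP tA]; rewrite central_count ?tA //.
by lia.
Qed.

(** The branch points on the path from the root to the second root [s] form
    the spine; the node is the last one with more than half of the [n] other
    leaves below it. *)
Definition spinal s n (o : option (btree T)) : bool :=
  if o is Some (Node l r) then
    ((s \in support l) && (2 * #|support l :\ s| <= n) ||
     (s \in support r) && (2 * #|support r :\ s| <= n)) &&
     (n < 2 * #|support (Node l r) :\ s|)
  else false.

Lemma spinal_notin s n t : uniq (leaves t) -> s \notin support t ->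
  \sum_(X in clusters t) spinal s n (subtree X t) = 0.
Proof.
elim: t => [a|l IHl r IHr] ut st; rewrite (subtree_sum (fun o => nat_of_bool (spinal s n o))) //.
have [ul ur _] := uniq_NodeP ut.
move: st; rewrite support_Node in_setU negb_or => /andP[sl sr].
by rewrite IHl // IHr //= (negbTE sl) (negbTE sr).
Qed.

(** Only the nodes on the path to [s] count, and along this path the number of
    leaves below decreases. *)
Lemma spinal_count s n t : uniq (leaves t) -> s \in support t ->
  \sum_(X in clusters t) spinal s n (subtree X t) = (n < 2 * #|support t :\ s|).
Proof.
elim: t => [a|l IHl r IHr] ut st; rewrite (subtree_sum (fun o => nat_of_bool (spinal s n o))) //.
  by move: st; rewrite support_Leaf inE => /eqP->; rewrite setDv cards0.
have [ul ur dlr] := uniq_NodeP ut.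
have := card_support_Node ut; rewrite (cardsD1 s (support _)) st add1n.
move=> cE; have := support_neq0 l; have := support_neq0 r; rewrite -!card_gt0 => r0 l0.
have /orP[sl|sr] : (s \in support l) || (s \in support r).
- by move: st; rewrite support_Node in_setU.
- have sr : s \notin support r by apply/negP; move: sl; rewrite !mem_support; apply: dlr.
  rewrite IHl // spinal_notin // [spinal _ _ _]/= sl (negbTE sr) /=.
  move: cE; rewrite [X in _ = X + _](cardsD1 s) sl; lia.
- have sl : s \notin support l by apply/negP => sl; move: sl sr; rewrite !mem_support; apply: dlr.
  rewrite IHr // (spinal_notin _ ul) // [spinal _ _ _]/= sr (negbTE sl) /=.
  move: cE; rewrite [X in _ = _ + X](cardsD1 s) sr; lia.
Qed.

(** The second root [s] stays a leaf of the first branch, and the hole is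
    called [s] as well, so the context has two roots again. The factor 2
    counts the side on which the branch of [s] lies, which is irrelevant for a
    function of the clusters. *)
Lemma spinal_sum A s (g : {set {set T}} -> nat) : s \notin A -> 0 < #|A| ->
  \sum_(t <- trees_on (s |: A)) g (clusters t) =
  2 * \sum_(p : {set T} * {set T} | [&& [disjoint p.1 & p.2], p.1 :|: p.2 \subset A,
      2 * #|p.1| <= #|A| & #|A| < 2 * #|p.1 :|: p.2|])
    \sum_(l <- trees_on (s |: p.1)) \sum_(r <- trees_on p.2)
    \sum_(C <- trees_on (s |: (A :\: (p.1 :|: p.2)))) g (clusters (subst s (Node l r) C)).
Proof.
move=> sA A0.
have sAD X : X \subset A -> s \in X = false.
  by move=> /subsetP XA; apply/negP => /XA; rewrite (negbTE sA).
have sU1 X : X \subset A -> (s |: X) :\ s = X by move=> XA; rewrite setU1K // sAD.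
rewrite (@decompose_sum (s |: A) s (spinal s #|A|)) //; first last.
- move=> t; rewrite trees_onP => /andP[ut /eqP tA]; rewrite spinal_count ?tA ?setU1K ?setU11 //.
  by lia.
- move=> X [a|l r] XA //; rewrite trees_onP => /andP[_ /eqP <-] /= /andP[+ _].
  by rewrite support_Node !inE; case: (s \in leaves l); case: (s \in leaves r).
pose W := fun p : {set T} * {set T} => \sum_(l <- trees_on p.1) \sum_(r <- trees_on p.2)
  spinal s #|A| (Some (Node l r)) *
  \sum_(C <- trees_on (s |: ((s |: A) :\: (p.1 :|: p.2)))) g (clusters (subst s (Node l r) C)).
transitivity (\sum_(p : {set T} * {set T} | [disjoint p.1 & p.2] && (p.1 :|: p.2 \subset s |: A)) W p) => //.
have swapW p1 p2 : W (p1, p2) = W (p2, p1).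
  rewrite /W /= exchange_big /= big_seq [RHS]big_seq; apply: eq_bigr => r.
  rewrite trees_onP => /andP[_ /eqP rp].
  rewrite big_seq [RHS]big_seq; apply: eq_bigr => l; rewrite trees_onP => /andP[_ /eqP lp].
  rewrite (setUC p1); congr (_ * _); first by rewrite /= !support_Node (setUC (support l)) orbC.
  rewrite big_seq [RHS]big_seq; apply: eq_bigr => C; rewrite trees_onP => /andP[uC /eqP CA].
  by rewrite clusters_subst_NodeC // -mem_support CA setU11.
rewrite (bigID (fun p : {set T} * {set T} => s \in p.1)) /= mul2n -addnn.
have half : \sum_(p : {set T} * {set T} | ([disjoint p.1 & p.2] && (p.1 :|: p.2 \subset s |: A)) && (s \in p.1)) W p =
  \sum_(p : {set T} * {set T} | [&& [disjoint p.1 & p.2], p.1 :|: p.2 \subset A,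
      2 * #|p.1| <= #|A| & #|A| < 2 * #|p.1 :|: p.2|])
    \sum_(l <- trees_on (s |: p.1)) \sum_(r <- trees_on p.2)
    \sum_(C <- trees_on (s |: (A :\: (p.1 :|: p.2)))) g (clusters (subst s (Node l r) C)).
  rewrite (reindex_onto (fun p => (s |: p.1, p.2)) (fun p => (p.1 :\ s, p.2))) /=; last first.
    by move=> [p1 p2] /= /andP[_ sp]; rewrite setD1K.
  transitivity (\sum_(p : {set T} * {set T} | [disjoint p.1 & p.2] && (p.1 :|: p.2 \subset A)) W (s |: p.1, p.2)).
    apply: eq_bigl => -[p1 p2] /=; rewrite setU11 andbT.
    apply/andP/andP.
      move=> [/andP[d sub] /eqP[pE]].
      have sp1 : s \notin p1 by rewrite -pE !inE eqxx.
      have sp2 : s \notin p2 by rewrite (disjointFr d) // setU11.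
      split; first by apply: disjointWl d; apply: subsetUr.
      apply/subsetP=> x xp; have := subsetP sub x; rewrite -setUA inE xp orbT !inE => /(_ isT).
      case: eqP xp => // ->; by rewrite inE (negbTE sp1) (negbTE sp2).
    move=> [d sub].
    have := sAD _ sub; rewrite inE => /negbT; rewrite negb_or => /andP[sp1 sp2].
    rewrite setU1K // eqxx -setUA setUS // andbT; split=> //.
    rewrite disjoints_subset; apply/subsetP=> x; rewrite !inE => /orP[/eqP->//|xp].
    by rewrite (disjointFr d xp).
  rewrite big_mkcondr [RHS]big_mkcond [LHS]big_mkcond; apply: eq_bigr => -[p1 p2] _.
  case: ifP => //= d; case: ifP => //= sub.
  have := sAD _ sub; rewrite inE => /negbT; rewrite negb_or => /andP[sp1 sp2].
  have E l r : l \in trees_on (s |: p1) -> r \in trees_on p2 ->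
      spinal s #|A| (Some (Node l r)) = (2 * #|p1| <= #|A|) && (#|A| < 2 * #|p1 :|: p2|).
    rewrite !trees_onP => /andP[_ /eqP lp] /andP[_ /eqP rp].
    rewrite /= support_Node lp rp setU11 (negbTE sp2) /= orbF sU1 -?setUA ?sU1 //.
    exact: subset_trans (subsetUl _ _) sub.
  have E2 : (s |: A) :\: ((s |: p1) :|: p2) = A :\: (p1 :|: p2).
    apply/setP=> x; rewrite !inE; case: eqP => //= ->.
    by rewrite (negbTE sA) andbF.
  rewrite /W [(_, _).1]/= [(_, _).2]/= E2; case: ifP => cp.
    rewrite big_seq [RHS]big_seq; apply: eq_bigr => l lp.
    by rewrite big_seq [RHS]big_seq; apply: eq_bigr => r rp; rewrite E // cp mul1n.
  rewrite big_seq big1 // => l lp; rewrite big_seq big1 // => r rp.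
  by rewrite E // cp.
congr (_ + _); first exact: half.
rewrite -half.
rewrite [LHS](bigID (fun p : {set T} * {set T} => s \in p.2)) /= [X in _ + X]big1 ?addn0; last first.
  move=> [p1 p2] /= /andP[/andP[_ sp1] sp2].
  rewrite /W /= big_seq big1 // => l; rewrite trees_onP => /andP[_ /eqP lp].
  rewrite big_seq big1 // => r; rewrite trees_onP => /andP[_ /eqP rp].
  by rewrite /= lp rp (negbTE sp1) (negbTE sp2).
rewrite (reindex_inj (h := fun p : {set T} * {set T} => (p.2, p.1))) /=; last by move=> [? ?] [? ?] [-> ->].
apply: eq_big => [[p1 p2]|[p1 p2] _] /=; last exact: swapW.
rewrite disjoint_sym setUC -!andbA; case d : [disjoint p1 & p2] => //=.
case sp : (s \in p1); rewrite ?andbF // !andbT.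
by rewrite (disjointFr d sp) andbT.
Qed.

End Decomposition.

Section Superadditivity.
Variable T : finType.
Implicit Types (t u C l r : btree T) (a b s x : T) (A B D E I S X Y : {set T}).
Implicit Types (F G : {set {set T}}).

(** * Superadditivity of the agreement *)

(** There is only one rooted tree with two given leaves. *)
Lemma agree_pair a s t t' : a \in support t -> s \in support t ->
  a \in support t' -> s \in support t' ->
  agree ([set a] :|: [set s]) (clusters t) (clusters t').
Proof.
have key v : a \in support v -> s \in support v ->
    restrict_family ([set a] :|: [set s]) (clusters v) = powerset ([set a] :|: [set s]).
  move=> av sv; apply/setP=> Y; rewrite powersetE; apply/restrict_familyP/idP.
    by case=> [->|[X _ ->]]; rewrite ?sub0set ?subsetIr.
  move=> Yas; have YP x : x \in Y -> x = a \/ x = s.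
    by move=> /(subsetP Yas); rewrite !inE => /orP[] /eqP; auto.
  case: (boolP (a \in Y)) => aY; case: (boolP (s \in Y)) => sY.
  - right; exists (support v); rewrite ?support_clusters //.
    apply/setP=> x; rewrite in_setI in_setU !in_set1; apply/idP/andP.
      by move=> /YP[]->; rewrite eqxx ?orbT.
    by case=> _ /orP[] /eqP->.
  - right; exists [set a]; first by rewrite clusters1 // -mem_support.
    apply/setP=> x; rewrite !inE; apply/idP/andP; last by case=> /eqP->.
    by move=> /[dup] xY /YP[xa|xs]; [rewrite xa eqxx|rewrite -xs xY in sY].
  - right; exists [set s]; first by rewrite clusters1 // -mem_support.
    apply/setP=> x; rewrite !inE; apply/idP/andP; last by case=> /eqP->.
    by move=> /[dup] xY /YP[xa|xs]; [rewrite -xa xY in aY|rewrite xs eqxx orbT].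
  - left; apply/setP=> x; rewrite inE; apply/negP=> /[dup] xY /YP[xa|xs].
      by rewrite -xa xY in aY.
    by rewrite -xs xY in sY.
by move=> av sv av' sv'; rewrite /agree !key.
Qed.

Lemma agree1 s t t' : s \in support t -> s \in support t' ->
  agree [set s] (clusters t) (clusters t').
Proof. by move=> st st'; rewrite -(setUid [set s]); apply: agree_pair. Qed.

Lemma agree0 F G : agree set0 F G.
Proof.
have key H : restrict_family set0 H = [set set0].
  apply/setP=> Y; rewrite in_set1; apply/restrict_familyP/eqP => [|->]; last by left.
  by case=> // -[X _ ->]; rewrite setI0.
by rewrite /agree !key.
Qed.

Lemma trees_on_hole s A C : C \in trees_on (s |: A) -> s \notin A ->
  [/\ uniq (leaves C), s \in leaves C & support C :\ s = A].
Proof.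
rewrite trees_onP => /andP[uC /eqP CA] sA; split=> //.
  by rewrite -mem_support CA setU11.
by rewrite CA setU1K.
Qed.

Lemma support_trees_on A t : t \in trees_on A -> support t = A.
Proof. by rewrite trees_onP => /andP[_ /eqP]. Qed.

Lemma disjointS A B D E : [disjoint A & B] -> D \subset A -> E \subset B -> [disjoint D & E].
Proof. by move=> AB DA EB; apply: disjointWl DA _; apply: disjointWr EB _. Qed.

Lemma disjointUl A B D : [disjoint A :|: B & D] = [disjoint A & D] && [disjoint B & D].
Proof. by rewrite -!setI_eq0 setIUl setU_eq0. Qed.

Lemma disjointUr A B D : [disjoint D & A :|: B] = [disjoint D & A] && [disjoint D & B].
Proof. by rewrite -!setI_eq0 setIUr setU_eq0. Qed.

Lemma disjoint1l a A : [disjoint [set a] & A] = (a \notin A).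
Proof. exact: disjoints1. Qed.

Lemma disjoint1r a A : [disjoint A & [set a]] = (a \notin A).
Proof. by rewrite disjoint_sym disjoints1. Qed.

Section Glue.
Variables (s : T) (A A1 A2 A3 A1' A2' A3' : {set T}).
Hypotheses (A12 : [disjoint A1 & A2]) (A13 : [disjoint A1 & A3]) (A23 : [disjoint A2 & A3]).
Hypotheses (A12' : [disjoint A1' & A2']) (A13' : [disjoint A1' & A3']).
Hypothesis (A23' : [disjoint A2' & A3']).
Hypotheses (AE : A = A1 :|: A2 :|: A3) (AE' : A = A1' :|: A2' :|: A3') (sA : s \notin A).

Let s_notin : [/\ s \notin A1, s \notin A2 & s \notin A3].
Proof. by move: sA; rewrite AE !inE !negb_or -andbA => /and3P. Qed.
Let s_notin' : [/\ s \notin A1', s \notin A2' & s \notin A3'].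
Proof. by move: sA; rewrite AE' !inE !negb_or -andbA => /and3P. Qed.

Lemma card_disjointU3 (B1 B2 B3 : {set T}) :
  B1 \subset A1 -> B2 \subset A2 -> B3 \subset A3 ->
  #|B3 :|: (B1 :|: B2)| = #|B1| + #|B2| + #|B3|.
Proof.
move=> b1 b2 b3; have cU X Y : [disjoint X & Y] -> #|X :|: Y| = #|X| + #|Y|.
  by move=> d; apply/eqP; rewrite (leq_card_setU X Y).2.
rewrite cU; last first.
  by rewrite disjointUr !(disjoint_sym B3) (disjointS A13) // (disjointS A23).
rewrite cU ?(disjointS A12) //; lia.
Qed.

(** Optimal common subtrees of the three pairs of pieces are glued at the two
    centroids. The one of the contexts has to contain the hole [s], where the
    other two are attached. *)
Lemma agreement_central l r C l' r' C' :
  l \in trees_on A1 -> r \in trees_on A2 -> C \in trees_on (s |: A3) ->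
  l' \in trees_on A1' -> r' \in trees_on A2' -> C' \in trees_on (s |: A3') ->
  agreement (A1 :&: A1') set0 (clusters l) (clusters l') +
  agreement (A2 :&: A2') set0 (clusters r) (clusters r') +
  agreement (A3 :&: A3') [set s] (clusters C) (clusters C') <=
  agreement A set0 (clusters (subst s (Node l r) C)) (clusters (subst s (Node l' r') C')).
Proof.
have [s1 s2 s3] := s_notin; have [s1' s2' s3'] := s_notin'.
move=> /support_trees_on lA /support_trees_on rA /trees_on_hole/(_ s3)[uC sC CA].
move=> /support_trees_on lA' /support_trees_on rA' /trees_on_hole/(_ s3')[uC' sC' CA'].
have [B1 [B1s a1 ->]] := agreement_witness (A1 :&: A1') (agree0 (clusters l) (clusters l')).
have [B2 [B2s a2 ->]] := agreement_witness (A2 :&: A2') (agree0 (clusters r) (clusters r')).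
have aC : agree [set s] (clusters C) (clusters C') by apply: agree1; rewrite inE.
have [B3 [B3s a3 ->]] := agreement_witness (A3 :&: A3') aC.
rewrite !setU0 in a1 a2.
move: B1s B2s B3s; rewrite !subsetI => /andP[b1 b1'] /andP[b2 b2'] /andP[b3 b3'].
rewrite -card_disjointU3 //; apply: leq_agreement.
  by rewrite AE !subUset; apply/and3P; split; apply/subsetP=> x; rewrite !inE => xB;
    rewrite ?(subsetP b1 x xB) ?(subsetP b2 x xB) ?(subsetP b3 x xB) ?orbT.
have d12 := disjointS A12; have d13 := disjointS A13; have d23 := disjointS A23.
have d12' := disjointS A12'; have d13' := disjointS A13'; have d23' := disjointS A23'.
rewrite setU0; apply: agree_subst => //; rewrite ?support_Node ?lA ?rA ?lA' ?rA' ?CA ?CA' ?setUSS //.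
- by apply: contra s3; apply: (subsetP b3).
- by rewrite disjointUr !(disjoint_sym B3) d13 // d23.
- by rewrite disjointUr !(disjoint_sym B3) d13' // d23'.
- by rewrite disjointUl d13 // d23.
- by rewrite disjointUl d13' // d23'.
have e1 := d12 _ _ b1 (subxx A2); have e1' := d12' _ _ b1' (subxx A2').
have e2 := d12 _ _ (subxx A1) b2; have e2' := d12' _ _ (subxx A1') b2'.
rewrite disjoint_sym in e2; rewrite disjoint_sym in e2'.
by apply: agree_Node; rewrite ?lA ?rA ?lA' ?rA'.
Qed.

(** The same gluing. Here the common subtree of the branches of the second
    root has to contain it as well, so that the result does. *)
Lemma agreement_spinal l r C l' r' C' :
  l \in trees_on (s |: A1) -> r \in trees_on A2 -> C \in trees_on (s |: A3) ->
  l' \in trees_on (s |: A1') -> r' \in trees_on A2' -> C' \in trees_on (s |: A3') ->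
  agreement (A1 :&: A1') [set s] (clusters l) (clusters l') +
  agreement (A2 :&: A2') set0 (clusters r) (clusters r') +
  agreement (A3 :&: A3') [set s] (clusters C) (clusters C') <=
  agreement A [set s] (clusters (subst s (Node l r) C)) (clusters (subst s (Node l' r') C')).
Proof.
have [s1 s2 s3] := s_notin; have [s1' s2' s3'] := s_notin'.
move=> /support_trees_on lA /support_trees_on rA /trees_on_hole/(_ s3)[uC sC CA].
move=> /support_trees_on lA' /support_trees_on rA' /trees_on_hole/(_ s3')[uC' sC' CA'].
have al : agree [set s] (clusters l) (clusters l').
  by apply: agree1; rewrite ?lA ?lA' setU11.
have [B1 [B1s a1 ->]] := agreement_witness (A1 :&: A1') al.
have [B2 [B2s a2 ->]] := agreement_witness (A2 :&: A2') (agree0 (clusters r) (clusters r')).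
have aC : agree [set s] (clusters C) (clusters C') by apply: agree1; rewrite inE.
have [B3 [B3s a3 ->]] := agreement_witness (A3 :&: A3') aC.
rewrite !setU0 in a2.
move: B1s B2s B3s; rewrite !subsetI => /andP[b1 b1'] /andP[b2 b2'] /andP[b3 b3'].
rewrite -card_disjointU3 //; apply: leq_agreement.
  by rewrite AE !subUset; apply/and3P; split; apply/subsetP=> x; rewrite !inE => xB;
    rewrite ?(subsetP b1 x xB) ?(subsetP b2 x xB) ?(subsetP b3 x xB) ?orbT.
have d12 := disjointS A12; have d13 := disjointS A13; have d23 := disjointS A23.
have d12' := disjointS A12'; have d13' := disjointS A13'; have d23' := disjointS A23'.
have sB X Y : X \subset Y -> s \notin Y -> s \notin X.
  by move=> /subsetP XY; apply: contra; apply: XY.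
rewrite -setUA (setUAC B1) -/(_ :|: _).
apply: agree_subst => //; rewrite ?support_Node ?lA ?rA ?lA' ?rA' ?CA ?CA'.
- exact: sB b3 s3.
- by rewrite setUSS // setUC setUS.
- by rewrite setUSS // setUC setUS.
- by rewrite !disjointUr disjoint1r !(disjoint_sym B3) (sB _ _ b3) // d13 // d23.
- by rewrite !disjointUr disjoint1r !(disjoint_sym B3) (sB _ _ b3) // d13' // d23'.
- by rewrite !disjointUl disjoint1l s3 d13 // d23.
- by rewrite !disjointUl disjoint1l s3' d13' // d23'.
apply: agree_Node; rewrite ?lA ?rA ?lA' ?rA' //.
- by rewrite setUC setUS.
- by rewrite setUC setUS.
- by rewrite !disjointUl disjoint1l s2 d12.
- by rewrite !disjointUl disjoint1l s2' d12'.
- by rewrite !disjointUr disjoint1r !(disjoint_sym B2) (sB _ _ b2) // d12.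
- by rewrite !disjointUr disjoint1r !(disjoint_sym B2) (sB _ _ b2') // d12'.
Qed.

End Glue.

Definition central_parts A (p : {set T} * {set T}) : bool :=
  [&& [disjoint p.1 & p.2], p.1 :|: p.2 \subset A,
      2 * #|p.1| <= #|A|, 2 * #|p.2| <= #|A| & #|A| < 2 * #|p.1 :|: p.2|].

Definition spinal_parts A (p : {set T} * {set T}) : bool :=
  [&& [disjoint p.1 & p.2], p.1 :|: p.2 \subset A,
      2 * #|p.1| <= #|A| & #|A| < 2 * #|p.1 :|: p.2|].

(** By symmetry the branches may be ordered by size, at the loss of ties. The
    order matters later on: of two trees, the smaller branches are compared
    with each other and the larger branches with each other, since pieces of
    similar sizes have the larger common subtrees. *)
Lemma central_sum_lt A s (g : {set {set T}} -> nat) : s \notin A -> 1 < #|A| ->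
  2 * \sum_(p | central_parts A p && (#|p.1| < #|p.2|))
    \sum_(l <- trees_on p.1) \sum_(r <- trees_on p.2)
    \sum_(C <- trees_on (s |: (A :\: (p.1 :|: p.2)))) g (clusters (subst s (Node l r) C))
  <= \sum_(t <- trees_on A) g (clusters t).
Proof.
move=> sA A1; rewrite (central_sum (g \o @clusters T) sA A1) /=.
pose V := fun p : {set T} * {set T} => \sum_(l <- trees_on p.1) \sum_(r <- trees_on p.2)
    \sum_(C <- trees_on (s |: (A :\: (p.1 :|: p.2)))) g (clusters (subst s (Node l r) C)).
suff : 2 * \sum_(p | central_parts A p && (#|p.1| < #|p.2|)) V p <= \sum_(p | central_parts A p) V p by [].
have sw : \sum_(p | central_parts A p && (#|p.1| < #|p.2|)) V p =
          \sum_(p | central_parts A p && (#|p.2| < #|p.1|)) V p.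
  rewrite (reindex_inj (h := fun p : {set T} * {set T} => (p.2, p.1))) /=; last first.
    by move=> [? ?] [? ?] [-> ->].
  apply: eq_big => [[p1 p2]|[p1 p2] /andP[cp _]]; rewrite /central_parts /=.
    rewrite disjoint_sym (setUC p1); do !case: (_ <= _) => //=; rewrite ?andbF //.
  rewrite /V /= exchange_big /= big_seq [RHS]big_seq; apply: eq_bigr => r rp.
  rewrite big_seq [RHS]big_seq; apply: eq_bigr => l lp.
  rewrite (setUC p1) big_seq [RHS]big_seq; apply: eq_bigr => C Cp.
  have [|uC sC _] := trees_on_hole Cp; first by rewrite inE (negbTE sA) andbF.
  by rewrite clusters_subst_NodeC.
rewrite mul2n -addnn {2}sw.
rewrite [leqRHS](bigID (fun p : {set T} * {set T} => #|p.1| < #|p.2|)) /=.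
apply: leq_add.
  by rewrite leq_eqVlt; apply/orP; left; apply/eqP; apply: eq_bigl.
rewrite [leqRHS](bigID (fun p : {set T} * {set T} => #|p.2| < #|p.1|)) /=.
apply: leq_trans (leq_addr _ _).
rewrite leq_eqVlt; apply/orP; left; apply/eqP; apply: eq_bigl => p.
rewrite /central_parts -leqNgt; case: (ltnP #|p.2| #|p.1|) => [/ltnW->|]; rewrite ?andbF // !andbT.
by [].
Qed.

End Superadditivity.

Local Open Scope nat_scope.

(** * Rooted trees *)

Section Rooting.
Variables (L : finType) (G : lgraph L).
Local Notation V := (vertex G).
Local Notation e := (@adj L G).
Implicit Types (x y z v w : V) (p q : seq V).

(** A graph that is a tree with root [r], given by the parent function [par];
    the rank [h] increases away from the root, so that [par] has no other
    cycles. *)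
Definition rooting (r : V) (par : V -> V) (h : V -> nat) : Prop :=
  [/\ par r = r, forall x, x != r -> h (par x) < h x
    & forall x y, e x y = (x != r) && (par x == y) || (y != r) && (par y == x)].

(** Otherwise [x] would close a cycle with a simple path from [y] to [y']. *)
Lemma tree_no_detour x y y' p : is_tree G -> e x y -> e x y' ->
  path e y p -> last y p = y' -> x \notin y :: p -> y = y'.
Proof.
move=> [_ syme irre _ acyc] xy xy' yp lp; case/shortenP: yp lp => q yq uq qp lq xp.
apply/eqP/negPn/negP => yy'.
apply: (acyc (x :: y :: q)).
  by case: q yq uq qp lq => [|z q] //= _ _ _ E; rewrite E eqxx in yy'.
rewrite /ucycle; apply/andP; split.
  by rewrite /= xy rcons_path yq lq syme.
rewrite cons_uniq uq andbT; apply: contra xp; rewrite !inE => /orP[->//|/qp->].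
by rewrite orbT.
Qed.

Section Distance.
Variable r : V.
Hypothesis treeG : is_tree G.

Let at_distance x k := [exists t : k.-tuple V, path e x t && (last x t == r)].

Let ex_distance x : exists k, at_distance x k.
Proof.
case: treeG => _ _ _ conn _.
case/connectP: (conn x r) => p xp rp; exists (size p); apply/existsP.
by exists (in_tuple p); rewrite /= xp rp eqxx.
Qed.

Definition distance x := ex_minn (ex_distance x).

Lemma distance_le x p : path e x p -> last x p = r -> distance x <= size p.
Proof.
move=> xp lp; rewrite /distance; case: ex_minnP => m _; apply.
by apply/existsP; exists (in_tuple p); rewrite /= xp lp eqxx.
Qed.

Lemma distance_path x : exists p, [/\ path e x p, last x p = r & size p = distance x].
Proof.
rewrite /distance; case: ex_minnP => m /existsP[t /andP[xt /eqP lt]] _.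
by exists t; rewrite size_tuple.
Qed.

Lemma distance_root : distance r = 0.
Proof. by apply/eqP; rewrite -leqn0; apply: (@distance_le r [::]). Qed.

Lemma distance0 x : distance x = 0 -> x = r.
Proof.
by have [p [_ lp sp]] := distance_path x; move=> x0; move: lp; rewrite (size0nil (etrans sp x0)).
Qed.

Lemma distance_step x : x != r -> exists2 y, e x y & distance x = (distance y).+1.
Proof.
move=> xr; have [[|y p] [/= xp lp sp]] := distance_path x.
  by rewrite lp eqxx in xr.
case/andP: xp => xy yp; exists y => //; apply/eqP; rewrite eqn_leq; apply/andP; split.
  have [q [yq lq sq]] := distance_path y.
  by rewrite -sq; apply: (@distance_le x (y :: q)); rewrite //= xy.
by rewrite -sp ltnS; apply: distance_le.
Qed.

Lemma geodesic x : exists p, [/\ path e x p, last x p = r &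
  all (fun y => distance y < distance x) p].
Proof.
have [n] := ubnP (distance x); elim: n x => // n IHn x.
have [->|xr] := eqVneq x r; first by exists [::].
have [y xy dx] := distance_step xr; rewrite dx ltnS => dn.
have [p [yp lp ap]] := IHn y dn.
exists (y :: p); rewrite /= xy ltnS leqnn; split=> //=.
by apply/allP => z /(allP ap) /ltnW; rewrite ltnS.
Qed.

(** Two neighbors of [x] that are not farther from the root than [x] are
    joined by geodesics through the root that avoid [x]. *)
Lemma closer_unique x y y' : e x y -> e x y' ->
  distance y <= distance x -> distance y' <= distance x -> y = y'.
Proof.
move=> xy xy' dy dy'; case: (treeG) => _ syme irre _ _.
have avoid z : e x z -> distance z <= distance x ->
    exists p, [/\ path e z p, last z p = r & x \notin z :: p].
  move=> xz dz; have [p [zp lp ap]] := geodesic z; exists p; split=> //.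
  rewrite inE negb_or; apply/andP; split.
    by apply/eqP => E; rewrite E irre in xz.
  by apply/negP => /(allP ap); rewrite ltnNge dz.
have [p [yp lp xp]] := avoid y xy dy; have [q [yq lq xq]] := avoid y' xy' dy'.
pose p' := rev (belast y' q).
have rq : path e r p' by rewrite -lq rev_path; apply: sub_path yq => a b; rewrite syme.
have lr : last r p' = y'.
  by rewrite /p'; case: (q) lq => [|z s] //=; rewrite rev_cons last_rcons.
apply: (tree_no_detour treeG xy xy' (p := p ++ p')).
- by rewrite cat_path yp lp.
- by rewrite last_cat lp.
rewrite -cat_cons mem_cat negb_or xp /= mem_rev.
by apply: contra xq => /mem_belast.
Qed.

Definition tree_parent x :=
  if x == r then r else odflt x [pick y | e x y && (distance y < distance x)].

(** By [closer_unique], each vertex except the root has exactly one neighbor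
    closer to the root, and no two adjacent vertices are at the same distance.
    *)
Lemma tree_rooting : rooting r tree_parent distance.
Proof.
have parP x : x != r -> e x (tree_parent x) /\ distance (tree_parent x) < distance x.
  move=> xr; rewrite /tree_parent (negbTE xr); case: pickP => [y /andP[]//|none].
  have [y xy dx] := distance_step xr.
  by have := none y; rewrite xy dx ltnSn.
case: (treeG) => _ syme irre _ _.
have uniqp x y : e x y -> distance y <= distance x -> (x != r) && (tree_parent x == y).
  move=> xy dyx; have xr : x != r.
    apply/eqP => E; move: dyx; rewrite E distance_root leqn0 => /eqP/distance0 yr.
    by rewrite E yr irre in xy.
  have [xp dp] := parP x xr; rewrite xr; apply/eqP.
  by apply: closer_unique xp xy (ltnW dp) dyx.
split=> [|x /parP[]//|x y]; first by rewrite /tree_parent eqxx.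
apply/idP/orP => [xy|[/andP[xr /eqP<-]|/andP[yr /eqP<-]]].
- by case/orP: (leq_total (distance y) (distance x)) => d; [left|right]; apply: uniqp; rewrite // syme.
- by have [] := parP x xr.
- by rewrite syme; have [] := parP y yr.
Qed.

End Distance.

(* Ancestors of [x] are the vertices [y] with [fconnect par x y]. *)
Section RootedTree.
Variables (r : V) (par : V -> V) (h : V -> nat).
Hypothesis rG : rooting r par h.
Local Notation anc := (fconnect par).

Let par_r : par r = r. Proof. by case: rG. Qed.
Let h_par x : x != r -> h (par x) < h x. Proof. by case: rG => _ H _; exact: H. Qed.
Let eE x y : e x y = (x != r) && (par x == y) || (y != r) && (par y == x).
Proof. by case: rG. Qed.

Lemma rooting_sym x y : e x y = e y x.
Proof. by rewrite !eE orbC. Qed.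

Lemma anc_ind (P : V -> Prop) x y : anc x y -> P x -> (forall z, anc x z -> P z -> P (par z)) -> P y.
Proof.
move=> /iter_findex <- Px step; elim: (findex _ _ _) => //= n IH.
by apply: step => //; exact: fconnect_iter.
Qed.

Lemma anc_par x : anc x (par x). Proof. exact: fconnect1. Qed.

Lemma anc_root x : anc x r.
Proof.
have [n] := ubnP (h x); elim: n x => // n IHn x; rewrite ltnS => hx.
have [->|xr] := eqVneq x r; first exact: connect0.
apply: connect_trans (anc_par x) _; apply: IHn.
exact: leq_trans (h_par xr) hx.
Qed.

Lemma anc_of_root x : anc r x -> x = r.
Proof. by move=> rx; apply: (@anc_ind (fun z => z = r) _ _ rx) => // z _ ->. Qed.

Lemma anc_h x y : anc x y -> x = y \/ h y < h x.
Proof.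
move=> xy; apply: (@anc_ind (fun y => x = y \/ h y < h x) _ _ xy); first by left.
move=> z _; have [->|zr] := eqVneq z r; first by rewrite par_r.
by have := h_par zr => hz [->|hzx]; right=> //; exact: ltn_trans hz hzx.
Qed.

Lemma anc_antisym x y : anc x y -> anc y x -> x = y.
Proof.
by move=> /anc_h[//|h1] /anc_h[//|h2]; have := ltn_trans h1 h2; rewrite ltnn.
Qed.

Lemma anc_step x y : anc x y -> x != y -> anc (par x) y.
Proof.
move=> xy; apply: (@anc_ind (fun y => x != y -> anc (par x) y) _ _ xy); first by rewrite eqxx.
move=> z xz IH xpz; have [->|xz'] := eqVneq x z; first exact: connect0.
exact: connect_trans (IH xz') (anc_par z).
Qed.

Lemma anc_comparable x y z : anc x y -> anc x z -> anc y z \/ anc z y.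
Proof.
move=> xy xz; apply: (@anc_ind (fun y => anc y z \/ anc z y) _ _ xy); first by left.
move=> v _ [vz|zv]; last by right; apply: connect_trans zv (anc_par v).
have [<-|vz'] := eqVneq v z; first by right; exact: anc_par.
by left; apply: anc_step.
Qed.

Definition child x c := (c != r) && (par c == x).

Lemma anc_child x y : anc y x -> y != x -> exists2 c, child x c & anc y c.
Proof.
move=> yx; apply: (@anc_ind (fun x => y != x -> exists2 c, child x c & anc y c) _ _ yx).
  by rewrite eqxx.
move=> z yz IH ypz; have [zr|zr] := eqVneq z r.
  by move: ypz; rewrite zr par_r -zr => /IH.
by exists z => //; rewrite /child zr eqxx.
Qed.

Lemma child_anc x c : child x c -> anc c x.
Proof. by move=> /andP[_ /eqP<-]; exact: anc_par. Qed.

Lemma child_neq x c : child x c -> c != x.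
Proof.
move=> /andP[cr /eqP<-]; apply: contraTneq (h_par cr) => <-.
by rewrite ltnn.
Qed.

Lemma child_disjoint x c c' y : child x c -> child x c' -> anc y c -> anc y c' -> c = c'.
Proof.
have key c1 c2 : child x c1 -> child x c2 -> anc c1 c2 -> c1 = c2.
  move=> h1 h2 c12; apply/eqP/negPn/negP => ne.
  have /andP[_ /eqP p1] := h1.
  have := anc_step c12 ne; rewrite p1 => /anc_antisym/(_ (child_anc h2)) E.
  by have := child_neq h2; rewrite -E eqxx.
move=> h1 h2 y1 y2; case: (anc_comparable y1 y2) => [/key|/key] H; first exact: H.
by apply/esym/H.
Qed.

Lemma adj_child x y : e x y = child y x || child x y.
Proof. exact: eE. Qed.

(** On a cycle, both neighbors of a vertex of maximal rank would be its
    parent. *)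
Lemma rooting_is_tree : is_tree G.
Proof.
split.
- by apply/card_gt0P; exists r.
- exact: rooting_sym.
- by move=> x; rewrite eE; apply/negbTE/norP; split; apply/negP => /andP[/h_par + /eqP E]; rewrite E ltnn.
- move=> x y.
  have up z : connect e z r.
    apply: (@connect_trans _ _ r); last exact: connect0.
    have [n] := ubnP (h z); elim: n z => // n IHn z; rewrite ltnS => hz.
    have [->|zr] := eqVneq z r; first exact: connect0.
    apply: connect_trans (connect1 _) (IHn (par z) (leq_trans (h_par zr) hz)).
    by rewrite /= eE zr eqxx.
  by apply: connect_trans (up x) _; rewrite (sym_connect_sym rooting_sym) up.
move=> p p2 /andP[cp up].
have [x0 x0p] : exists x, x \in p by case: p p2 {cp up} => // x *; exists x; rewrite mem_head.
case: (@arg_maxnP _ x0 [in p] h x0p) => m mp max.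
have /rot_to[k q pq] : m \in p by [].
move: cp up p2; rewrite -(rot_cycle k) -(rot_uniq k) -(size_rot k) pq.
have maxq x : x \in m :: q -> h x <= h m by rewrite -pq mem_rot; exact: max.
have near x : x \in m :: q -> e m x -> x = par m.
  move=> /maxq xm; rewrite eE => /orP[/andP[_ /eqP->]//|/andP[/h_par + /eqP E]].
  by rewrite E ltnNge xm.
case: q {pq} maxq near => [|a [|b q]] // maxq near /=; rewrite rcons_path /=.
set l := last _ _ => /and3P[ma _ /andP[_ lm]] /and3P[mn an _] _.
have lq : l \in b :: q by exact: mem_last.
have al : a = l.
  rewrite (near a) ?inE ?eqxx ?orbT // (near l) // 1?rooting_sym //.
  by rewrite !inE; move: lq; rewrite inE => ->; rewrite !orbT.
by rewrite al lq in an.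
Qed.

(** * Induced subtrees *)

Section Induced.
Variable (rho : L).
Local Notation lab := (@label L G).

(** The labeled vertices are the leaves, one of which is the root, of label
    [rho], and the others are branch points, with two children. *)
Definition binary_labeling : Prop :=
  [/\ lab r = Some rho,
      forall x y a, lab x = Some a -> lab y = Some a -> x = y,
      forall x c, x != r -> lab x <> None -> ~~ child x c,
      exists c0, forall c, child r c = (c == c0)
    & forall x, lab x = None ->
        exists c1 c2, c1 != c2 /\ forall c, child x c = (c == c1) || (c == c2)].

Definition cluster v : {set L} := [set a | [exists y, (lab y == Some a) && anc y v]].

Hypothesis bG : binary_labeling.
Let lab_r : lab r = Some rho. Proof. by case: bG. Qed.
Let lab_inj x y a : lab x = Some a -> lab y = Some a -> x = y.
Proof. by case: bG => _ H _ _ _; exact: H. Qed.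
Let leaf_child x c : x != r -> lab x <> None -> ~~ child x c.
Proof. by case: bG => _ _ H _ _; exact: H. Qed.
Let root_child : exists c0, forall c, child r c = (c == c0).
Proof. by case: bG. Qed.
Let inner_child x : lab x = None ->
  exists c1 c2, c1 != c2 /\ forall c, child x c = (c == c1) || (c == c2).
Proof. by case: bG => _ _ _ _ H; exact: H. Qed.

Lemma clusterP v a : reflect (exists2 y, lab y = Some a & anc y v) (a \in cluster v).
Proof.
rewrite inE; apply: (iffP existsP) => [[y /andP[/eqP ya yv]]|[y ya yv]]; exists y => //.
by rewrite ya eqxx.
Qed.

Lemma cluster_anc x y : anc x y -> cluster x \subset cluster y.
Proof.
move=> xy; apply/subsetP=> a /clusterP[z za zx]; apply/clusterP.
by exists z => //; apply: connect_trans zx xy.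
Qed.

Lemma cluster_leaf x a : x != r -> lab x = Some a -> cluster x = [set a].
Proof.
move=> xr xa; apply/setP=> b; rewrite inE; apply/clusterP/eqP => [[y yb yx]|->]; last first.
  by exists x.
have [E|yx'] := eqVneq y x; first by move: yb; rewrite E xa => -[].
have [c cx _] := anc_child yx yx'.
by have := leaf_child c xr; rewrite xa cx; move=> /(_ (fun H => ltac:(discriminate H))).
Qed.

Lemma cluster_inner x c1 c2 : lab x = None -> (forall c, child x c = (c == c1) || (c == c2)) ->
  cluster x = cluster c1 :|: cluster c2.
Proof.
move=> x0 xc; have [h1 h2] : child x c1 /\ child x c2 by rewrite !xc !eqxx orbT.
apply/eqP; rewrite eqEsubset subUset !cluster_anc ?child_anc // !andbT.
apply/subsetP=> a /clusterP[y ya yx].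
have [E|yx'] := eqVneq y x; first by rewrite E x0 in ya.
have [c + yc] := anc_child yx yx'; rewrite xc inE => /orP[] /eqP E; rewrite E in yc.
  by apply/orP; left; apply/clusterP; exists y.
by apply/orP; right; apply/clusterP; exists y.
Qed.

Lemma cluster_disjoint x c1 c2 : child x c1 -> child x c2 -> c1 != c2 ->
  [disjoint cluster c1 & cluster c2].
Proof.
move=> h1 h2 c12; rewrite -setI_eq0; apply/eqP/setP=> a; rewrite inE in_set0.
apply/negP => /andP[/clusterP[y ya y1] /clusterP[z za z2]].
rewrite (lab_inj za ya) in z2.
by rewrite (child_disjoint h1 h2 y1 z2) eqxx in c12.
Qed.

Lemma cluster_notin_root v : v != r -> rho \notin cluster v.
Proof.
move=> vr; apply/negP => /clusterP[y yr yv]; move: yv; rewrite (lab_inj yr lab_r).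
by move=> /anc_of_root E; rewrite E eqxx in vr.
Qed.

Lemma cluster_neq0 v : v != r -> cluster v != set0.
Proof.
have [n] := ubnP #|[set y | anc y v]|; elim: n v => // n IHn v; rewrite ltnS => vn vr.
case E : (lab v) => [a|].
  by rewrite (cluster_leaf vr E); apply/set0Pn; exists a; rewrite inE.
have [c1 [c2 [c12 xc]]] := inner_child E.
have h1 : child v c1 by rewrite xc eqxx.
rewrite (cluster_inner E xc) setU_eq0 negb_and IHn //; last by case/andP: h1.
apply: leq_trans vn; apply: proper_card; apply/properP; split.
  apply/subsetP=> y; rewrite !inE => yc; exact: connect_trans yc (child_anc h1).
exists v; rewrite !inE ?connect0 //; apply/negP => vc.
by have := child_neq h1; rewrite (anc_antisym vc (child_anc h1)) eqxx.
Qed.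

Section Restrict.
Variable (B : {set L}).
Hypothesis rhoB : rho \notin B.
Local Notation S := (rho |: B).

Definition trace v := cluster v :&: B.

Lemma trace_anc x y : anc x y -> trace x \subset trace y.
Proof. by move=> xy; apply: setSI; exact: cluster_anc. Qed.

Lemma labeled_below x z : labeled_in S x -> trace z = set0 -> z != r -> ~~ anc x z.
Proof.
move=> [a aS xa] z0 zr; apply/negP => xz.
have az : a \in cluster z by apply/clusterP; exists x.
move: aS; rewrite !inE => /orP[/eqP E|aB].
  by move: az; rewrite E (negbTE (cluster_notin_root zr)).
by have := in_set0 a; rewrite -z0 inE az aB.
Qed.

Lemma edge_below x y z : e x y -> x != z -> y != z -> anc x z = anc y z.
Proof.
have key a b : child a b -> b != z -> anc a z = anc b z.
  move=> ab bz; apply/idP/idP => [az|/anc_step/(_ bz)]; last by case/andP: ab => _ /eqP->.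
  exact: connect_trans (child_anc ab) az.
by rewrite adj_child => /orP[] xy xz yz; [apply/esym|]; apply: key xy _.
Qed.

Lemma path_below x p z : path e x p -> z \notin x :: p -> {in x :: p, forall y, anc y z = anc x z}.
Proof.
elim: p x => [|y p IHp] x /=; first by move=> _ _ y; rewrite inE => /eqP->.
move=> /andP[xy yp]; rewrite inE negb_or => /andP[zx zp] w; rewrite inE => /orP[/eqP->//|wp].
rewrite (IHp y) // (edge_below xy) // eq_sym //.
by move: zp; rewrite inE negb_or => /andP[].
Qed.

Lemma ascent x : exists p, [/\ path e x p, last x p = r, uniq (x :: p) & x :: p =i fun y => anc x y].
Proof.
have [n] := ubnP (h x); elim: n x => // n IHn x; rewrite ltnS => hx.
have [->|xr] := eqVneq x r.
  exists [::]; split=> // y; rewrite inE; apply/eqP/idP => [->|]; first exact: connect0.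
  exact: anc_of_root.
have [p [xp lp up pE]] := IHn (par x) (leq_trans (h_par xr) hx).
exists (par x :: p); split=> //.
- by rewrite /= xp eE xr eqxx.
- rewrite cons_uniq up andbT pE; apply/negP => /anc_h[E|].
    by have := h_par xr; rewrite E ltnn.
  by rewrite ltnNge ltnW // h_par.
move=> y; rewrite inE pE; apply/orP/idP => [[/eqP->|]|xy]; first exact: connect0.
  exact: connect_trans (anc_par x).
have [->|yx] := eqVneq y x; [by left|right].
by apply: anc_step; rewrite // eq_sym.
Qed.

(** The root has a selected label. A simple path between selected leaves that
    visits a vertex [z] below the root without a selected leaf below it would
    have to pass twice through the parent of [z]. *)
Lemma spanP z : (z \in span G S) = (z == r) || (trace z != set0).
Proof.
rewrite inE; apply/asboolP/orP; last first.
  case=> [/eqP->|/set0Pn[a]].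
    exists r, [::]; split=> //; try by exists rho; rewrite ?setU11.
    by rewrite mem_head.
  rewrite inE => /andP[/clusterP[y ya yz] aB].
  have [p [yp lp up pE]] := ascent y.
  exists y, p; split=> //; last by rewrite pE.
    by exists a; rewrite // inE aB orbT.
  by rewrite lp; exists rho; rewrite ?setU11.
case=> x [p [xS lS xp up zp]].
have [->|zr] := eqVneq z r; [by left|right].
apply/negP => /eqP z0.
have xz := labeled_below xS z0 zr; have lz := labeled_below lS z0 zr.
have zx : z != x by apply: contra xz => /eqP->; exact: connect0.
move: zp; rewrite inE (negbTE zx) /= => zp.
case/splitPr: zp xp up lz {lS} => p1 p2; rewrite cat_path last_cat -cat_cons cat_uniq.
rewrite [path _ _ (z :: _)]/= [last _ (z :: _)]/= cons_uniq.
move=> /and3P[xp1 uz zp2] /and3P[u1 /hasPn d /andP[z2 u2]] lz.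
set u := last x p1 in uz.
have zn : z \notin x :: p1 by apply: (d z); rewrite mem_head.
have ux : u \in x :: p1 by exact: mem_last.
have uzN : ~~ anc u z by rewrite (path_below xp1 zn ux).
have uE : par z = u.
  move: uz; rewrite adj_child => /orP[/child_anc|/andP[_ /eqP//]].
  by rewrite (negbTE uzN).
case: p2 zp2 z2 lz d {u2} => [|w p2] /=; first by rewrite connect0.
move=> /andP[zw wp] z2 lz d.
have wzN : ~~ anc w z.
  by rewrite -(path_below wp z2 (mem_last _ _)).
have wE : par z = w.
  move: zw; rewrite adj_child => /orP[/andP[_ /eqP//]|/child_anc].
  by rewrite (negbTE wzN).
have : w \notin x :: p1 by apply: d; rewrite !inE eqxx orbT.
by rewrite -wE uE ux.
Qed.

Lemma root_kept : r \in kept G S.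
Proof.
rewrite inE spanP eqxx /= neq_ltn; apply/orP; left.
have [c0 rc] := root_child.
rewrite ltnS; apply: leq_trans (_ : #|[set c0]| <= 1); last by rewrite cards1.
apply/subset_leq_card/subsetP=> y; rewrite !inE adj_child => /andP[_ /orP[/andP[]|]].
  by rewrite eqxx.
by rewrite rc.
Qed.

Lemma span_par z : z \in span G S -> par z \in span G S.
Proof.
rewrite !spanP; have [->|zr] := eqVneq z r; first by rewrite par_r eqxx.
move=> /= /set0Pn[a az]; apply/orP; right; apply/set0Pn; exists a.
exact: subsetP (trace_anc (anc_par z)) a az.
Qed.

(** The parent of a spanned vertex is spanned. So a branch point is suppressed
    exactly when leaves with label in [B] are found below only one of its
    children. *)
Lemma inner_span_degree x c1 c2 : lab x = None -> c1 != c2 -> x \in span G S ->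
  (forall c, child x c = (c == c1) || (c == c2)) ->
  span_degree S x = 1 + (trace c1 != set0) + (trace c2 != set0).
Proof.
move=> x0 c12 xs xc.
have [h1 h2] : child x c1 /\ child x c2 by rewrite !xc !eqxx orbT.
have xr : x != r by apply: contra_eq_neq x0 => ->; rewrite lab_r.
have nr c : child x c -> c != r by case/andP.
have sc c : child x c -> (c \in span G S) = (trace c != set0).
  by move=> xc'; rewrite spanP (negbTE (nr c xc')).
rewrite /span_degree.
have pne c : child x c -> par x != c.
  move=> xc'; apply/eqP => E; have := child_neq xc'; rewrite (anc_antisym (child_anc xc')) ?eqxx //.
  by rewrite -E anc_par.
have gen (P : {set V}) : (forall c, child x c -> (c \in P) = (trace c != set0)) -> par x \in P ->
    [set y in P | e x y] = par x |: ([set c in [set c1] | trace c1 != set0] :|: [set c in [set c2] | trace c2 != set0]).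
  move=> {}sc px; apply/setP=> y; rewrite !inE adj_child xc {1}/child xr /= (eq_sym (par x)).
  apply/idP/idP.
    case/andP => ys /orP[/eqP->|/orP[]/eqP E]; first by rewrite eqxx.
      by have := sc _ h1; rewrite -E ys => <-; rewrite eqxx orbT.
    by have := sc _ h2; rewrite -E ys => <-; rewrite eqxx !orbT.
  case/orP => [/eqP->|]; first by rewrite px eqxx.
  by case/orP => /andP[/eqP-> t]; rewrite sc ?t // eqxx ?orbT.
rewrite (gen _ sc (span_par xs)) cardsU1 !in_setU !in_set !in_set1 (negbTE (pne _ h1)) (negbTE (pne _ h2)) /=.
congr (_ + _).
have cE c : #|[set c0 in [set c] | trace c != set0]| = (trace c != set0).
  case: (trace c != set0).
    by rewrite (_ : [set _ in _ | _] = [set c]) ?cards1 //; apply/setP=> ?; rewrite !inE andbT.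
  by apply/eqP; rewrite cards_eq0; apply/eqP/setP=> ?; rewrite !inE andbF.
rewrite -!cE; apply/eqP; rewrite (leq_card_setU _ _).2 -setI_eq0; apply/eqP/setP=> y.
by rewrite !inE; case: (eqVneq y c1) => [->|] //=; rewrite (negbTE c12) /= andbF.
Qed.

Lemma kept_span x : x \in kept G S -> x \in span G S.
Proof. by move=> /setIdP[]. Qed.

Lemma suppressed_span x : x \in suppressed G S -> x \in span G S.
Proof. by move=> /setIdP[]. Qed.

Lemma kept_leaf x a : x != r -> lab x = Some a -> a \in B -> x \in kept G S.
Proof.
move=> xr xa aB; apply/setIdP; split.
  rewrite spanP (negbTE xr) /trace (cluster_leaf xr xa); apply/set0Pn; exists a.
  by rewrite !inE eqxx.
rewrite neq_ltn; apply/orP; left; rewrite ltnS.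
apply: leq_trans (_ : #|[set par x]| <= 1); last by rewrite cards1.
apply/subset_leq_card/subsetP=> y /setIdP[_]; rewrite inE adj_child => /orP[/andP[_ /eqP->]//|].
by rewrite (negbTE (leaf_child _ xr _)) // xa.
Qed.

Lemma kept_inner x c1 c2 : lab x = None -> c1 != c2 ->
  (forall c, child x c = (c == c1) || (c == c2)) ->
  (x \in kept G S) = (trace c1 != set0) && (trace c2 != set0).
Proof.
move=> x0 c12 xc; apply/idP/idP.
  move=> /setIdP[xs]; rewrite (inner_span_degree x0 c12 xs xc).
  have : trace x != set0.
    have xr : x != r by apply: contra_eq_neq x0 => ->; rewrite lab_r.
    by move: xs; rewrite spanP (negbTE xr).
  rewrite {1}/trace (cluster_inner x0 xc) setIUl setU_eq0 -!/(trace _).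
  by case: eqP; case: eqP.
move=> /andP[t1 t2]; have xs : x \in span G S.
  rewrite spanP; apply/orP; right; rewrite /trace (cluster_inner x0 xc) setIUl setU_eq0.
  by rewrite negb_and t1.
by apply/setIdP; split; rewrite ?(inner_span_degree x0 c12 xs xc) ?t1 ?t2.
Qed.

(** Descending from [z], as long as only one child has leaves with label in
    [B] below it the trace does not change; the first vertex where this fails
    is kept. *)
Lemma kept_below z : z != r -> trace z != set0 ->
  exists y, [/\ y \in kept G S, y != r, anc y z & trace y = trace z].
Proof.
have [n] := ubnP #|[set y | anc y z]|; elim: n z => // n IHn z; rewrite ltnS => zn zr z0.
case E : (lab z) => [a|].
  exists z; split=> //; apply: (kept_leaf zr E).
  by case/set0Pn: z0 => b; rewrite inE (cluster_leaf zr E) inE => /andP[/eqP->].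
have [c1 [c2 [c12 zc]]] := inner_child E.
have tz : trace z = trace c1 :|: trace c2 by rewrite /trace (cluster_inner E zc) setIUl.
have cn c : child z c -> #|[set y | anc y c]| < n.
  move=> hc; apply: leq_trans zn; apply: proper_card; apply/properP; split.
    apply/subsetP=> y; rewrite !inE => yc; exact: connect_trans yc (child_anc hc).
  exists z; rewrite !inE ?connect0 //; apply/negP => vc.
  by have := child_neq hc; rewrite (anc_antisym vc (child_anc hc)) eqxx.
have step c : child z c -> trace z = trace c ->
    exists y, [/\ y \in kept G S, y != r, anc y z & trace y = trace z].
  move=> hc tc; have cr : c != r by case/andP: hc.
  have [|y [yk yr yc ty]] := IHn c (cn c hc) cr; first by rewrite -tc.
  by exists y; split=> //; rewrite ?ty //; apply: connect_trans yc (child_anc hc).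
have [t1|t1] := eqVneq (trace c1) set0.
  by apply: (step c2); rewrite ?zc ?eqxx ?orbT // tz t1 set0U.
have [t2|t2] := eqVneq (trace c2) set0.
  by apply: (step c1); rewrite ?zc ?eqxx ?orbT // tz t2 setU0.
by exists z; split=> //; rewrite (kept_inner E c12 zc) t1.
Qed.

(** The trace of the root may coincide with that of the top branch point;
    adding [rho] makes it different from the traces of all other vertices. *)
Definition full_trace v := if v == r then S else trace v.

Lemma trace_sub v : trace v \subset B. Proof. exact: subsetIr. Qed.

Lemma full_trace_anc x y : anc x y -> full_trace x \subset full_trace y.
Proof.
move=> xy; rewrite /full_trace; have [E|xr] := eqVneq x r.
  by rewrite E in xy; rewrite (anc_of_root xy) eqxx.
case: eqP => _; last exact: trace_anc.
exact: subset_trans (trace_sub x) (subsetUr _ _).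
Qed.

(** A kept branch point has labels of [B] below both of its children. *)
Lemma full_trace_strict x y : x \in span G S -> y \in kept G S -> anc x y -> x != y ->
  full_trace x \proper full_trace y.
Proof.
move=> xs yk xy nxy; rewrite properE full_trace_anc //=.
have xr : x != r by apply: contra nxy => /eqP E; rewrite E in xy *; rewrite (anc_of_root xy).
rewrite /full_trace (negbTE xr); have [yr|yr] := eqVneq y r.
  apply/negP => /subsetP/(_ rho); rewrite setU11 => /(_ isT)/(subsetP (trace_sub x)).
  by rewrite (negbTE rhoB).
have [c yc xc] := anc_child xy nxy.
case E : (lab y) => [a|]; first by have := leaf_child c yr; rewrite E yc; move=> /(_ (fun H => ltac:(discriminate H))).
have [c1 [c2 [c12 ychild]]] := inner_child E.
move: yk; rewrite (kept_inner E c12 ychild) => /andP[t1 t2].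
have other c' : child y c' -> c' != c -> trace c' != set0 -> ~~ (trace y \subset trace x).
  move=> yc' cc' /set0Pn[a ac]; apply/negP => /subsetP sub.
  have := sub a (subsetP (trace_anc (child_anc yc')) a ac).
  move=> /(subsetP (trace_anc xc)); rewrite inE => /andP[ac1 _].
  move: ac; rewrite inE => /andP[ac2 _].
  by have := disjointFr (cluster_disjoint yc' yc cc') ac2; rewrite ac1.
move: (yc); rewrite ychild => /orP[] /eqP cE.
  by apply: (other c2); rewrite ?ychild ?eqxx ?orbT // cE eq_sym.
by apply: (other c1); rewrite ?ychild ?eqxx ?orbT // cE.
Qed.

Lemma full_trace_sub x y : x \in kept G S -> y \in kept G S ->
  full_trace x \subset full_trace y -> anc x y.
Proof.
move=> xk yk; rewrite /full_trace.
have [->|yr] := eqVneq y r; first by rewrite anc_root.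
have [xr|xr] := eqVneq x r.
  by move=> /subsetP/(_ rho); rewrite setU11 => /(_ isT)/(subsetP (trace_sub y)); rewrite (negbTE rhoB).
move=> sub; have /set0Pn[a ax] : trace x != set0.
  by have := kept_span xk; rewrite spanP (negbTE xr).
have ay := subsetP sub a ax.
have /setIP[/clusterP[u ua ux] _] := ax; have /setIP[/clusterP[v va vy] _] := ay.
rewrite (lab_inj va ua) in vy.
case: (anc_comparable ux vy) => // yx.
have [->|nyx] := eqVneq y x; first exact: connect0.
have := full_trace_strict (kept_span yk) xk yx nyx.
by rewrite /full_trace (negbTE xr) (negbTE yr) properE sub andbF.
Qed.

Definition cover x y := [/\ x != y, anc x y & forall z, z \in kept G S -> anc x z -> anc z y -> z = x \/ z = y].

Lemma cover_path x y : x \in span G S -> y \in kept G S -> cover x y ->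
  exists p, [/\ path e x (rcons p y), uniq (x :: rcons p y), all [in suppressed G S] p
    & forall z, z \in rcons p y -> h z < h x].
Proof.
move=> + yk; have [n] := ubnP (h x); elim: n x => // n IHn x; rewrite ltnS => hx xs [xy axy none].
have xr : x != r by apply: contra xy => /eqP E; rewrite E in axy *; rewrite (anc_of_root axy).
have hp := h_par xr.
have ex : e x (par x) by rewrite eE xr eqxx.
have uq q : (forall z, z \in q -> h z < h x) -> x \notin q.
  by move=> H; apply/negP => /H; rewrite ltnn.
have [py|py] := eqVneq (par x) y.
  exists [::]; rewrite /= -py ex; split=> //.
    by rewrite inE andbT; apply/eqP => E; move: hp; rewrite -E ltnn.
  by move=> z; rewrite inE => /eqP->.
have apy := anc_step axy xy.
have psp := span_par xs.
have ps : par x \in suppressed G S.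
  apply/setIdP; split=> //; apply/negPn/negP => deg.
  have pk : par x \in kept G S by apply/setIdP.
  case: (none _ pk (anc_par x) apy) => E; last by rewrite E eqxx in py.
  by move: hp; rewrite E ltnn.
have [|p [pp up sp hq]] := IHn (par x) (leq_trans hp hx) psp.
  split=> // z zk pz zy; case: (none z zk (connect_trans (anc_par x) pz) zy) => [zx|]; last by right.
  have : h x <= h (par x) by case: (anc_h pz) => [->|]; rewrite zx // => /ltnW.
  by rewrite leqNgt hp.
have hq' z : z \in par x :: rcons p y -> h z < h x.
  by rewrite inE => /orP[/eqP->//|/hq hz]; apply: ltn_trans hz hp.
exists (par x :: p); split=> //=; try by rewrite ex.
  by rewrite uq.
by rewrite ps.
Qed.

(** Interior vertices of the path are suppressed. If the path went up to such
    a vertex and then down again, both children of this vertex would be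
    spanned, and it would be kept. *)
Lemma path_ascends x p y : x \in span G S -> y \in span G S -> x != r ->
  path e x (rcons p y) -> uniq (x :: rcons p y) -> all [in suppressed G S] p ->
  head y p = par x -> anc x y /\ (forall z, anc x z -> anc z y -> [\/ z = x, z = y | z \in p]).
Proof.
move=> + ys; elim: p x => [|m p IHp] x xs xr.
  move=> _ _ _ /= ->; split; first exact: anc_par.
  move=> z xz zp; have [->|zx] := eqVneq z x; first by constructor 1.
  by constructor 2; apply/esym/anc_antisym => //; apply: anc_step; rewrite // eq_sym.
rewrite rcons_cons [path _ _ _]/= cons_uniq => /andP[xm mp] /andP[xn um] /= /andP[ms sp] mE.
have mr : m != r.
  apply/eqP => E; have := root_kept; rewrite -E => /setIdP[_]; apply/negP; rewrite negbK.
  by case/setIdP: ms.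
pose w := head y p.
have [q qE] : exists q, rcons p y = w :: q.
  by rewrite /w; case: (p) => [|a p']; [exists [::]|exists (rcons p' y)].
have emw : e m w by move: mp; rewrite qE => /andP[].
have wx : w != x by apply: contra xn => /eqP <-; rewrite qE !inE eqxx orbT.
have ws : w \in span G S.
  have : w \in rcons p y by rewrite qE mem_head.
  by rewrite mem_rcons inE => /orP[/eqP->//|/(allP sp)/suppressed_span].
have wE : w = par m.
  move: emw; rewrite adj_child => /orP[/andP[_ /eqP->]//|mw].
  have mx : child m x by rewrite /child xr mE eqxx.
  case E : (lab m) => [a|]; first by have := leaf_child w mr; rewrite E mw; move=> /(_ (fun H => ltac:(discriminate H))).
  have [c1 [c2 [c12 mc]]] := inner_child E.
  have ts c : child m c -> c \in span G S -> trace c != set0.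
    by move=> /andP[cr _]; rewrite spanP (negbTE cr).
  have tx := ts x mx xs; have tw := ts w mw ws.
  have [t1 t2] : trace c1 != set0 /\ trace c2 != set0.
    by move: mx mw wx; rewrite !mc => /orP[]/eqP<- /orP[]/eqP<-; rewrite ?eqxx.
  by case/setIdP: ms => msp; rewrite (inner_span_degree E c12 msp mc) t1 t2.
have [my between] := IHp m (suppressed_span ms) mr mp um sp wE.
rewrite mE in my; split; first exact: connect_trans (anc_par x) my.
move=> z xz zy; have [->|zx] := eqVneq z x; first by constructor 1.
have mz : anc m z by rewrite mE; apply: anc_step; rewrite // eq_sym.
by case: (between z mz zy) => [->|->|zp]; [constructor 3; rewrite mem_head|constructor 2|constructor 3; rewrite inE zp orbT].
Qed.

(** A simple path that has gone down can only go up again through the vertex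
    it came from. *)
Lemma path_descends x p y : path e x (rcons p y) -> uniq (x :: rcons p y) ->
  child x (head y p) -> y != r /\ par y = last x p.
Proof.
elim: p x => [|m p IHp] x; first by move=> _ _ /= /andP[yr /eqP].
rewrite rcons_cons [path _ _ _]/= cons_uniq => /andP[xm mp] /andP[xn um] /= xmc.
apply: IHp => //.
have [q qE] : exists q, rcons p y = head y p :: q.
  by case: (p) => [|a p']; [exists [::]|exists (rcons p' y)].
have : e m (head y p) by move: mp; rewrite qE => /andP[].
rewrite adj_child => /orP[/andP[_ /eqP E]|//]; case/andP: xmc => _ /eqP xE.
by move: xn; rewrite qE -E xE !inE eqxx orbT.
Qed.

Lemma suppressed_adj_sym (x y : {x | x \in kept G S}) :
  suppressed_adj x y -> suppressed_adj y x.
Proof.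
move=> /asboolP[p [xp up sp]]; apply/asboolP; exists (rev p).
have rE : rcons (rev p) (val x) = rev (belast (val x) (rcons p (val y))).
  by rewrite belast_rcons rev_cons.
have uE : val y :: rcons (rev p) (val x) = rev (val x :: rcons p (val y)).
  by rewrite rev_cons rev_rcons.
split; last by rewrite all_rev.
  rewrite rE; have := rev_path e (val x) (rcons p (val y)); rewrite last_rcons => ->.
  by apply: sub_path xp => a b; rewrite rooting_sym.
by rewrite uE rev_uniq.
Qed.

(** A path with suppressed interior that starts upwards stays on the ancestors
    of its origin by [path_ascends]; one that starts downwards is the reverse
    of such a path. So adjacency in the induced tree is the covering relation
    of the ancestor order restricted to kept vertices. *)
Lemma suppressed_adjP (x y : {x | x \in kept G S}) :
  suppressed_adj x y <-> cover (val x) (val y) \/ cover (val y) (val x).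
Proof.
have up (a b : {x | x \in kept G S}) p :
   path e (val a) (rcons p (val b)) -> uniq (val a :: rcons p (val b)) ->
   all [in suppressed G S] p -> val a != r -> head (val b) p = par (val a) ->
   cover (val a) (val b).
  move=> ap ua sp ar hE; have [ab bet] := path_ascends (kept_span (valP a)) (kept_span (valP b)) ar ap ua sp hE.
  split=> //.
    by apply: contraTneq ua => ->; rewrite cons_uniq mem_rcons mem_head.
  move=> z zk az zb; case: (bet z az zb); [by left|by right|].
  by move=> /(allP sp); case/setIdP: zk => _ /negbTE zd /setIdP[_]; rewrite zd.
have down (a b : {x | x \in kept G S}) : cover (val a) (val b) -> suppressed_adj a b.
  move=> /(cover_path (kept_span (valP a)) (valP b))[p [ap ua sp _]].
  by apply/asboolP; exists p.
split; last by case=> /down // /suppressed_adj_sym.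
move=> /[dup] /suppressed_adj_sym/asboolP[q [yq uq sq]] /asboolP[p [xp upp sp]].
have [s sE] : exists s, rcons p (val y) = head (val y) p :: s.
  by case: (p) => [|a p']; [exists [::]|exists (rcons p' (val y))].
have : e (val x) (head (val y) p) by move: xp; rewrite sE => /andP[].
rewrite adj_child => /orP[/andP[xr /eqP hE]|xc].
  by left; apply: up xp upp sp xr _.
have [yr yE] := path_descends xp upp xc.
right; apply: (up y x (rev p)) => //.
- have rE : rcons (rev p) (val x) = rev (belast (val x) (rcons p (val y))).
    by rewrite belast_rcons rev_cons.
  rewrite rE; have := rev_path e (val x) (rcons p (val y)); rewrite last_rcons => ->.
  by apply: sub_path xp => a b; rewrite rooting_sym.
- have uE : val y :: rcons (rev p) (val x) = rev (val x :: rcons p (val y)).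
    by rewrite rev_cons rev_rcons.
  by rewrite uE rev_uniq.
- by rewrite all_rev.
rewrite yE; case/lastP: (p) => // p' a; by rewrite rev_rcons last_rcons.
Qed.

Definition traces := [set full_trace z | z in kept G S].

Definition covers (F : {set {set L}}) (X Y : {set L}) : bool :=
  (X \proper Y) && [forall Z in F, ~~ ((X \proper Z) && (Z \proper Y))].

(** On kept vertices the ancestor order is the inclusion of traces, so the
    covering relation can be recovered from the family of traces alone. *)
Lemma cover_traces x y : x \in kept G S -> y \in kept G S ->
  cover x y <-> covers traces (full_trace x) (full_trace y).
Proof.
move=> xk yk; split.
  move=> [xy axy none]; rewrite /covers full_trace_strict ?kept_span //=.
  apply/forall_inP => _ /imsetP[z zk ->]; apply/negP => /andP[xz zy].
  have := none z zk (full_trace_sub xk zk (proper_sub xz)) (full_trace_sub zk yk (proper_sub zy)).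
  by case=> E; [rewrite E properxx in xz|rewrite E properxx in zy].
move=> /andP[pxy /forall_inP none]; split.
- by apply: contraTneq pxy => ->; rewrite properxx.
- exact: full_trace_sub (proper_sub pxy).
move=> z zk xz zy; have [->|zx] := eqVneq z x; [by left|].
have [->|zy'] := eqVneq z y; [by right|].
have := none (full_trace z) (imset_f _ zk).
by rewrite !full_trace_strict ?kept_span // eq_sym.
Qed.

Definition family := [set cluster v | v in predC1 r].

(** By [kept_below], no nonempty trace is lost when only kept vertices are
    considered. *)
Lemma tracesE : traces = S |: (restrict_family B family :\ set0).
Proof.
apply/setP=> Y; rewrite !inE; apply/imsetP/orP.
  case=> z zk ->; rewrite /full_trace; have [zr|zr] := eqVneq z r; first by left.
  right; have := kept_span zk; rewrite spanP (negbTE zr) /= => -> /=.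
  apply/orP; right; apply/imsetP; exists (cluster z) => //.
  by apply/imsetP; exists z.
case=> [/eqP->|/andP[Y0]]; first by exists r; rewrite ?root_kept // /full_trace eqxx.
rewrite (negbTE Y0) => /imsetP[_ /imsetP[v vr ->] YE].
rewrite -/(trace v) in YE; rewrite YE in Y0 *.
have [y [yk yr _ ty]] := kept_below vr Y0.
by exists y; rewrite // /full_trace (negbTE yr) ty.
Qed.

Lemma full_trace_inj : {in kept G S &, injective full_trace}.
Proof.
by move=> x y xk yk E; apply: anc_antisym; apply: full_trace_sub => //; rewrite E.
Qed.

(** A kept branch point has at least two labels of [B] below it, so the labels
    of kept vertices can be read off their traces as well. *)
Lemma kept_label x a : x \in kept G S ->
  lab x = Some a <-> (full_trace x = [set a] \/ full_trace x = S /\ a = rho).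
Proof.
move=> xk; rewrite /full_trace; have [->|xr] := eqVneq x r.
  rewrite lab_r; split=> [[->]|]; first by right.
  case=> [E|[_ ->]//]; have : rho \in S by rewrite setU11.
  by rewrite E inE => /eqP->.
have tx : trace x != set0 by have := kept_span xk; rewrite spanP (negbTE xr).
have nS : trace x <> S.
  move=> E; have : rho \in trace x by rewrite E setU11.
  by rewrite inE (negbTE rhoB) andbF.
split=> [xa|[xa|[]//]].
  left; apply/eqP; move: tx; rewrite /trace (cluster_leaf xr xa).
  by case: (boolP (a \in B)) => aB; [rewrite (setIidPl _) ?sub1set ?eqxx|
    rewrite (_ : _ :&: _ = set0) ?eqxx //; apply/setP=> b; rewrite !inE; case: eqP => // ->; rewrite (negbTE aB)].
case E : (lab x) => [b|].
  have := cluster_leaf xr E => cE; have : a \in trace x by rewrite xa inE.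
  by rewrite inE cE inE => /andP[/eqP->].
have [c1 [c2 [c12 xc]]] := inner_child E.
move: xk; rewrite (kept_inner E c12 xc) => /andP[/set0Pn[b1 t1] /set0Pn[b2 t2]].
have h1 : child x c1 by rewrite xc eqxx. have h2 : child x c2 by rewrite xc eqxx orbT.
have := subsetP (trace_anc (child_anc h1)) b1 t1; rewrite xa inE => /eqP b1E.
have := subsetP (trace_anc (child_anc h2)) b2 t2; rewrite xa inE => /eqP b2E.
move: t1 t2; rewrite b1E b2E => /setIP[q1 _] /setIP[q2 _].
by have := disjointFr (cluster_disjoint h1 h2 c12) q1; rewrite q2.
Qed.

End Restrict.
End Induced.

End RootedTree.
End Rooting.

Section Hierarchy.
Variables (L : finType) (rho : L).
Implicit Types (G H K : lgraph L) (F : {set {set L}}) (B : {set L}).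

(** * Hierarchies of leaf-labeled trees *)

Lemma equivalent_refl G : equivalent G G.
Proof. by exists id; split=> //; exists id. Qed.

Lemma equivalent_sym G H : equivalent G H -> equivalent H G.
Proof.
case=> f [[g fK gK] fa fl]; exists g; split; first by exists f.
  by move=> x y; rewrite -fa !gK.
by move=> x; rewrite -fl gK.
Qed.

Lemma equivalent_trans G H K : equivalent G H -> equivalent H K -> equivalent G K.
Proof.
case=> f [fb fa fl] [g [gb ga gl]]; exists (g \o f); split; first exact: bij_comp.
  by move=> x y /=; rewrite ga fa.
by move=> x /=; rewrite gl fl.
Qed.

(** The tree is rooted at its leaf of label [rho]; all clusters are sets of
    other labels. *)
Definition hierarchy G F : Prop :=
  exists r par h, [/\ @rooting L G r par h, binary_labeling r par rho & F = family r par].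

(** The vertices, the adjacency and the labels of an induced tree can be
    recovered from its family of traces, by [full_trace_inj],
    [suppressed_adjP], [cover_traces] and [kept_label]. So equal families of
    traces give an isomorphism. *)
Lemma restrict_equivalent G H F F' B : hierarchy G F -> hierarchy H F' ->
  rho \notin B -> agree B F F' ->
  equivalent (restrict G (rho |: B)) (restrict H (rho |: B)).
Proof.
move=> [r [par [h [rG bG ->]]]] [r' [par' [h' [rH bH ->]]]] rhoB /eqP agr.
set S := rho |: B.
have TT : traces r par rho B = traces r' par' rho B.
  by rewrite (tracesE rG bG B) (tracesE rH bH B) agr.
have corr (G1 H1 : lgraph L) r1 par1 h1 r2 par2 h2 :
    @rooting L G1 r1 par1 h1 -> @rooting L H1 r2 par2 h2 ->
    binary_labeling r1 par1 rho -> binary_labeling r2 par2 rho ->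
    traces r1 par1 rho B = traces r2 par2 rho B ->
    exists f : {x | x \in kept G1 S} -> {x | x \in kept H1 S},
      forall x, full_trace r2 par2 rho B (val (f x)) = full_trace r1 par1 rho B (val x).
  move=> R1 R2 b1 b2 T12.
  suff ex : forall x : {x | x \in kept G1 S}, exists y : {x | x \in kept H1 S},
      full_trace r2 par2 rho B (val y) = full_trace r1 par1 rho B (val x).
    by have [f fE] := choice ex; exists f.
  move=> x; have : full_trace r1 par1 rho B (val x) \in traces r2 par2 rho B.
    by rewrite -T12; apply: imset_f; exact: valP.
  by case/imsetP => y yk ->; exists (Sub y yk).
have [f fE] := corr _ _ _ _ _ _ _ _ rG rH bG bH TT.
have [g gE] := corr _ _ _ _ _ _ _ _ rH rG bH bG (esym TT).
exists f; split.
- exists g => x; apply: val_inj.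
    by apply: (full_trace_inj rG bG rhoB); [exact: valP|exact: valP|rewrite gE fE].
  by apply: (full_trace_inj rH bH rhoB); [exact: valP|exact: valP|rewrite fE gE].
- move=> x y; apply/idP/idP.
    move=> /(suppressed_adjP rH bH) xy; apply/(suppressed_adjP rG bG).
    case: xy => /(cover_traces rH bH rhoB (valP _) (valP _)); rewrite !fE -TT => c;
    by [left; apply/(cover_traces rG bG rhoB (valP _) (valP _))|right; apply/(cover_traces rG bG rhoB (valP _) (valP _))].
  move=> /(suppressed_adjP rG bG) xy; apply/(suppressed_adjP rH bH).
  case: xy => /(cover_traces rG bG rhoB (valP _) (valP _)) => c;
  by [left; apply/(cover_traces rH bH rhoB (valP _) (valP _)); rewrite !fE -TT|right; apply/(cover_traces rH bH rhoB (valP _) (valP _)); rewrite !fE -TT].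
move=> x /=.
have lE a : label (val (f x)) = Some a <-> label (val x) = Some a.
  by rewrite (kept_label rH bH rhoB a (valP (f x))) (kept_label rG bG rhoB a (valP x)) fE.
case E : (label (val x)) => [a|]; first by apply/lE.
by case E' : (label (val (f x))) => [a|//]; move/lE: E'; rewrite E.
Qed.

(** The position of the root determines the orientation of all edges, by
    induction on the rank. *)
Lemma rooting_iso G H r par h r' par' h' (f : vertex G -> vertex H) :
  @rooting L G r par h -> @rooting L H r' par' h' -> injective f ->
  (forall x y, adj (f x) (f y) = adj x y) -> f r = r' ->
  forall x, par' (f x) = f (par x).
Proof.
move=> [pr hp eG] [pr' hp' eH] finj fa fr x.
have [n] := ubnP (h x); elim: n x => // n IHn x; rewrite ltnS => hx.
have [->|xr] := eqVneq x r; first by rewrite pr fr pr'.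
have fxr : f x != r' by rewrite -fr (inj_eq finj).
have : adj (f x) (f (par x)) by rewrite fa eG xr eqxx.
rewrite eH fxr /= => /orP[/eqP//|/andP[pxr /eqP E]].
have hpx := hp x xr.
move: E; rewrite IHn ?(leq_trans hpx) // => /finj E.
have [pxr'|pxr'] := eqVneq (par x) r.
  by move: xr; rewrite -E pxr' pr eqxx.
by have := hp _ pxr'; rewrite E => /(ltn_trans hpx); rewrite ltnn.
Qed.

Lemma hierarchy_equivalent G H F F' : hierarchy G F -> hierarchy H F' ->
  equivalent G H -> F = F'.
Proof.
have sub G1 H1 F1 F2 : hierarchy G1 F1 -> hierarchy H1 F2 -> equivalent G1 H1 -> F1 \subset F2.
  move=> [r [par [h [rG bG ->]]]] [r' [par' [h' [rH bH ->]]]] [f [fb fa fl]].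
  have [lr inj _ _ _] := bG; have [lr' inj' _ _ _] := bH.
  have fr : f r = r' by apply: inj' lr'; rewrite fl lr.
  have fi := bij_inj fb; have pE := rooting_iso rG rH fi fa fr.
  have ancE x y : fconnect par x y -> fconnect par' (f x) (f y).
    move=> /iter_findex <-; elim: (findex _ _ _) => [|k IHk]; first exact: connect0.
    by apply: connect_trans IHk _; rewrite iterS -pE; exact: fconnect1.
  have ancE' x y : fconnect par' (f x) (f y) -> fconnect par x y.
    have itE k : iter k par' (f x) = f (iter k par x).
      by elim: k => //= k ->; rewrite pE.
    by move=> /iter_findex; rewrite itE => /fi <-; exact: fconnect_iter.
  apply/subsetP=> _ /imsetP[v vr ->]; apply/imsetP; exists (f v).
    by rewrite !inE -fr (inj_eq fi) -in_setC1 -?topredE //= in vr *.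
  apply/setP=> a; apply/clusterP/clusterP => -[y ya yv].
    by exists (f y); rewrite ?fl //; apply: ancE.
  case: fb => g fK gK; rewrite -(gK y) in ya yv; exists (g y); first by rewrite -fl.
  exact: ancE'.
move=> hG hH eGH; apply/eqP; rewrite eqEsubset (sub G H) //= (sub H G) //.
exact: equivalent_sym.
Qed.

(** When all labels are selected every vertex is kept. *)
Lemma equivalent_restrictT G F : hierarchy G F -> equivalent (restrict G [set: L]) G.
Proof.
move=> [r [par [h [rG bG _]]]].
pose B := ~: [set rho]; have rhoB : rho \notin B by rewrite !inE eqxx.
have -> : [set: L] = rho |: B by apply/setP=> a; rewrite !inE; case: eqP.
have trE v : v != r -> trace par B v = cluster par v.
  move=> vr; apply/setIidPl/subsetP=> a av; rewrite !inE; apply: contraTneq av => ->.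
  have := cluster_notin_root rG bG vr. exact.
have [lr inj _ _ inner] := bG.
have allk v : v \in kept G (rho |: B).
  have [->|vr] := eqVneq v r; first exact: (root_kept rG bG B).
  case E : (label v) => [a|].
    apply: (kept_leaf rG bG vr E); rewrite !inE; apply: contra_neqT vr => /negPn/eqP aE.
    by apply: inj lr; rewrite E aE.
  have [c1 [c2 [c12 vc]]] := inner v E.
  have cr c : (c == c1) || (c == c2) -> c != r by rewrite -vc => /andP[].
  rewrite (kept_inner rG bG B E c12 vc) !trE ?cr ?eqxx ?orbT //.
  by rewrite !(cluster_neq0 rG bG) ?cr ?eqxx ?orbT.
have nosup v : v \in suppressed G (rho |: B) = false.
  by have := allk v; rewrite !inE => /andP[-> /negbTE->].
exists val; split=> //.
  by exists (fun v => Sub v (allk v)) => v //; apply: val_inj; rewrite SubK.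
move=> x y; apply/idP/asboolP => [xy|[[|p q] [xp _ sp]]].
- exists [::]; rewrite /= xy !inE; split=> //; rewrite andbT.
  have [_ hp eG] := rG; apply/eqP => /val_inj E; move: xy; rewrite E eG orbb.
  by case/andP => yr /eqP E'; have := hp _ yr; rewrite E' ltnn.
- by move: xp => /= /andP[].
by move: sp => /= /andP[]; rewrite nosup.
Qed.

Lemma same_hierarchy_equivalent G H F : hierarchy G F -> hierarchy H F -> equivalent G H.
Proof.
move=> hG hH.
have e1 := equivalent_restrictT hG; have e2 := equivalent_restrictT hH.
apply: equivalent_trans (equivalent_sym e1) (equivalent_trans _ e2).
have -> : [set: L] = rho |: ~: [set rho] by apply/setP=> a; rewrite !inE; case: eqP.
by apply: restrict_equivalent hG hH _ _; rewrite ?inE ?eqxx // /agree.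
Qed.

(** The leaf [rho] can be added to the common subtree of the rooted trees,
    because the rooted induced trees coincide. *)
Lemma kappa_agreement G H F F' : hierarchy G F -> hierarchy H F' ->
  agreement (~: [set rho]) set0 F F' <= kappa G H.
Proof.
move=> hG hH; have [B [BD aB ->]] := agreement_witness (~: [set rho]) (agree0 F F').
have rhoB : rho \notin B by apply/negP => /(subsetP BD); rewrite !inE eqxx.
rewrite setU0 in aB; apply: (@leq_trans #|rho |: B|).
  by apply: subset_leq_card; exact: subsetUr.
apply: (leq_bigmax_cond (rho |: B)); apply/asboolP.
exact: restrict_equivalent hG hH rhoB aB.
Qed.

Lemma degree_children G r par h (x : vertex G) : @rooting L G r par h ->
  degree x = (x != r) + #|[set c | child r par x c]|.
Proof.
move=> rG; rewrite /degree.
have -> : [set y | adj x y] = (if x == r then set0 else [set par x]) :|: [set c | child r par x c].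
  apply/setP=> y; rewrite inE (adj_child rG) in_setU [y \in [set _ | _]]inE {1}/child.
  by case: eqP => _; rewrite ?inE // (eq_sym y).
case: (eqVneq x r) => [_|xr] /=; first by rewrite set0U.
rewrite cardsU1 inE; case: (boolP (child r par x (par x))) => // xc.
have := child_neq rG xc; have := anc_antisym rG (child_anc xc) (fconnect1 par x) => ->.
by rewrite eqxx.
Qed.

Section FromTree.
Variables (G : lgraph L).
Hypothesis treeG : is_leaf_labeled_binary_tree G [set: L].
Hypothesis L2 : 1 < #|L|.

Lemma binary_tree_rooted : exists r par h,
  @rooting L G r par h /\ binary_labeling r par rho.
Proof.
have [[tG bG] leafE _ labE] := treeG.
have lab1 a : exists! x : vertex G, label x = Some a by apply: labE; rewrite inE.
have [r [lr _]] := lab1 rho.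
have rG := tree_rooting r tG; set par := tree_parent _ _ in rG.
exists r, par, (distance r tG); split=> //.
have inj (x y : vertex G) a : label x = Some a -> label y = Some a -> x = y.
  by have [z [_ zu]] := lab1 a; move=> /zu <- /zu <-.
have V1 : #|vertex G| <> 1.
  move=> /eqP/fintype1P[x xall].
  have /card_gt0P[b] : 0 < #|~: [set rho]|.
    by have := cardsC [set rho]; rewrite cards1; lia.
  rewrite !inE => /negP brho; have [y [yb _]] := lab1 b.
  by apply: brho; rewrite (xall y) -(xall r) lr in yb; case: yb => ->.
have deg (x : vertex G) : degree x = 1 \/ degree x = 3 by case: bG => [/V1[]|/(_ x)].
have degE (x : vertex G) := degree_children x rG.
split=> //.
- move=> x c xr xl; apply/negP => xc.
  have /leafE := xl; rewrite /is_leaf degE xr => d.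
  have : 0 < #|[set c | child r par x c]| by apply/card_gt0P; exists c; rewrite inE.
  by move: d; lia.
- have : degree r = 1.
    have /leafE : label r <> None by rewrite lr.
    by rewrite /is_leaf; case: (deg r) => ->.
  rewrite degE eqxx /= add0n => /eqP/cards1P[c0 cE]; exists c0 => c.
  by have := in_set1 c c0; rewrite -cE inE.
move=> x x0.
have xr : x != r by apply: contra_eq_neq x0 => ->; rewrite lr.
have : degree x = 3.
  case: (deg x) => // d1; have : label x <> None by apply/leafE; rewrite /is_leaf d1.
  by rewrite x0.
rewrite degE xr => -[] /eqP/cards2P[c1 [c2 [c12 cE]]]; exists c1, c2; split=> // c.
by have := in_set2 c c1 c2; rewrite -cE inE.
Qed.

End FromTree.

Section Reading.
Variables (G : lgraph L) (r : vertex G) (par : vertex G -> vertex G) (h : vertex G -> nat).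
Hypothesis rG : rooting r par h.
Hypothesis bG : binary_labeling r par rho.

(** The subtree below [x] is read from the leaves up, the two children of each
    branch point being taken in an arbitrary order. *)
Lemma plane_reading x : x != r -> exists t, [/\ uniq (leaves t), support t = cluster par x
  & clusters t = [set cluster par y | y in fconnect par ^~ x]].
Proof.
have [lr inj leafc rootc inner] := bG.
have [n] := ubnP #|[set y | fconnect par y x]|; elim: n x => // n IHn x; rewrite ltnS => xn xr.
case E : (label x) => [a|].
  have cE := cluster_leaf rG bG xr E.
  exists (Leaf a); rewrite support_Leaf cE; split=> //=.
  apply/setP=> Y; rewrite inE; apply/eqP/imsetP => [->|[y yx ->]].
    by exists x; rewrite ?cE //; exact: connect0.
  have [->//|yx'] := eqVneq y x.
  have [c cx _] := anc_child rG yx yx'.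
  by have := leafc x c xr; rewrite E cx => /(_ (fun e => ltac:(discriminate e))).
have [c1 [c2 [c12 xc]]] := inner x E.
have h1 : child r par x c1 by rewrite xc eqxx.
have h2 : child r par x c2 by rewrite xc eqxx orbT.
have cn c : child r par x c -> #|[set y | fconnect par y c]| < n.
  move=> hc; apply: leq_trans xn; apply: proper_card; apply/properP; split.
    apply/subsetP=> y; rewrite !inE => yc; exact: connect_trans yc (child_anc hc).
  exists x; rewrite !inE ?connect0 //; apply/negP => vc.
  by have := child_neq rG hc; rewrite (anc_antisym rG vc (child_anc hc)) eqxx.
have [t1 [u1 s1 cl1]] := IHn c1 (cn c1 h1) (proj1 (andP h1)).
have [t2 [u2 s2 cl2]] := IHn c2 (cn c2 h2) (proj1 (andP h2)).
have sE : support (Node t1 t2) = cluster par x.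
  by rewrite support_Node s1 s2 (cluster_inner rG E xc).
exists (Node t1 t2); split=> //.
  rewrite /= cat_uniq u1 u2 andbT /=; apply/hasPn => a a2 /=.
  rewrite -mem_support s1; rewrite -mem_support s2 in a2.
  by rewrite (disjointFl (cluster_disjoint rG bG h1 h2 c12) a2).
rewrite [LHS]/= sE cl1 cl2; apply/setP=> Y; rewrite !inE; apply/or3P/imsetP.
  case=> [/eqP->|/imsetP[y yc ->]|/imsetP[y yc ->]].
  - by exists x => //; exact: connect0.
  - by exists y => //; apply: connect_trans yc (child_anc h1).
  - by exists y => //; apply: connect_trans yc (child_anc h2).
case=> y yx ->; have [->|yx'] := eqVneq y x; first by constructor 1.
have [c + yc] := anc_child rG yx yx'; rewrite xc => /orP[] /eqP cE; rewrite cE in yc.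
  by constructor 2; apply: imset_f.
by constructor 3; apply: imset_f.
Qed.

Lemma plane_reading_family : (forall a, exists x : vertex G, label x = Some a) ->
  exists2 t, t \in trees_on (~: [set rho]) & clusters t = family r par.
Proof.
move=> labE; have [lr inj leafc [c0 rc] inner] := bG.
have h0 : child r par r c0 by rewrite rc.
have c0r : c0 != r by case/andP: h0.
have below y : y != r -> fconnect par y c0.
  by move=> yr; have [c + yc] := anc_child rG (anc_root rG y) yr; rewrite rc => /eqP <-.
have [t [ut st ct]] := plane_reading c0r; exists t.
  rewrite trees_onP ut st; apply/eqP/setP=> a; rewrite !inE; apply/idP/idP.
    by apply: contraTneq => ->; have := cluster_notin_root rG bG c0r; rewrite inE.
  move=> ar; have [y ya] := labE a; apply/existsP; exists y; rewrite ya eqxx below //.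
  by apply: contraNneq ar => E; move: ya; rewrite E lr => -[->].
rewrite ct; apply/setP=> Y; apply/imsetP/imsetP => -[y yc ->]; exists y => //; last first.
  exact: below.
rewrite !inE; apply: contraTneq yc => ->; apply/negP => /(anc_of_root rG) E.
by rewrite E eqxx in c0r.
Qed.

End Reading.

End Hierarchy.

(** * Plane trees with the same clusters *)

Section SameClusters.
Variable T : finType.
Implicit Types (t u l r : btree T) (X Y Z P : {set T}).

Lemma clusters_Node_cases l r X : uniq (leaves (Node l r)) -> X \in clusters (Node l r) ->
  [\/ X = support (Node l r),
      [/\ X \in clusters l, X != support (Node l r), X \subset support l & ~~ (X \subset support r)]
    | [/\ X \in clusters r, X != support (Node l r), X \subset support r & ~~ (X \subset support l)]].
Proof.
move=> ut; have [ul ur dlr] := uniq_NodeP ut.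
have key v w Y : (forall x, x \in leaves v -> x \in leaves w -> False) -> Y \in clusters v ->
    Y \subset support v /\ ~~ (Y \subset support w).
  move=> d Xv; have Xs := clusters_sub Xv; split=> //.
  have /set0Pn[x xX] := clusters_neq0 Xv; apply/negP => /subsetP/(_ x xX).
  by have := subsetP Xs x xX; rewrite !inE; exact: d.
rewrite [clusters _]/= !in_setU in_set1 => /or3P[/eqP->|Xl|Xr]; first by constructor 1.
  have [h1 h2] := key l r X dlr Xl; constructor 2; split=> //.
  apply: contraTneq h1 => ->; rewrite support_Node subUset negb_and.
  by rewrite (key r l _ (fun x a b => dlr x b a) (support_clusters r)).2 orbT.
have [h1 h2] := key r l X (fun x a b => dlr x b a) Xr; constructor 3; split=> //.
apply: contraTneq h1 => ->; rewrite support_Node subUset negb_and.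
by rewrite (key l r _ dlr (support_clusters l)).2.
Qed.

Lemma clusters_left l r : uniq (leaves (Node l r)) ->
  clusters l = [set X in clusters (Node l r) | X \subset support l].
Proof.
move=> ut; apply/setP=> X; rewrite inE; apply/idP/andP => [Xl|[Xt Xl]].
  by rewrite clusters_sub // [clusters (Node _ _)]/= !in_setU Xl orbT.
case: (clusters_Node_cases ut Xt) => [E|[]//|[_ _ _]]; last by rewrite Xl.
have /set0Pn[x xr] := support_neq0 r.
have [_ _ /(_ x)] := uniq_NodeP ut; rewrite -!mem_support xr => H.
by exfalso; apply: H => //; apply: (subsetP Xl); rewrite E support_Node inE xr orbT.
Qed.

Lemma clusters_right l r : uniq (leaves (Node l r)) ->
  clusters r = [set X in clusters (Node l r) | X \subset support r].
Proof.
move=> ut; rewrite clusters_NodeC; apply: clusters_left.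
by rewrite /= uniq_catC.
Qed.

Lemma clusters_Node_eq l r l' r' : uniq (leaves (Node l r)) -> uniq (leaves (Node l' r')) ->
  clusters (Node l r) = clusters (Node l' r') ->
  (support l' = support l /\ support r' = support r) \/
  (support l' = support r /\ support r' = support l).
Proof.
move=> ut ut' E.
have sub (v w v' w' : btree T) : uniq (leaves (Node v w)) -> uniq (leaves (Node v' w')) ->
    clusters (Node v w) = clusters (Node v' w') ->
    support v \subset support v' \/ support v \subset support w'.
  move=> u u' E'; have : support v \in clusters (Node v' w').
    by rewrite -E' [clusters _]/= !in_setU support_clusters orbT.
  move=> /(clusters_Node_cases u')[sE|[]|[]]; [|by left|by right].
  have : support (Node v' w') = support (Node v w).
    apply/eqP; rewrite eqEsubset; apply/andP; split.
      by rewrite -sE support_Node subsetUl.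
    by apply: clusters_sub; rewrite -E' support_clusters.
  have /set0Pn[x xw] := support_neq0 w; move=> sE'.
  have : x \in support v by rewrite sE sE' support_Node inE xw orbT.
  by move: xw; rewrite !mem_support; have [_ _ H] := uniq_NodeP u => /(fun a b => H x b a).
have uC (v w : btree T) : uniq (leaves (Node v w)) -> uniq (leaves (Node w v)) by rewrite /= uniq_catC.
have contra (v w : btree T) (S : {set T}) : uniq (leaves (Node v w)) -> support v \subset S -> S \subset support w -> False.
  move=> u vS Sw; have /set0Pn[x xv] := support_neq0 v.
  have := subsetP Sw _ (subsetP vS _ xv); move: xv; rewrite !mem_support.
  by have [_ _ H] := uniq_NodeP u; exact: H.
have E1 := sub _ _ _ _ ut ut' E.
have E2 := sub _ _ _ _ (uC _ _ ut) (uC _ _ ut') (etrans (clusters_NodeC r l) (etrans E (clusters_NodeC l' r'))).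
have E3 := sub _ _ _ _ ut' ut (esym E).
have E4 := sub _ _ _ _ (uC _ _ ut') (uC _ _ ut) (etrans (clusters_NodeC r' l') (etrans (esym E) (clusters_NodeC l r))).
case: E1 => l1.
  left; case: E3 => l3; last by case: (contra _ _ _ ut l1 l3).
  case: E2 => l2; last by case: (contra _ _ _ (uC _ _ ut) l2 l3).
  case: E4 => l4; last by case: (contra _ _ _ (uC _ _ ut') l4 l1).
  by split; apply/eqP; rewrite eqEsubset ?l1 ?l2 ?l3 ?l4.
right; case: E4 => l4; first by case: (contra _ _ _ ut l1 l4).
case: E3 => l3; first by case: (contra _ _ _ ut' l3 l1).
case: E2 => l2; first by case: (contra _ _ _ ut' l3 l2).
by split; apply/eqP; rewrite eqEsubset ?l1 ?l2 ?l3 ?l4.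
Qed.

(** The clusters of a tree determine the unordered pair of its branches. So
    trees with the same clusters differ by exchanging branches, independently
    at each of the branch points, whose number is one less than the number of
    leaves. *)
Lemma count_same_clusters t : uniq (leaves t) ->
  \sum_(u <- trees_on (support t)) (clusters u == clusters t) = 2 ^ (size (leaves t)).-1.
Proof.
elim: t => [a|l IHl r IHr] ut.
  rewrite (perm_big [:: Leaf a]) ?big_seq1 ?eqxx //.
  apply: uniq_perm; rewrite ?trees_on_uniq // => u; rewrite trees_onP support_Leaf inE.
  apply/andP/eqP => [[uu /eqP su]|->]; last by rewrite support_Leaf.
  have := card_support uu; rewrite su cards1.
  case: u {uu} su => [b|v w] su /=; last first.
    by rewrite size_cat; have := size_leaves_gt0 v; have := size_leaves_gt0 w; lia.
  by rewrite support_Leaf in su; move/set1_inj: su => ->.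
have [ul ur dlr] := uniq_NodeP ut.
have s2 : 1 < #|support (Node l r)|.
  by rewrite card_support //= size_cat; have := size_leaves_gt0 l; have := size_leaves_gt0 r; lia.
have lr : support l != support r.
  have /set0Pn[x xl] := support_neq0 l; apply/eqP => E.
  by move: (xl); rewrite {1}mem_support => /dlr; apply; rewrite -mem_support -E.
rewrite (node_sum (fun u => nat_of_bool (clusters u == clusters (Node l r))) s2).
have dis : [disjoint support l & support r].
  by rewrite disjoint_subset; apply/subsetP=> x; rewrite !inE => xl; apply/negP => /(dlr x xl).
have inX (X Y : {set T}) v w : [disjoint X & Y] -> v \in trees_on X -> w \in trees_on Y -> uniq (leaves (Node v w)).
  move=> dXY; rewrite !trees_onP => /andP[uv /eqP vX] /andP[uw /eqP wY].
  rewrite /= cat_uniq uv uw andbT /=; apply/hasPn => x xw /=.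
  by rewrite -mem_support in xw; rewrite -mem_support vX (disjointFl dXY) // -wY.
have part X Y v w : [disjoint X & Y] -> v \in trees_on X -> w \in trees_on Y ->
   (clusters (Node v w) == clusters (Node l r)) =
   ((X == support l) && (Y == support r)) && ((clusters v == clusters l) && (clusters w == clusters r)) ||
   ((X == support r) && (Y == support l)) && ((clusters v == clusters r) && (clusters w == clusters l)).
  move=> dXY vX wY; have uvw := inX _ _ _ _ dXY vX wY.
  have vE := support_trees_on vX; have wE := support_trees_on wY.
  apply/eqP/orP.
    move=> /[dup] E /(clusters_Node_eq uvw ut)[[sl sr]|[sl sr]]; [left|right].
      rewrite -vE -wE -sl -sr !eqxx /= (clusters_left uvw) (clusters_right uvw) E -sl -sr.
      by rewrite -(clusters_left ut) -(clusters_right ut) !eqxx.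
    rewrite -vE -wE -sl -sr !eqxx /= (clusters_left uvw) (clusters_right uvw) E -sl -sr.
    by rewrite -(clusters_left ut) -(clusters_right ut) !eqxx.
  case=> /andP[/andP[/eqP XE /eqP YE] /andP[/eqP cv /eqP cw]].
    by rewrite /= !support_Node vE wE XE YE cv cw.
  by rewrite clusters_NodeC /= !support_Node vE wE XE YE cv cw.
pose f := fun X Y : {set T} => \sum_(v <- trees_on X) \sum_(w <- trees_on Y) nat_of_bool (clusters (Node v w) == clusters (Node l r)).
rewrite -[LHS]/(\sum_(p : {set T} * {set T} | _) f p.1 p.2).
have f1 : f (support l) (support r) = 2 ^ (size (leaves l)).-1 * 2 ^ (size (leaves r)).-1.
  rewrite -(IHl ul) -(IHr ur) big_distrlr /= /f big_seq [RHS]big_seq; apply: eq_bigr => v vl.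
  rewrite big_seq [RHS]big_seq; apply: eq_bigr => w wr.
  by rewrite (part _ _ _ _ dis vl wr) !eqxx (negbTE lr) /= orbF; do !case: (_ == _).
have f2 : f (support r) (support l) = 2 ^ (size (leaves l)).-1 * 2 ^ (size (leaves r)).-1.
  rewrite -(IHl ul) -(IHr ur) mulnC big_distrlr /= /f big_seq [RHS]big_seq; apply: eq_bigr => v vl.
  rewrite big_seq [RHS]big_seq; apply: eq_bigr => w wr.
  rewrite disjoint_sym in dis.
  by rewrite (part _ _ _ _ dis vl wr) !eqxx eq_sym (negbTE lr) /=; do !case: (_ == _).
rewrite (bigD1 (support l, support r)) /= ?support_Node ?dis ?eqxx //.
rewrite (bigD1 (support r, support l)) /=; last first.
  by rewrite disjoint_sym dis setUC eqxx /= xpair_eqE eq_sym (negbTE lr).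
rewrite big1 ?addn0 => [|[X Y] /= /andP[/andP[/andP[dXY _] n1] n2]]; last first.
  rewrite /f big_seq big1 // => v vX; rewrite big_seq big1 // => w wY.
  rewrite (part _ _ _ _ dXY vX wY); move: n1 n2; rewrite !xpair_eqE => /negbTE-> /negbTE->.
  by [].
rewrite f1 f2 addnn -mul2n -expnD -expnS /= size_cat; congr (2 ^ _).
by have := size_leaves_gt0 l; have := size_leaves_gt0 r; lia.
Qed.

(** * The parent of a cluster *)

(** The smallest cluster that strictly contains [X], where [P] stands for the
    parent of the top cluster. This is the parent function of the tree whose
    vertices are the clusters. *)
Fixpoint parset P t X : {set T} :=
  match t with
  | Leaf _ => P
  | Node l r =>
    if X == support (Node l r) then P
    else if X \subset support l then parset (support (Node l r)) l X
    else parset (support (Node l r)) r X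
  end.

Definition inner_clusters t := [set X in clusters t | 1 < #|X|].

Lemma inner_support l r : uniq (leaves (Node l r)) -> 1 < #|support (Node l r)|.
Proof.
move=> ut; rewrite card_support //= size_cat.
by have := size_leaves_gt0 l; have := size_leaves_gt0 r; lia.
Qed.

Lemma parset_mem P t X : uniq (leaves t) -> X \in clusters t ->
  parset P t X = P \/ parset P t X \in inner_clusters t.
Proof.
elim: t P X => [a|l IHl r IHr] P X ut Xt; first by left.
have [ul ur dlr] := uniq_NodeP ut.
have topI : support (Node l r) \in inner_clusters (Node l r).
  by rewrite inE support_clusters inner_support.
case: (clusters_Node_cases ut Xt) => [->|[Xl /negbTE Xn Xs _]|[Xr /negbTE Xn _ /negbTE Xs]];
    rewrite [parset _ _ _]/= ?eqxx; first by left.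
  rewrite Xn Xs; right; case: (IHl (support (Node l r)) X ul Xl) => [->//|].
  by rewrite !inE => /andP[-> ->]; rewrite orbT.
rewrite Xn Xs; right; case: (IHr (support (Node l r)) X ur Xr) => [->//|].
by rewrite !inE => /andP[-> ->]; rewrite !orbT.
Qed.

Lemma support_proper l r : uniq (leaves (Node l r)) ->
  support l \proper support (Node l r) /\ support r \proper support (Node l r).
Proof.
move=> ut; have [_ _ dlr] := uniq_NodeP ut; rewrite support_Node.
have /set0Pn[x xl] := support_neq0 l; have /set0Pn[y yr] := support_neq0 r.
split; apply/properP; split; rewrite ?subsetUl ?subsetUr //.
  exists y; first by rewrite in_setU yr orbT.
  by apply/negP; move: yr; rewrite !mem_support => yr /dlr/(_ yr).
exists x; first by rewrite in_setU xl.
by apply/negP; move: xl; rewrite !mem_support => /dlr.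
Qed.

Lemma parset_proper P t X : uniq (leaves t) -> support t \proper P -> X \in clusters t ->
  X \proper parset P t X.
Proof.
elim: t P X => [a|l IHl r IHr] P X ut tP Xt.
  exact: sub_proper_trans (clusters_sub Xt) tP.
have [ul ur dlr] := uniq_NodeP ut; have [pl pr] := support_proper ut.
by case: (clusters_Node_cases ut Xt) => [->|[Xl /negbTE Xn Xs _]|[Xr /negbTE Xn _ /negbTE Xs]];
    rewrite [parset _ _ _]/= ?eqxx // Xn Xs; [apply: IHl|apply: IHr].
Qed.

Lemma parset_sub P t X : uniq (leaves t) -> support t \subset P -> X \in clusters t ->
  parset P t X \subset P.
Proof.
move=> ut tP Xt; case: (parset_mem P ut Xt) => [->//|].
by rewrite inE => /andP[/clusters_sub/subset_trans/(_ tP)].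
Qed.

Lemma parset_min P t X Z : uniq (leaves t) -> X \in clusters t -> Z \in clusters t ->
  X \proper Z -> parset P t X \subset Z.
Proof.
elim: t P X Z => [a|l IHl r IHr] P X Z ut Xt Zt XZ.
  by move: Xt Zt XZ; rewrite !inE => /eqP-> /eqP->; rewrite properxx.
have [ul ur dlr] := uniq_NodeP ut; have [/proper_sub pl /proper_sub pr] := support_proper ut.
case: (clusters_Node_cases ut Xt) => [XE|[Xl /negbTE Xn Xs Xr']|[Xr /negbTE Xn Xr' /negbTE Xs]].
- by move: XZ; rewrite XE properE (clusters_sub Zt) andbF.
- rewrite [parset _ _ _]/= Xn Xs; case: (clusters_Node_cases ut Zt) => [->|[Zl _ _ _]|[_ _ Zr _]].
  + exact: parset_sub.
  + exact: IHl.
  + by case/negP: Xr'; apply: subset_trans (proper_sub XZ) Zr.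
- rewrite [parset _ _ _]/= Xn Xs; case: (clusters_Node_cases ut Zt) => [->|[_ _ Zl _]|[Zr _ _ _]].
  + exact: parset_sub.
  + by case/negP: Xs; apply: subset_trans (proper_sub XZ) Zl.
  + exact: IHr.
Qed.

Lemma parset_top P t X : uniq (leaves t) -> support t \proper P -> X \in clusters t ->
  (parset P t X == P) = (X == support t).
Proof.
case: t => [a|l r] ut tP Xt.
  by move: Xt; rewrite inE support_Leaf => /eqP->; rewrite /= !eqxx.
have [ul ur dlr] := uniq_NodeP ut; have [pl pr] := support_proper ut.
have ne Y : Y \subset support (Node l r) -> (Y == P) = false.
  by move=> Ys; apply/eqP => E; move: tP; rewrite properE -E Ys andbF.
by case: (clusters_Node_cases ut Xt) => [->|[Xl /negbTE Xn Xs _]|[Xr /negbTE Xn _ /negbTE Xs]];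
    rewrite [parset _ _ _]/= ?eqxx // Xn Xs; apply: ne; apply: parset_sub; rewrite ?proper_sub.
Qed.

Lemma parset_children P t Y l r X : uniq (leaves t) -> support t \proper P ->
  subtree Y t = Some (Node l r) -> X \in clusters t ->
  (parset P t X == Y) = (X == support l) || (X == support r).
Proof.
elim: t P X => [a|l0 IHl r0 IHr] P X ut tP; first by rewrite [subtree _ _]/=; case: eqP.
have [ul ur dlr] := uniq_NodeP ut; have [pl pr] := support_proper ut.
have YP : subtree Y (Node l0 r0) <> None -> Y \in clusters (Node l0 r0).
  by move=> h; apply/negPn/negP => /subtree_None.
move=> sE Xt; have Yt : Y \in clusters (Node l0 r0) by apply: YP; rewrite sE.
have Ys := clusters_sub Yt.
have XTop v : support v \proper support (Node l0 r0) -> support (Node l0 r0) == support v = false.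
  by move=> h; apply/eqP => E; move: h; rewrite E properxx.
move: sE; rewrite [subtree _ _]/=; case: eqP => [YE [lE rE]|/eqP YN sE].
  rewrite -YE -lE -rE {lE rE}.
  case: (clusters_Node_cases ut Xt) => [->|[Xl /negbTE Xn Xs Xr']|[Xr /negbTE Xn Xr' Xs]];
    rewrite [parset _ _ _]/= ?eqxx.
  - rewrite !XTop //; apply/eqP => E; move: tP; rewrite E properxx. by [].
  - rewrite Xn Xs parset_top //; case: (eqVneq X (support r0)) => [E|_]; last by rewrite orbF.
    by rewrite E subxx in Xr'.
  - rewrite Xn (negbTE Xs) parset_top //; case: (eqVneq X (support l0)) => [E|_] //.
    by rewrite E subxx in Xs.
(* From here on [Y] is a cluster of one of the two branches. *)
have [u [su uY uu _]] := subtreeP ut Yt.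
have uE : u = Node l r by move: su; rewrite [subtree _ _]/= (negbTE YN) sE => -[->].
have Yin (v : btree T) : v = l \/ v = r -> support v \subset Y.
  by move=> [->|->]; rewrite -uY uE support_Node ?subsetUl ?subsetUr.
have YNP : Y == P = false.
  by apply/eqP => E; move: tP; rewrite properE -E Ys andbF.
have nosub v w S : (forall x, x \in leaves v -> x \in leaves w -> False) -> S \in clusters v ->
    S \subset support w = false.
  move=> d Sv; have /set0Pn[x xS] := clusters_neq0 Sv; apply/negP => /subsetP/(_ x xS).
  by have := subsetP (clusters_sub Sv) x xS; rewrite !inE; exact: d.
case: (clusters_Node_cases ut Xt) => [->|[Xl /negbTE Xn Xs Xr']|[Xr /negbTE Xn Xr' /negbTE Xs]];
  rewrite [parset _ _ _]/= ?eqxx.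
- rewrite eq_sym YNP; apply/esym/negbTE; rewrite negb_or.
  have key v : v = l \/ v = r -> support (Node l0 r0) != support v.
    move=> /Yin vY; apply: contraNneq YN => E; rewrite eqEsubset Ys E vY. by [].
  by rewrite !key; auto.
- rewrite Xn Xs; case: (clusters_Node_cases ut Yt) => [E|[Yl _ _ _]|[Yr _ Yrs _]].
  + by rewrite E eqxx in YN.
  + apply: IHl => //; move: sE; case: (subtree Y l0) => [v|] //.
    by have /subtree_None-> := clusters_disjoint ut Yl.
  + have -> : (parset (support (Node l0 r0)) l0 X == Y) = false.
      case: (parset_mem (support (Node l0 r0)) ul Xl) => [->|]; first by rewrite (negbTE YN).
      rewrite inE => /andP[pm _]; apply/eqP => E; rewrite E in pm.
      by have := clusters_disjoint ut pm; rewrite Yr.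
    apply/esym/negbTE; rewrite negb_or; apply/andP; split; apply: contraNneq Xr' => ->;
    by apply: subset_trans Yrs; apply: Yin; auto.
- rewrite Xn Xs; case: (clusters_Node_cases ut Yt) => [E|[Yl _ Yls _]|[Yr _ Yrs _]].
  + by rewrite E eqxx in YN.
  + have -> : (parset (support (Node l0 r0)) r0 X == Y) = false.
      case: (parset_mem (support (Node l0 r0)) ur Xr) => [->|]; first by rewrite (negbTE YN).
      rewrite inE => /andP[pm _]; apply/eqP => E; rewrite E in pm.
      by have := clusters_disjoint ut Yl; rewrite pm.
    apply/esym/negbTE; rewrite negb_or; apply/andP; split; apply: contraFneq Xs => ->;
    by apply: subset_trans Yls; apply: Yin; auto.
  + apply: IHr => //; move: sE.
    have -> // : subtree Y l0 = None.
    by apply: subtree_None; apply: contraL Yr; apply: clusters_disjoint.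
Qed.

Lemma card_inner_clusters t : uniq (leaves t) -> #|inner_clusters t|.+1 = size (leaves t).
Proof.
elim: t => [a|l IHl r IHr] ut.
  rewrite (_ : inner_clusters _ = set0) ?cards0 //; apply/setP=> X; rewrite !inE.
  by case: eqP => // ->; rewrite cards1.
have [ul ur dlr] := uniq_NodeP ut; have [pl pr] := support_proper ut.
have -> : inner_clusters (Node l r) = support (Node l r) |: (inner_clusters l :|: inner_clusters r).
  apply/setP=> X; have E1 v : (X \in inner_clusters v) = (X \in clusters v) && (1 < #|X|) by rewrite inE.
  rewrite in_setU1 in_setU !E1 [clusters (Node l r)]/= in_setU1 in_setU.
  by case: eqP => [->|_] /=; rewrite ?inner_support // andb_orl.
rewrite cardsU1 [X in _ + X](_ : _ = #|inner_clusters l| + #|inner_clusters r|); last first.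
  apply/eqP; rewrite (leq_card_setU _ _).2 disjoint_subset; apply/subsetP=> X.
  by rewrite !inE => /andP[/(clusters_disjoint ut)/negbTE->].
rewrite [leaves _]/= size_cat -IHl // -IHr //.
rewrite in_setU !in_set negb_or.
have no v : support v \proper support (Node l r) -> support (Node l r) \in clusters v = false.
  by move=> h; apply/negP => /clusters_sub; move: h; rewrite properE => /andP[_ /negbTE->].
by rewrite !no //= addnS.
Qed.

End SameClusters.

(** * Every plane tree is the reading of a leaf-labeled tree *)

Section Realization.
Variables (n : nat) (rho : 'I_n) (t : btree 'I_n).
Hypothesis n2 : 1 < n.
Hypothesis ut : uniq (leaves t).
Hypothesis st : support t = ~: [set rho].

Local Notation V := (tree_vertex n).

Let rho_notin X : X \in clusters t -> rho \notin X.
Proof.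
by move=> /clusters_sub/subsetP sub; apply/negP => /sub; rewrite st !inE eqxx.
Qed.

Let tproper : support t \proper [set: 'I_n].
Proof. by rewrite properT st; apply/eqP => /setP/(_ rho); rewrite !inE eqxx. Qed.

Let card_inner : #|inner_clusters t| = n - 2.
Proof.
have := card_inner_clusters ut; rewrite -card_support // st.
by have := cardsC [set rho]; rewrite cards1 card_ord; lia.
Qed.

(** The cluster of a vertex of the prescribed vertex set. The leaves are given
    by their labels, and the n - 2 branch points are matched with the clusters
    of at least two elements by an enumeration; the root gets the set of all
    labels. *)
Let K (v : V) : {set 'I_n} :=
  match v with
  | inl i => if i == rho then [set: 'I_n] else [set i]
  | inr j => enum_val (cast_ord (esym card_inner) j)
  end.

Let K_inr j : K (inr j) \in inner_clusters t. Proof. exact: enum_valP. Qed.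

Let inner_in X : X \in inner_clusters t -> X \in clusters t /\ 1 < #|X|.
Proof. by rewrite inE => /andP[]. Qed.

Let cardT : 1 < #|[set: 'I_n]|. Proof. by rewrite cardsT card_ord. Qed.

Let setT_notin : [set: 'I_n] \notin clusters t.
Proof. by apply/negP => /rho_notin; rewrite inE. Qed.

Let root : V := inl rho.

Let K_root : K root = [set: 'I_n]. Proof. by rewrite /= eqxx. Qed.

Let K_clusters v : v != root -> K v \in clusters t.
Proof.
case: v => [i|j] vr; last by have [] := inner_in (K_inr j).
have ir : i != rho by apply: contra_neq vr => ->.
by rewrite /= (negbTE ir) clusters1 // -mem_support st !inE.
Qed.

Let K_inj : injective K.
Proof.
have ci i : i != rho -> #|K (inl i)| = 1 by move=> /negbTE /= ->; rewrite cards1.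
have cj j : 1 < #|K (inr j)| by have [] := inner_in (K_inr j).
have nT v : v != root -> K v <> [set: 'I_n].
  by move=> /K_clusters + E; rewrite E (negbTE setT_notin).
have key (x y : V) : x != root -> y != root -> K x = K y -> x = y.
  case: x => [i|i]; case: y => [j|j] xr yr E.
  - move: E => /=; have ir : i != rho by apply: contra_neq xr => ->.
    have jr : j != rho by apply: contra_neq yr => ->.
    by rewrite (negbTE ir) (negbTE jr) => /set1_inj->.
  - by have := cj j; rewrite -E ci //; apply: contra_neq xr => ->.
  - by have := cj i; rewrite E ci //; apply: contra_neq yr => ->.
  - by move/enum_val_inj/cast_ord_inj: E => ->.
move=> x y E; have [xr|xr] := eqVneq x root; have [yr|yr] := eqVneq y root.
- by rewrite xr yr.
- by case: (nT y yr); rewrite -E xr K_root.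
- by case: (nT x xr); rewrite E yr K_root.
- exact: key.
Qed.

Let at_cluster X : V := odflt root [pick v | K v == X].

Let K_at X : X = [set: 'I_n] \/ X \in clusters t -> K (at_cluster X) = X.
Proof.
move=> XF; rewrite /at_cluster; case: pickP => [v /eqP//|none].
exfalso; case: XF => [XT|Xt]; first by have := none root; rewrite K_root XT eqxx.
have := clusters_neq0 Xt; rewrite -card_gt0 => X0.
case: (ltnP 1 #|X|) => X1.
  have Xi : X \in inner_clusters t by rewrite inE Xt X1.
  have := none (inr (cast_ord card_inner (enum_rank_in Xi X))).
  by rewrite /= cast_ordK enum_rankK_in ?eqxx.
have /cards1P[i Xi] : #|X| == 1 by rewrite eqn_leq X1 X0.
have ir : i != rho by apply: contraTneq (rho_notin Xt) => <-; rewrite Xi inE eqxx.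
by have := none (inl i); rewrite /= (negbTE ir) Xi eqxx.
Qed.

Let par v := if v == root then root else at_cluster (parset [set: 'I_n] t (K v)).

Let K_par v : v != root -> K (par v) = parset [set: 'I_n] t (K v).
Proof.
move=> vr; rewrite /par (negbTE vr); apply: K_at.
case: (parset_mem [set: 'I_n] ut (K_clusters vr)) => [->|/inner_in[]]; by [left|right].
Qed.

(* Each vertex is joined to the vertex of the parent of its cluster. *)
Let E := [set p : V * V | (p.1 != root) && (par p.1 == p.2) || (p.2 != root) && (par p.2 == p.1)].

Let rE : @rooting _ (graph_of E) root par (fun v => n - #|K v|).
Proof.
split; first by rewrite /par eqxx.
  move=> v vr; have := parset_proper ut tproper (K_clusters vr); rewrite -K_par // => /proper_card.
  have := max_card (mem (K (par v))); rewrite card_ord.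
  by move: #|K v| #|K (par v)| => a b bn ab; lia.
by move=> x y /=; rewrite inE.
Qed.

Let childE x c : child (G := graph_of E) root par x c =
  (c != root) && (parset [set: 'I_n] t (K c) == K x).
Proof.
rewrite /child; have [//|cr] := eqVneq c root; rewrite -K_par // /=.
by rewrite (inj_eq K_inj).
Qed.

Let bE : binary_labeling (G := graph_of E) root par rho.
Proof.
have suppne X : X \in clusters t -> X != [set: 'I_n] by move=> Xt; apply: contraNneq setT_notin => <-.
split=> //=.
- by move=> [i|i] [j|j] a //= [->] [->].
- move=> [i|j] // c xr _; rewrite childE; apply/negP => /andP[cr /eqP pE].
  have ir : i != rho by apply: contra_neq xr => ->.
  have Ki : K (inl i) = [set i] by rewrite /= (negbTE ir).
  case: (parset_mem [set: 'I_n] ut (K_clusters cr)) => [E'|/inner_in[_]].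
    by move: cardT; rewrite -E' pE Ki cards1.
  by rewrite pE Ki cards1.
- exists (at_cluster (support t)) => c; rewrite childE K_root.
  have Ks : K (at_cluster (support t)) = support t by apply: K_at; right; exact: support_clusters.
  apply/andP/eqP => [[cr]|->].
    by rewrite parset_top ?K_clusters // => /eqP cE; apply: K_inj; rewrite Ks.
  have sr : at_cluster (support t) != root.
    apply: contraNneq (suppne _ (support_clusters t)) => E'.
    by rewrite -Ks E' K_root.
  by rewrite sr Ks parset_top ?support_clusters ?eqxx.
move=> [//|j] _.
have [Yt Y1] := inner_in (K_inr j); set Y := K (inr j) in Yt Y1 *.
have [u [su uY uu _]] := subtreeP ut Yt.
case: u su uY uu => [a|l r] su uY uu; first by move: Y1; rewrite -uY support_Leaf cards1.
have inc v : v = l \/ v = r -> support v \in clusters t.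
  have sub : clusters (Node l r) \subset clusters t.
    have [rr [_ _ _ /(_ rho)]] := subtreeP ut Yt.
    case; first by rewrite st !inE eqxx andbF.
    have [C [sC _ _ _]] : exists C, [/\ subtree Y t = Some C, True, True & True].
      by exists (Node l r).
    move=> tE _.
    have [u' [su' _ _ /(_ rho)]] := subtreeP ut Yt.
    case; first by rewrite st !inE eqxx andbF.
    move: su'; rewrite su => -[<-] tE' pC.
    rewrite -tE' clusters_subst ?subsetUl // (perm_uniq pC, perm_mem pC) //=.
      by rewrite filter_uniq // mem_filter -mem_support st !inE eqxx andbF.
    by rewrite mem_head.
  by move=> vlr; apply: (subsetP sub); case: vlr => ->; rewrite /= !in_setU support_clusters ?orbT.
have Kv v : v = l \/ v = r -> K (at_cluster (support v)) = support v.
  by move=> /inc vt; apply: K_at; right.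
have atr v : v = l \/ v = r -> at_cluster (support v) != root.
  move=> vlr; apply: contraNneq (suppne _ (inc v vlr)) => E'.
  by rewrite -(Kv v vlr) E' K_root.
exists (at_cluster (support l)), (at_cluster (support r)); split.
  apply/eqP => E'; have := Kv r (or_intror erefl); rewrite -E' (Kv l (or_introl erefl)).
  have [_ _ dlr] := uniq_NodeP uu; have /set0Pn[x xl] := support_neq0 l => slr.
  by move: (xl); rewrite {1}mem_support => /dlr; apply; rewrite -mem_support -slr.
move=> c; rewrite childE; apply/andP/orP => [[cr]|].
  rewrite (parset_children ut tproper su (K_clusters cr)).
  rewrite -{1}(Kv l (or_introl erefl)) -{1}(Kv r (or_intror erefl)).
  by rewrite !(inj_eq K_inj) => /orP.
have fin v : v = l \/ v = r -> parset [set: 'I_n] t (support v) == Y.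
  by move=> vlr; rewrite (parset_children ut tproper su (inc v vlr)); case: vlr => ->; rewrite eqxx ?orbT.
by case=> /eqP->; [have lr : l = l \/ l = r by left|have lr : r = l \/ r = r by right]; rewrite Kv ?atr ?fin.
Qed.

Let anc_K w v : fconnect par w v = (K w \subset K v).
Proof.
apply/idP/idP => [wv|].
  apply: (@anc_ind _ (graph_of E) par (fun v => K w \subset K v) w v wv) => // z _ wz.
  have [->|zr] := eqVneq z root; first by rewrite /par eqxx K_root subsetT.
  rewrite K_par //; apply: subset_trans wz _; apply: proper_sub.
  exact: parset_proper ut tproper (K_clusters zr).
have [k] := ubnP (n - #|K w|); elim: k w => // k IHk w; rewrite ltnS => wk wv.
have [->|ne] := eqVneq w v; first exact: connect0.
have pwv : K w \proper K v by rewrite properEneq wv (inj_eq K_inj) ne.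
have wr : w != root.
  by apply: contraTneq pwv => ->; rewrite K_root properE subsetT andbF.
apply: connect_trans (fconnect1 par w) _; apply: IHk.
  have [_ hp _] := rE; exact: leq_trans (hp w wr) wk.
have [->|vr] := eqVneq v root; first by rewrite K_root subsetT.
rewrite K_par //; apply: parset_min => //; exact: K_clusters.
Qed.

Let family_E : family (G := graph_of E) root par = clusters t.
Proof.
have cE (v : V) : v != root -> cluster (G := graph_of E) par v = K v.
  move=> vr; apply/setP=> i; have vt := K_clusters vr; apply/clusterP/idP.
    move=> [[j|j] //= [->]]; rewrite anc_K /=; case: eqP => [_|_]; last by rewrite sub1set.
    by rewrite subTset => /eqP Ev; rewrite Ev (negbTE setT_notin) in vt.
  move=> iv; exists (inl i) => //; rewrite anc_K /=.
  have ir : i != rho by apply: contraTneq iv => ->; exact: rho_notin.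
  by rewrite (negbTE ir) sub1set.
apply/setP=> X; apply/imsetP/idP => [[v vr ->]|Xt].
  by rewrite cE ?K_clusters.
have KX : K (at_cluster X) = X by apply: K_at; right.
have ar : at_cluster X != root.
  by apply: contraNneq setT_notin => E'; rewrite -K_root -E' KX.
by exists (at_cluster X); rewrite ?cE.
Qed.

(** The tree whose vertices are the clusters of [t], with the parent function
    [parset]. *)
Lemma realization : exists2 E : {set tree_vertex n * tree_vertex n},
  E \in binary_trees n & hierarchy rho (graph_of E) (clusters t).
Proof.
exists E; last first.
  by exists root, par, (fun v : V => n - #|K v|); split; [exact: rE|exact: bE|rewrite family_E].
rewrite inE; apply/asboolP.
have degE (x : V) := degree_children (G := graph_of E) x rE.
have [_ _ leafc [c0 rc] inner] := bE.
have deg_lab (x : vertex (graph_of E)) : label x <> None -> degree x = 1.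
  move=> xl; rewrite degE; have [->|xr] := eqVneq x root.
    rewrite (_ : [set _ | _] = [set c0]) ?cards1 //; apply/setP=> c.
    by rewrite !inE rc.
  rewrite (_ : [set _ | _] = set0) ?cards0 //; apply/setP=> c.
  by rewrite in_set in_set0; apply/negbTE/leafc.
have deg_inner (x : vertex (graph_of E)) : label x = None -> degree x = 3.
  move=> x0; have [c1 [c2 [c12 xc]]] := inner x x0.
  have xr : x != root by apply: contra_eq_neq x0 => ->.
  rewrite degE xr (_ : [set _ | _] = [set c1; c2]) ?cards2 ?c12 //.
  by apply/setP=> c; rewrite in_set xc in_set2.
split.
- split; first exact: rooting_is_tree rE.
  right=> x; case xl : (label x) => [a|]; [left; apply: deg_lab; rewrite xl|right; exact: deg_inner].
  by [].
- move=> x; rewrite /is_leaf; split; last by move=> /deg_lab->.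
  by move=> d x0; rewrite deg_inner in d.
- by move=> x a _; rewrite inE.
- move=> a _; exists (inl a); split=> // -[i|j] //= [->].
  by [].
Qed.

End Realization.

(** * Classes of leaf-labeled trees *)

Section Classes.
Variables (n : nat) (rho : 'I_n).
Hypothesis n2 : 1 < n.

Definition hierarchies := [set F : {set {set 'I_n}} | has (fun t => clusters t == F) (trees_on (~: [set rho]))].

Lemma hierarchiesP F :
  reflect (exists2 t, t \in trees_on (~: [set rho]) & clusters t = F) (F \in hierarchies).
Proof.
rewrite inE; apply: (iffP hasP) => -[t tA]; first by move=> /eqP; exists t.
by move=> /eqP; exists t.
Qed.

Definition class_of F : {set {set tree_vertex n * tree_vertex n}} :=
  [set E in binary_trees n | `[< hierarchy rho (graph_of E) F >]].

Lemma tree_hierarchy E : E \in binary_trees n ->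
  exists2 F, F \in hierarchies & hierarchy rho (graph_of E) F.
Proof.
rewrite inE => /asboolP bt.
have [|r [par [h [rG bG]]]] := binary_tree_rooted rho bt; first by rewrite card_ord.
exists (family (G := graph_of E) r par); last by exists r, par, h.
have [_ _ _ labE] := bt.
have [a|t tA tE] := plane_reading_family rG bG.
  by have [x [xa _]] := labE a (in_setT a); exists x.
by apply/hierarchiesP; exists t.
Qed.

Lemma hierarchy_tree F : F \in hierarchies -> exists E, E \in class_of F.
Proof.
move=> /hierarchiesP[t]; rewrite trees_onP => /andP[ut /eqP st] <-.
have [E Eb hE] := realization n2 ut st; exists E; rewrite inE Eb.
exact/asboolP.
Qed.

(** The hierarchy is a complete invariant of the classes, by
    [hierarchy_equivalent] and [same_hierarchy_equivalent]. *)
Lemma tree_classesE : tree_classes n = [set class_of F | F in hierarchies].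
Proof.
have same E F : E \in class_of F ->
    [set y in binary_trees n | `[< equivalent (graph_of E) (graph_of y) >]] = class_of F.
  rewrite inE => /andP[Eb /asboolP hE]; apply/setP=> E'; rewrite !inE.
  case: (boolP (`[< is_leaf_labeled_binary_tree (graph_of E') [set: 'I_n] >])) => //= b'.
  apply/asboolP/asboolP => [eq|hE']; last exact: same_hierarchy_equivalent hE hE'.
  have [|F' _ hF'] := @tree_hierarchy E'; first by rewrite inE.
  by rewrite (hierarchy_equivalent hE hF' eq).
apply/setP=> c; apply/imsetP/imsetP => [[E Eb ->]|[F FH ->]].
  have [F FH hE] := tree_hierarchy Eb; exists F => //; apply: same.
  by rewrite inE Eb; exact/asboolP.
have [E Ec] := hierarchy_tree FH; exists E; last by rewrite (same _ _ Ec).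
by move: Ec; rewrite inE => /andP[].
Qed.

Lemma class_of_inj : {in hierarchies &, injective class_of}.
Proof.
move=> F F' FH _ FF'; have [E EF] := hierarchy_tree FH.
move: (EF); rewrite FF' !inE => /andP[_ /asboolP h2].
move: EF; rewrite !inE => /andP[_ /asboolP h1].
exact: hierarchy_equivalent h1 h2 (equivalent_refl _).
Qed.

(** Every class is read by the same number of plane trees, by
    [count_same_clusters], so a uniform random plane tree gives a uniform
    random class. *)
Lemma sum_plane_trees (f : {set {set 'I_n}} -> nat) :
  \sum_(t <- trees_on (~: [set rho])) f (clusters t) = 2 ^ (n - 2) * \sum_(F in hierarchies) f F.
Proof.
rewrite big_seq_cond (partition_big (@clusters _) (mem hierarchies)) /=; last first.
  by move=> t /andP[tA _]; apply/hierarchiesP; exists t.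
rewrite big_distrr /=; apply: eq_bigr => F /hierarchiesP[t tA tE].
have := tA; rewrite trees_onP => /andP[ut /eqP st].
have sz : (size (leaves t)).-1 = n - 2.
  rewrite -card_support // st; have := cardsC [set rho]; rewrite cards1 card_ord.
  by move: #|~: [set rho]| => a; lia.
rewrite -sz -(count_same_clusters ut) st tE big_distrl /= [RHS]big_seq.
rewrite (eq_bigl (fun u => (u \in trees_on (~: [set rho])) && (clusters u == F))).
  rewrite big_mkcondr /=; apply: eq_bigr => u _.
  by case: eqP => [->|]; rewrite ?mul1n ?mul0n.
by move=> u; rewrite andbT.
Qed.

Lemma card_tree_classes : num_trees n.-1 = 2 ^ (n - 2) * #|tree_classes n|.
Proof.
rewrite tree_classesE card_in_imset; last exact: class_of_inj.
rewrite -sum1_card -(sum_plane_trees (fun=> 1)) sum1_size size_trees_on.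
by congr num_trees; have := cardsC [set rho]; rewrite cards1 card_ord; lia.
Qed.

Lemma total_agreement_le : total_agreement (~: [set rho]) set0 <=
  (2 ^ (n - 2)) ^ 2 * \sum_(c in tree_classes n) \sum_(c' in tree_classes n) kappa_class c c'.
Proof.
rewrite /total_agreement setU0.
under eq_bigr do rewrite (sum_plane_trees (fun F => agreement _ _ _ F)).
rewrite -big_distrr /= (sum_plane_trees (fun F => \sum_(F' in hierarchies) agreement _ _ F F')).
rewrite mulnA mulnn leq_mul2l; apply/orP; right.
rewrite tree_classesE big_imset /=; last exact: class_of_inj.
apply: leq_sum => F FH; rewrite big_imset /=; last exact: class_of_inj.
apply: leq_sum => F' FH'.
have [E EF] := hierarchy_tree FH; have [E' EF'] := hierarchy_tree FH'.
apply: leq_trans (leq_bigmax_cond E EF); apply: leq_trans (leq_bigmax_cond E' EF').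
move: EF EF'; rewrite !inE => /andP[_ /asboolP h1] /andP[_ /asboolP h2].
exact: kappa_agreement h1 h2.
Qed.

End Classes.

From mathcomp Require Import all_order all_algebra.
From mathcomp Require Import fingroup perm.
From mathcomp Require Import ring lra.

Import Order.TTheory GRing.Theory Num.Theory.

Local Open Scope nat_scope.

Section Recursion.
Variable T : finType.
Implicit Types (t u C l r : btree T) (a b s x : T) (A B D E I S X Y : {set T}).
Implicit Types (F G : {set {set T}}).

(** * The recursive inequalities *)

Lemma sum3_separate (I J K : Type) (r1 : seq I) (r2 : seq J) (r3 : seq K) f g h :
  \sum_(i <- r1) \sum_(j <- r2) \sum_(k <- r3) (f i + g j + h k) =
  size r2 * size r3 * (\sum_(i <- r1) f i) +
  size r1 * size r3 * (\sum_(j <- r2) g j) +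
  size r1 * size r2 * (\sum_(k <- r3) h k).
Proof.
have cst (L : Type) (q : seq L) (c : nat) : \sum_(i <- q) c = size q * c.
  by rewrite big_const_seq count_predT iter_addn_0 mulnC.
under eq_bigr => i _.
  under eq_bigr => j _ do rewrite big_split /= cst.
  rewrite big_split /= cst -big_distrr big_split /= cst.
  over.
rewrite !big_split /= cst -big_distrr big_split /= cst -big_distrr /=.
lia.
Qed.

Definition rest A (p : {set T} * {set T}) := A :\: (p.1 :|: p.2).

(** Both trees are cut at their centroids, into the parts [p] and [p']. By
    [agreement_central] the agreement is at least the sum of those of the
    three pairs of pieces; in the sum for one pair the other pieces are free,
    which gives the factors [num_trees]. The factor 4 comes from ordering the
    branches of both trees. *)
Lemma central_recursion_nat A s (P : pred ({set T} * {set T})) : s \notin A -> 1 < #|A| ->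
  (forall p, P p -> central_parts A p && (#|p.1| < #|p.2|)) ->
  4 * \sum_(p | P p) \sum_(p' | P p')
   (num_trees #|p.2| * num_trees #|rest A p|.+1 * (num_trees #|p'.2| * num_trees #|rest A p'|.+1) *
     \sum_(l <- trees_on p.1) \sum_(l' <- trees_on p'.1)
       agreement (p.1 :&: p'.1) set0 (clusters l) (clusters l') +
    num_trees #|p.1| * num_trees #|rest A p|.+1 * (num_trees #|p'.1| * num_trees #|rest A p'|.+1) *
     \sum_(l <- trees_on p.2) \sum_(l' <- trees_on p'.2)
       agreement (p.2 :&: p'.2) set0 (clusters l) (clusters l') +
    num_trees #|p.1| * num_trees #|p.2| * (num_trees #|p'.1| * num_trees #|p'.2|) *
     \sum_(C <- trees_on (s |: rest A p)) \sum_(C' <- trees_on (s |: rest A p'))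
       agreement (rest A p :&: rest A p') [set s] (clusters C) (clusters C'))
  <= total_agreement A set0.
Proof.
move=> sA A1 PP; rewrite /total_agreement setU0.
have step (g : {set {set T}} -> nat) :
   2 * \sum_(p | P p) \sum_(l <- trees_on p.1) \sum_(r <- trees_on p.2)
    \sum_(C <- trees_on (s |: rest A p)) g (clusters (subst s (Node l r) C))
    <= \sum_(t <- trees_on A) g (clusters t).
  apply: leq_trans (central_sum_lt g sA A1); rewrite leq_mul2l /=.
  rewrite [leqLHS]big_mkcond [leqRHS]big_mkcond; apply: leq_sum => p _.
  by case: ifP => // /PP ->.
apply: leq_trans; last first.
  apply: leq_sum => t _; exact: (step (agreement A set0 (clusters t))).
rewrite -big_distrr /= [X in _ <= 2 * X]exchange_big /= [X in 4 * X]exchange_big /=.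
rewrite (_ : 4 = 2 * 2) // -mulnA leq_mul2l /= big_distrr /=.
apply: leq_sum => p' Pp'.
apply: leq_trans (step (fun F => \sum_(l' <- trees_on p'.1) \sum_(r' <- trees_on p'.2)
    \sum_(C' <- trees_on (s |: rest A p')) agreement A set0 F (clusters (subst s (Node l' r') C')))).
rewrite leq_mul2l /=; apply: leq_sum => p Pp.
have parts q : P q -> [/\ [disjoint q.1 & q.2], [disjoint q.1 & rest A q],
     [disjoint q.2 & rest A q] & A = q.1 :|: q.2 :|: rest A q].
  move=> /PP/andP[/and5P[d sub _ _ _] _]; split=> //.
  - by rewrite disjoints_subset; apply/subsetP=> x; rewrite !inE => ->.
  - by rewrite disjoints_subset; apply/subsetP=> x; rewrite !inE => ->; rewrite orbT.
  - by rewrite /rest -{1}(setID A (q.1 :|: q.2)) (setIidPr sub).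
have [d12 d13 d23 AE] := parts p Pp; have [d12' d13' d23' AE'] := parts p' Pp'.
have sr q : P q -> size (trees_on (s |: rest A q)) = num_trees #|rest A q|.+1.
  move=> Pq; rewrite size_trees_on cardsU1 inE (negbTE sA) andbF /= add1n //.
apply: (@leq_trans (\sum_(l <- trees_on p.1) \sum_(r <- trees_on p.2)
    \sum_(C <- trees_on (s |: rest A p)) \sum_(l' <- trees_on p'.1) \sum_(r' <- trees_on p'.2)
    \sum_(C' <- trees_on (s |: rest A p'))
     (agreement (p.1 :&: p'.1) set0 (clusters l) (clusters l') +
      agreement (p.2 :&: p'.2) set0 (clusters r) (clusters r') +
      agreement (rest A p :&: rest A p') [set s] (clusters C) (clusters C')))); last first.
  rewrite big_seq [leqRHS]big_seq; apply: leq_sum => l lp.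
  rewrite big_seq [leqRHS]big_seq; apply: leq_sum => r rp.
  rewrite big_seq [leqRHS]big_seq; apply: leq_sum => C Cp.
  rewrite big_seq [leqRHS]big_seq; apply: leq_sum => l' lp'.
  rewrite big_seq [leqRHS]big_seq; apply: leq_sum => r' rp'.
  rewrite big_seq [leqRHS]big_seq; apply: leq_sum => C' Cp'.
  by apply: (@agreement_central _ s A p.1 p.2 (rest A p) p'.1 p'.2 (rest A p')).
under [leqRHS]eq_bigr do under eq_bigr do under eq_bigr do rewrite sum3_separate.
rewrite sum3_separate -!big_distrr /= !sr // !size_trees_on.
by rewrite !mulnA.
Qed.

Lemma spinal_recursion_nat A s (P : pred ({set T} * {set T})) : s \notin A -> 0 < #|A| ->
  (forall p, P p -> spinal_parts A p) ->
  4 * \sum_(p | P p) \sum_(p' | P p')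
   (num_trees #|p.2| * num_trees #|rest A p|.+1 * (num_trees #|p'.2| * num_trees #|rest A p'|.+1) *
     \sum_(l <- trees_on (s |: p.1)) \sum_(l' <- trees_on (s |: p'.1))
       agreement (p.1 :&: p'.1) [set s] (clusters l) (clusters l') +
    num_trees #|p.1|.+1 * num_trees #|rest A p|.+1 * (num_trees #|p'.1|.+1 * num_trees #|rest A p'|.+1) *
     \sum_(l <- trees_on p.2) \sum_(l' <- trees_on p'.2)
       agreement (p.2 :&: p'.2) set0 (clusters l) (clusters l') +
    num_trees #|p.1|.+1 * num_trees #|p.2| * (num_trees #|p'.1|.+1 * num_trees #|p'.2|) *
     \sum_(C <- trees_on (s |: rest A p)) \sum_(C' <- trees_on (s |: rest A p'))
       agreement (rest A p :&: rest A p') [set s] (clusters C) (clusters C'))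
  <= total_agreement A [set s].
Proof.
move=> sA A1 PP; rewrite /total_agreement (setUC A).
have step (g : {set {set T}} -> nat) :
   2 * \sum_(p | P p) \sum_(l <- trees_on (s |: p.1)) \sum_(r <- trees_on p.2)
    \sum_(C <- trees_on (s |: rest A p)) g (clusters (subst s (Node l r) C))
    <= \sum_(t <- trees_on (s |: A)) g (clusters t).
  rewrite (spinal_sum g sA A1) leq_mul2l /=.
  rewrite [leqLHS]big_mkcond [leqRHS]big_mkcond; apply: leq_sum => p _.
  by case: ifP => // /PP; rewrite /spinal_parts => ->.
apply: leq_trans; last first.
  apply: leq_sum => t _; exact: (step (agreement A [set s] (clusters t))).
rewrite -big_distrr /= [X in _ <= 2 * X]exchange_big /= [X in 4 * X]exchange_big /=.
rewrite (_ : 4 = 2 * 2) // -mulnA leq_mul2l /= big_distrr /=.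
apply: leq_sum => p' Pp'.
apply: leq_trans (step (fun F => \sum_(l' <- trees_on (s |: p'.1)) \sum_(r' <- trees_on p'.2)
    \sum_(C' <- trees_on (s |: rest A p')) agreement A [set s] F (clusters (subst s (Node l' r') C')))).
rewrite leq_mul2l /=; apply: leq_sum => p Pp.
have parts q : P q -> [/\ [disjoint q.1 & q.2], [disjoint q.1 & rest A q],
     [disjoint q.2 & rest A q] & A = q.1 :|: q.2 :|: rest A q].
  move=> /PP/and4P[d sub _ _]; split=> //.
  - by rewrite disjoints_subset; apply/subsetP=> x; rewrite !inE => ->.
  - by rewrite disjoints_subset; apply/subsetP=> x; rewrite !inE => ->; rewrite orbT.
  - by rewrite /rest -{1}(setID A (q.1 :|: q.2)) (setIidPr sub).
have [d12 d13 d23 AE] := parts p Pp; have [d12' d13' d23' AE'] := parts p' Pp'.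
have sr q : P q -> size (trees_on (s |: rest A q)) = num_trees #|rest A q|.+1.
  move=> Pq; rewrite size_trees_on cardsU1 inE (negbTE sA) andbF /= add1n //.
have s1 q : P q -> size (trees_on (s |: q.1)) = num_trees #|q.1|.+1.
  move=> /parts[_ _ _ qE]; rewrite size_trees_on cardsU1.
  by move: sA; rewrite qE !inE !negb_or => /andP[/andP[-> _] _].
apply: (@leq_trans (\sum_(l <- trees_on (s |: p.1)) \sum_(r <- trees_on p.2)
    \sum_(C <- trees_on (s |: rest A p)) \sum_(l' <- trees_on (s |: p'.1)) \sum_(r' <- trees_on p'.2)
    \sum_(C' <- trees_on (s |: rest A p'))
     (agreement (p.1 :&: p'.1) [set s] (clusters l) (clusters l') +
      agreement (p.2 :&: p'.2) set0 (clusters r) (clusters r') +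
      agreement (rest A p :&: rest A p') [set s] (clusters C) (clusters C')))); last first.
  rewrite big_seq [leqRHS]big_seq; apply: leq_sum => l lp.
  rewrite big_seq [leqRHS]big_seq; apply: leq_sum => r rp.
  rewrite big_seq [leqRHS]big_seq; apply: leq_sum => C Cp.
  rewrite big_seq [leqRHS]big_seq; apply: leq_sum => l' lp'.
  rewrite big_seq [leqRHS]big_seq; apply: leq_sum => r' rp'.
  rewrite big_seq [leqRHS]big_seq; apply: leq_sum => C' Cp'.
  by apply: (@agreement_spinal _ s A p.1 p.2 (rest A p) p'.1 p'.2 (rest A p')).
under [leqRHS]eq_bigr do under eq_bigr do under eq_bigr do rewrite sum3_separate.
rewrite sum3_separate -!big_distrr /= !sr // !s1 // !size_trees_on.
by rewrite !mulnA.
Qed.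

Local Open Scope ring_scope.

Section RealRecursion.
Variables (R : realFieldType) (phiF phiG : nat -> R) (A : {set T}) (s : T).
Hypothesis sA : s \notin A.
Hypothesis phiF0 : phiF 0 = 0.
Hypothesis HF : forall I, I \subset A -> (#|I| < #|A|)%N ->
  phiF #|I| * (num_trees #|I|)%:R ^+ 2 <= (total_agreement I set0)%:R.
Hypothesis HG : forall I, I \subset A -> (#|I| < #|A|)%N ->
  phiG #|I| * (num_trees #|I|.+1)%:R ^+ 2 <= (total_agreement I [set s])%:R.

(** Two pieces have only the leaves of [X :&: X'] in common, on which they
    induce independent uniform trees, so the lower bound for the smaller set
    [X :&: X'] applies. *)
Lemma restricted_boundF (X X' : {set T}) : X \subset A -> X' \subset A -> (#|X| < #|A|)%N ->
  phiF #|X :&: X'| * ((num_trees #|X|)%:R * (num_trees #|X'|)%:R) <=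
  (\sum_(l <- trees_on X) \sum_(l' <- trees_on X')
       agreement (X :&: X') set0 (clusters l) (clusters l'))%:R.
Proof.
move=> XA XA' cX; set I := X :&: X'.
have IX : I \subset X by rewrite subsetIl.
have IX' : I \subset X' by rewrite subsetIr.
have [I0|I0] := eqVneq I set0; first by rewrite I0 cards0 phiF0 mul0r ler0n.
have w0 : 0 < (num_trees #|I|)%:R ^+ 2 :> R.
  by rewrite exprn_gt0 // ltr0n num_trees_gt0 // card_gt0.
have := @sum_agreement_restrict _ I set0 X X'; rewrite setU0 => /(_ IX IX' I0) /(congr1 (fun k => k%:R : R)).
rewrite [LHS]natrM natrX !natrM => E; rewrite -(ler_pM2l w0) E.
have swap (x y z t : R) : 0 <= y -> z * x <= t -> x * (z * y) <= y * t.
  by move=> y0 zx; rewrite (_ : x * _ = y * (z * x)); [exact: ler_wpM2l|ring].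
apply: swap; first by rewrite mulr_ge0 ?ler0n.
rewrite HF ?(subset_trans IX) //.
exact: leq_ltn_trans (subset_leq_card IX) cX.
Qed.

Lemma restricted_boundG (X X' : {set T}) : X \subset A -> X' \subset A -> (#|X| < #|A|)%N ->
  phiG #|X :&: X'| * ((num_trees #|X|.+1)%:R * (num_trees #|X'|.+1)%:R) <=
  (\sum_(l <- trees_on (s |: X)) \sum_(l' <- trees_on (s |: X'))
       agreement (X :&: X') [set s] (clusters l) (clusters l'))%:R.
Proof.
move=> XA XA' cX; set I := X :&: X'.
have IX : I :|: [set s] \subset s |: X by rewrite setUC setUS // subsetIl.
have IX' : I :|: [set s] \subset s |: X' by rewrite setUC setUS // subsetIr.
have cs (Y : {set T}) : Y \subset A -> #|s |: Y| = #|Y|.+1.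
  by move=> YA; rewrite cardsU1 (contra (subsetP YA s) sA).
have IA : I \subset A by apply: subset_trans XA; rewrite subsetIl.
have w0 : 0 < (num_trees #|I|.+1)%:R ^+ 2 :> R.
  by rewrite exprn_gt0 // ltr0n num_trees_gt0.
have I0 : I :|: [set s] != set0 by apply/set0Pn; exists s; rewrite !inE eqxx orbT.
have := sum_agreement_restrict IX IX' I0 => /(congr1 (fun k => k%:R : R)).
rewrite (setUC I) !cs // [LHS]natrM natrX !natrM => E.
rewrite -(ler_pM2l w0) E.
have swap (x y z t : R) : 0 <= y -> z * x <= t -> x * (z * y) <= y * t.
  by move=> y0 zx; rewrite (_ : x * _ = y * (z * x)); [exact: ler_wpM2l|ring].
apply: swap; first by rewrite mulr_ge0 ?ler0n.
rewrite HG //.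
by apply: leq_ltn_trans (subset_leq_card _) cX; rewrite subsetIl.
Qed.

(** The number of trees that are cut into the parts [p]; [weightG] is its
    analogue for trees with two roots. *)
Definition weightF (p : {set T} * {set T}) : R :=
  (num_trees #|p.1|)%:R * (num_trees #|p.2|)%:R * (num_trees #|rest A p|.+1)%:R.

Definition weightG (p : {set T} * {set T}) : R :=
  (num_trees #|p.1|.+1)%:R * (num_trees #|p.2|)%:R * (num_trees #|rest A p|.+1)%:R.

(** If [phiF] and [phiG] are lower bounds for the expected agreement of trees
    with one and two roots and fewer leaves, then the average of their sums
    over two independent random decompositions is one for the set [A]. The two
    outer branches have one root, the centroid, and the context has two. *)
Lemma central_recursion (P : pred ({set T} * {set T})) : (1 < #|A|)%N ->
  (forall p, P p -> central_parts A p && (#|p.1| < #|p.2|)%N) ->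
  4 * \sum_(p | P p) \sum_(p' | P p') weightF p * weightF p' *
   (phiF #|p.1 :&: p'.1| + phiF #|p.2 :&: p'.2| + phiG #|rest A p :&: rest A p'|)
  <= (total_agreement A set0)%:R.
Proof.
move=> A1 PP; have := central_recursion_nat sA A1 PP; rewrite -(ler_nat R).
apply: le_trans; rewrite natrM ler_pM2l // !natr_sum.
have parts q : P q -> [/\ q.1 \subset A, q.2 \subset A, rest A q \subset A
    & [/\ #|q.1| < #|A|, #|q.2| < #|A| & #|rest A q| < #|A|]%N].
  move=> /PP/andP[/and5P[d + c1 c2 c3] _]; rewrite subUset => /andP[q1 q2]; split=> //.
    exact: subsetDl.
  have : (#|A :&: (q.1 :|: q.2)| + #|rest A q| = #|A|)%N by rewrite cardsID.
  by rewrite (setIidPr _) ?subUset ?q1 // => cE; split; lia.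
apply: ler_sum => p /parts[p1 p2 p3 [c1 c2 c3]].
rewrite natr_sum; apply: ler_sum => p' /parts[p1' p2' p3' _].
rewrite !natrD ![(_ * \sum_(_ <- _) _)%:R]natrM !mulrDr.
apply: lerD; first apply: lerD.
- apply: le_trans (ler_wpM2l _ (restricted_boundF p1 p1' c1)); last by rewrite ler0n.
  by rewrite !natrM /weightF -subr_ge0 le_eqVlt; apply/orP; left; apply/eqP; ring.
- apply: le_trans (ler_wpM2l _ (restricted_boundF p2 p2' c2)); last by rewrite ler0n.
  by rewrite !natrM /weightF -subr_ge0 le_eqVlt; apply/orP; left; apply/eqP; ring.
- apply: le_trans (ler_wpM2l _ (restricted_boundG p3 p3' c3)); last by rewrite ler0n.
  by rewrite !natrM /weightF -subr_ge0 le_eqVlt; apply/orP; left; apply/eqP; ring.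
Qed.

(** As [central_recursion]. Here the branch between the cut and the second
    root and the context between the root and the cut have two roots, the
    branch at the side of the spine has one. *)
Lemma spinal_recursion (P : pred ({set T} * {set T})) : (0 < #|A|)%N ->
  (forall p, P p -> spinal_parts A p && (#|p.2| < #|A|)%N) ->
  4 * \sum_(p | P p) \sum_(p' | P p') weightG p * weightG p' *
   (phiG #|p.1 :&: p'.1| + phiF #|p.2 :&: p'.2| + phiG #|rest A p :&: rest A p'|)
  <= (total_agreement A [set s])%:R.
Proof.
move=> A1 PP; have PP1 p : P p -> spinal_parts A p by move=> /PP/andP[].
have := spinal_recursion_nat sA A1 PP1; rewrite -(ler_nat R).
apply: le_trans; rewrite natrM ler_pM2l // !natr_sum.
have parts q : P q -> [/\ q.1 \subset A, q.2 \subset A, rest A q \subset A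
    & [/\ #|q.1| < #|A|, #|q.2| < #|A| & #|rest A q| < #|A|]%N].
  move=> /PP/andP[/and4P[d + c1 c3] c2]; rewrite subUset => /andP[q1 q2]; split=> //.
    exact: subsetDl.
  have : (#|A :&: (q.1 :|: q.2)| + #|rest A q| = #|A|)%N by rewrite cardsID.
  by rewrite (setIidPr _) ?subUset ?q1 // => cE; split; lia.
apply: ler_sum => p /parts[p1 p2 p3 [c1 c2 c3]].
rewrite natr_sum; apply: ler_sum => p' /parts[p1' p2' p3' _].
rewrite !natrD ![(_ * \sum_(_ <- _) _)%:R]natrM !mulrDr.
apply: lerD; first apply: lerD.
- apply: le_trans (ler_wpM2l _ (restricted_boundG p1 p1' c1)); last by rewrite ler0n.
  by rewrite !natrM /weightG -subr_ge0 le_eqVlt; apply/orP; left; apply/eqP; ring.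
- apply: le_trans (ler_wpM2l _ (restricted_boundF p2 p2' c2)); last by rewrite ler0n.
  by rewrite !natrM /weightG -subr_ge0 le_eqVlt; apply/orP; left; apply/eqP; ring.
- apply: le_trans (ler_wpM2l _ (restricted_boundG p3 p3' c3)); last by rewrite ler0n.
  by rewrite !natrM /weightG -subr_ge0 le_eqVlt; apply/orP; left; apply/eqP; ring.
Qed.

End RealRecursion.

End Recursion.

Local Open Scope ring_scope.

(** * Second moments of hypergeometric variables *)

Section Exchangeable.
Variables (T : finType) (R : realFieldType) (A : {set T}).
Variables (J : finType) (act : {perm T} -> J -> J) (X : J -> {set T}).
Hypothesis act_inj : forall pi, injective (act pi).
Hypothesis actX : forall (pi : {perm T}) j, [set pi x | x in A] = A -> X (act pi j) = [set pi x | x in X j].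

(** Weights on decompositions that are invariant under the permutations of the
    ground set [A]. Under such weights [X] is a random subset of [A] that is
    uniform given its size, so that its intersection with a fixed set is
    hypergeometric. *)
Definition exchangeable (w : J -> R) :=
  forall (pi : {perm T}) j, [set pi x | x in A] = A -> w (act pi j) = w j.

Hypothesis A1 : (1 < #|A|)%N.

Let n := #|A|%:R : R.
Let n0 : 0 < n. Proof. by rewrite ltr0n; lia. Qed.

Lemma tperm_imset (a b : T) : a \in A -> b \in A -> [set tperm a b x | x in A] = A.
Proof.
move=> aA bA; apply/setP=> x; apply/imsetP/idP => [[y yA ->]|xA].
  by case: tpermP => // ->.
by exists (tperm a b x); rewrite ?tpermK //; case: tpermP.
Qed.

Lemma sum_mem (B : {set T}) : #|B|%:R = \sum_(a : T) (a \in B)%:R :> R.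
Proof.
by rewrite -sum1_card natr_sum big_mkcond; apply: eq_bigr => a _; case: (a \in B).
Qed.

Lemma exchange_act (w : J -> R) (pi : {perm T}) (f : {set T} -> R) : exchangeable w ->
  [set pi x | x in A] = A ->
  \sum_j w j * f (X j) = \sum_j w j * f [set pi x | x in X j].
Proof.
move=> we piA; rewrite (reindex_inj (@act_inj pi)).
by apply: eq_bigr => j _; rewrite we // actX.
Qed.

Lemma mem_act (pi : {perm T}) (B : {set T}) x : (pi x \in [set pi y | y in B]) = (x \in B).
Proof. by rewrite mem_imset //; exact: perm_inj. Qed.

(** The permutations of [A] act transitively on its points. *)
Lemma first_moment (w : J -> R) a : exchangeable w -> (forall j, w j != 0 -> X j \subset A) ->
  a \in A -> \sum_j w j * (a \in X j)%:R = (\sum_j w j * #|X j|%:R) / n.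
Proof.
move=> we wA aA; apply: (canRL (mulfK (lt0r_neq0 n0))).
under [RHS]eq_bigr do rewrite sum_mem mulr_sumr.
rewrite [RHS]exchange_big /= [RHS](bigID (mem A)) /= [X in _ = _ + X]big1 ?addr0; last first.
  move=> b bA; apply: big1 => j _; have [->|wj] := eqVneq (w j) 0; first by rewrite mul0r.
  by rewrite (negbTE (contra (subsetP (wA j wj) b) bA)) mulr0.
rewrite [RHS](eq_bigr (fun=> \sum_j w j * (a \in X j)%:R)); last first.
  move=> b bA; rewrite (exchange_act (fun B => (b \in B)%:R) we (tperm_imset aA bA)).
  by apply: eq_bigr => j _; rewrite -{1}(tpermL a b) mem_act.
by rewrite sumr_const -mulr_natr.
Qed.

(** The permutations of [A] act transitively on its pairs of distinct points.
    *)
Lemma second_moment (w : J -> R) a b : exchangeable w -> (forall j, w j != 0 -> X j \subset A) ->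
  a \in A -> b \in A -> a != b ->
  \sum_j w j * ((a \in X j) && (b \in X j))%:R =
  (\sum_j w j * (#|X j|%:R * (#|X j|%:R - 1))) / (n * (n - 1)).
Proof.
move=> we wA aA bA ab.
have n1 : 0 < n - 1 by rewrite subr_gt0 ltr1n.
apply: (canRL (mulfK _)); first by rewrite mulf_neq0 ?gt_eqF.
have E (B : {set T}) : #|B|%:R * (#|B|%:R - 1) =
    \sum_(c : T) \sum_(d : T | d != c) ((c \in B) && (d \in B))%:R :> R.
  rewrite {1}sum_mem mulr_suml; apply: eq_bigr => c _.
  rewrite sum_mem (bigD1 c) //=; case: (c \in B) => /=; last by rewrite mul0r big1.
  by rewrite mul1r addrAC subrr add0r.
under [RHS]eq_bigr do rewrite E mulr_sumr.
rewrite [RHS]exchange_big /= [RHS](bigID (mem A)) /= [X in _ = _ + X]big1 ?addr0; last first.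
  move=> c cA; apply: big1 => j _; have [->|wj] := eqVneq (w j) 0; first by rewrite mul0r.
  rewrite big1 ?mulr0 // => d _.
  by rewrite (negbTE (contra (subsetP (wA j wj) c) cA)).
rewrite [RHS](eq_bigr (fun=> (n - 1) * \sum_j w j * ((a \in X j) && (b \in X j))%:R)); last first.
  move=> c cA; under eq_bigr do rewrite mulr_sumr.
  rewrite exchange_big /= (bigID (mem A)) /= [X in _ + X]big1 ?addr0; last first.
    move=> d /andP[_ dA]; apply: big1 => j _; have [->|wj] := eqVneq (w j) 0; first by rewrite mul0r.
    by rewrite (negbTE (contra (subsetP (wA j wj) d) dA)) andbF mulr0.
  rewrite (eq_bigr (fun=> \sum_j w j * ((a \in X j) && (b \in X j))%:R)); last first.
    move=> d /andP[dc dA].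
    pose pi := (tperm a c * tperm (tperm a c b) d)%g.
    have tA : tperm a c b \in A by case: tpermP.
    have piA : [set pi x | x in A] = A.
      rewrite -[RHS](tperm_imset tA dA) -[in RHS](tperm_imset aA cA) -imset_comp.
      by apply: eq_imset => x; rewrite permM.
    have pia : pi a = c.
      rewrite permM tpermL tpermD // 1?eq_sym //.
      by rewrite -{1}(tpermL a c) (inj_eq perm_inj).
    have pib : pi b = d by rewrite permM tpermL.
    rewrite (exchange_act (fun B => ((c \in B) && (d \in B))%:R) we piA).
    by apply: eq_bigr => j _; rewrite -{1}pia -{1}pib !mem_act.
  rewrite sumr_const -mulr_natl; congr (_ * _).
  rewrite (eq_card (B := mem (A :\ c))); last by move=> d; rewrite !inE.
  by rewrite /n (cardsD1 c A) cA natrD addrAC subrr add0r.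
by rewrite sumr_const -mulr_natl -/n; ring.
Qed.

(** The indicators that two different points of [Y] belong to [X] are
    negatively correlated, so the variance of a hypergeometric variable is at
    most its mean. *)
Lemma variance_bound (w : J -> R) (Y : {set T}) : exchangeable w ->
  (forall j, 0 <= w j) -> (forall j, w j != 0 -> X j \subset A) -> Y \subset A ->
  \sum_j w j * (#|X j :&: Y|%:R - #|X j|%:R * #|Y|%:R / n) ^+ 2 <=
  \sum_j w j * (#|X j|%:R * #|Y|%:R / n).
Proof.
move=> we w0 wA YA.
pose y := #|Y|%:R : R.
have Iin (B : {set T}) : #|B :&: Y|%:R = \sum_(a in Y) (a \in B)%:R :> R.
  rewrite sum_mem [RHS]big_mkcond; apply: eq_bigr => a _; rewrite inE.
  by case: (a \in Y); rewrite ?andbT ?andbF.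
have M1 (v : J -> R) : exchangeable v -> (forall j, v j != 0 -> X j \subset A) ->
    \sum_j v j * #|X j :&: Y|%:R = y / n * \sum_j v j * #|X j|%:R.
  move=> ve vA; under eq_bigr do rewrite Iin mulr_sumr.
  rewrite exchange_big /= (eq_bigr (fun=> (\sum_j v j * #|X j|%:R) / n)); last first.
    by move=> a aY; rewrite first_moment // (subsetP YA).
  by rewrite sumr_const -mulr_natl mulrA mulrAC.
have n1 : 0 < n - 1 by rewrite subr_gt0 ltr1n.
have M2 : \sum_j w j * #|X j :&: Y|%:R ^+ 2 =
    y / n * (\sum_j w j * #|X j|%:R) +
    y * (y - 1) / (n * (n - 1)) * \sum_j w j * (#|X j|%:R * (#|X j|%:R - 1)).
  have E (B : {set T}) : #|B :&: Y|%:R ^+ 2 = #|B :&: Y|%:R +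
      \sum_(a in Y) \sum_(b in Y | b != a) ((a \in B) && (b \in B))%:R :> R.
    rewrite expr2 {1}Iin mulr_suml [X in X + _]Iin -big_split /=; apply: eq_bigr => a aY.
    rewrite Iin (bigD1 a) //=; case: (a \in B) => /=; last by rewrite mul0r big1 ?add0r.
    by rewrite mul1r.
  under eq_bigr do rewrite E mulrDr.
  rewrite big_split /= M1 //; congr (_ + _).
  under eq_bigr do rewrite mulr_sumr.
  rewrite exchange_big /=.
  rewrite (eq_bigr (fun=> (y - 1) * ((\sum_j w j * (#|X j|%:R * (#|X j|%:R - 1))) / (n * (n - 1))))); last first.
    move=> a aY; under eq_bigr do rewrite mulr_sumr.
    rewrite exchange_big /=.
    rewrite (eq_bigr (fun=> (\sum_j w j * (#|X j|%:R * (#|X j|%:R - 1))) / (n * (n - 1)))); last first.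
      by move=> b /andP[bY ba]; rewrite second_moment ?(subsetP YA) // eq_sym.
    rewrite sumr_const -mulr_natl; congr (_ * _).
    rewrite (eq_card (B := mem (Y :\ a))); last by move=> d; rewrite !inE andbC.
    by rewrite /y (cardsD1 a Y) aY natrD addrAC subrr add0r.
  rewrite sumr_const -mulr_natl -/y; set S := \sum_j _; field.
  by rewrite !gt_eqF.
have we1 : exchangeable (fun j => w j * #|X j|%:R).
  by move=> pi j piA; rewrite we // actX // card_imset //; exact: perm_inj.
have wA1 j : w j * #|X j|%:R != 0 -> X j \subset A.
  by move=> h; apply: wA; apply: contraNneq h => ->; rewrite mul0r.
have M3 := M1 _ we1 wA1.
pose S1 := \sum_j w j * #|X j|%:R.
pose S2 := \sum_j w j * #|X j|%:R * #|X j|%:R.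
have -> : \sum_j w j * (#|X j :&: Y|%:R - #|X j|%:R * #|Y|%:R / n) ^+ 2 =
   \sum_j w j * #|X j :&: Y|%:R ^+ 2 - 2 * (y / n) * (\sum_j w j * #|X j|%:R * #|X j :&: Y|%:R)
   + (y / n) ^+ 2 * S2.
  rewrite /S2 !mulr_sumr -sumrB -big_split /=; apply: eq_bigr => j _; rewrite -/y; ring.
have -> : \sum_j w j * (#|X j|%:R * #|Y|%:R / n) = y / n * S1.
  by rewrite /S1 mulr_sumr; apply: eq_bigr => j _; rewrite -/y; ring.
rewrite M2 M3 -/S1 -/S2.
have -> : \sum_j w j * (#|X j|%:R * (#|X j|%:R - 1)) = S2 - S1.
  by rewrite /S1 /S2 -sumrB; apply: eq_bigr => j _; ring.
have S12 : S1 <= S2.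
  apply: ler_sum => j _; rewrite -mulrA ler_wpM2l // -natrM ler_nat.
  by case: #|X j| => // k; rewrite leq_pmull.
have S10 : 0 <= S1 by apply: sumr_ge0 => j _; rewrite mulr_ge0.
have S2n : S2 <= n * S1.
  rewrite /S1 mulr_sumr; apply: ler_sum => j _.
  have [->|wj] := eqVneq (w j) 0; first by rewrite !mul0r mulr0.
  rewrite mulrC ler_wpM2r ?mulr_ge0 //.
  by rewrite ler_nat subset_leq_card // wA.
have y0 : 0 <= y by rewrite ler0n.
have yn : y <= n by rewrite ler_nat subset_leq_card.
have y1 : y * (y - 1) >= 0.
  rewrite /y; case: #|Y| => [|k]; first by rewrite mul0r.
  by rewrite mulr_ge0 // subr_ge0 ler1n.
rewrite -subr_ge0.
have -> : y / n * S1 - (y / n * S1 + y * (y - 1) / (n * (n - 1)) * (S2 - S1) -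
     2 * (y / n) * (y / n * S2) + (y / n) ^+ 2 * S2) =
   (y / (n ^+ 2 * (n - 1))) * ((n - y) * S2 + n * (y - 1) * S1).
  by field; rewrite !gt_eqF.
have [->|Y0] := eqVneq y 0; first by rewrite !mul0r.
have y1' : 1 <= y.
  by rewrite /y ler1n lt0n -(eqr_nat R).
apply: mulr_ge0; first by rewrite divr_ge0 // mulr_ge0 ?exprn_ge0 // ltW.
apply: addr_ge0; first by rewrite mulr_ge0 ?subr_ge0 // (le_trans S10).
by rewrite !mulr_ge0 ?subr_ge0 // ltW.
Qed.

(** If [f] is bounded below by a concave parabola whose top lies at the mean
    [mu], only the variance is needed to bound the expectation of [f] from
    below. The height [M] of the parabola may depend on the size of [X]:
    multiplying the weights by a function of that size keeps them
    exchangeable, which reduces the claim to [variance_bound] for other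
    weights. *)
Lemma concentration (w M : J -> R) (Y : {set T}) (f : nat -> R) (d mu0 : R) :
  exchangeable w -> exchangeable M ->
  (forall j, 0 <= w j) -> (forall j, 0 <= M j) -> (forall j, w j != 0 -> X j \subset A) ->
  Y \subset A -> 0 < d -> 0 < mu0 ->
  (forall j, w j != 0 -> mu0 <= #|X j|%:R * #|Y|%:R / n) ->
  (forall j, w j != 0 -> let mu := #|X j|%:R * #|Y|%:R / n in
     M j * (1 - d - (#|X j :&: Y|%:R / mu - 1) ^+ 2 / d) <= f #|X j :&: Y|) ->
  (1 - d - (d * mu0)^-1) * \sum_j w j * M j <= \sum_j w j * f #|X j :&: Y|.
Proof.
move=> we Me w0 M0 wA YA d0 mu0p mule fle.
pose mu j := #|X j|%:R * #|Y|%:R / n : R.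
have muact (pi : {perm T}) j : [set pi x | x in A] = A -> mu (act pi j) = mu j.
  by move=> piA; rewrite /mu actX // card_imset //; exact: perm_inj.
have mup j : w j != 0 -> 0 < mu j by move=> /mule; apply: lt_le_trans.
pose v j := w j * (M j / (d * mu j ^+ 2)).
have v0 j : 0 <= v j.
  by rewrite mulr_ge0 // divr_ge0 // mulr_ge0 ?sqr_ge0 // ltW.
have ve : exchangeable v by move=> pi j piA; rewrite /v we // Me // muact.
have vA j : v j != 0 -> X j \subset A.
  by move=> h; apply: wA; apply: contraNneq h => h; rewrite /v h mul0r.
have := variance_bound ve v0 vA YA; rewrite -/mu => var.
apply: (@le_trans _ _ (\sum_j w j * M j * (1 - d) - \sum_j v j * (#|X j :&: Y|%:R - mu j) ^+ 2)); last first.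
  rewrite -sumrB; apply: ler_sum => j _.
  have [wj|wj] := eqVneq (w j) 0; first by rewrite /v wj !mul0r subr0.
  have mj := mup j wj.
  apply: le_trans (ler_wpM2l (w0 j) (fle j wj)); rewrite le_eqVlt; apply/orP; left; apply/eqP.
  by rewrite /v -/(mu j); field; rewrite !gt_eqF.
apply: le_trans (lerB (lexx _) var).
rewrite mulr_sumr -sumrB; apply: ler_sum => j _.
have [wj|wj] := eqVneq (w j) 0; first by rewrite /v wj !mul0r mulr0 subr0.
have mj := mup j wj.
rewrite -/(mu j).
have -> : v j * mu j = w j * M j * (d * mu j)^-1 by rewrite /v; field; rewrite !gt_eqF.
rewrite -mulrBr mulrC ler_wpM2l ?mulr_ge0 // lerD2l lerN2.
rewrite lef_pV2 ?posrE; [|exact: mulr_gt0|exact: mulr_gt0].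
by rewrite ler_pM2l // mule.
Qed.

End Exchangeable.

Section SumSubsets.
Variables (T : finType) (R : realFieldType).

Lemma sum_subsets (B : {set T}) (h : nat -> R) :
  \sum_(X : {set T} | X \subset B) h #|X| = \sum_(k < #|B|.+1) 'C(#|B|, k)%:R * h k.
Proof.
rewrite (partition_big (fun X : {set T} => inord #|X| : 'I_#|B|.+1) predT) //=.
apply: eq_bigr => k _.
rewrite (eq_bigl (fun Y => Y \in [set X : {set T} | (X \subset B) && (#|X| == k)])); last first.
  move=> X; rewrite !inE; case: (boolP (X \subset B)) => //= XB.
  by rewrite -val_eqE /= inordK // ltnS subset_leq_card.
rewrite (eq_bigr (fun=> h k)); last by move=> X; rewrite inE => /andP[_ /eqP->].
by rewrite sumr_const cards_draws mulr_natl.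
Qed.

Lemma sum_parts (A : {set T}) (h : nat -> nat -> R) :
  \sum_(p : {set T} * {set T} | [disjoint p.1 & p.2] && (p.1 :|: p.2 \subset A)) h #|p.1| #|p.2| =
  \sum_(k < #|A|.+1) 'C(#|A|, k)%:R * \sum_(l < (#|A| - k).+1) 'C(#|A| - k, l)%:R * h k l.
Proof.
rewrite -(sum_subsets A (fun k => \sum_(l < (#|A| - k).+1) 'C(#|A| - k, l)%:R * h k l)).
rewrite (eq_bigl (fun p : {set T} * {set T} => (p.1 \subset A) && (p.2 \subset A :\: p.1))); last first.
  move=> p; rewrite subUset subsetD disjoint_sym.
  by case: (p.1 \subset A); case: (p.2 \subset A); rewrite ?andbF ?andbT.
rewrite -(pair_big_dep (fun X : {set T} => X \subset A) (fun X Y : {set T} => Y \subset A :\: X) (fun X Y => h #|X| #|Y|)) /=.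
apply: eq_bigr => X XA.
rewrite (sum_subsets (A :\: X) (h #|X|)).
by rewrite cardsD (setIidPr XA).
Qed.

End SumSubsets.

From mathcomp Require Import all_classical all_reals all_analysis.
From mathcomp Require Import measurable_realfun.

Import numFieldNormedType.Exports.

(** * Sums over lattice points and integrals over the plane *)

Section Plane.
Local Open Scope classical_set_scope.
Local Open Scope ring_scope.
Variable R : realType.
Local Notation line := (measurableTypeR R).
Local Notation plane := (line * line)%type.
Local Notation mu := (@lebesgue_measure R \x @lebesgue_measure R)%E.

(** By Fubini, since all vertical sections are null sets. *)
Lemma null_graph (A : set plane) : measurable A ->
  (forall x, exists y, xsection A x `<=` [set y]) -> mu A = 0%E.
Proof.
move=> mA sec; rewrite /product_measure1; apply: integral0_eq => x _ /=.
have [y Ay] := sec x.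
apply/eqP; rewrite eq_le measure_ge0 andbT -(lebesgue_measure_set1 y).
by apply: le_measure => //; rewrite inE //; exact: measurable_xsection.
Qed.

Let measurable_eq (f g : plane -> R) :
  measurable_fun setT f -> measurable_fun setT g -> measurable [set x | f x = g x].
Proof.
move=> mf mg; rewrite (_ : [set x | f x = g x] = [set x | f x <= g x] `&` [set x | g x <= f x]).
  by apply: measurableI; rewrite -[X in measurable X]setTI; exact: measurable_fun_le.
apply/seteqP; split => x /= => [->//|[h1 h2]].
by apply/eqP; rewrite eq_le h1.
Qed.

Let mproj1 : measurable_fun [set: plane] (fun z => z.1 : R). Proof. exact: measurable_fst. Qed.
Let mproj2 : measurable_fun [set: plane] (fun z => z.2 : R). Proof. exact: measurable_snd. Qed.

Lemma negligible_vertical (c : R) : mu.-negligible [set z : plane | z.1 = c].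
Proof.
exists [set z : plane | z.1 = c]; split => //; first exact: measurable_eq.
rewrite (_ : [set _ | _] = [set c] `*` setT); last first.
  by apply/seteqP; split => z //= [].
have mc : measurable ([set c] : set line) by exact: measurable_set1.
by rewrite product_measure1E //= lebesgue_measure_set1 mul0e.
Qed.

Lemma negligible_horizontal (c : R) : mu.-negligible [set z : plane | z.2 = c].
Proof.
exists [set z : plane | z.2 = c]; split => //; first exact: measurable_eq.
rewrite (_ : [set _ | _] = setT `*` [set c]); last first.
  by apply/seteqP; split => z //= [].
have mc : measurable ([set c] : set line) by exact: measurable_set1.
by rewrite product_measure1E //= lebesgue_measure_set1 mule0.
Qed.

Lemma negligible_diagonal : mu.-negligible [set z : plane | z.1 = z.2 :> R].
Proof.
exists [set z : plane | z.1 = z.2 :> R]; split => //; first exact: measurable_eq.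
apply: null_graph; first exact: measurable_eq.
by move=> x; exists x => y; rewrite /xsection /= inE /= => ->.
Qed.

Lemma negligible_antidiagonal (c : R) : mu.-negligible [set z : plane | z.1 + z.2 = c :> R].
Proof.
have m12 : measurable [set z : plane | z.1 + z.2 = c :> R].
  by apply: measurable_eq => //; exact: measurable_funD.
exists [set z : plane | z.1 + z.2 = c :> R]; split => //.
apply: null_graph => // x; exists (c - x) => y.
by rewrite /xsection /= inE /= => <-; rewrite addrC addKr.
Qed.

(** ** An integrable singularity *)

(* [u ^+ 4] = 2, so that [u ^+ (3 * j)] is the value of t^(-3/4) at t =
   2^(-j). *)
Let u : R := Num.sqrt (Num.sqrt 2).

Let u4 : u ^+ 4 = 2.
Proof. by rewrite (_ : 4 = 2 * 2)%N // exprM !sqr_sqrtr ?sqrtr_ge0. Qed.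

Let u0 : 0 < u. Proof. by rewrite !sqrtr_gt0. Qed.

Let u1 : 1 < u.
Proof. by rewrite -(@ltr_pXn2r _ 4) ?nnegrE ?ltW // u4 expr1n ltr1n. Qed.

Let box (c : R) (j : nat) : set line := `[c - 2 * 2^-1 ^+ j, c + 2 * 2^-1 ^+ j]%classic.

(** A majorant of |x - c|^(-3/4) near c, up to a factor, as a sum of step
    functions. The exponent -3/4 is integrable, and being a sum over dyadic
    scales the function is easily integrated term by term. *)
Definition spike (c : R) (x : line) : \bar R :=
  (\sum_(0 <= j <oo) (u ^+ (3 * j.+1) * \1_(box c j) x)%:E)%E.

Let measurable_box c j : measurable (box c j : set line).
Proof. exact: measurable_itv. Qed.

Let term_ge0 c j x : (0 <= (u ^+ (3 * j.+1) * \1_(box c j) x)%:E)%E.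
Proof. by rewrite lee_fin mulr_ge0 ?exprn_ge0 ?(ltW u0) // indicE. Qed.

Let measurable_term c j :
  measurable_fun [set: line] (fun x => (u ^+ (3 * j.+1) * \1_(box c j) x)%:E).
Proof.
by apply/measurable_EFinP; apply: measurable_funM.
Qed.

Lemma measurable_spike c : measurable_fun [set: line] (spike c).
Proof. by apply: ge0_emeasurable_sum => *; [exact: term_ge0|exact: measurable_term]. Qed.

Lemma spike_ge0 c x : (0 <= spike c x)%E.
Proof. by apply: nneseries_ge0 => j _ _; exact: term_ge0. Qed.

(** The integrals of the terms form a geometric sequence of ratio 1 / [u]. *)
Lemma integral_spike c : (\int[@lebesgue_measure R]_x spike c x < +oo)%E.
Proof.
rewrite integral_nneseries //=.
have E j : (\int[@lebesgue_measure R]_x (u ^+ (3 * j.+1) * \1_(box c j) x)%:E =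
    (geometric (4 * u ^+ 3) u^-1 j)%:E)%E.
  under eq_integral do rewrite EFinM.
  rewrite ge0_integralZl_EFin //; last 2 first.
  - by apply/measurable_EFinP.
  - by rewrite exprn_ge0 // ltW.
  rewrite integral_indic // setIT.
  rewrite -[X in (_ * X)%E]/(@lebesgue_measure R (box c j)) /box lebesgue_measure_itv /=.
  have b0 : 0 < 2 * 2^-1 ^+ j :> R by rewrite mulr_gt0 // exprn_gt0 // invr_gt0.
  rewrite lte_fin ifT; last by lra.
  rewrite -EFinB -EFinM; congr EFin.
  rewrite /geometric /=.
  have -> : 2^-1 ^+ j = u^-1 ^+ (4 * j) :> R by rewrite exprM [u^-1 ^+ 4]exprVn u4.
  rewrite mulnS exprD; have -> : u^-1 ^+ (4 * j) = u ^- (3 * j) * u^-1 ^+ j.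
    by rewrite -!exprVn -exprD; congr (_ ^+ _); lia.
  by field; rewrite expf_neq0 // gt_eqF.
under eq_eseriesr do rewrite E.
have ul : `|u^-1| < 1.
  by rewrite ger0_norm ?invr_ge0 ?ltW // invf_lt1.
have := cvg_geometric_series ul => /(_ (4 * u ^+ 3)) cv.
have -> : (\sum_(0 <= j <oo) (geometric (4 * u ^+ 3) u^-1 j)%:E)%E = (4 * u ^+ 3 / (1 - u^-1))%:E.
  apply/cvg_lim => //.
  under eq_fun do rewrite sumEFin.
  by apply/cvg_EFin; [exact: nearW|exact: cv].
exact: ltry.
Qed.

(** The boxes of all dyadic scales above r contain x, and the last of them
    contributes at least r^(-3/4), which by hypothesis is at least e. *)
Lemma le_spike c (x r e : R) : 0 < r -> r <= 1 -> `|x - c| <= 2 * r -> 0 <= e ->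
  e ^+ 4 * r ^+ 3 <= 1 -> (e%:E <= spike c x)%E.
Proof.
move=> r0 r1 xr e0 er.
have ex : exists j, 2^-1 ^+ j.+1 < r.
  have := @cvg_geometric R 1 2^-1; rewrite ger0_norm ?invr_ge0 // invf_lt1 // => /(_ (ltr1n _ _)).
  move=> /cvgrPdist_lt/(_ r r0)[N _ /(_ N.+1)]; rewrite /= => /(_ (leqnSn N)).
  rewrite sub0r normrN /geometric /= mul1r ger0_norm; last by rewrite exprn_ge0.
  by exists N.
have [j jr min] := ex_minnP ex.
have rj : r <= 2^-1 ^+ j.
  case: j jr min => [|j] jr min; first by rewrite expr0.
  by rewrite leNgt; apply/negP => /min; rewrite ltnn.
apply: (@le_trans _ _ (u ^+ (3 * j.+1) * \1_(box c j) x)%:E).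
  rewrite indicE mem_set ?mulr1; last first.
    rewrite /box /= in_itv /=; move: xr; rewrite ler_norml => /andP[a b].
    by apply/andP; split; lra.
  rewrite lee_fin -(@ler_pXn2r _ 4) ?nnegrE ?exprn_ge0 ?(ltW u0) //.
  rewrite exprAC exprM u4 -(ler_pM2r (exprn_gt0 3 r0)); apply: le_trans er _.
  rewrite -exprAC -exprMn -[leLHS](expr1n _ 3) ler_pXn2r ?nnegrE ?mulr_ge0 ?exprn_ge0 ?(ltW r0) //.
  have := ler_wpM2l (exprn_ge0 j.+1 (ler0n R 2)) (ltW jr).
  by rewrite -exprMn mulfV // expr1n.
rewrite /spike.
have := @nneseries_lim_ge R (fun j => (u ^+ (3 * j.+1) * \1_(box c j) x)%:E) xpredT 0 j.+1.
move=> /(_ (fun j _ _ => term_ge0 c j x)); apply: le_trans.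
by rewrite big_nat_recr //= leeDr // sume_ge0.
Qed.

Definition spikes (x : line) : \bar R := (spike 0 x + spike 2^-1 x)%E.

Lemma spikes_ge0 x : (0 <= spikes x)%E.
Proof. by rewrite adde_ge0 ?spike_ge0. Qed.

Lemma measurable_spikes : measurable_fun [set: line] spikes.
Proof. by apply: emeasurable_funD; exact: measurable_spike. Qed.

(** The densities of the splits grow like d^(-3/2) where the relative size d
    of one piece is small. In the region of the splits both coordinates are
    then within d of special values, 0 or 1/2. So the singularity can be
    shared equally by the two coordinates, and a product of integrable
    functions dominates. *)
Definition singularity (C : R) (z : plane) : \bar R := (C%:E * (spikes z.1 * spikes z.2))%E.

Lemma integrable_singularity C : 0 <= C -> mu.-integrable setT (singularity C).
Proof.
move=> C0.
have m1 : measurable_fun [set: plane] (fun z => spikes z.1).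
  by apply: measurableT_comp measurable_spikes _; exact: measurable_fst.
have m2 : measurable_fun [set: plane] (fun z => spikes z.2).
  by apply: measurableT_comp measurable_spikes _; exact: measurable_snd.
have m12 : measurable_fun [set: plane] (fun z => spikes z.1 * spikes z.2)%E.
  exact: emeasurable_funM.
have s0 z : (0 <= spikes z.1 * spikes z.2)%E by rewrite mule_ge0 ?spikes_ge0.
apply/integrableP; split; first exact: emeasurable_funM.
under eq_integral do rewrite gee0_abs ?mule_ge0 ?spikes_ge0 ?lee_fin //.
rewrite ge0_integralZl_EFin //.
rewrite lte_mul_pinfty ?lee_fin //.
rewrite fubini_tonelli1 //= /fubini_F.
under eq_integral.
  move=> x _; rewrite /= ge0_integralZl ?spikes_ge0 //; last 2 first.
  - exact: measurable_spikes.
  - by move=> y _; exact: spikes_ge0.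
  over.
have I0 : (0 <= \int[@lebesgue_measure R]_x spikes x)%E.
  by apply: integral_ge0 => x _; exact: spikes_ge0.
rewrite ge0_integralZr ?I0 //; last 2 first.
- exact: measurable_spikes.
- by move=> y _; exact: spikes_ge0.
have : (\int[@lebesgue_measure R]_x spikes x < +oo)%E.
  rewrite ge0_integralD //; last 4 first.
  - by move=> x _; exact: spike_ge0.
  - exact: measurable_spike.
  - by move=> x _; exact: spike_ge0.
  - exact: measurable_spike.
  by rewrite lte_add_pinfty // integral_spike.
move=> Ioo; rewrite lte_mul_pinfty // ge0_fin_numE //.
Qed.

(** ** Step functions *)

Definition cell (n k : nat) : set line := `[k%:R / n%:R, k.+1%:R / n%:R[%classic.

Let measurable_cell n k : measurable (cell n k).
Proof. exact: measurable_itv. Qed.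

Definition step (n : nat) (a : nat -> nat -> R) (z : plane) : R :=
  \sum_(k < n.+1) \sum_(l < n.+1) a k l * \1_(cell n k `*` cell n l) z.

Lemma in_cell n k (x : line) : (0 < n)%N -> (x \in cell n k) = (0 <= x) && (Num.trunc (n%:R * x) == k).
Proof.
move=> n0; have n0' : 0 < n%:R :> R by rewrite ltr0n.
have -> : x \in cell n k = (k%:R <= n%:R * x < k.+1%:R).
  rewrite mem_setE in_itv /= ler_pdivrMr // ltr_pdivlMr // ![x * _]mulrC //.
have [x0|x0] := leP 0 x; first by rewrite truncn_eq // mulr_ge0.
rewrite /=; apply/negbTE/negP => /andP[kx _].
have : n%:R * x < 0 by rewrite pmulr_rlt0.
by rewrite ltNge (le_trans _ kx).
Qed.

Lemma stepE n (a : nat -> nat -> R) (z : plane) : (0 < n)%N ->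
  (forall k l, (n < k)%N || (n < l)%N -> a k l = 0) ->
  step n a z = if (0 <= z.1) && (0 <= z.2) then a (Num.trunc (n%:R * z.1)) (Num.trunc (n%:R * z.2)) else 0.
Proof.
move=> n0 a0; rewrite /step.
have I k l : \1_(cell n k `*` cell n l) z = ((0 <= z.1) && (0 <= z.2) &&
    ((Num.trunc (n%:R * z.1) == k) && (Num.trunc (n%:R * z.2) == l)))%:R :> R.
  by rewrite indicE in_setX !in_cell // andbACA.
under eq_bigr do under eq_bigr do rewrite I.
case: ((0 <= z.1) && (0 <= z.2)) => /=; last first.
  by rewrite big1 // => k _; rewrite big1 // => l _; rewrite mulr0.
set p := Num.trunc (n%:R * z.1); set q := Num.trunc (n%:R * z.2).
have [kn|kn] := ltnP n p.
  rewrite a0 ?kn // big1 // => k _; rewrite big1 // => l _.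
  by rewrite gtn_eqF ?mulr0 // (leq_trans (ltn_ord k)).
have [ln|ln] := ltnP n q.
  rewrite a0 ?ln ?orbT // big1 // => k _; rewrite big1 // => l _.
  by rewrite [q == _]gtn_eqF ?andbF ?mulr0 // (leq_trans (ltn_ord l)).
rewrite (bigD1 (Ordinal (kn : (p < n.+1)%N))) //= [X in _ + X]big1 ?addr0; last first.
  move=> k; rewrite -val_eqE /= eq_sym => /negbTE kp; rewrite big1 // => l _.
  by rewrite kp mulr0.
rewrite (bigD1 (Ordinal (ln : (q < n.+1)%N))) //= [X in _ + X]big1 ?addr0; last first.
  by move=> l; rewrite -val_eqE /= eq_sym => /negbTE lq; rewrite lq andbF mulr0.
by rewrite !eqxx mulr1.
Qed.

Let measurable_block n k l : measurable (cell n k `*` cell n l : set plane).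
Proof. exact: measurableX. Qed.

Lemma measurable_step n a : measurable_fun [set: plane] (step n a).
Proof.
apply: measurable_sum => k; apply: measurable_sum => l.
by apply: measurable_funM.
Qed.

Lemma integral_step n (a : nat -> nat -> R) : (0 < n)%N -> (forall k l, 0 <= a k l) ->
  (\int[mu]_z (step n a z)%:E = ((\sum_(k < n.+1) \sum_(l < n.+1) a k l) / n%:R ^+ 2)%:E)%E.
Proof.
move=> n0 a0; have n0' : n%:R != 0 :> R by rewrite pnatr_eq0 -lt0n.
have blk k l : (\int[mu]_z (a k l * \1_(cell n k `*` cell n l) z)%:E = (a k l / n%:R ^+ 2)%:E)%E.
  under eq_integral do rewrite EFinM.
  rewrite ge0_integralZl_EFin //; last by apply/measurable_EFinP.
  rewrite integral_indic // setIT.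
  rewrite -[X in (_ * X)%E]/(mu (cell n k `*` cell n l)) product_measure1E //.
  rewrite -[X in (_ * (X * _))%E]/(@lebesgue_measure R (cell n k)).
  rewrite -[X in (_ * (_ * X))%E]/(@lebesgue_measure R (cell n l)).
  rewrite /cell !lebesgue_measure_itv /= !lte_fin.
  rewrite !ltr_pM2r ?invr_gt0 ?ltr0n // !ltr_nat !ltnSn -!EFinB -!EFinM; congr EFin.
  by rewrite -!natr1; field.
under eq_integral do rewrite /step -sumEFin.
have mt k l : measurable_fun [set: plane] (fun z => (a k l * \1_(cell n k `*` cell n l) z)%:E).
  by apply/measurable_EFinP; apply: measurable_funM.
have t0 k l z : (0 <= (a k l * \1_(cell n k `*` cell n l) z)%:E)%E.
  by rewrite lee_fin mulr_ge0.
rewrite ge0_integral_sum //; last 2 first.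
- move=> k; apply/measurable_EFinP; apply: measurable_sum => l.
  by apply: measurable_funM.
- move=> k z _; rewrite lee_fin sumr_ge0 // => l _.
  by have := t0 k l z; rewrite lee_fin.
rewrite mulr_suml -sumEFin; apply: eq_bigr => k _.
under eq_integral do rewrite -sumEFin.
rewrite ge0_integral_sum //.
by rewrite mulr_suml -sumEFin; apply: eq_bigr => l _.
Qed.

(** The lattice sum is the integral of the step function whose value on the
    cell of (k / n, l / n) is n^2 [a n k l], and the claim is dominated
    convergence. The null set [N] is for the boundary of the region where the
    summands do not vanish. *)
Lemma lattice_sums_cvg (a : nat -> nat -> nat -> R) (f : plane -> R) (C : R) (N : set plane) :
  (forall n k l, 0 <= a n k l) ->
  (forall n k l, (n < k)%N || (n < l)%N -> a n k l = 0) ->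
  measurable_fun setT f -> 0 <= C ->
  mu.-negligible N ->
  (forall z n, (0 < n)%N -> 0 <= z.1 -> 0 <= z.2 ->
    ((n%:R ^+ 2 * a n (Num.trunc (n%:R * z.1)) (Num.trunc (n%:R * z.2)))%:E <= singularity C z)%E) ->
  (forall z, ~ N z -> 0 <= z.1 -> 0 <= z.2 ->
    n%:R ^+ 2 * a n (Num.trunc (n%:R * z.1)) (Num.trunc (n%:R * z.2)) @[n --> \oo] --> f z) ->
  (forall z, ~ N z -> (z.1 < 0) || (z.2 < 0) -> f z = 0) ->
  mu.-integrable setT (EFin \o f) /\
  (\sum_(k < n.+1) \sum_(l < n.+1) a n k l)%:E @[n --> \oo] --> (\int[mu]_z (f z)%:E)%E.
Proof.
move=> a0 aout mf C0 [A [mA A0 NA]] dom lim fout.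
pose g n (z : plane) := (step n.+1 (fun k l => n.+1%:R ^+ 2 * a n.+1 k l) z)%:E.
have gE n z : g n z = (if (0 <= z.1) && (0 <= z.2) then
    n.+1%:R ^+ 2 * a n.+1 (Num.trunc (n.+1%:R * z.1)) (Num.trunc (n.+1%:R * z.2)) else 0)%:E.
  by rewrite /g stepE // => k l kl; rewrite aout ?mulr0.
have := @dominated_convergence _ _ _ mu setT measurableT g (EFin \o f) (singularity C).
case.
- by move=> n; apply/measurable_EFinP; exact: measurable_step.
- exact/measurable_EFinP.
- exists A; split => // z /= nz; apply: contrapT => Az; apply: nz => _.
  have Nz : ~ N z by move=> /NA.
  under eq_fun do rewrite gE.
  apply/cvg_EFin; first exact: nearW.
  case: (boolP ((0 <= z.1) && (0 <= z.2))) => [/andP[z1 z2]|].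
    rewrite /comp /=.
    by have := lim z Nz z1 z2; rewrite -(cvg_shiftS _).
  rewrite negb_and -!ltNge => zn; rewrite (fout z Nz zn); exact: cvg_cst.
- exact: integrable_singularity.
- apply: aeW => z n _; rewrite gE; case: ifPn => [/andP[z1 z2]|_].
    rewrite gee0_abs ?lee_fin ?mulr_ge0 ?exprn_ge0 //; exact: dom.
  by rewrite abse0 mule_ge0 ?mule_ge0 ?spikes_ge0 ?lee_fin.
move=> If _ cv; split => //.
rewrite -(cvg_shiftS _); apply: cvg_trans cv; apply: near_eq_cvg; apply: nearW => n.
rewrite /= /g integral_step //; last by move=> k l; rewrite mulr_ge0 ?exprn_ge0.
congr EFin; rewrite mulr_suml; apply: eq_bigr => k _.
rewrite mulr_suml; apply: eq_bigr => l _.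
by rewrite mulrAC mulfV ?mul1r // expf_neq0 // pnatr_eq0.
Qed.

End Plane.

(** * Asymptotics of the split probabilities *)

Section Counting.
Local Open Scope classical_set_scope.
Local Open Scope ring_scope.
Variable R : realType.

(** The quotient of the central binomial coefficient 'C(2 m, m) by 4 ^ m,
    which is the number of trees without its factorial and exponential
    factors. *)
Definition catalan_ratio (m : nat) : R := (num_trees m.+1)%:R / (m`!%:R * 4 ^+ m).
Local Notation r := catalan_ratio.

Lemma catalan_ratio0 : r 0 = 1.
Proof. by rewrite /r /= expr0 mulr1 divr1. Qed.

Lemma catalan_ratioS m : r m.+1 = r m * ((2 * m%:R + 1) / (2 * m%:R + 2)).
Proof.
rewrite /r num_treesS // factS exprS natrM [(m.+1 * _)%N%:R]natrM.
have -> : (2 * (2 * m.+1 - 1))%N%:R = 2 * (2 * m%:R + 1) :> R.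
  by rewrite (_ : 2 * (2 * m.+1 - 1) = 2 * (2 * m + 1))%N; [rewrite !(natrM, natrD)|lia].
rewrite -natr1; field.
have m0 : 0 <= m%:R :> R by [].
by apply/and4P; split; rewrite ?expf_neq0 ?pnatr_eq0 -?lt0n ?fact_gt0 ?gt_eqF //; lra.
Qed.

Lemma catalan_ratio_gt0 m : 0 < r m.
Proof.
by rewrite divr_gt0 ?mulr_gt0 ?exprn_gt0 ?ltr0n ?fact_gt0 // num_trees_gt0.
Qed.

Local Opaque catalan_ratio.

(** By induction, as (2 m + 1) (2 m + 3) <= (2 m + 2) ^ 2. *)
Lemma catalan_ratio_le m : r m ^+ 2 * (2 * m%:R + 1) <= 1.
Proof.
elim: m => [|m IHm]; first by rewrite catalan_ratio0 expr1n mul1r mulr0 add0r.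
apply: le_trans IHm; rewrite catalan_ratioS exprMn -mulrA ler_wpM2l ?sqr_ge0 //.
rewrite expr_div_n mulrAC ler_pdivrMr; last by rewrite exprn_gt0 // ltr_wpDl ?mulr_ge0.
have m0 : 0 <= m%:R :> R by [].
by rewrite -natr1; nra.
Qed.

Definition catalan_sqrt (m : nat) : R := r m * Num.sqrt m%:R.
Local Notation q := catalan_sqrt.

Let qS m : (0 < m)%N -> r m ^+ 2 * m%:R <= r m.+1 ^+ 2 * m.+1%:R.
Proof.
move=> m0; rewrite catalan_ratioS; set t := _ / _.
rewrite (_ : (r m * t) ^+ 2 * _ = r m ^+ 2 * (t ^+ 2 * m.+1%:R)); last by ring.
rewrite ler_wpM2l ?sqr_ge0 // /t.
have m1 : 0 < m%:R :> R by rewrite ltr0n.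
rewrite expr_div_n mulrAC ler_pdivlMr; last by rewrite exprn_gt0 // ltr_wpDl ?mulr_ge0.
by rewrite -natr1; nra.
Qed.

Lemma catalan_ratio_ge m : (0 < m)%N -> 1 <= 4 * (r m ^+ 2 * m%:R).
Proof.
elim: m => // -[|m] IHm _.
  rewrite catalan_ratioS catalan_ratio0 mul1r mulr0 !add0r mulr1; lra.
by apply: le_trans (IHm _) _ => //; rewrite ler_pM2l // qS.
Qed.

Lemma catalan_sqrt_sqr m : q m ^+ 2 = r m ^+ 2 * m%:R.
Proof. by rewrite exprMn sqr_sqrtr. Qed.

Lemma catalan_sqrt_ge0 m : 0 <= q m.
Proof. by rewrite mulr_ge0 ?sqrtr_ge0 ?ltW ?catalan_ratio_gt0. Qed.

(** The sequence is increasing and bounded by 1. Its limit is the inverse of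
    the square root of pi, but the value is immaterial: it cancels in the
    normalization of the limit laws. *)
Lemma catalan_sqrt_cvg : exists2 c : R, 0 < c & q @ \oo --> c.
Proof.
have nd : nondecreasing_seq (fun m => q m.+1).
  apply/nondecreasing_seqP => m.
  by rewrite -(@ler_pXn2r _ 2) ?nnegrE ?catalan_sqrt_ge0 // !catalan_sqrt_sqr qS.
have ub : has_ubound (range (fun m => q m.+1)).
  exists 1 => _ [m _ <-]; rewrite -(@ler_pXn2r _ 2) ?nnegrE ?catalan_sqrt_ge0 //.
  rewrite catalan_sqrt_sqr expr1n; apply: le_trans (catalan_ratio_le m.+1).
  rewrite ler_wpM2l ?sqr_ge0 //; have : 0 <= m.+1%:R :> R by []. 
  by lra.
have cv := nondecreasing_cvgn nd ub.
exists (sup (range (fun m => q m.+1))); last by rewrite -(cvg_shiftS _).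
apply: (@lt_le_trans _ _ (q 1)); last by apply: ub_le_sup => //; exists 0.
by rewrite /q sqrtr1 mulr1 catalan_ratio_gt0.
Qed.

Lemma catalan_ratio_le_sqrt m : r m <= (Num.sqrt m.+1%:R)^-1.
Proof.
rewrite -(@ler_pXn2r _ 2) ?nnegrE ?invr_ge0 ?sqrtr_ge0 ?(ltW (catalan_ratio_gt0 m)) //.
rewrite exprVn sqr_sqrtr // -[leRHS]mul1r ler_pdivlMr ?ltr0n //.
apply: le_trans (catalan_ratio_le m); rewrite ler_wpM2l ?sqr_ge0 //.
have : 0 <= m%:R :> R by [].
by rewrite -natr1; lra.
Qed.

Lemma catalan_ratio_ge_sqrt m : (0 < m)%N -> (2 * Num.sqrt m%:R)^-1 <= r m.
Proof.
move=> m0; have m1 : 0 < m%:R :> R by rewrite ltr0n.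
have s0 : 0 < Num.sqrt m%:R :> R by rewrite sqrtr_gt0.
rewrite -(@ler_pXn2r _ 2) ?nnegrE ?invr_ge0 ?mulr_ge0 ?sqrtr_ge0 ?(ltW (catalan_ratio_gt0 m)) //.
rewrite exprVn exprMn sqr_sqrtr // -[leLHS]mul1r ler_pdivrMr ?mulr_gt0 ?exprn_gt0 //.
by have := catalan_ratio_ge m0; lra.
Qed.

(** ** The split probabilities *)

(** For k < l, the probability that the branches below the centroid of a
    random tree with n leaves have k and l leaves, in some order; see
    [central_probE]. *)
Definition central_prob (n k l : nat) : R :=
  r k * r l * r (n - k - l) * (2 * n%:R - 1) /
  (r n * ((2 * k%:R - 1) * (2 * l%:R - 1))).

(** The probability that at the vertex selected by [spinal] the branch of the
    second root has k leaves besides it, and the branch of the root l; see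
    [spinal_probE]. The remaining n - k - l leaves are in the branch at the
    side. *)
Definition spinal_prob (n k l : nat) : R :=
  r k * r l * r (n - k - l) / (r n * (2 * (n - k - l)%:R - 1)).

Let wS m : (num_trees m.+1)%:R = r m * (m`!%:R * 4 ^+ m) :> R.
Proof.
have f0 : m`!%:R != 0 :> R by rewrite pnatr_eq0 -lt0n fact_gt0.
Transparent catalan_ratio.
by rewrite /r mulfVK // mulf_neq0 ?expf_neq0 ?pnatr_eq0.
Qed.

Let w_pos m : (0 < m)%N -> (num_trees m)%:R = r m * (m`!%:R * 4 ^+ m) / (2 * (2 * m%:R - 1)) :> R.
Proof.
move=> m0; rewrite -wS num_treesS //.
have m1 : 1 <= m%:R :> R by rewrite ler1n.
have -> : (2 * (2 * m - 1) * num_trees m)%N%:R = 2 * (2 * m%:R - 1) * (num_trees m)%:R :> R.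
  by rewrite !natrM natrB ?natrM // muln_gt0.
by field; rewrite gt_eqF //; lra.
Qed.

Let bin2 n k l : (k + l <= n)%N -> 'C(n, k)%:R * 'C(n - k, l)%:R = n`!%:R / (k`!%:R * l`!%:R * (n - k - l)`!%:R) :> R.
Proof.
move=> kln; have kn : (k <= n)%N by lia.
have ln : (l <= n - k)%N by lia.
have f0 m : m`!%:R != 0 :> R by rewrite pnatr_eq0 -lt0n fact_gt0.
apply: (canRL (mulfK _)); first by rewrite !mulf_neq0.
by rewrite -(bin_fact kn) -(bin_fact ln) !natrM; ring.
Qed.

Lemma central_probE n k l : (0 < k)%N -> (0 < l)%N -> (k + l <= n)%N ->
  2 * ('C(n, k)%:R * 'C(n - k, l)%:R) *
    ((num_trees k)%:R * (num_trees l)%:R * (num_trees (n - k - l).+1)%:R) / (num_trees n)%:R =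
  central_prob n k l.
Proof.
move=> k0 l0 kln; have n0 : (0 < n)%N by lia.
rewrite bin2 // wS !w_pos // /central_prob.
have f0 m : m`!%:R != 0 :> R by rewrite pnatr_eq0 -lt0n fact_gt0.
have m1 m : (0 < m)%N -> 2 * m%:R - 1 != 0 :> R.
  by move=> m0; have : 1 <= m%:R :> R by [rewrite ler1n]; move=> ?; rewrite gt_eqF //; lra.
have r0 m : r m != 0 by rewrite gt_eqF ?catalan_ratio_gt0.
rewrite (_ : 4 ^+ n = 4 ^+ k * 4 ^+ l * 4 ^+ (n - k - l) :> R); last first.
  by rewrite -!exprD; congr (_ ^+ _); lia.
by field; rewrite !expf_neq0 // !f0 !m1 // !r0.
Qed.

Lemma spinal_probE n k l : (k + l < n)%N ->
  2 * ('C(n, k)%:R * 'C(n - k, l)%:R) *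
    ((num_trees k.+1)%:R * (num_trees l.+1)%:R * (num_trees (n - k - l))%:R) / (num_trees n.+1)%:R =
  spinal_prob n k l.
Proof.
move=> kln; have n0 : (0 < n)%N by lia.
have m0 : (0 < n - k - l)%N by lia.
rewrite bin2 1?ltnW // !wS !w_pos // /spinal_prob.
have f0 m : m`!%:R != 0 :> R by rewrite pnatr_eq0 -lt0n fact_gt0.
have m1 m : (0 < m)%N -> 2 * m%:R - 1 != 0 :> R.
  by move=> m0'; have : 1 <= m%:R :> R by [rewrite ler1n]; move=> ?; rewrite gt_eqF //; lra.
have r0 m : r m != 0 by rewrite gt_eqF ?catalan_ratio_gt0.
rewrite (_ : 4 ^+ n = 4 ^+ k * 4 ^+ l * 4 ^+ (n - k - l) :> R); last first.
  by rewrite -!exprD; congr (_ ^+ _); lia.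
by field; rewrite !expf_neq0 // !f0 !m1 // !r0.
Qed.

(** ** Limits *)

Lemma trunc_ratio_cvg (x : R) : 0 <= x -> (Num.trunc (n%:R * x))%:R / n%:R @[n --> \oo] --> x.
Proof.
move=> x0; apply/cvgrPdist_le => e e0.
near=> n.
have n0 : 0 < n%:R :> R by near: n; exists 1%N => // n /=; rewrite ltr0n.
have /andP[a b] := truncn_itv (mulr_ge0 (ltW n0) x0).
have en : 1 <= e * n%:R.
  rewrite -ler_pdivrMl // mulr1; near: n; exact: nbhs_infty_ger.
have -> : x - (Num.trunc (n%:R * x))%:R / n%:R = (n%:R * x - (Num.trunc (n%:R * x))%:R) / n%:R.
  by field; rewrite gt_eqF.
rewrite normrM normfV (ger0_norm (ltW n0)) ler_pdivrMr // ger0_norm ?subr_ge0 //.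
by move: b; rewrite -natr1; lra.
Unshelve. all: by end_near. Qed.

Lemma catalan_ratio_cvg (c x : R) (k : nat -> nat) : q @ \oo --> c -> 0 < x ->
  (k n)%:R / n%:R @[n --> \oo] --> x ->
  r (k n) * Num.sqrt n%:R @[n --> \oo] --> c / Num.sqrt x.
Proof.
move=> qc x0 kx.
have kpos : \forall n \near \oo, x / 2 < (k n)%:R / n%:R.
  by apply: (cvgr_gt _ kx); lra.
have koo : k @ \oo --> \oo.
  apply/cvgnyPge => A; near=> n.
  have n0 : 0 < n%:R :> R by near: n; exists 1%N => // n /=; rewrite ltr0n.
  have : x / 2 < (k n)%:R / n%:R by near: n.
  rewrite ltr_pdivlMr // => h.
  rewrite -(ler_nat R); apply: le_trans (ltW h).
  rewrite -ler_pdivrMl ?divr_gt0 //; near: n; exact: nbhs_infty_ger.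
have qk : q (k n) @[n --> \oo] --> c by apply: cvg_comp koo qc.
have sk : Num.sqrt ((k n)%:R / n%:R) @[n --> \oo] --> Num.sqrt x.
  by apply: (cvg_comp _ _ kx); exact: sqrt_continuous.
have sx : Num.sqrt x != 0 by rewrite gt_eqF ?sqrtr_gt0.
apply: cvg_trans (cvgM qk (cvgV sx sk)); apply: near_eq_cvg; near=> n.
have n0 : 0 < n%:R :> R by near: n; exists 1%N => // n /=; rewrite ltr0n.
have : x / 2 < (k n)%:R / n%:R by near: n.
rewrite ltr_pdivlMr // => h.
have k0 : 0 < (k n)%:R :> R by apply: lt_trans h; rewrite mulr_gt0 // divr_gt0.
rewrite /q /= sqrtrM ?ltW // sqrtrV ?ltW //.
by field; rewrite !gt_eqF ?sqrtr_gt0.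
Unshelve. all: by end_near. Qed.

Lemma powR_central (x : R) : 0 < x -> x `^ (- 2^-1 - 1) = (x * Num.sqrt x)^-1.
Proof.
move=> x0; rewrite -opprD powRN powRD; last by rewrite gt_eqF ?implybT.
by rewrite powR12_sqrt ?ltW // powRr1 ?ltW // mulrC.
Qed.

Lemma powR_side (x : R) : 0 < x -> x `^ (2^-1 - 1) = (Num.sqrt x)^-1.
Proof.
move=> x0; rewrite (_ : 2^-1 - 1 = - 2^-1); last by lra.
by rewrite powRN powR12_sqrt ?ltW.
Qed.

Lemma inv_nat_cvg : n%:R^-1 @[n --> \oo] --> (0 : R).
Proof. by rewrite -(cvg_shiftS _); exact: cvg_harmonic. Qed.

Section PointLimit.
Variables (c x y : R).
Hypotheses (qc : q @ \oo --> c) (c0 : 0 < c) (x0 : 0 < x) (y0 : 0 < y) (xy1 : x + y < 1).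
Let k n := Num.trunc (n%:R * x).
Let l n := Num.trunc (n%:R * y).

Lemma trunc_parts n : (k n + l n <= n)%N.
Proof.
have n0 : 0 <= n%:R :> R by [].
have /andP[a _] := truncn_itv (mulr_ge0 n0 (ltW x0)).
have /andP[b _] := truncn_itv (mulr_ge0 n0 (ltW y0)).
rewrite -(ler_nat R) natrD; apply: le_trans (lerD a b) _.
by rewrite -mulrDr ler_piMr // ltW.
Qed.

Lemma rest_parts n : (n - k n - l n)%:R = n%:R - (k n)%:R - (l n)%:R :> R.
Proof. by have := trunc_parts n => h; rewrite !natrB //; lia. Qed.

Lemma rest_ratio_cvg : (n - k n - l n)%:R / n%:R @[n --> \oo] --> 1 - x - y.
Proof.
have A := trunc_ratio_cvg (ltW x0); have B := trunc_ratio_cvg (ltW y0).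
apply: cvg_trans (cvgB (cvgB (cvg_cst (1 : R)) A) B); apply: near_eq_cvg; near=> n.
have n0 : 0 < n%:R :> R by near: n; exists 1%N => // n /=; rewrite ltr0n.
rewrite rest_parts /=; rewrite -/(k n) -/(l n) !fctE; field; by rewrite gt_eqF.
Unshelve. all: by end_near. Qed.

Let r0 m : r m != 0. Proof. by rewrite gt_eqF ?catalan_ratio_gt0. Qed.

Let odd0 m : 2 * m%:R - 1 != 0 :> R.
Proof. by rewrite subr_eq0 -natrM -[1]/(1%:R) eqr_nat; apply/eqP; lia. Qed.

Let core_cvg : n%:R * (r (k n) * r (l n) * r (n - k n - l n) / r n) @[n --> \oo] -->
  c ^+ 2 / (Num.sqrt x * Num.sqrt y * Num.sqrt (1 - x - y)).
Proof.
have z0 : 0 < 1 - x - y by rewrite -addrA -opprD subr_gt0.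
have A := catalan_ratio_cvg qc x0 (trunc_ratio_cvg (ltW x0)).
have B := catalan_ratio_cvg qc y0 (trunc_ratio_cvg (ltW y0)).
have C := catalan_ratio_cvg qc z0 rest_ratio_cvg.
have c0' : c != 0 by rewrite gt_eqF.
rewrite (_ : c ^+ 2 / (Num.sqrt x * Num.sqrt y * Num.sqrt (1 - x - y)) =
   c / Num.sqrt x * (c / Num.sqrt y) * (c / Num.sqrt (1 - x - y)) / c); last first.
  by field; rewrite c0' !gt_eqF ?sqrtr_gt0.
apply: cvg_trans (cvgM (cvgM (cvgM A B) C) (cvgV c0' qc)); apply: near_eq_cvg; near=> n.
have n0 : 0 < n%:R :> R by near: n; exists 1%N => // n /=; rewrite ltr0n.
have s0 : Num.sqrt n%:R != 0 :> R by rewrite gt_eqF // sqrtr_gt0.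
rewrite /= -/(k n) -/(l n) /q -[X in _ = X * _](sqr_sqrtr (ltW n0)).
by field; rewrite s0 r0.
Unshelve. all: by end_near. Qed.

(** Each factor [catalan_ratio] contributes [c] over the square root of its
    argument and each odd factor a power of its argument; in the limit this is
    the density of the Dirichlet law of parameters -1/2, -1/2, 1/2. *)
Lemma central_prob_cvg : n%:R ^+ 2 * central_prob n (k n) (l n) @[n --> \oo] -->
  c ^+ 2 / 2 * (x `^ (- 2^-1 - 1) * y `^ (- 2^-1 - 1) * (1 - x - y) `^ (2^-1 - 1)).
Proof.
have z0 : 0 < 1 - x - y by rewrite -addrA -opprD subr_gt0.
rewrite !powR_central // powR_side //.
have D (t : R) : 0 < t -> 2 * ((Num.trunc (n%:R * t))%:R / n%:R) - n%:R^-1 @[n --> \oo] --> 2 * t.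
  move=> t0; rewrite -[2 * t]subr0; apply: cvgB; last exact: inv_nat_cvg.
  by apply: cvgMr; exact: trunc_ratio_cvg (ltW t0).
have xy : 2 * x * (2 * y) != 0 by rewrite !mulf_neq0 ?gt_eqF.
have N2 : 2 - n%:R^-1 @[n --> \oo] --> (2 : R).
  by rewrite -[X in _ --> X]subr0; apply: cvgB; [exact: cvg_cst|exact: inv_nat_cvg].
rewrite (_ : c ^+ 2 / 2 * ((x * Num.sqrt x)^-1 * (y * Num.sqrt y)^-1 * (Num.sqrt (1 - x - y))^-1) =
  c ^+ 2 / (Num.sqrt x * Num.sqrt y * Num.sqrt (1 - x - y)) * 2 / (2 * x * (2 * y))); last first.
  by field; rewrite !gt_eqF ?sqrtr_gt0.
apply: cvg_trans (cvgM (cvgM core_cvg N2) (cvgV xy (cvgM (D x x0) (D y y0)))); apply: near_eq_cvg; near=> n.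
have n0 : 0 < n%:R :> R by near: n; exists 1%N => // n /=; rewrite ltr0n.
rewrite /= -/(k n) -/(l n) /central_prob.
field.
rewrite r0 !odd0 gt_eqF //=.
Unshelve. all: by end_near. Qed.

(** Here the odd factor belongs to the branch with one root, the last
    coordinate, which gives the parameters 1/2, 1/2, -1/2. *)
Lemma spinal_prob_cvg : n%:R ^+ 2 * spinal_prob n (k n) (l n) @[n --> \oo] -->
  c ^+ 2 / 2 * (x `^ (2^-1 - 1) * y `^ (2^-1 - 1) * (1 - x - y) `^ (- 2^-1 - 1)).
Proof.
have z0 : 0 < 1 - x - y by rewrite -addrA -opprD subr_gt0.
rewrite powR_central // !powR_side //.
have D : 2 * ((n - k n - l n)%:R / n%:R) - n%:R^-1 @[n --> \oo] --> 2 * (1 - x - y).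
  rewrite -[2 * _]subr0; apply: cvgB; last exact: inv_nat_cvg.
  by apply: cvgMr; exact: rest_ratio_cvg.
have zz : 2 * (1 - x - y) != 0 by rewrite !mulf_neq0 ?gt_eqF.
rewrite (_ : c ^+ 2 / 2 * ((Num.sqrt x)^-1 * (Num.sqrt y)^-1 * ((1 - x - y) * Num.sqrt (1 - x - y))^-1) =
  c ^+ 2 / (Num.sqrt x * Num.sqrt y * Num.sqrt (1 - x - y)) / (2 * (1 - x - y))); last first.
  by field; rewrite !gt_eqF ?sqrtr_gt0.
apply: cvg_trans (cvgM core_cvg (cvgV zz D)); apply: near_eq_cvg; near=> n.
have n0 : 0 < n%:R :> R by near: n; exists 1%N => // n /=; rewrite ltr0n.
rewrite /= /spinal_prob; move: (odd0 (n - k n - l n)); set m := (n - k n - l n)%N => m0.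
field.
rewrite r0 m0 gt_eqF //=.
Unshelve. all: by end_near. Qed.

End PointLimit.

(** ** Domination *)

Section Domination.
Variable n : nat.
Hypothesis n0 : (0 < n)%N.
(* [S j] and [e j] are the powers of j / n of exponents -1/2 and -3/4. *)
Let S (j : nat) : R := Num.sqrt (n%:R / j%:R).
Let e (j : nat) : R := Num.sqrt (S j ^+ 3).

Let n1 : 0 < n%:R :> R. Proof. by rewrite ltr0n. Qed.

Let S0 j : 0 <= S j. Proof. exact: sqrtr_ge0. Qed.

Let SE j : (0 < j)%N -> S j = Num.sqrt n%:R / Num.sqrt j%:R.
Proof. by move=> j0; rewrite /S sqrtrM ?ltW // sqrtrV ?ltW // ltr0n. Qed.

Let S_sqr j : S j ^+ 2 = n%:R / j%:R.
Proof. by rewrite sqr_sqrtr // divr_ge0. Qed.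

Let e2 j : e j ^+ 2 = S j ^+ 3.
Proof. by rewrite sqr_sqrtr // exprn_ge0. Qed.

Let S_ge1 j : (0 < j)%N -> (j <= n)%N -> 1 <= S j.
Proof.
move=> j0 jn; rewrite -(@ler_pXn2r _ 2) ?nnegrE // S_sqr expr1n.
by rewrite ler_pdivlMr ?ltr0n // mul1r ler_nat.
Qed.

Let S_le_e j : (0 < j)%N -> (j <= n)%N -> S j <= e j.
Proof.
move=> j0 jn; rewrite -(@ler_pXn2r _ 2) ?nnegrE ?sqrtr_ge0 // e2.
by rewrite ler_weXn2l // S_ge1.
Qed.

Let S_le2 j : (n <= 4 * j)%N -> S j <= 2.
Proof.
move=> nj; have j0 : (0 < j)%N by lia.
rewrite -(@ler_pXn2r _ 2) ?nnegrE // S_sqr ler_pdivrMr ?ltr0n //.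
by rewrite -natrX -natrM ler_nat.
Qed.

Let spike_e (c : R) j (t : R) : (0 < j)%N -> (j <= n)%N -> `|t - c| <= 2 * (j%:R / n%:R) ->
  ((e j)%:E <= spike c t)%E.
Proof.
move=> j0 jn tc; have j1 : 0 < j%:R :> R by rewrite ltr0n.
apply: (@le_spike _ c t (j%:R / n%:R)) => //.
- by rewrite divr_gt0.
- by rewrite ler_pdivrMr // mul1r ler_nat.
- exact: sqrtr_ge0.
- rewrite (_ : e j ^+ 4 = (S j ^+ 2) ^+ 3); last by rewrite -exprM mulnC (exprM _ 2 2) e2 -exprM.
  by rewrite S_sqr -exprMn mulrA mulfVK ?gt_eqF // mulfV ?gt_eqF // expr1n.
Qed.

Let ratio_le j : (0 < j)%N -> r j <= (Num.sqrt j%:R)^-1.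
Proof.
move=> j0; apply: le_trans (catalan_ratio_le_sqrt j) _.
by rewrite lef_pV2 ?posrE ?sqrtr_gt0 ?ltr0n // ler_sqrt // ler_nat.
Qed.

Let ratio_n : (r n)^-1 <= 2 * Num.sqrt n%:R.
Proof.
rewrite -[leRHS]invrK lef_pV2 ?posrE ?catalan_ratio_gt0 ?invr_gt0 ?mulr_gt0 ?sqrtr_gt0 //.
exact: catalan_ratio_ge_sqrt.
Qed.

Let odd_le j : (0 < j)%N -> 0 < 2 * j%:R - 1 :> R /\ (2 * j%:R - 1)^-1 <= j%:R^-1 :> R.
Proof.
move=> j0; have j1 : 1 <= j%:R :> R by rewrite ler1n.
have p : 0 < 2 * j%:R - 1 :> R by lra.
by split=> //; rewrite lef_pV2 ?posrE //; lra.
Qed.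

Lemma central_prob_le k l : (0 < k)%N -> (0 < l)%N -> (k + l <= n)%N ->
  n%:R ^+ 2 * central_prob n k l <= 4 * (S k ^+ 3 * S l ^+ 3 * S (n - k - l).+1).
Proof.
move=> k0 l0 kln; set m := (n - k - l)%N.
have [pk ok] := odd_le k0; have [pl ol] := odd_le l0.
have rp j : 0 <= r j by rewrite ltW // catalan_ratio_gt0.
have sp (j : nat) : (0 < j)%N -> 0 < Num.sqrt j%:R :> R by move=> j0; rewrite sqrtr_gt0 ltr0n.
have kp : 0 < k%:R :> R by rewrite ltr0n.
have lp : 0 < l%:R :> R by rewrite ltr0n.
have -> : n%:R ^+ 2 * central_prob n k l = n%:R ^+ 2 *
    (r k * r l * r m * (2 * n%:R - 1) * (r n)^-1 * (2 * k%:R - 1)^-1 * (2 * l%:R - 1)^-1).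
  by rewrite /central_prob -/m !invfM; ring.
have -> : 4 * (S k ^+ 3 * S l ^+ 3 * S m.+1) = n%:R ^+ 2 *
    ((Num.sqrt k%:R)^-1 * (Num.sqrt l%:R)^-1 * (Num.sqrt m.+1%:R)^-1 * (2 * n%:R) *
      (2 * Num.sqrt n%:R) * k%:R^-1 * l%:R^-1).
  rewrite !SE //.
  have E j : j%:R = Num.sqrt j%:R ^+ 2 :> R by rewrite sqr_sqrtr.
  rewrite [in n%:R ^+ 2](E n) [in 2 * n%:R](E n) [in k%:R^-1](E k) [in l%:R^-1](E l).
  by field; rewrite !gt_eqF ?sp.
apply: ler_wpM2l; first exact: exprn_ge0.
have n21 : 0 <= 2 * n%:R - 1 :> R by have : 1 <= n%:R :> R by [rewrite ler1n]; lra.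
have i0 (t : R) : 0 < t -> 0 <= t^-1 by move=> ?; rewrite invr_ge0 ltW.
have n2n : 2 * n%:R - 1 <= 2 * n%:R :> R by rewrite lerBlDr lerDl.
have := ler_pM _ _ (ler_pM _ _ (ratio_le k0) (ratio_le l0)) (catalan_ratio_le_sqrt m).
rewrite !mulr_ge0 ?rp // => /(_ isT isT isT isT) P3.
have := ler_pM _ _ (ler_pM _ _ (ler_pM _ _ (ler_pM _ _ P3 n2n) ratio_n) ok) ol.
by apply; rewrite ?mulr_ge0 ?rp ?i0 ?catalan_ratio_gt0.
Qed.

Lemma spinal_prob_le k l : (k + l < n)%N ->
  n%:R ^+ 2 * spinal_prob n k l <= 2 * (S k.+1 * S l.+1 * S (n - k - l) ^+ 3).
Proof.
move=> kln; set m := (n - k - l)%N; have m0 : (0 < m)%N by rewrite /m; lia.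
have [pm om] := odd_le m0.
have rp j : 0 <= r j by rewrite ltW // catalan_ratio_gt0.
have sp (j : nat) : (0 < j)%N -> 0 < Num.sqrt j%:R :> R by move=> j0; rewrite sqrtr_gt0 ltr0n.
have mp : 0 < m%:R :> R by rewrite ltr0n.
have -> : n%:R ^+ 2 * spinal_prob n k l = n%:R ^+ 2 *
    (r k * r l * r m * (r n)^-1 * (2 * m%:R - 1)^-1).
  by rewrite /spinal_prob -/m !invfM; ring.
have -> : 2 * (S k.+1 * S l.+1 * S m ^+ 3) = n%:R ^+ 2 *
    ((Num.sqrt k.+1%:R)^-1 * (Num.sqrt l.+1%:R)^-1 * (Num.sqrt m%:R)^-1 *
      (2 * Num.sqrt n%:R) * m%:R^-1).
  rewrite !SE //.
  have E j : j%:R = Num.sqrt j%:R ^+ 2 :> R by rewrite sqr_sqrtr.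
  rewrite [in n%:R ^+ 2](E n) [in m%:R^-1](E m).
  by field; rewrite !gt_eqF ?sp.
apply: ler_wpM2l; first exact: exprn_ge0.
have i0 (t : R) : 0 < t -> 0 <= t^-1 by move=> ?; rewrite invr_ge0 ltW.
have := ler_pM _ _ (ler_pM _ _ (catalan_ratio_le_sqrt k) (catalan_ratio_le_sqrt l)) (ratio_le m0).
rewrite !mulr_ge0 ?rp // => /(_ isT isT isT isT) P3.
have := ler_pM _ _ (ler_pM _ _ P3 ratio_n) om.
by apply; rewrite ?mulr_ge0 ?rp ?i0 ?catalan_ratio_gt0.
Qed.

(* 256 = 4 * 8 * 8 is the largest constant that occurs below: two sizes are at
   least n / 4, where the cube of [S] is at most 8. *)
Let singularity_le (z : measurableTypeR R * measurableTypeR R) (X d1 d2 : R) j1 j2 :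
  (d1 = 0 \/ d1 = 2^-1) -> (d2 = 0 \/ d2 = 2^-1) ->
  (0 < j1 <= n)%N -> (0 < j2 <= n)%N ->
  `|z.1 - d1| <= 2 * (j1%:R / n%:R) -> `|z.2 - d2| <= 2 * (j2%:R / n%:R) ->
  X <= 256 * (e j1 * e j2) -> (X%:E <= singularity 256 z)%E.
Proof.
move=> h1 h2 /andP[p1 q1] /andP[p2 q2] z1 z2 X12.
have sp (d t : R) j : (d = 0 \/ d = 2^-1) -> ((e j)%:E <= spike d t)%E -> ((e j)%:E <= spikes t)%E.
  move=> hd le; apply: le_trans le _; rewrite /spikes; case: hd => ->.
    by rewrite leeDl ?spike_ge0.
  by rewrite leeDr ?spike_ge0.
have e1 := sp _ _ _ h1 (spike_e p1 q1 z1).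
have e3 := sp _ _ _ h2 (spike_e p2 q2 z2).
apply: (@le_trans _ _ (256%:E * ((e j1)%:E * (e j2)%:E))%E); first by rewrite -!EFinM lee_fin.
apply: lee_wpmul2l; first by rewrite lee_fin.
by apply: lee_pmul => //; rewrite lee_fin sqrtr_ge0.
Qed.

Let near_lattice (t d : R) (k j : nat) : k%:R <= n%:R * t < k.+1%:R ->
  d * n%:R - 2 * j%:R <= k%:R -> k.+1%:R <= d * n%:R + 2 * j%:R ->
  `|t - d| <= 2 * (j%:R / n%:R).
Proof.
move=> /andP[a b] h1 h2; rewrite ler_norml mulrA.
rewrite lerBrDl -mulNr -(ler_pM2r n1) mulrDl mulfVK ?gt_eqF // lerBlDl -[X in _ && X](ler_pM2r n1) mulrDl mulfVK ?gt_eqF //.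
by apply/andP; split; lra.
Qed.

(** The centroid condition forces l >= n / 4. If k >= n / 4 too, then k and l
    are within m + 1 of n / 2, where m = n - k - l is possibly small.
    Otherwise m >= n / 4, and l is within k of n / 2. In both cases the small
    quantity controls the distance of two coordinates to their special values.
    *)
Lemma central_dominated (z : measurableTypeR R * measurableTypeR R) :
  0 <= z.1 -> 0 <= z.2 ->
  let k := Num.trunc (n%:R * z.1) in let l := Num.trunc (n%:R * z.2) in
  (0 < k)%N -> (k <= l)%N -> (2 * l <= n)%N -> (n < 2 * (k + l))%N ->
  ((n%:R ^+ 2 * central_prob n k l)%:E <= singularity 256 z)%E.
Proof.
move=> z1 z2 k l k0 kl ln nkl.
have Kz := truncn_itv (mulr_ge0 (ltW n1) z1); rewrite -/k in Kz.
have Lz := truncn_itv (mulr_ge0 (ltW n1) z2); rewrite -/l in Lz.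
have [l0 kln nl4 mn k4] : [/\ (0 < l)%N, (k + l <= n)%N, (n <= 4 * l)%N,
    (0 < (n - k - l).+1 <= n)%N & (4 * k < n)%N -> (n <= 4 * (n - k - l).+1)%N].
  by clear -k0 kl ln nkl; move: k l k0 kl ln nkl => k l; split; lia.
have kn : (0 < k <= n)%N by rewrite k0 (leq_trans (leq_addr l k)).
have B := central_prob_le k0 l0 kln.
have Sl : S l <= 2 by exact: S_le2.
have Sl3 : S l ^+ 3 <= 8 by rewrite (_ : 8 = 2 ^+ 3); [rewrite lerXn2r ?nnegrE|lra].
move: B; set m := (n - k - l)%N => B.
have mE : m%:R = n%:R - k%:R - l%:R :> R.
  by rewrite /m -subnDA natrB // natrD opprD addrA.
have klR : k%:R <= l%:R :> R by rewrite ler_nat.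
have lnR : 2 * l%:R <= n%:R :> R by rewrite -natrM ler_nat.
have nklR : n%:R < 2 * (k%:R + l%:R) :> R by rewrite -natrD -natrM ltr_nat.
have k1R : 1 <= k%:R :> R by rewrite ler1n.
have m0R : 0 <= m%:R :> R by [].
have [nk|nk] := leqP n (4 * k).
  have Sk : S k <= 2 by exact: S_le2.
  have Sk3 : S k ^+ 3 <= 8 by rewrite (_ : 8 = 2 ^+ 3); [rewrite lerXn2r ?nnegrE|lra].
  have S1 := S_ge1 (ltn0Sn m) (proj2 (andP mn)).
  apply: (@singularity_le z _ 2^-1 2^-1 m.+1 m.+1); auto.
  - by apply: near_lattice Kz _ _; rewrite -?[m.+1%:R]natr1 -?[k.+1%:R]natr1 -?[l.+1%:R]natr1; lra.
  - by apply: near_lattice Lz _ _; rewrite -?[m.+1%:R]natr1 -?[k.+1%:R]natr1 -?[l.+1%:R]natr1; lra.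
  apply: le_trans B _; rewrite -expr2 e2.
  apply: (@le_trans _ _ (4 * (8 * 8 * S m.+1 ^+ 3))); last by lra.
  rewrite ler_pM2l //; apply: ler_pM; rewrite ?mulr_ge0 ?exprn_ge0 //.
    by apply: ler_pM; rewrite ?exprn_ge0.
  by rewrite -[leLHS]expr1 ler_weXn2l.
have Sm : S m.+1 <= 2 by apply: S_le2; exact: k4.
apply: (@singularity_le z _ 0 2^-1 k k); auto.
- by apply: near_lattice Kz _ _; rewrite -?[m.+1%:R]natr1 -?[k.+1%:R]natr1 -?[l.+1%:R]natr1; lra.
- by apply: near_lattice Lz _ _; rewrite -?[m.+1%:R]natr1 -?[k.+1%:R]natr1 -?[l.+1%:R]natr1; lra.
apply: le_trans B _; rewrite -expr2 e2.
apply: (@le_trans _ _ (4 * (S k ^+ 3 * 8 * 2))).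
  rewrite ler_pM2l //; apply: ler_pM; rewrite ?mulr_ge0 ?exprn_ge0 //.
  by apply: ler_pM; rewrite ?exprn_ge0.
have : 0 <= S k ^+ 3 by exact: exprn_ge0.
lra.
Qed.

(** Either m = n - k - l is at least n / 4, and the bound is a product of
    inverse square roots of k / n and l / n; or k and l are both within m of n
    / 2. *)
Lemma spinal_dominated (z : measurableTypeR R * measurableTypeR R) :
  0 <= z.1 -> 0 <= z.2 ->
  let k := Num.trunc (n%:R * z.1) in let l := Num.trunc (n%:R * z.2) in
  (2 * k <= n)%N -> (2 * l < n)%N ->
  ((n%:R ^+ 2 * spinal_prob n k l)%:E <= singularity 256 z)%E.
Proof.
move=> z1 z2 k l kn ln.
have Kz := truncn_itv (mulr_ge0 (ltW n1) z1); rewrite -/k in Kz.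
have Lz := truncn_itv (mulr_ge0 (ltW n1) z2); rewrite -/l in Lz.
have [kln [k1 l1 mn m0] n4] : [/\ (k + l < n)%N,
    [/\ (0 < k.+1 <= n)%N, (0 < l.+1 <= n)%N, (0 < n - k - l <= n)%N & (0 < n - k - l)%N] &
    (4 * (n - k - l) < n)%N -> (n <= 4 * k.+1)%N /\ (n <= 4 * l.+1)%N].
  by clear -kn ln; move: k l kn ln => k l; split; [|split|split]; lia.
have B := spinal_prob_le kln.
move: B; set m := (n - k - l)%N => B.
have mE : m%:R = n%:R - k%:R - l%:R :> R.
  by rewrite /m -subnDA natrB 1?ltnW // natrD opprD addrA.
have lnR : 2 * l%:R <= n%:R :> R by rewrite -natrM ler_nat ltnW.
have knR : 2 * k%:R <= n%:R :> R by rewrite -natrM ler_nat.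
have k0R : 0 <= k%:R :> R by [].
have l0R : 0 <= l%:R :> R by [].
have m1R : 1 <= m%:R :> R by rewrite ler1n.
have [nm|nm] := leqP n (4 * m).
  have Sm : S m <= 2 by exact: S_le2.
  have Sm3 : S m ^+ 3 <= 8 by rewrite (_ : 8 = 2 ^+ 3); [rewrite lerXn2r ?nnegrE|lra].
  apply: (@singularity_le z _ 0 0 k.+1 l.+1); auto.
  - by apply: near_lattice Kz _ _; rewrite -?[m.+1%:R]natr1 -?[k.+1%:R]natr1 -?[l.+1%:R]natr1; lra.
  - by apply: near_lattice Lz _ _; rewrite -?[m.+1%:R]natr1 -?[k.+1%:R]natr1 -?[l.+1%:R]natr1; lra.
  apply: le_trans B _.
  apply: (@le_trans _ _ (2 * (e k.+1 * e l.+1 * 8))).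
    rewrite ler_pM2l //; apply: ler_pM; rewrite ?mulr_ge0 ?exprn_ge0 //.
    by apply: ler_pM => //; apply: S_le_e.
  have : 0 <= e k.+1 * e l.+1 by rewrite mulr_ge0 ?sqrtr_ge0.
  lra.
have [k4 l4] := n4 nm.
have Sk : S k.+1 <= 2 by exact: S_le2.
have Sl : S l.+1 <= 2 by exact: S_le2.
apply: (@singularity_le z _ 2^-1 2^-1 m m); auto.
- by apply: near_lattice Kz _ _; rewrite -?[m.+1%:R]natr1 -?[k.+1%:R]natr1 -?[l.+1%:R]natr1; lra.
- by apply: near_lattice Lz _ _; rewrite -?[m.+1%:R]natr1 -?[k.+1%:R]natr1 -?[l.+1%:R]natr1; lra.
apply: le_trans B _; rewrite -expr2 e2.
apply: (@le_trans _ _ (2 * (2 * 2 * S m ^+ 3))).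
  rewrite ler_pM2l //; apply: ler_pM; rewrite ?mulr_ge0 ?exprn_ge0 //.
  by apply: ler_pM.
have : 0 <= S m ^+ 3 by exact: exprn_ge0.
lra.
Qed.

End Domination.

End Counting.

(** * Moments of the Dirichlet laws *)

Section Density.
Local Open Scope classical_set_scope.
Local Open Scope ring_scope.
Context d1 d2 (T : measurableType d1) (S : measurableType d2) (R : realType).
Variables (mu : {measure set T -> \bar R}) (nu : {measure set S -> \bar R}).
Variables (phi : T -> S) (dens : T -> R).
Hypothesis mphi : measurable_fun setT phi.
Hypothesis mdens : measurable_fun setT dens.
Hypothesis dens0 : forall z, 0 <= dens z.
Hypothesis nuE : forall A, measurable A ->
  nu A = (\int[mu]_(z in phi @^-1` A) (dens z)%:E)%E.

Import HBNNSimple.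

(** True by hypothesis for indicator functions, hence for simple functions
    and, by monotone convergence, for nonnegative functions. *)
Lemma ge0_integral_density (f : S -> R) : measurable_fun setT f -> (forall x, 0 <= f x) ->
  (\int[nu]_x (f x)%:E = \int[mu]_z (f (phi z) * dens z)%:E)%E.
Proof.
move=> mf f0.
have mEf : measurable_fun setT (EFin \o f) by exact/measurable_EFinP.
pose h := nnsfun_approx measurableT mEf.
have hf x : EFin (h n x) @[n --> \oo] --> (f x)%:E.
  by apply: (@cvg_nnsfun_approx _ _ _ _ measurableT _ mEf) => // y _; rewrite lee_fin.
have hnd x a b : (a <= b)%N -> h a x <= h b x.
  by move=> ab; exact/lefP/nd_nnsfun_approx.
have pre A : measurable A -> measurable (phi @^-1` A).
  by move=> mA; rewrite -[X in measurable X]setTI; exact: mphi.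
have -> : (\int[nu]_x (f x)%:E = lim (\int[nu]_x (h n x)%:E @[n --> \oo]))%E.
  rewrite -monotone_convergence //.
  - by apply: eq_integral => x _; apply/esym/cvg_lim => //; exact: hf.
  - by move=> n; apply/measurable_EFinP.
  - by move=> n x _; rewrite lee_fin.
  - by move=> x _ a b ab; rewrite lee_fin hnd.
have -> : (\int[mu]_z (f (phi z) * dens z)%:E =
    lim (\int[mu]_z (h n (phi z) * dens z)%:E @[n --> \oo]))%E.
  rewrite -monotone_convergence //.
  - apply: eq_integral => z _; apply/esym/cvg_lim => //.
    under eq_fun do rewrite EFinM.
    by rewrite EFinM; apply: cvgeZr => //; exact: hf.
  - move=> n; apply/measurable_EFinP; apply: measurable_funM => //.
    exact: measurableT_comp.
  - by move=> n z _; rewrite lee_fin mulr_ge0.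
  - by move=> z _ a b ab; rewrite lee_fin ler_wpM2r ?hnd.
suff suf n : (\int[nu]_x (h n x)%:E = \int[mu]_z (h n (phi z) * dens z)%:E)%E.
  by under eq_fun do rewrite suf.
transitivity (\int[nu]_x (\sum_(y \in range (h n)) (y * \1_(h n @^-1` [set y]) x)%:E))%E.
  by apply: eq_integral => x _; rewrite fimfunE -fsumEFin.
rewrite ge0_integral_fsum //; last 2 first.
- by move=> y; apply/measurable_EFinP; apply: measurable_funM.
- by move=> y x _; exact: nnfun_muleindic_ge0.
transitivity (\int[mu]_z (\sum_(y \in range (h n))
    (y * \1_(h n @^-1` [set y]) (phi z))%:E * (dens z)%:E))%E; last first.
  apply: eq_integral => z _; rewrite -ge0_mule_fsuml => [|y]; last exact: nnfun_muleindic_ge0.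
  by rewrite fsumEFin // -(fimfunE _ (phi z)) EFinM.
have mi y : measurable_fun [set: T] (fun z => \1_(h n @^-1` [set y]) (phi z) : R).
  by apply: measurableT_comp mphi; exact: measurable_indic.
rewrite ge0_integral_fsum //; last 2 first.
- move=> y; apply: emeasurable_funM; last exact/measurable_EFinP.
  by apply/measurable_EFinP; apply: measurable_funM.
- move=> y z _; apply: mule_ge0; last by rewrite lee_fin.
  exact: nnfun_muleindic_ge0.
apply: eq_fsbigr => y yh.
have y0 : 0 <= y by move: yh; rewrite inE => -[t _ <-].
under eq_integral do rewrite EFinM.
rewrite ge0_integralZl_EFin //; last by apply/measurable_EFinP.
rewrite integral_indic // setIT -[X in (_ * X)%E]/(nu (h n @^-1` [set y])) nuE //.
under [RHS]eq_integral do rewrite EFinM -muleA.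
rewrite ge0_integralZl_EFin //; last 2 first.
- by move=> z _; rewrite mule_ge0 ?lee_fin.
- by apply: emeasurable_funM; exact/measurable_EFinP.
congr (_ * _)%E; rewrite integral_mkcond; apply: eq_integral => z _.
rewrite patchE indicE /=.
rewrite (_ : (phi z \in h n @^-1` [set y]) = (z \in phi @^-1` (h n @^-1` [set y]))) //.
by case: (_ \in _); rewrite ?mul1e ?mul0e.
Qed.

End Density.

Section Laws.
Local Open Scope classical_set_scope.
Local Open Scope ring_scope.
Variable R : realType.
Local Notation line := (measurableTypeR R).
Local Notation plane := (line * line)%type.
Local Notation mu := (@lebesgue_measure R \x @lebesgue_measure R)%E.

Section Dirichlet.
Variables (E : set (real_triple R)) (mE : measurable E) (a1 a2 a3 C : R).

(** The Dirichlet density read in the chart. The normalizing constant [C] is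
    not computed: it is known once the total mass is, as the limit of sums of
    probabilities. *)
Definition scaled_density (z : plane) : R :=
  C * (dirichlet_density a1 a2 a3 (chart z) * \1_E (chart z)).

Hypothesis C0 : 0 < C.
Hypothesis total : (\int[mu]_z (scaled_density z)%:E = 1)%E.

Lemma measurable_scaled_density : measurable_fun setT scaled_density.
Proof.
have md : measurable_fun setT (fun z => dirichlet_density a1 a2 a3 (chart z : real_triple R)).
  by apply: measurableT_comp (@measurable_dirichlet_density R a1 a2 a3) (@measurable_chart R).
have mi : measurable_fun setT (fun z : plane => \1_E (chart z) : R).
  by apply: measurableT_comp (@measurable_chart R); exact: measurable_indic.
by apply: measurable_funM => //; exact: measurable_funM.
Qed.

Lemma scaled_density_ge0 z : 0 <= scaled_density z.
Proof. by rewrite mulr_ge0 ?(ltW C0) // mulr_ge0 // !mulr_ge0 ?powR_ge0. Qed.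

Let weightE A : measurable A ->
  (C%:E * dirichlet_weight a1 a2 a3 mE A = \int[mu]_(z in (@chart R) @^-1` A) (scaled_density z)%:E)%E.
Proof.
move=> mA; rewrite /dirichlet_weight.
have mAE : measurable (A `&` E) by exact: measurableI.
rewrite ge0_integral_pushforward //; last 3 first.
- exact: measurable_chart.
- by apply/measurable_funTS/measurable_EFinP; exact: measurable_dirichlet_density.
- by move=> x _; rewrite lee_fin !mulr_ge0 ?powR_ge0.
have pre B : measurable B -> measurable ((@chart R) @^-1` B).
  by move=> mB; rewrite -[X in measurable X]setTI; exact: measurable_chart.
have md : measurable_fun setT (fun z => dirichlet_density a1 a2 a3 (chart z : real_triple R)).
  by apply: measurableT_comp (@measurable_dirichlet_density R a1 a2 a3) (@measurable_chart R).
have d0 z : 0 <= dirichlet_density a1 a2 a3 (chart z : real_triple R).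
  by rewrite !mulr_ge0 ?powR_ge0.
rewrite -ge0_integralZl_EFin ?(ltW C0) //; last 3 first.
- exact: pre.
- by move=> z _; rewrite lee_fin.
- exact/measurable_funTS/measurable_EFinP.
rewrite preimage_setI integral_mkcondr; apply: eq_integral => z _.
rewrite patchE /scaled_density indicE /= -EFinM.
rewrite (_ : (chart z \in E) = (z \in (@chart R) @^-1` E)); last by apply/idP/idP; rewrite !inE.
by case: (_ \in _); rewrite ?mulr1 ?mulr0 ?mulr0.
Qed.

Lemma dirichlet_integral (f : real_triple R -> R) : measurable_fun setT f -> (forall x, 0 <= f x) ->
  (\int[dirichlet mE a1 a2 a3]_x (f x)%:E = \int[mu]_z (f (chart z) * scaled_density z)%:E)%E.
Proof.
move=> mf f0; apply: (ge0_integral_density (phi := @chart R)) => //.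
- exact: measurable_chart.
- exact: measurable_scaled_density.
- exact: scaled_density_ge0.
move=> A mA; rewrite -weightE //.
have W : dirichlet_weight a1 a2 a3 mE setT = (C^-1)%:E.
  have := weightE measurableT; rewrite preimage_setT total => CW.
  have : (C^-1%:E * (C%:E * dirichlet_weight a1 a2 a3 mE setT) = C^-1%:E * 1)%E by rewrite CW.
  by rewrite muleA -EFinM mulVf ?gt_eqF // mul1e mule1.
have W' : (dirichlet_weight a1 a2 a3 mE : {measure set _ -> \bar R}) setT = (C^-1)%:E := W.
rewrite -[LHS]/(mnormalize (dirichlet_weight a1 a2 a3 mE : {measure set _ -> \bar R})
  (dirac ((0, 0, 1)%R : real_triple R)) A) /mnormalize W'.
rewrite eqe invr_eq0 gt_eqF //= invrK muleC.
by [].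
Qed.

Lemma dirichlet_moment (X : real_triple R -> R) (b : R) : measurable_fun setT X ->
  moment (dirichlet mE a1 a2 a3) X b = fine (\int[mu]_z (X (chart z) `^ b * scaled_density z)%:E)%E.
Proof.
move=> mX; rewrite /moment unlock (@dirichlet_integral (fun x => X x `^ b)) //.
  exact: measurableT_comp (@measurable_powR R b) mX.
by move=> x; exact: powR_ge0.
Qed.

End Dirichlet.

(** ** Lattice sums converge to moments *)

Section Limits.
Variable c : R.
Hypothesis qc : catalan_sqrt R @ \oo --> c.
Hypothesis c0 : 0 < c.

Local Notation tr n x := (Num.trunc (n%:R * x)).

Definition U_density : plane -> R := scaled_density (@U_domain R) (- 2^-1) (- 2^-1) 2^-1 (c ^+ 2 / 2).
Definition V_density : plane -> R := scaled_density (@V_domain R) 2^-1 2^-1 (- 2^-1) (c ^+ 2 / 2).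

Definition central_region (n k l : nat) := [&& 0 < k, k <= l, 2 * l <= n & n < 2 * (k + l)]%N.
Definition spinal_region (n k l : nat) := ((2 * k <= n) && (2 * l < n))%N.

(** Strict linear inequalities between x, y and 1 become inequalities between
    the lattice points below n x, n y and n. *)
Lemma near_trunc (x y a b d : R) : 0 <= x -> 0 <= y -> 0 < a * x + b * y + d ->
  \forall n \near \oo, 0 < a * (tr n x)%:R + b * (tr n y)%:R + d * n%:R.
Proof.
move=> x0 y0 abd.
have A : a * ((tr n x)%:R / n%:R) @[n --> \oo] --> a * x by apply: cvgMr; exact: trunc_ratio_cvg.
have B : b * ((tr n y)%:R / n%:R) @[n --> \oo] --> b * y by apply: cvgMr; exact: trunc_ratio_cvg.
have lim : a * ((tr n x)%:R / n%:R) + b * ((tr n y)%:R / n%:R) + d @[n --> \oo] --> a * x + b * y + d.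
  by apply: cvgD; [exact: cvgD|exact: cvg_cst].
near=> n.
have n0 : 0 < n%:R :> R by near: n; exists 1%N => // n /=; rewrite ltr0n.
have : 0 < a * ((tr n x)%:R / n%:R) + b * ((tr n y)%:R / n%:R) + d.
  by near: n; exact: (cvgr_gt _ lim).
rewrite -(pmulr_lgt0 _ n0) !mulrDl -!mulrA !mulVf ?gt_eqF // !mulr1.
by [].
Unshelve. all: by end_near. Qed.

Section Central.
Variables (g : nat -> nat -> nat -> R) (gam : plane -> R).
Hypothesis g01 : forall n k l, 0 <= g n k l <= 1.
Hypothesis mgam : measurable_fun setT gam.
Hypothesis gcvg : forall x y, 0 < x -> x < y -> y < 2^-1 -> 2^-1 < x + y ->
  g n (tr n x) (tr n y) @[n --> \oo] --> gam (x, y).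

Let a (n k l : nat) : R := if central_region n k l then g n k l * central_prob R n k l else 0.

Lemma central_prob_ge0 n k l : (0 < k)%N -> (0 < l)%N -> (0 < n)%N -> 0 <= central_prob R n k l.
Proof.
have p m : (0 < m)%N -> 0 <= 2 * m%:R - 1 :> R.
  by move=> m0; have : 1 <= m%:R :> R by [rewrite ler1n]; lra.
move=> k0 l0 n0; rewrite /central_prob divr_ge0 ?mulr_ge0 ?p //; exact/ltW/catalan_ratio_gt0.
Qed.

(** Outside the lines that bound the domain, membership of a lattice point in
    the region is eventually the same as membership of its limit in the
    domain. The test function [g] is 1 for the total mass and a power of the
    relative size of a piece for the moments. *)
Lemma central_sums_cvg :
  mu.-integrable setT (EFin \o (fun z => gam z * U_density z)) /\
  (\sum_(k < n.+1) \sum_(l < n.+1) a n k l)%:E @[n --> \oo] --> (\int[mu]_z (gam z * U_density z)%:E)%E.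
Proof.
pose N := [set z : plane | z.1 = 0] `|` [set z : plane | z.1 = z.2 :> R] `|` [set z : plane | z.2 = 2^-1]
  `|` [set z : plane | z.1 + z.2 = 2^-1 :> R].
apply: (@lattice_sums_cvg R a _ 256 N) => //.
- move=> n k l; rewrite /a; case: ifPn => // /and4P[k0 kl ln _].
  have /andP[g0 _] := g01 n k l.
  by rewrite mulr_ge0 // central_prob_ge0 //; lia.
- move=> n k l kl; rewrite /a ifF //; apply/negbTE/negP => /and4P[]; lia.
- apply: measurable_funM => //; exact: (measurable_scaled_density (@measurable_U_domain R)).
- apply: negligibleU; last exact: negligible_antidiagonal.
  apply: negligibleU; last exact: negligible_horizontal.
  apply: negligibleU; last exact: negligible_diagonal.
  exact: negligible_vertical.
- move=> z n n0 z1 z2; rewrite /a; case: ifPn => [/and4P[k0 kl ln nkl]|_]; last first.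
    by rewrite mulr0 mule_ge0 ?mule_ge0 ?spikes_ge0 ?lee_fin.
  apply: le_trans (central_dominated n0 z1 z2 k0 kl ln nkl); rewrite lee_fin.
  have /andP[g0 g1] := g01 n (tr n z.1) (tr n z.2).
  have ? : (0 < tr n z.2)%N by lia.
  by rewrite ler_wpM2l ?exprn_ge0 // ler_piMl // central_prob_ge0.
- move=> [x y]; rewrite /N /= => /not_orP[/not_orP[/not_orP[x0 xy] y2] xy2] x1 y1.
  have Uout : ~ U_domain (chart (x, y)) -> U_density (x, y) = 0.
    by move=> nU; rewrite /U_density /scaled_density indicE memNset // !mulr0.
  have zero : (\forall n \near \oo, ~~ central_region n (tr n x) (tr n y)) ->
      ~ U_domain (chart (x, y)) -> n%:R ^+ 2 * a n (tr n x) (tr n y) @[n --> \oo] --> gam (x, y) * U_density (x, y).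
    move=> nr nU; rewrite Uout // mulr0.
    apply: cvg_near_cst; near=> n.
    have : ~~ central_region n (tr n x) (tr n y) by near: n.
    by rewrite /a => /negbTE ->; rewrite mulr0.
  have [yx|yx|] := ltgtP y x; last by move=> /esym.
    apply: zero; last by case=> _ [] /=; rewrite /coord1 /coord2 /=; lra.
    near=> n; apply/negP => /and4P[_ kl _ _].
    have : 0 < 1 * (tr n x)%:R + -1 * (tr n y)%:R + 0 * n%:R :> R.
      by near: n; apply: (@near_trunc x y (1) (-1) (0) x1 y1); lra.
    by have : (tr n x)%:R <= (tr n y)%:R :> R by [rewrite ler_nat]; lra.
  have [y12|y12|//] := ltgtP y 2^-1; last first.
    apply: zero; last by case=> _ [] /=; rewrite /coord1 /coord2 /=; lra.
    near=> n; apply/negP => /and4P[_ _ ln _].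
    have : 0 < 0 * (tr n x)%:R + 2 * (tr n y)%:R + -1 * n%:R :> R.
      by near: n; apply: (@near_trunc x y (0) (2) (-1) x1 y1); lra.
    by have : 2 * (tr n y)%:R <= n%:R :> R by [rewrite -natrM ler_nat]; lra.
  have [xy12|xy12|//] := ltgtP (x + y) 2^-1.
    apply: zero; last by case=> _ [] /=; rewrite /coord1 /coord2 /coord3 /=; lra.
    near=> n; apply/negP => /and4P[_ _ _ nkl].
    have : 0 < -2 * (tr n x)%:R + -2 * (tr n y)%:R + 1 * n%:R :> R.
      by near: n; apply: (@near_trunc x y (-2) (-2) (1) x1 y1); lra.
    by have : n%:R < 2 * ((tr n x)%:R + (tr n y)%:R) :> R by [rewrite -natrD -natrM ltr_nat]; lra.
  have x0' : 0 < x by rewrite lt_neqAle eq_sym x1 andbT; apply/eqP.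
  have y0' : 0 < y by exact: lt_trans yx.
  have xy1 : x + y < 1 by lra.
  have UE : U_density (x, y) = c ^+ 2 / 2 * (x `^ (- 2^-1 - 1) * y `^ (- 2^-1 - 1) * (1 - x - y) `^ (2^-1 - 1)).
    rewrite /U_density /scaled_density indicE mem_set ?mulr1 //.
    split; split; rewrite /coord1 /coord2 /coord3 /=; lra.
  rewrite UE; apply: cvg_trans (cvgM (gcvg x0' yx y12 xy12) (central_prob_cvg qc c0 x0' y0' xy1)).
  apply: near_eq_cvg; near=> n.
  rewrite /a ifT; first by rewrite /= mulrCA.
  apply/and4P; split.
  + have : 0 < 1 * (tr n x)%:R + 0 * (tr n y)%:R + 0 * n%:R :> R.
      by near: n; apply: (@near_trunc x y (1) (0) (0) x1 y1); lra.
    by rewrite !mul0r !addr0 mul1r ltr0n.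
  + have : 0 < -1 * (tr n x)%:R + 1 * (tr n y)%:R + 0 * n%:R :> R.
      by near: n; apply: (@near_trunc x y (-1) (1) (0) x1 y1); lra.
    by move=> h; rewrite -(ler_nat R); lra.
  + have : 0 < 0 * (tr n x)%:R + -2 * (tr n y)%:R + 1 * n%:R :> R.
      by near: n; apply: (@near_trunc x y (0) (-2) (1) x1 y1); lra.
    by move=> h; rewrite -(ler_nat R) natrM; lra.
  + have : 0 < 2 * (tr n x)%:R + 2 * (tr n y)%:R + -1 * n%:R :> R.
      by near: n; apply: (@near_trunc x y (2) (2) (-1) x1 y1); lra.
    by move=> h; rewrite -(ltr_nat R) natrM natrD; lra.
- move=> [x y] _ /= xy; rewrite /U_density /scaled_density indicE memNset ?mulr0 //.
  by case=> -[] /=; rewrite /coord1 /coord2 /= => x0 y0 _ _ _; move: xy; rewrite !ltNge x0 y0.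
Unshelve. all: by end_near. Qed.

End Central.

Section Spinal.
Variables (g : nat -> nat -> nat -> R) (gam : plane -> R).
Hypothesis g01 : forall n k l, 0 <= g n k l <= 1.
Hypothesis mgam : measurable_fun setT gam.
Hypothesis gcvg : forall x y, 0 < x -> x < 2^-1 -> 0 < y -> y < 2^-1 ->
  g n (tr n x) (tr n y) @[n --> \oo] --> gam (x, y).

Let a (n k l : nat) : R := if spinal_region n k l then g n k l * spinal_prob R n k l else 0.

Lemma spinal_prob_ge0 n k l : (k + l < n)%N -> 0 <= spinal_prob R n k l.
Proof.
move=> kln; rewrite /spinal_prob divr_ge0 ?mulr_ge0 //; try exact/ltW/catalan_ratio_gt0.
by have : 1 <= (n - k - l)%:R :> R by [rewrite ler1n; lia]; lra.
Qed.

(** The same argument for the other law. *)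
Lemma spinal_sums_cvg :
  mu.-integrable setT (EFin \o (fun z => gam z * V_density z)) /\
  (\sum_(k < n.+1) \sum_(l < n.+1) a n k l)%:E @[n --> \oo] --> (\int[mu]_z (gam z * V_density z)%:E)%E.
Proof.
pose N := [set z : plane | z.1 = 0] `|` [set z : plane | z.2 = 0] `|` [set z : plane | z.1 = 2^-1]
  `|` [set z : plane | z.2 = 2^-1].
apply: (@lattice_sums_cvg R a _ 256 N) => //.
- move=> n k l; rewrite /a; case: ifPn => // /andP[kn ln].
  have /andP[g0 _] := g01 n k l.
  by rewrite mulr_ge0 // spinal_prob_ge0 //; lia.
- move=> n k l kl; rewrite /a ifF //; apply/negbTE/negP => /andP[]; lia.
- apply: measurable_funM => //; exact: (measurable_scaled_density (@measurable_V_domain R)).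
- apply: negligibleU; last exact: negligible_horizontal.
  apply: negligibleU; last exact: negligible_vertical.
  apply: negligibleU; last exact: negligible_horizontal.
  exact: negligible_vertical.
- move=> z n n0 z1 z2; rewrite /a; case: ifPn => [/andP[kn ln]|_]; last first.
    by rewrite mulr0 mule_ge0 ?mule_ge0 ?spikes_ge0 ?lee_fin.
  apply: le_trans (spinal_dominated n0 z1 z2 kn ln); rewrite lee_fin.
  have /andP[g0 g1] := g01 n (tr n z.1) (tr n z.2).
  by rewrite ler_wpM2l ?exprn_ge0 // ler_piMl // spinal_prob_ge0 //; lia.
- move=> [x y]; rewrite /N /= => /not_orP[/not_orP[/not_orP[x0 y0] x2] y2] x1 y1.
  have zero : (\forall n \near \oo, ~~ spinal_region n (tr n x) (tr n y)) ->
      ~ V_domain (chart (x, y)) -> n%:R ^+ 2 * a n (tr n x) (tr n y) @[n --> \oo] --> gam (x, y) * V_density (x, y).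
    move=> nr nV; rewrite /V_density /scaled_density indicE memNset // !mulr0.
    apply: cvg_near_cst; near=> n.
    have : ~~ spinal_region n (tr n x) (tr n y) by near: n.
    by rewrite /a => /negbTE ->; rewrite mulr0.
  have [x12|x12|//] := ltgtP x 2^-1; last first.
    apply: zero; last by case=> _ [] /=; rewrite /coord1 /coord2 /=; lra.
    near=> n; apply/negP => /andP[kn _].
    have : 0 < 2 * (tr n x)%:R + 0 * (tr n y)%:R + -1 * n%:R :> R.
      by near: n; apply: (@near_trunc x y (2) (0) (-1) x1 y1); lra.
    by have : 2 * (tr n x)%:R <= n%:R :> R by [rewrite -natrM ler_nat]; lra.
  have [y12|y12|//] := ltgtP y 2^-1; last first.
    apply: zero; last by case=> _ [] /=; rewrite /coord1 /coord2 /=; lra.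
    near=> n; apply/negP => /andP[_ ln].
    have : 0 < 0 * (tr n x)%:R + 2 * (tr n y)%:R + -1 * n%:R :> R.
      by near: n; apply: (@near_trunc x y (0) (2) (-1) x1 y1); lra.
    by have : 2 * (tr n y)%:R < n%:R :> R by [rewrite -natrM ltr_nat]; lra.
  have x0' : 0 < x by rewrite lt_neqAle eq_sym x1 andbT; apply/eqP.
  have y0' : 0 < y by rewrite lt_neqAle eq_sym y1 andbT; apply/eqP.
  have xy1 : x + y < 1 by lra.
  have VE : V_density (x, y) = c ^+ 2 / 2 * (x `^ (2^-1 - 1) * y `^ (2^-1 - 1) * (1 - x - y) `^ (- 2^-1 - 1)).
    rewrite /V_density /scaled_density indicE mem_set ?mulr1 //.
    split; split; rewrite /coord1 /coord2 /coord3 /=; lra.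
  rewrite VE; apply: cvg_trans (cvgM (gcvg x0' x12 y0' y12) (spinal_prob_cvg qc c0 x0' y0' xy1)).
  apply: near_eq_cvg; near=> n.
  rewrite /a ifT; first by rewrite /= mulrCA.
  apply/andP; split.
  + have : 0 < -2 * (tr n x)%:R + 0 * (tr n y)%:R + 1 * n%:R :> R.
      by near: n; apply: (@near_trunc x y (-2) (0) (1) x1 y1); lra.
    by move=> h; rewrite -(ler_nat R) natrM; lra.
  + have : 0 < 0 * (tr n x)%:R + -2 * (tr n y)%:R + 1 * n%:R :> R.
      by near: n; apply: (@near_trunc x y (0) (-2) (1) x1 y1); lra.
    by move=> h; rewrite -(ltr_nat R) natrM; lra.
- move=> [x y] _ /= xy; rewrite /V_density /scaled_density indicE memNset ?mulr0 //.
  by case=> -[] /=; rewrite /coord1 /coord2 /= => x0 y0 _ _ _; move: xy; rewrite !ltNge x0 y0.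
Unshelve. all: by end_near. Qed.

End Spinal.

End Limits.

End Laws.

From mathcomp Require Import fintype finset.

Local Open Scope ring_scope.

(** * Sums over decompositions as lattice sums *)

Section LatticeSums.
Variables (T : finType) (R : realType).
Implicit Types (A : {set T}) (p : {set T} * {set T}).

Lemma card_rest A p : [disjoint p.1 & p.2] && (p.1 :|: p.2 \subset A) ->
  #|rest A p| = (#|A| - #|p.1| - #|p.2|)%N.
Proof.
move=> /andP[d sub]; rewrite /rest cardsD (setIidPr sub) -subnDA.
have -> : #|p.1 :|: p.2| = (#|p.1| + #|p.2|)%N by apply/eqP; rewrite (leq_card_setU p.1 p.2) d.
by [].
Qed.

Lemma sum_parts_lattice A (h : nat -> nat -> R) :
  \sum_(p : {set T} * {set T} | [disjoint p.1 & p.2] && (p.1 :|: p.2 \subset A)) h #|p.1| #|p.2| =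
  \sum_(k < #|A|.+1) \sum_(l < #|A|.+1) 'C(#|A|, k)%:R * 'C(#|A| - k, l)%:R * h k l.
Proof.
rewrite sum_parts; apply: eq_bigr => k _; rewrite big_distrr /=.
rewrite (@big_ord_widen _ _ _ _ #|A|.+1 (fun l => 'C(#|A|, k)%:R * ('C(#|A| - k, l)%:R * h k l))) ?ltnS ?leq_subr //.
rewrite [LHS]big_mkcond; apply: eq_bigr => l _; rewrite mulrA.
by case: ifP => // /negbT; rewrite -leqNgt => kl; rewrite (bin_small kl) mulr0 mul0r.
Qed.

(** For two roots the sum is indexed by the sizes of the first part and of the
    rest, which are the pieces with two roots, as in the coordinates of the
    limit law. *)
Lemma sum_parts_rest A (h : nat -> nat -> R) :
  \sum_(p : {set T} * {set T} | [disjoint p.1 & p.2] && (p.1 :|: p.2 \subset A)) h #|p.1| #|rest A p| =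
  \sum_(k < #|A|.+1) \sum_(l < #|A|.+1) 'C(#|A|, k)%:R * 'C(#|A| - k, l)%:R * h k l.
Proof.
rewrite (eq_bigr (fun p => h #|p.1| (#|A| - #|p.1| - #|p.2|)%N)); last by move=> p /card_rest->.
rewrite (sum_parts _ (fun k m => h k (#|A| - k - m)%N)); apply: eq_bigr => k _.
rewrite (reindex_inj rev_ord_inj) /=.
rewrite big_distrr /=.
rewrite (eq_bigr (fun l : 'I_(#|A| - k).+1 => 'C(#|A|, k)%:R * 'C(#|A| - k, l)%:R * h k l)); last first.
  move=> l _; have := ltn_ord l; rewrite ltnS => lk.
  by rewrite subSS bin_sub // subKn // mulrA.
rewrite (@big_ord_widen _ _ _ _ #|A|.+1 (fun l => 'C(#|A|, k)%:R * 'C(#|A| - k, l)%:R * h k l)) ?ltnS ?leq_subr //.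
rewrite [LHS]big_mkcond; apply: eq_bigr => l _.
by case: ifP => // /negbT; rewrite -leqNgt => kl; rewrite (bin_small kl) mulr0 mul0r.
Qed.

End LatticeSums.

Section Totals.
Variable R : realType.

Let hole n : exists (s : 'I_n.+1) (A : {set 'I_n.+1}), s \notin A /\ #|A| = n.
Proof.
exists ord0, (~: [set ord0]); split; first by rewrite !inE eqxx.
by have := cardsC [set (ord0 : 'I_n.+1)]; rewrite cards1 card_ord => -[].
Qed.

Lemma central_prob_sym n k l : central_prob R n k l = central_prob R n l k.
Proof.
rewrite /central_prob subnAC [catalan_ratio R k * _]mulrC.
by rewrite [(2 * k%:R - 1) * _]mulrC.
Qed.

Let sum_symmetric n (t : nat -> nat -> R) : (forall k l, t k l = t l k) ->
  \sum_(k < n) \sum_(l < n) t k l =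
  \sum_(k < n) \sum_(l < n) (if (k <= l)%N then (if (k : nat) == l then t k l else 2 * t k l) else 0).
Proof.
move=> ts.
have split3 (k l : nat) : t k l = (if (k < l)%N then t k l else 0) + (if k == l then t k l else 0) +
    (if (l < k)%N then t l k else 0).
  by rewrite (ts l k); case: ltngtP => _; rewrite ?addr0 ?add0r.
under eq_bigr do under eq_bigr do rewrite split3.
under eq_bigr do rewrite !big_split.
rewrite !big_split /= [X in _ + X]exchange_big /= -!big_split /=; apply: eq_bigr => k _.
rewrite -!big_split /=; apply: eq_bigr => l _.
by case: ltngtP => _; rewrite ?addr0 ?add0r // mulr_natl mulr2n.
Qed.

(** The sum counts all trees according to their cut at the centroid: this is
    [central_sum] for the constant function 1. Ordering the two branches by
    size doubles all terms except those on the diagonal. *)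
Lemma central_total n : (1 < n)%N ->
  \sum_(k < n.+1) \sum_(l < n.+1)
    (if central_region n k l then (if (k : nat) == l then 2^-1 else 1) * central_prob R n k l else 0) = 1.
Proof.
move=> n1; have [s [A [sA cA]]] := hole n.
have A1 : (1 < #|A|)%N by rewrite cA.
have w0 : (num_trees n)%:R != 0 :> R by rewrite pnatr_eq0 -lt0n num_trees_gt0 // ltnW.
pose sym k l := [&& 2 * k <= n, 2 * l <= n & n < 2 * (k + l)]%N.
have symC k l : sym k l = sym l k by rewrite /sym andbCA addnC.
have E : \sum_(k < n.+1) \sum_(l < n.+1) (if sym k l then central_prob R n k l / 2 else 0) = 1.
  have := central_sum (fun=> 1%N) sA A1; rewrite sum1_size size_trees_on cA => /(congr1 (fun m => m%:R : R)).
  rewrite natr_sum => W; apply: (mulfI w0); rewrite mulr1 [RHS]W.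
  pose h k l : R := if sym k l then (num_trees k)%:R * (num_trees l)%:R * (num_trees (n - k - l).+1)%:R else 0.
  transitivity (\sum_(p : {set 'I_n.+1} * {set 'I_n.+1} | [disjoint p.1 & p.2] && (p.1 :|: p.2 \subset A)) h #|p.1| #|p.2|).
    rewrite sum_parts_lattice cA mulr_sumr; apply: eq_bigr => k _.
    rewrite mulr_sumr; apply: eq_bigr => l _; rewrite /h; case: ifP => [/and3P[kn ln nkl]|]; last by rewrite !mulr0.
    have [k0 l0 kln] : [/\ 0 < k, 0 < l & k + l <= n]%N.
      by move: (k : nat) (l : nat) kn ln nkl => k' l'; split; lia.
    rewrite -central_probE //; field.
    by rewrite w0.
  rewrite [LHS]big_mkcond [RHS]big_mkcond; apply: eq_bigr => p _.
  case: (boolP [disjoint p.1 & p.2]) => //= d.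
  case: (boolP (p.1 :|: p.2 \subset A)) => //= sub.
  have cU : #|p.1 :|: p.2| = (#|p.1| + #|p.2|)%N by apply/eqP; rewrite (leq_card_setU p.1 p.2) d.
  rewrite cU /h /sym; case: ifP => // _.
  have cr : #|s |: A :\: (p.1 :|: p.2)| = (n - #|p.1| - #|p.2|).+1.
    by rewrite cardsU1 inE (negbTE sA) andbF /= -/(rest A p) card_rest ?d ?sub // cA.
  under eq_bigr do under eq_bigr do rewrite sum1_size size_trees_on cr.
  rewrite !big_const_seq !count_predT !size_trees_on !iter_addn_0 !natrM.
  by ring.
rewrite -[RHS]E (sum_symmetric _ (t := fun k l => if sym k l then central_prob R n k l / 2 else 0)); last first.
  by move=> k l; rewrite symC central_prob_sym.
apply: eq_bigr => k _; apply: eq_bigr => l _.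
rewrite (_ : central_region n k l = (k <= l)%N && sym k l); last first.
  by rewrite /central_region /sym; move: (k : nat) (l : nat) => k' l'; apply/idP/idP; lia.
case: leqP => //= _; case: (sym k l); last by case: ifP => _; rewrite ?mulr0.
by case: ifP => _; [rewrite mulrC|field].
Qed.

Lemma spinal_regionE n k l : (k + l <= n)%N ->
  spinal_region n k l = (2 * k <= n)%N && (n < 2 * (k + (n - k - l)))%N.
Proof. by move=> kl; rewrite /spinal_region; apply/idP/idP; lia. Qed.

(** The sum counts all trees according to their cut at the spine. *)
Lemma spinal_total n : (0 < n)%N ->
  \sum_(k < n.+1) \sum_(l < n.+1) (if spinal_region n k l then 1 * spinal_prob R n k l else 0) = 1.
Proof.
move=> n0; have [s [A [sA cA]]] := hole n.
have A1 : (0 < #|A|)%N by rewrite cA.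
have w0 : (num_trees n.+1)%:R != 0 :> R by rewrite pnatr_eq0 -lt0n num_trees_gt0.
have csU (X : {set 'I_n.+1}) : X \subset A -> #|s |: X| = #|X|.+1.
  by move=> XA; rewrite cardsU1 (contra (subsetP XA s) sA).
have := spinal_sum (fun=> 1%N) sA A1; rewrite sum1_size size_trees_on csU // cA => /(congr1 (fun m => m%:R : R)).
rewrite natrM natr_sum => W; apply: (mulfI w0); rewrite mulr1 [RHS]W.
pose h k l : R := if spinal_region n k l then
  (num_trees k.+1)%:R * (num_trees l.+1)%:R * (num_trees (n - k - l))%:R else 0.
transitivity (2 * \sum_(p : {set 'I_n.+1} * {set 'I_n.+1} | [disjoint p.1 & p.2] && (p.1 :|: p.2 \subset A)) h #|p.1| #|rest A p|).
  rewrite sum_parts_rest cA !mulr_sumr; apply: eq_bigr => k _.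
  rewrite !mulr_sumr; apply: eq_bigr => l _; rewrite /h; case: ifP => [/andP[kn ln]|]; last by rewrite !mulr0.
  have kln : (k + l < n)%N.
    by move: (k : nat) (l : nat) kn ln => k' l'; lia.
  by rewrite mul1r -spinal_probE //; field.
congr (_ * _).
rewrite [LHS]big_mkcond [RHS]big_mkcond; apply: eq_bigr => p _.
case: (boolP [disjoint p.1 & p.2]) => //= d.
case: (boolP (p.1 :|: p.2 \subset A)) => //= sub.
have cU : #|p.1 :|: p.2| = (#|p.1| + #|p.2|)%N by apply/eqP; rewrite (leq_card_setU p.1 p.2) d.
have p12 : (#|p.1| + #|p.2| <= n)%N by have := subset_leq_card sub; rewrite cU cA.
have cr : #|rest A p| = (n - #|p.1| - #|p.2|)%N by rewrite card_rest ?d ?sub // cA.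
have p2 : (n - #|p.1| - #|rest A p| = #|p.2|)%N by rewrite cr; move: p12; clear; move: #|p.1| #|p.2| => a b; lia.
have pr : (#|p.1| + #|rest A p| <= n)%N by rewrite cr; move: p12; clear; move: #|p.1| #|p.2| => a b; lia.
rewrite cU /h spinal_regionE // p2; case: ifP => // _.
have [p1A p2A] : p.1 \subset A /\ p.2 \subset A by apply/andP; rewrite -subUset.
rewrite -/(rest A p).
under eq_bigr do under eq_bigr do rewrite sum1_size size_trees_on csU ?subsetDl //.
rewrite !big_const_seq !count_predT !size_trees_on csU // !iter_addn_0 !natrM.
by ring.
Qed.

End Totals.

(** * The recursive lower bounds *)

Section PowerBound.
Variable R : realType.

(** The parabola lies below 1 and below the line 2 t - 1. For t <= 1 this line
    is below t, which is at most the power since the exponent is at most 1. *)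
Lemma powR_parabola (b d t : R) : 0 < b -> b <= 1 -> 0 < d -> 0 <= t ->
  1 - d - (t - 1) ^+ 2 / d <= t `^ b.
Proof.
move=> b0 b1 d0 t0.
have sq : (t - 1) ^+ 2 / d >= 2 * (1 - t) - d.
  rewrite ler_pdivlMr // -subr_ge0.
  by rewrite (_ : _ - _ = (1 - t - d) ^+ 2); [exact: sqr_ge0|ring].
have [t1|t1] := leP 1 t.
  have : 1 <= t `^ b.
    apply: le_trans (_ : 1 <= 1 `^ b) _; first by rewrite powR1.
    by apply: ge0_ler_powR => //; rewrite ?nnegrE ?(ltW b0).
  have : 0 <= (t - 1) ^+ 2 / d by rewrite divr_ge0 ?sqr_ge0 // ltW.
  lra.
have [tE|tn0] := eqVneq t 0.
  by move: sq; rewrite tE powR0 ?gt_eqF //; lra.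
have t1' : 0 < t <= 1 by rewrite lt_neqAle eq_sym tn0 t0 ltW.
have := ger1_powR t1' b1.
lra.
Qed.

(** k >= n ^ (3/4). The expected size of the intersection of two such subsets
    of a set of n elements is at least the square root of n, which tends to
    infinity. *)
Definition nice (n k : nat) := (n ^ 3 <= k ^ 4)%N.

Lemma nice_mean n k k' : (0 < n)%N -> nice n k -> nice n k' ->
  Num.sqrt n%:R <= k%:R * k'%:R / n%:R :> R.
Proof.
move=> n0 nk nk'; have n1 : 0 < n%:R :> R by rewrite ltr0n.
rewrite ler_pdivlMr //.
rewrite -(@ler_pXn2r _ 4) ?nnegrE ?mulr_ge0 ?sqrtr_ge0 //.
rewrite !exprMn (_ : 4 = 2 * 2)%N // [Num.sqrt _ ^+ _]exprM sqr_sqrtr //.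
rewrite -!natrX -!natrM ler_nat -expnD.
by rewrite (_ : (2 + 2 * 2 = 3 + 3)%N) // expnD leq_mul.
Qed.

Lemma nice_gt0 n k : (0 < n)%N -> nice n k -> (0 < k)%N.
Proof. by case: k => // n0; rewrite /nice exp0n // leqn0 expn_eq0 (gtn_eqF n0). Qed.

End PowerBound.

Section CoordinateBound.
Variables (T : finType) (R : realType) (A : {set T}).
Let J := ({set T} * {set T})%type.
Let act (pi : {perm T}) (p : J) : J := ([set pi x | x in p.1], [set pi x | x in p.2]).

Let act_inj pi : injective (act pi).
Proof.
by move=> [X Y] [X' Y'] [] /(imset_inj (@perm_inj _ pi)) -> /(imset_inj (@perm_inj _ pi)) ->.
Qed.

Let imsetD (pi : {perm T}) (B D : {set T}) :
  [set pi x | x in B :\: D] = [set pi x | x in B] :\: [set pi x | x in D].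
Proof.
apply/setP=> y; rewrite -(permKV pi y) inE !mem_imset; try exact: perm_inj.
by rewrite inE.
Qed.

Definition equivariant (X : J -> {set T}) := forall (pi : {perm T}) p,
  [set pi x | x in A] = A -> X (act pi p) = [set pi x | x in X p].

Lemma equivariant_fst : equivariant fst. Proof. by []. Qed.
Lemma equivariant_snd : equivariant snd. Proof. by []. Qed.
Lemma equivariant_rest : equivariant (rest A).
Proof. by move=> pi p piA; rewrite /rest /= -imsetU imsetD piA. Qed.

Definition invariant_weight (w : J -> R) := exchangeable A act w.

Lemma card_equivariant X (pi : {perm T}) p : equivariant X -> [set pi x | x in A] = A -> #|X (act pi p)| = #|X p|.
Proof. by move=> eX piA; rewrite eX // card_imset //; exact: perm_inj. Qed.

Lemma disjoint_act (pi : {perm T}) (X Y : {set T}) :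
  [disjoint [set pi x | x in X] & [set pi x | x in Y]] = [disjoint X & Y].
Proof.
rewrite -!setI_eq0 -imsetI; last by move=> x y _ _; exact: perm_inj.
by rewrite imset_eq0.
Qed.

Lemma subset_act (pi : {perm T}) (X : {set T}) : [set pi x | x in A] = A ->
  ([set pi x | x in X] \subset A) = (X \subset A).
Proof.
move=> piA; rewrite -{1}piA; apply/subsetP/subsetP => sub x; last first.
  by move=> /imsetP[y yX ->]; apply: imset_f; exact: sub.
by move=> xX; rewrite -(mem_act pi); apply: sub; exact: imset_f.
Qed.

Variables (X : J -> {set T}) (w : J -> R) (b c d : R).
Hypothesis eX : equivariant X.
Hypothesis ew : invariant_weight w.
Hypothesis w0 : forall p, 0 <= w p.
Hypothesis wX : forall p, w p != 0 -> (X p \subset A) && nice #|A| #|X p|.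
Hypothesis A1 : (1 < #|A|)%N.
Hypothesis b0 : 0 < b.
Hypothesis b1 : b <= 1.
Hypothesis c0 : 0 <= c.
Hypothesis d0 : 0 < d.

(** The contribution of one pair of pieces to the recursion. The size of the
    intersection is concentrated around |A| times the product of the relative
    sizes of the two pieces, by [concentration] for [powR_parabola], and these
    are independent: hence the square of a single moment. *)
Lemma coordinate_bound :
  (1 - d - (d * Num.sqrt #|A|%:R)^-1) *
    (c * #|A|%:R `^ b * (\sum_p w p * (#|X p|%:R / #|A|%:R) `^ b) ^+ 2) <=
  \sum_p \sum_p' w p * w p' * (c * #|X p :&: X p'|%:R `^ b).
Proof.
have n0 : 0 < #|A|%:R :> R by rewrite ltr0n ltnW.
rewrite exchange_big /=.
pose M p' p : R := c * (#|X p|%:R * #|X p'|%:R / #|A|%:R) `^ b.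
set K := 1 - d - _; set S := \sum_p w p * _.
have inner p' : \sum_p w p * M p' p = c * #|A|%:R `^ b * (#|X p'|%:R / #|A|%:R) `^ b * S.
  rewrite mulr_sumr /=; apply: eq_bigr => p _.
  rewrite /M (_ : _ / _ = #|A|%:R * ((#|X p|%:R / #|A|%:R) * (#|X p'|%:R / #|A|%:R))); last first.
    by field; rewrite gt_eqF.
  rewrite !powRM ?mulr_ge0 ?invr_ge0 ?ler0n //.
  ring.
have -> : K * (c * #|A|%:R `^ b * S ^+ 2) = \sum_p' w p' * (K * \sum_p w p * M p' p).
  under [RHS]eq_bigr do rewrite inner.
  rewrite (eq_bigr (fun p' => (K * c * #|A|%:R `^ b * S) * (w p' * (#|X p'|%:R / #|A|%:R) `^ b))); last first.
    by move=> p' _; ring.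
  by rewrite -mulr_sumr -/S; ring.
apply: ler_sum => p' _.
rewrite [X in _ <= X](eq_bigr (fun p => w p' * (w p * (c * #|X p :&: X p'|%:R `^ b)))); last first.
  by move=> p _; rewrite [RHS]mulrCA !mulrA.
rewrite -mulr_sumr; have [->|wp'] := eqVneq (w p') 0; first by rewrite !mul0r.
rewrite ler_wpM2l //.
have /andP[p'A np'] := wX wp'.
apply: (@concentration _ R A _ act X act_inj _ A1 w (M p') (X p') (fun m => c * m%:R `^ b) d (Num.sqrt #|A|%:R)) => //.
- by move=> pi p piA; rewrite /M card_equivariant.
- by move=> p; rewrite mulr_ge0 ?powR_ge0.
- by move=> p /wX /andP[].
- by rewrite sqrtr_gt0.
- by move=> p /wX /andP[_ np]; apply: nice_mean => //; exact: ltnW.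
move=> p wp /=; have /andP[pA np] := wX wp.
have mu0 : 0 < #|X p|%:R * #|X p'|%:R / #|A|%:R :> R.
  by apply: lt_le_trans (nice_mean _ (ltnW A1) np np'); rewrite sqrtr_gt0.
set m := #|X p|%:R * _ / _ in mu0 *; rewrite /M -/m -mulrA ler_wpM2l //.
set x := #|X p :&: X p'|%:R.
have -> : x `^ b = m `^ b * (x / m) `^ b.
  by rewrite -powRM ?divr_ge0 ?ler0n ?(ltW mu0) // mulrCA divff ?mulr1 // gt_eqF.
rewrite ler_wpM2l ?powR_ge0 //; apply: powR_parabola => //.
by rewrite divr_ge0 ?ler0n // ltW.
Qed.

End CoordinateBound.

(** ** One step of the recursion *)

Section Step.
Variables (T : finType) (R : realType) (A : {set T}) (s : T) (b c al d : R).
Local Notation n := #|A|.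
Hypothesis sA : s \notin A.
Hypothesis A1 : (1 < n)%N.
Hypothesis b0 : 0 < b.
Hypothesis b1 : b <= 1.
Hypothesis c0 : 0 <= c.
Hypothesis al0 : 0 <= al.
Hypothesis d0 : 0 < d.
Hypothesis HF : forall I : {set T}, I \subset A -> (#|I| < n)%N ->
  c * #|I|%:R `^ b * (num_trees #|I|)%:R ^+ 2 <= (total_agreement I finset.set0)%:R.
Hypothesis HG : forall I : {set T}, I \subset A -> (#|I| < n)%N ->
  c * al * #|I|%:R `^ b * (num_trees #|I|.+1)%:R ^+ 2 <= (total_agreement I [set s]%SET)%:R.

(** All pieces are large enough for concentration. Decompositions with smaller
    pieces are given up; they are negligible in the limit. *)
Definition good (m k l : nat) := [&& (k + l <= m)%N, nice m k, nice m l & nice m (m - k - l)].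

Definition central_power (x : nat -> nat -> nat -> nat) (m k l : nat) : R :=
  if good m k l && (k < l)%N then ((x m k l)%:R / m%:R) `^ b else 0.

Definition spinal_power (x : nat -> nat -> nat -> nat) (m k l : nat) : R :=
  if good m k l then ((x m k l)%:R / m%:R) `^ b else 0.

Definition central_moment x (m : nat) : R :=
  \sum_(k < m.+1) \sum_(l < m.+1)
    (if central_region m k l then central_power x m k l * central_prob R m k l else 0).

Definition spinal_moment x (m : nat) : R :=
  \sum_(k < m.+1) \sum_(l < m.+1)
    (if spinal_region m k l then spinal_power x m k l * spinal_prob R m k l else 0).

(** The pieces are numbered like the coordinates of the limit law. *)
Definition size1 (m k l : nat) := k.
Definition size2 (m k l : nat) := l.
Definition size3 (m k l : nat) := (m - k - l)%N.

Let phiF (m : nat) : R := c * m%:R `^ b.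
Let phiG (m : nat) : R := c * al * m%:R `^ b.

Let n0 : (0 < n)%N. Proof. exact: ltnW. Qed.

Let K := 1 - d - (d * Num.sqrt n%:R)^-1.

Section CentralStep.

Let P p := central_parts A p && good n #|p.1| #|p.2| && (#|p.1| < #|p.2|)%N.
Let w p : R := if P p then weightF R A p else 0.

Let w0 p : 0 <= w p.
Proof. by rewrite /w; case: ifP => // _; rewrite /weightF !mulr_ge0. Qed.

Let PP p : P p -> [/\ [disjoint p.1 & p.2] && (p.1 :|: p.2 \subset A),
  #|rest A p| = (n - #|p.1| - #|p.2|)%N & good n #|p.1| #|p.2|].
Proof.
move=> /andP[/andP[/and5P[dp sub _ _ _] gd] _]; rewrite dp sub; split=> //.
by rewrite card_rest // dp.
Qed.

Let ew : invariant_weight A w.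
Proof.
move=> pi p piA; rewrite /w /P /central_parts /weightF.
rewrite (card_equivariant p (@equivariant_rest _ A) piA) /= disjoint_act -imsetU subset_act //.
by rewrite !card_imset //; exact: perm_inj.
Qed.

Let wP p : w p != 0 -> P p.
Proof. by rewrite /w; case: ifP => //; rewrite eqxx. Qed.

Let wX1 p : w p != 0 -> (p.1 \subset A) && nice n #|p.1|.
Proof. by move=> /wP/PP[/andP[_]]; rewrite subUset => /andP[-> _] _ /and4P[]. Qed.
Let wX2 p : w p != 0 -> (p.2 \subset A) && nice n #|p.2|.
Proof. by move=> /wP/PP[/andP[_]]; rewrite subUset => /andP[_ ->] _ /and4P[]. Qed.
Let wX3 p : w p != 0 -> (rest A p \subset A) && nice n #|rest A p|.
Proof. by move=> /wP/PP[_ -> /and4P[_ _ _ ->]]; rewrite subsetDl. Qed.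

Let moment_sum (x : nat -> nat -> nat -> nat) (X : {set T} * {set T} -> {set T}) :
  (forall p : {set T} * {set T}, [disjoint p.1 & p.2] && (p.1 :|: p.2 \subset A) -> #|X p| = x n #|p.1| #|p.2|) ->
  \sum_p w p * (#|X p|%:R / n%:R) `^ b = (num_trees n)%:R / 2 * central_moment x n.
Proof.
move=> Xx.
have wn0 : (num_trees n)%:R != 0 :> R by rewrite pnatr_eq0 -lt0n num_trees_gt0.
pose h k l : R := if central_region n k l then central_power x n k l *
   ((num_trees k)%:R * (num_trees l)%:R * (num_trees (n - k - l).+1)%:R) else 0.
transitivity (\sum_(p : {set T} * {set T} | [disjoint p.1 & p.2] && (p.1 :|: p.2 \subset A)) h #|p.1| #|p.2|).
  rewrite [RHS]big_mkcond; apply: eq_bigr => p _; rewrite /w.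
  case: (boolP ([disjoint p.1 & p.2] && (p.1 :|: p.2 \subset A))) => [ds|nds]; last first.
    case: ifP => [|_]; last by rewrite mul0r.
    by move=> /PP[]; rewrite (negbTE nds).
  have [dp sub] := andP ds.
  have cU : #|p.1 :|: p.2| = (#|p.1| + #|p.2|)%N by apply/eqP; rewrite (leq_card_setU p.1 p.2) dp.
  have PE : P p = central_region n #|p.1| #|p.2| && (good n #|p.1| #|p.2| && (#|p.1| < #|p.2|)%N).
    rewrite /P /central_parts dp sub cU /= -andbA.
    case: (boolP (good n #|p.1| #|p.2|)) => gd; last by rewrite !andbF.
    have /and4P[_ /(nice_gt0 n0) k0 _ _] := gd.
    by rewrite /central_region /=; move: k0; clear; move: #|p.1| #|p.2| => k l k0; apply/idP/idP; lia.
  rewrite PE /h /central_power; case: (central_region _ _ _) => /=; last by rewrite mul0r.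
  case: ifP => _; last by rewrite !mul0r.
  by rewrite /weightF card_rest // Xx // mulrC.
rewrite sum_parts_lattice /central_moment mulr_sumr; apply: eq_bigr => k _.
rewrite mulr_sumr; apply: eq_bigr => l _; rewrite /h.
case: ifP => [/and4P[k0 kl ln nkl]|]; last by rewrite !mulr0.
have [l0 kln] : (0 < l)%N /\ (k + l <= n)%N.
  by move: (k : nat) (l : nat) k0 kl ln nkl => k' l'; split; lia.
rewrite -central_probE //; field.
by rewrite wn0.
Qed.

(** The induction step: the recursive inequality, bounded term by term by
    [coordinate_bound]. The factor [K] is the loss by concentration. The total
    weight of the ordered decompositions is half of the number of trees, which
    compensates the factor 4. *)
Lemma central_step :
  K * (c * n%:R `^ b * (central_moment size1 n ^+ 2 + central_moment size2 n ^+ 2 +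
     al * central_moment size3 n ^+ 2)) * (num_trees n)%:R ^+ 2 <= (total_agreement A finset.set0)%:R.
Proof.
have PP' p : P p -> central_parts A p && (#|p.1| < #|p.2|)%N by move=> /andP[/andP[-> _] ->].
have phiF0 : phiF 0 = 0 by rewrite /phiF powR0 ?mulr0 // gt_eqF.
apply: le_trans (central_recursion (phiF := phiF) (phiG := phiG) sA phiF0 HF HG A1 PP').
have B1 := coordinate_bound (@equivariant_fst _ A) ew w0 wX1 A1 b0 b1 c0 d0.
have B2 := coordinate_bound (@equivariant_snd _ A) ew w0 wX2 A1 b0 b1 c0 d0.
have B3 := coordinate_bound (@equivariant_rest _ A) ew w0 wX3 A1 b0 b1 (mulr_ge0 c0 al0) d0.
rewrite -/K in B1 B2 B3.
rewrite (@moment_sum size1) // in B1.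
rewrite (@moment_sum size2) // in B2.
rewrite (@moment_sum size3) // in B3; last by move=> p /card_rest.
apply: (@le_trans _ _ (4 * (\sum_p \sum_p' w p * w p' * (c * #|p.1 :&: p'.1|%:R `^ b) +
   \sum_p \sum_p' w p * w p' * (c * #|p.2 :&: p'.2|%:R `^ b) +
   \sum_p \sum_p' w p * w p' * (c * al * #|rest A p :&: rest A p'|%:R `^ b)))).
  apply: (@le_trans _ _ (4 * (K * (c * n%:R `^ b * ((num_trees n)%:R / 2 * central_moment size1 n) ^+ 2) +
     K * (c * n%:R `^ b * ((num_trees n)%:R / 2 * central_moment size2 n) ^+ 2) +
     K * (c * al * n%:R `^ b * ((num_trees n)%:R / 2 * central_moment size3 n) ^+ 2)))).
    by rewrite le_eqVlt; apply/orP; left; apply/eqP; field.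
  by rewrite ler_pM2l // !lerD.
rewrite ler_pM2l // -!big_split /= [X in _ <= X]big_mkcond; apply: ler_sum => p _.
rewrite -!big_split /=; case: ifP => Pp; last first.
  by rewrite big1 // => p' _; rewrite /w Pp !mul0r !addr0.
rewrite [X in _ <= X]big_mkcond; apply: ler_sum => p' _; rewrite /w Pp; case: ifP => Pp'; last first.
  by rewrite !mulr0 !mul0r !addr0.
by rewrite -!mulrDr.
Qed.

End CentralStep.

Section SpinalStep.

Let P p := spinal_parts A p && good n #|p.1| #|rest A p|.
Let w p : R := if P p then weightG R A p else 0.

Let w0 p : 0 <= w p.
Proof. by rewrite /w; case: ifP => // _; rewrite /weightG !mulr_ge0. Qed.

Let size_p2 (p : {set T} * {set T}) : [disjoint p.1 & p.2] && (p.1 :|: p.2 \subset A) ->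
  (#|p.1| + #|rest A p| <= n)%N /\ #|p.2| = (n - #|p.1| - #|rest A p|)%N.
Proof.
move=> ds; have [dp sub] := andP ds; rewrite card_rest //.
have cU : #|p.1 :|: p.2| = (#|p.1| + #|p.2|)%N by apply/eqP; rewrite (leq_card_setU p.1 p.2) dp.
have := subset_leq_card sub; rewrite cU; clear.
by move: #|p.1| #|p.2| #|A| => k l m; lia.
Qed.

Let PP p : P p -> [/\ [disjoint p.1 & p.2] && (p.1 :|: p.2 \subset A),
  nice n #|p.1|, nice n #|p.2| & nice n #|rest A p|].
Proof.
move=> /andP[/and4P[dp sub _ _] gd]; have ds : [disjoint p.1 & p.2] && (p.1 :|: p.2 \subset A) by rewrite dp.
have [_ E] := size_p2 ds.
by split=> //; move: gd => /and4P[_ g1 g2]; rewrite -?E.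
Qed.

Let ew : invariant_weight A w.
Proof.
move=> pi p piA; rewrite /w /P /spinal_parts /weightG.
rewrite (card_equivariant p (@equivariant_rest _ A) piA) /= disjoint_act -imsetU subset_act //.
by rewrite !card_imset //; exact: perm_inj.
Qed.

Let wP p : w p != 0 -> P p.
Proof. by rewrite /w; case: ifP => //; rewrite eqxx. Qed.

Let wX1 p : w p != 0 -> (p.1 \subset A) && nice n #|p.1|.
Proof. by move=> /wP/PP[/andP[_]]; rewrite subUset => /andP[-> _] ->. Qed.
Let wX2 p : w p != 0 -> (p.2 \subset A) && nice n #|p.2|.
Proof. by move=> /wP/PP[/andP[_]]; rewrite subUset => /andP[_ ->] _ ->. Qed.
Let wX3 p : w p != 0 -> (rest A p \subset A) && nice n #|rest A p|.
Proof. by move=> /wP/PP[_ _ _ ->]; rewrite subsetDl. Qed.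

Let moment_sum (x : nat -> nat -> nat -> nat) (X : {set T} * {set T} -> {set T}) :
  (forall p : {set T} * {set T}, [disjoint p.1 & p.2] && (p.1 :|: p.2 \subset A) -> #|X p| = x n #|p.1| #|rest A p|) ->
  \sum_p w p * (#|X p|%:R / n%:R) `^ b = (num_trees n.+1)%:R / 2 * spinal_moment x n.
Proof.
move=> Xx.
have wn0 : (num_trees n.+1)%:R != 0 :> R by rewrite pnatr_eq0 -lt0n num_trees_gt0.
pose h k l : R := if spinal_region n k l then spinal_power x n k l *
   ((num_trees k.+1)%:R * (num_trees l.+1)%:R * (num_trees (n - k - l))%:R) else 0.
transitivity (\sum_(p : {set T} * {set T} | [disjoint p.1 & p.2] && (p.1 :|: p.2 \subset A)) h #|p.1| #|rest A p|).
  rewrite [RHS]big_mkcond; apply: eq_bigr => p _; rewrite /w.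
  case: (boolP ([disjoint p.1 & p.2] && (p.1 :|: p.2 \subset A))) => [ds|nds]; last first.
    case: ifP => [|_]; last by rewrite mul0r.
    by move=> /PP[]; rewrite (negbTE nds).
  have [dp sub] := andP ds; have [kln p2E] := size_p2 ds.
  have cU : #|p.1 :|: p.2| = (#|p.1| + #|p.2|)%N by apply/eqP; rewrite (leq_card_setU p.1 p.2) dp.
  have PE : P p = spinal_region n #|p.1| #|rest A p| && good n #|p.1| #|rest A p|.
    by rewrite /P /spinal_parts dp sub cU /= spinal_regionE // -p2E.
  rewrite PE /h /spinal_power; case: (spinal_region _ _ _) => /=; last by rewrite mul0r.
  case: ifP => _; last by rewrite !mul0r.
  by rewrite /weightG Xx // -p2E; ring.
rewrite sum_parts_rest /spinal_moment mulr_sumr; apply: eq_bigr => k _.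
rewrite mulr_sumr; apply: eq_bigr => l _; rewrite /h.
case: ifP => [/andP[kn ln]|]; last by rewrite !mulr0.
have kln : (k + l < n)%N by move: (k : nat) (l : nat) kn ln => k' l'; lia.
rewrite -spinal_probE //; field.
by rewrite wn0.
Qed.

(** As [central_step]; the second coordinate is the rest, and the third one
    the branch with one root. *)
Lemma spinal_step :
  K * (c * n%:R `^ b * (al * spinal_moment size1 n ^+ 2 + al * spinal_moment size2 n ^+ 2 +
     spinal_moment size3 n ^+ 2)) * (num_trees n.+1)%:R ^+ 2 <= (total_agreement A [set s]%SET)%:R.
Proof.
have PP' p : P p -> spinal_parts A p && (#|p.2| < n)%N.
  move=> Pp; have [ds np _ _] := PP Pp; have [-> _] := andP Pp.
  have [kln ->] := size_p2 ds; have k0 := nice_gt0 n0 np.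
  by move: kln k0 n0; clear; move: #|p.1| #|rest A p| #|A| => k l m; lia.
have phiF0 : phiF 0 = 0 by rewrite /phiF powR0 ?mulr0 // gt_eqF.
apply: le_trans (spinal_recursion (phiF := phiF) (phiG := phiG) sA phiF0 HF HG n0 PP').
have B1 := coordinate_bound (@equivariant_fst _ A) ew w0 wX1 A1 b0 b1 (mulr_ge0 c0 al0) d0.
have B2 := coordinate_bound (@equivariant_snd _ A) ew w0 wX2 A1 b0 b1 c0 d0.
have B3 := coordinate_bound (@equivariant_rest _ A) ew w0 wX3 A1 b0 b1 (mulr_ge0 c0 al0) d0.
rewrite -/K in B1 B2 B3.
rewrite (@moment_sum size1) // in B1.
rewrite (@moment_sum size3) // in B2; last by move=> p /size_p2[].
rewrite (@moment_sum size2) // in B3.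
apply: (@le_trans _ _ (4 * (\sum_p \sum_p' w p * w p' * (c * al * #|p.1 :&: p'.1|%:R `^ b) +
   \sum_p \sum_p' w p * w p' * (c * #|p.2 :&: p'.2|%:R `^ b) +
   \sum_p \sum_p' w p * w p' * (c * al * #|rest A p :&: rest A p'|%:R `^ b)))).
  apply: (@le_trans _ _ (4 * (K * (c * al * n%:R `^ b * ((num_trees n.+1)%:R / 2 * spinal_moment size1 n) ^+ 2) +
     K * (c * n%:R `^ b * ((num_trees n.+1)%:R / 2 * spinal_moment size3 n) ^+ 2) +
     K * (c * al * n%:R `^ b * ((num_trees n.+1)%:R / 2 * spinal_moment size2 n) ^+ 2)))).
    by rewrite le_eqVlt; apply/orP; left; apply/eqP; field.
  by rewrite ler_pM2l // !lerD.
rewrite ler_pM2l // -!big_split /= [X in _ <= X]big_mkcond; apply: ler_sum => p _.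
rewrite -!big_split /=; case: ifP => Pp; last first.
  by rewrite big1 // => p' _; rewrite /w Pp !mul0r !addr0.
rewrite [X in _ <= X]big_mkcond; apply: ler_sum => p' _; rewrite /w Pp; case: ifP => Pp'; last first.
  by rewrite !mulr0 !mul0r !addr0.
by rewrite -!mulrDr.
Qed.

End SpinalStep.

End Step.

(** * Limits of the split moments *)

Section MomentLimits.
Local Open Scope classical_set_scope.
Local Open Scope ring_scope.
Variable R : realType.
Local Notation line := (measurableTypeR R).
Local Notation plane := (line * line)%type.
Local Notation mu := (@lebesgue_measure R \x @lebesgue_measure R)%E.
Local Notation tr n x := (Num.trunc (n%:R * x)).

Lemma cvg_powR (b x : R) (f : nat -> R) : 0 < x -> f @ \oo --> x -> f n `^ b @[n --> \oo] --> x `^ b.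
Proof.
move=> x0 fx; apply: (@cvg_comp _ _ _ f (fun t => t `^ b) _ _ _ fx).
have := is_derive1_powR b x0 => d.
have cont : {for x, continuous (fun t : R => t `^ b)}.
  by apply: differentiable_continuous; apply/derivable1_diffP; exact: ex_derive.
exact: cont.
Qed.

Lemma near_nice (x : R) (k : nat -> nat) : 0 < x -> (k n)%:R / n%:R @[n --> \oo] --> x ->
  \forall n \near \oo, nice n (k n).
Proof.
move=> x0 kx.
near=> n.
have n0 : 0 < n%:R :> R by near: n; exists 1%N => // n /=; rewrite ltr0n.
have kn : x / 2 < (k n)%:R / n%:R by near: n; apply: (cvgr_gt _ kx); lra.
have x4 : 0 < (x / 2) ^+ 4 by rewrite exprn_gt0 // divr_gt0.
have xn : 1 <= (x / 2) ^+ 4 * n%:R.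
  by rewrite -ler_pdivrMl // mulr1; near: n; exact: nbhs_infty_ger.
rewrite ltr_pdivlMr // in kn.
rewrite /nice -(ler_nat R) !natrX.
apply: (@le_trans _ _ ((x / 2 * n%:R) ^+ 4)).
  by rewrite exprMn (exprS _ 3) mulrA ler_peMl // exprn_ge0 // ltW.
by rewrite lerXn2r ?nnegrE ?mulr_ge0 ?divr_ge0 ?(ltW x0) // ltW.
Unshelve. all: by end_near. Qed.

Section FixedConstant.
Variable c : R.
Hypothesis qc : catalan_sqrt R @ \oo --> c.
Hypothesis c0 : 0 < c.

Let c20 : 0 < c ^+ 2 / 2. Proof. by rewrite divr_gt0 // exprn_gt0. Qed.

(** The probabilities of all splits add up to 1 by [central_total], and so
    does their limit. In particular the normalizing constant of the Dirichlet
    law is [c ^+ 2 / 2]. *)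
Lemma U_total : (\int[mu]_z (U_density c z)%:E = 1)%E.
Proof.
pose g (n k l : nat) : R := if k == l then 2^-1 else 1.
have g01 n k l : 0 <= g n k l <= 1.
  by rewrite /g; case: ifP => _; rewrite ?invr_ge0 ?ler01 ?lexx ?ler0n //= invf_le1 ?ler1n.
have m1 : measurable_fun [set: plane] (fun _ : plane => 1 : R) by [].
have gl (x y : R) : 0 < x -> x < y -> y < 2^-1 -> 2^-1 < x + y ->
    g n (tr n x) (tr n y) @[n --> \oo] --> (1 : R).
  move=> x0 xy y2 xy2; apply: cvg_near_cst; near=> n.
  have : 0 < -1 * (tr n x)%:R + 1 * (tr n y)%:R + 0 * n%:R :> R.
    by near: n; apply: (@near_trunc R x y (-1) 1 0); lra.
  by rewrite /g; case: eqP => [->|//]; rewrite mulN1r mul1r mul0r addr0 addNr ltxx.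
have [_ cv] := central_sums_cvg qc c0 g01 m1 gl.
have -> : (\int[mu]_z (U_density c z)%:E = \int[mu]_z (1 * U_density c z)%:E)%E.
  by apply: eq_integral => z _; rewrite mul1r.
move/cvg_lim: cv => <- //; apply: cvg_lim => //.
apply: cvg_near_cst; exists 2%N => // n /= n2; congr EFin.
exact: central_total.
Unshelve. all: by end_near. Qed.

Lemma V_total : (\int[mu]_z (V_density c z)%:E = 1)%E.
Proof.
pose g (n k l : nat) : R := 1.
have g01 n k l : 0 <= g n k l <= 1 by rewrite /g ler01 lexx.
have m1 : measurable_fun [set: plane] (fun _ : plane => 1 : R) by [].
have gl (x y : R) : 0 < x -> x < 2^-1 -> 0 < y -> y < 2^-1 ->
    g n (tr n x) (tr n y) @[n --> \oo] --> (1 : R) by move=> *; exact: cvg_cst.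
have [_ cv] := spinal_sums_cvg qc c0 g01 m1 gl.
have -> : (\int[mu]_z (V_density c z)%:E = \int[mu]_z (1 * V_density c z)%:E)%E.
  by apply: eq_integral => z _; rewrite mul1r.
move/cvg_lim: cv => <- //; apply: cvg_lim => //.
apply: cvg_near_cst; exists 1%N => // n /= n2; congr EFin.
exact: spinal_total.
Qed.

Section Coordinate.
Variables (b : R) (x : nat -> nat -> nat -> nat) (X : real_triple R -> R).
Hypothesis b0 : 0 < b.
Hypothesis x_le : forall m k l, (k + l <= m)%N -> (x m k l <= m)%N.
Hypothesis mX : measurable_fun [set: real_triple R] X.
Hypothesis X_pos : forall u v, 0 < u -> 0 < v -> u + v < 1 -> 0 < X (chart (u, v)).
Hypothesis x_cvg : forall u v, 0 < u -> 0 < v -> u + v < 1 ->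
  (x n (tr n u) (tr n v))%:R / n%:R @[n --> \oo] --> X (chart (u, v)).

Let gam (z : plane) : R := X (chart z) `^ b.

Let mgam : measurable_fun [set: plane] gam.
Proof.
apply: measurableT_comp (@measurable_powR R b) _.
exact: measurableT_comp mX (@measurable_chart R).
Qed.

Let ratio01 m k l : (k + l <= m)%N -> 0 <= ((x m k l)%:R / m%:R) `^ b <= 1.
Proof.
move=> klm; rewrite powR_ge0 /=; apply: le_trans (_ : _ <= 1 `^ b) _; last by rewrite powR1.
apply: ge0_ler_powR; rewrite ?nnegrE ?divr_ge0 ?(ltW b0) //.
case: m klm => [|m] klm; first by rewrite invr0 mulr0.
by rewrite ler_pdivrMr ?ltr0n // mul1r ler_nat x_le.
Qed.

Let near_good (u v : R) : 0 < u -> 0 < v -> u + v < 1 ->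
  \forall n \near \oo, good n (tr n u) (tr n v).
Proof.
move=> u0 v0 uv; have A := near_nice u0 (trunc_ratio_cvg (ltW u0)).
have B := near_nice v0 (trunc_ratio_cvg (ltW v0)).
have w0 : 0 < 1 - u - v by lra.
have C := near_nice w0 (rest_ratio_cvg c0 u0 v0 uv).
near=> n; apply/and4P; split; try by near: n.
exact: (trunc_parts u0 v0 uv).
Unshelve. all: by end_near. Qed.

(** The decompositions that are not good disappear in the limit, since at an
    interior point of the domain all pieces are of order n. *)
Lemma U_moment_cvg :
  mu.-integrable [set: plane] (EFin \o (fun z => X (chart z) `^ b * U_density c z)) /\
  central_moment b x n @[n --> \oo] --> moment (U_law R) X b.
Proof.
have g01 n k l : 0 <= central_power b x n k l <= 1.
  rewrite /central_power; case: ifP => [/andP[/and4P[kl _ _ _] _]|_]; first exact: ratio01.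
  by rewrite lexx ler01.
have gl (u v : R) : 0 < u -> u < v -> v < 2^-1 -> 2^-1 < u + v ->
    central_power b x n (tr n u) (tr n v) @[n --> \oo] --> gam (u, v).
  move=> u0 uv v2 uv2; have v0 : 0 < v by lra.
  have uv1 : u + v < 1 by lra.
  rewrite -[gam _]/(X (chart (u, v)) `^ b).
  have P := cvg_powR (b := b) (X_pos u0 v0 uv1) (x_cvg u0 v0 uv1); apply: cvg_trans P.
  apply: near_eq_cvg; near=> n; rewrite /central_power ifT //.
  apply/andP; split; first by near: n; exact: near_good.
  have : 0 < -1 * (tr n u)%:R + 1 * (tr n v)%:R + 0 * n%:R :> R.
    by near: n; apply: (@near_trunc R u v (-1) 1 0); lra.
  by rewrite -(ltr_nat R); lra.
have [int cv] := central_sums_cvg qc c0 g01 mgam gl; split=> //.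
rewrite (dirichlet_moment _ c20 U_total) //; last first.
have fin : (\int[mu]_z (gam z * U_density c z)%:E)%E \is a fin_num.
  exact: integrable_fin_num int.
move: cv; rewrite -(fineK fin) => /fine_cvgP[_].
exact.
Unshelve. all: by end_near. Qed.

Lemma V_moment_cvg :
  mu.-integrable [set: plane] (EFin \o (fun z => X (chart z) `^ b * V_density c z)) /\
  spinal_moment b x n @[n --> \oo] --> moment (V_law R) X b.
Proof.
have g01 n k l : 0 <= spinal_power b x n k l <= 1.
  rewrite /spinal_power; case: ifP => [/and4P[kl _ _ _]|_]; first exact: ratio01.
  by rewrite lexx ler01.
have gl (u v : R) : 0 < u -> u < 2^-1 -> 0 < v -> v < 2^-1 ->
    spinal_power b x n (tr n u) (tr n v) @[n --> \oo] --> gam (u, v).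
  move=> u0 u2 v0 v2.
  have uv1 : u + v < 1 by lra.
  rewrite -[gam _]/(X (chart (u, v)) `^ b).
  have P := cvg_powR (b := b) (X_pos u0 v0 uv1) (x_cvg u0 v0 uv1); apply: cvg_trans P.
  apply: near_eq_cvg; near=> n; rewrite /spinal_power ifT //.
  by near: n; exact: near_good.
have [int cv] := spinal_sums_cvg qc c0 g01 mgam gl; split=> //.
rewrite (dirichlet_moment _ c20 V_total) //; last first.
have fin : (\int[mu]_z (gam z * V_density c z)%:E)%E \is a fin_num.
  exact: integrable_fin_num int.
move: cv; rewrite -(fineK fin) => /fine_cvgP[_].
exact.
Unshelve. all: by end_near. Qed.

End Coordinate.

Lemma size1_cvg (u v : R) : 0 < u -> 0 < v -> u + v < 1 ->
  (size1 n (tr n u) (tr n v))%:R / n%:R @[n --> \oo] --> coord1 (chart (u, v)).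
Proof. by move=> u0 v0 uv; exact: trunc_ratio_cvg (ltW u0). Qed.

Lemma size2_cvg (u v : R) : 0 < u -> 0 < v -> u + v < 1 ->
  (size2 n (tr n u) (tr n v))%:R / n%:R @[n --> \oo] --> coord2 (chart (u, v)).
Proof. by move=> u0 v0 uv; exact: trunc_ratio_cvg (ltW v0). Qed.

Lemma size3_cvg (u v : R) : 0 < u -> 0 < v -> u + v < 1 ->
  (size3 n (tr n u) (tr n v))%:R / n%:R @[n --> \oo] --> coord3 (chart (u, v)).
Proof. by move=> u0 v0 uv; exact: rest_ratio_cvg c0 u0 v0 uv. Qed.

End FixedConstant.

End MomentLimits.

(** * The exponent inequalities *)

Section Comparison.
Local Open Scope classical_set_scope.
Local Open Scope ring_scope.
Variable R : realType.
Local Notation line := (measurableTypeR R).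
Local Notation plane := (line * line)%type.
Local Notation mu := (@lebesgue_measure R \x @lebesgue_measure R)%E.

Lemma le_moment (E : set (real_triple R)) (mE : measurable E) (a1 a2 a3 C lam p q : R)
    (X : real_triple R -> R) :
  0 < C -> (\int[mu]_z (scaled_density E a1 a2 a3 C z)%:E = 1)%E ->
  measurable_fun [set: real_triple R] X ->
  mu.-integrable [set: plane] (EFin \o (fun z => X (chart z) `^ p * scaled_density E a1 a2 a3 C z)) ->
  mu.-integrable [set: plane] (EFin \o (fun z => X (chart z) `^ q * scaled_density E a1 a2 a3 C z)) ->
  0 <= lam -> (forall x, E x -> lam * X x `^ p <= X x `^ q) ->
  lam * moment (dirichlet mE a1 a2 a3) X p <= moment (dirichlet mE a1 a2 a3) X q.
Proof.
move=> C0 tot mX ip iq lam0 le.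
rewrite !(dirichlet_moment mE C0 tot) //.
have d0 z : 0 <= scaled_density E a1 a2 a3 C z by exact: scaled_density_ge0.
have fp : (\int[mu]_z (X (chart z) `^ p * scaled_density E a1 a2 a3 C z)%:E)%E \is a fin_num.
  exact: integrable_fin_num ip.
have fq : (\int[mu]_z (X (chart z) `^ q * scaled_density E a1 a2 a3 C z)%:E)%E \is a fin_num.
  exact: integrable_fin_num iq.
have -> : lam * fine (\int[mu]_z (X (chart z) `^ p * scaled_density E a1 a2 a3 C z)%:E)%E =
    fine (lam%:E * \int[mu]_z (X (chart z) `^ p * scaled_density E a1 a2 a3 C z)%:E)%E.
  by rewrite fineM.
have mp : measurable_fun [set: plane] (fun z => (X (chart z) `^ p * scaled_density E a1 a2 a3 C z)%:E).
  exact: (measurable_int mu ip).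
rewrite -ge0_integralZl_EFin //; last by move=> z _; rewrite lee_fin mulr_ge0 ?powR_ge0.
apply: fine_le => //.
- rewrite ge0_integralZl_EFin //; last by move=> z _; rewrite lee_fin mulr_ge0 ?powR_ge0.
  by rewrite fin_numM.
apply: ge0_le_integral => //.
- move=> z _; rewrite -EFinM lee_fin; apply: mulr_ge0 => //.
  by apply: mulr_ge0; [exact: powR_ge0|exact: d0].
- by apply: emeasurable_funM.
- exact: (measurable_int mu iq).
move=> z _; rewrite -EFinM lee_fin mulrA /scaled_density.
case: (boolP (chart z \in E)) => Ez; last by rewrite indicE (negbTE Ez) !mulr0.
rewrite ler_wpM2r ?le //; last exact: set_mem.
exact: d0.
Qed.

(** Lowering the exponent of a number of at most 1/2 multiplies its power by a
    factor at least that of 1/2. *)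
Lemma powR_gap (p q t : R) : 0 < q -> q <= p -> 0 <= t -> t <= 2^-1 ->
  2 `^ (p - q) * t `^ p <= t `^ q.
Proof.
move=> q0 qp t0 t2; have p0 : 0 < p by exact: lt_le_trans qp.
have [->|tn0] := eqVneq t 0; first by rewrite !powR0 ?gt_eqF // mulr0.
have -> : t `^ p = t `^ (p - q) * t `^ q.
  by rewrite -powRD ?subrK //; rewrite tn0 implybT.
rewrite mulrA -powRM //; rewrite ler_piMl ?powR_ge0 //.
apply: le_trans (_ : _ <= 1 `^ (p - q)) _; last by rewrite powR1.
by apply: ge0_ler_powR; rewrite ?nnegrE ?subr_ge0 ?mulr_ge0 //; lra.
Qed.

Lemma powR_gap1 (p q t : R) : 0 < q -> q <= p -> 0 <= t -> t <= 1 -> 1 * t `^ p <= t `^ q.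
Proof.
move=> q0 qp t0 t1; have p0 : 0 < p by exact: lt_le_trans qp.
rewrite mul1r; have [->|tn0] := eqVneq t 0; first by rewrite !powR0 ?gt_eqF.
by apply: ger_powR => //; rewrite lt_neqAle eq_sym tn0 t0.
Qed.

(** The unprimed moments are those at the critical exponent, where both
    conclusions hold with equality for [al' = al]. At a smaller exponent the
    first three gain the factor [l] > 1, which leaves room for [al'] slightly
    below [al]; and this makes the second inequality strict. *)
Lemma fixed_point_gap (al l u1 u2 u3 v1 v2 v3 u1' u2' u3' v1' v2' v3' : R) :
  0 < al -> 1 < l ->
  al = (1 - u1 ^+ 2 - u2 ^+ 2) / u3 ^+ 2 -> al = v3 ^+ 2 / (1 - v1 ^+ 2 - v2 ^+ 2) ->
  0 <= u1 -> 0 <= u2 -> 0 <= u3 -> 0 <= v1 -> 0 <= v2 -> 0 <= v3 ->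
  l * u1 <= u1' -> l * u2 <= u2' -> l * u3 <= u3' ->
  v1 <= v1' -> v2 <= v2' -> v3 <= v3' ->
  exists2 al' : R, 0 < al' & 1 < u1' ^+ 2 + u2' ^+ 2 + al' * u3' ^+ 2 /\
    al' < al' * v1' ^+ 2 + al' * v2' ^+ 2 + v3' ^+ 2.
Proof.
move=> al0 l1 hU hV u10 u20 u30 v10 v20 v30 h1 h2 h3 k1 k2 k3.
have u3n : u3 ^+ 2 != 0 by apply: contraTneq al0 => E; rewrite hU E invr0 mulr0 ltxx.
have Dn : 1 - v1 ^+ 2 - v2 ^+ 2 != 0 by apply: contraTneq al0 => E; rewrite hV E invr0 mulr0 ltxx.
have EU : u1 ^+ 2 + u2 ^+ 2 + al * u3 ^+ 2 = 1 by rewrite {1}hU mulfVK //; ring.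
have EV : v3 ^+ 2 = al * (1 - v1 ^+ 2 - v2 ^+ 2) by rewrite {1}hV mulfVK.
have D0 : 0 < 1 - v1 ^+ 2 - v2 ^+ 2.
  rewrite lt_neqAle eq_sym Dn /= -(pmulr_rge0 _ al0) -EV; exact: sqr_ge0.
have sqle (a b : R) : 0 <= a -> a <= b -> a ^+ 2 <= b ^+ 2.
  by move=> a0 ab; rewrite lerXn2r ?nnegrE // (le_trans a0).
have l0 : 0 < l by lra.
have l2 : 1 < l ^+ 2 by rewrite expr_gt1 // ltW.
have H1 := sqle _ _ (mulr_ge0 (ltW l0) u10) h1.
have H2 := sqle _ _ (mulr_ge0 (ltW l0) u20) h2.
have H3 := sqle _ _ (mulr_ge0 (ltW l0) u30) h3.
have G1 := sqle _ _ v10 k1; have G2 := sqle _ _ v20 k2; have G3 := sqle _ _ v30 k3.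
rewrite !exprMn in H1 H2 H3.
(* half of the relative decrease of [al] that the first inequality can afford
   *)
pose e : R := (1 - (l ^+ 2)^-1) / 2.
have li : 0 < (l ^+ 2)^-1 < 1 by rewrite invr_gt0 exprn_gt0 //= invf_lt1 // exprn_gt0.
have e0 : 0 < e < 1 by apply/andP; rewrite /e; split; lra.
have el : 1 < (1 - e) * l ^+ 2.
  rewrite /e (_ : _ * l ^+ 2 = (l ^+ 2 + 1) / 2); first by lra.
  by field; rewrite gt_eqF.
have [e00 e1] := andP e0.
exists (al * (1 - e)); first by rewrite mulr_gt0 // subr_gt0.
split.
  apply: (@lt_le_trans _ _ ((1 - e) * l ^+ 2 * (u1 ^+ 2 + u2 ^+ 2 + al * u3 ^+ 2))).
    by rewrite EU mulr1.
  have s1 : 0 <= l ^+ 2 * u1 ^+ 2 by rewrite mulr_ge0 ?sqr_ge0.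
  have s2 : 0 <= l ^+ 2 * u2 ^+ 2 by rewrite mulr_ge0 ?sqr_ge0.
  have p3 : al * (1 - e) * (l ^+ 2 * u3 ^+ 2) <= al * (1 - e) * u3' ^+ 2.
    by rewrite ler_wpM2l // mulr_ge0 ?subr_ge0 // ltW.
  nra.
have a1 : 0 <= al * (1 - e) by rewrite mulr_ge0 ?subr_ge0 // ltW.
have q1 : al * (1 - e) * v1 ^+ 2 <= al * (1 - e) * v1' ^+ 2 by rewrite ler_wpM2l.
have q2 : al * (1 - e) * v2 ^+ 2 <= al * (1 - e) * v2' ^+ 2 by rewrite ler_wpM2l.
have gap : 0 < e * (al * (1 - v1 ^+ 2 - v2 ^+ 2)) by rewrite mulr_gt0 // mulr_gt0.
nra.
Qed.

End Comparison.

(** * The lower bound *)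

Section LowerBound.
Local Open Scope classical_set_scope.
Local Open Scope ring_scope.
Variable R : realType.

(** A single leaf is always a common subtree. *)
Lemma total_agreement_pos (T : finType) (A : {set T}) : (0 < #|A|)%N ->
  (num_trees #|A| ^ 2 <= total_agreement A finset.set0)%N.
Proof.
move=> A0; have /card_gt0P[a aA] := A0.
rewrite /total_agreement setU0 -mulnn -{1}size_trees_on -(size_trees_on A) -!sum1_size.
rewrite big_distrl /= big_seq [X in (_ <= X)%N]big_seq; apply: leq_sum => t tA.
rewrite mul1n big_seq [X in (_ <= X)%N]big_seq; apply: leq_sum => t' tA'.
have := @leq_agreement T A finset.set0 (clusters t) (clusters t') [set a]%SET.
rewrite setU0 cards1; apply; first by rewrite sub1set.
by apply: agree1; rewrite ?(support_trees_on tA) ?(support_trees_on tA').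
Qed.

Lemma total_agreement_pos_rooted (T : finType) (A : {set T}) (s : T) : (0 < #|A|)%N -> s \notin A ->
  (num_trees #|A|.+1 ^ 2 <= total_agreement A [set s]%SET)%N.
Proof.
move=> A0 sA; have /card_gt0P[a aA] := A0.
have cA : #|A :|: [set s]%SET| = #|A|.+1 by rewrite setUC cardsU1 sA.
rewrite /total_agreement -mulnn -{1}cA -{1}size_trees_on -cA -(size_trees_on (A :|: _)) -!sum1_size.
rewrite big_distrl /= big_seq [X in (_ <= X)%N]big_seq; apply: leq_sum => t tA.
rewrite mul1n big_seq [X in (_ <= X)%N]big_seq; apply: leq_sum => t' tA'.
have := @leq_agreement T A [set s]%SET (clusters t) (clusters t') [set a]%SET.
rewrite cards1; apply; first by rewrite sub1set.
by apply: agree_pair; rewrite ?(support_trees_on tA) ?(support_trees_on tA') !inE ?aA ?eqxx ?orbT.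
Qed.

Lemma near_step (L a d : R) (f : nat -> R) : a < (1 - d) * L -> 0 < d -> f @ \oo --> L ->
  \forall n \near \oo, a < (1 - d - (d * Num.sqrt n%:R)^-1) * f n.
Proof.
move=> aL d0 fL; apply: (cvgr_gt _ _ _ aL).
apply: cvgM fL.
rewrite -[X in _ --> X]subr0; apply: cvgB; first exact: cvg_cst.
under eq_fun do rewrite invfM.
rewrite -(mulr0 d^-1); apply: cvgMr.
have S : Num.sqrt n%:R^-1 @[n --> \oo] --> Num.sqrt (0 : R).
  by apply: (cvg_comp _ _ (@inv_nat_cvg R)); exact: sqrt_continuous.
rewrite sqrtr0 in S; apply: cvg_trans S; apply: near_eq_cvg; apply: nearW => n.
by rewrite sqrtrV.
Qed.

Variables (b al : R).
Hypothesis b0 : 0 < b.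
Hypothesis b1 : b <= 1.
Hypothesis al0 : 0 < al.

(** Strong induction on the size of [A]. For small sets [M] makes the claim
    follow from the trivial common subtree. For large sets the strict
    inequalities on [LF] and [LG] absorb the loss by concentration and the
    error of the limit. *)
Lemma agreement_lower_bound (LF LG : R) :
  1 < LF -> al < LG ->
  (central_moment b size1 n ^+ 2 + central_moment b size2 n ^+ 2 +
     al * central_moment b size3 n ^+ 2 : R) @[n --> \oo] --> LF ->
  (al * spinal_moment b size1 n ^+ 2 + al * spinal_moment b size2 n ^+ 2 +
     spinal_moment b size3 n ^+ 2 : R) @[n --> \oo] --> LG ->
  exists2 c : R, 0 < c & forall (T : finType) (A : {set T}) (s : T), s \notin A ->
    c * #|A|%:R `^ b * (num_trees #|A|)%:R ^+ 2 <= (total_agreement A finset.set0)%:R /\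
    c * al * #|A|%:R `^ b * (num_trees #|A|.+1)%:R ^+ 2 <= (total_agreement A [set s]%SET)%:R.
Proof.
move=> LF1 LGa cF cG.
have LF0 : 0 < LF by lra.
have LG0 : 0 < LG by exact: lt_trans LGa.
pose d := Num.min ((LF - 1) / (2 * LF)) ((LG - al) / (2 * LG)).
have dF : d <= (LF - 1) / (2 * LF) by rewrite /d ge_min lexx.
have dG : d <= (LG - al) / (2 * LG) by rewrite /d ge_min lexx orbT.
have d0 : 0 < d by rewrite /d lt_min !divr_gt0 ?mulr_gt0 ?subr_gt0.
have F1 : 1 < (1 - d) * LF by move: dF; rewrite ler_pdivlMr ?mulr_gt0 //; lra.
have G1 : al < (1 - d) * LG by move: dG; rewrite ler_pdivlMr ?mulr_gt0 //; lra.
have [N _ HN] : \forall n \near \oo,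
    1 < (1 - d - (d * Num.sqrt n%:R)^-1) * (central_moment b size1 n ^+ 2 + central_moment b size2 n ^+ 2 +
     al * central_moment b size3 n ^+ 2) /\
    al < (1 - d - (d * Num.sqrt n%:R)^-1) * (al * spinal_moment b size1 n ^+ 2 + al * spinal_moment b size2 n ^+ 2 +
     spinal_moment b size3 n ^+ 2).
  by apply: filterS2 (near_step F1 d0 cF) (near_step G1 d0 cG) => n /= ? ?.
pose M := N.+2%:R `^ b * (1 + al).
have al1 : 0 < al := al0.
have M0 : 0 < M by rewrite mulr_gt0 ?powR_gt0 ?ltr0n // addr_gt0.
exists M^-1; first by rewrite invr_gt0.
have base (m : nat) : (m <= N.+2)%N -> M^-1 * m%:R `^ b <= 1 /\ M^-1 * al * m%:R `^ b <= 1.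
  move=> mN; have : m%:R `^ b <= N.+2%:R `^ b :> R.
    by apply: ge0_ler_powR; rewrite ?nnegrE ?(ltW b0) ?ler0n ?ler_nat.
  set p := m%:R `^ b; set q := N.+2%:R `^ b => pq.
  have p0 : 0 <= p by exact: powR_ge0.
  rewrite -mulrA ![M^-1 * _]mulrC !ler_pdivrMr // mul1r /M -/q.
  by split; nra.
move=> T A s; have [k] := ubnP #|A|; elim: k A => // k IHk A; rewrite ltnS => Ak sA.
have [A0|A0] := posnP #|A|.
  by rewrite A0 powR0 ?gt_eqF // !mulr0 !mul0r !ler0n.
have IHF (I : {set T}) : I \subset A -> (#|I| < #|A|)%N ->
    M^-1 * #|I|%:R `^ b * (num_trees #|I|)%:R ^+ 2 <= (total_agreement I finset.set0)%:R.
  move=> IA cI; have [] // := IHk I; first exact: leq_trans cI Ak.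
  by apply: contra sA; exact: (subsetP IA).
have IHG (I : {set T}) : I \subset A -> (#|I| < #|A|)%N ->
    M^-1 * al * #|I|%:R `^ b * (num_trees #|I|.+1)%:R ^+ 2 <= (total_agreement I [set s]%SET)%:R.
  move=> IA cI; have [] // := IHk I; first exact: leq_trans cI Ak.
  by apply: contra sA; exact: (subsetP IA).
have [small|big] := leqP #|A| N.+2.
  have [B1 B2] := base _ small.
  split.
    apply: (@le_trans _ _ (1 * (num_trees #|A|)%:R ^+ 2)); first by rewrite ler_wpM2r ?sqr_ge0.
    by rewrite mul1r -natrX ler_nat total_agreement_pos.
  apply: (@le_trans _ _ (1 * (num_trees #|A|.+1)%:R ^+ 2)); first by rewrite ler_wpM2r ?sqr_ge0.
  by rewrite mul1r -natrX ler_nat total_agreement_pos_rooted.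
have A1 : (1 < #|A|)%N by apply: leq_trans big.
have [HF HG] := HN #|A| (leq_trans (leqW (leqnSn N)) (ltnW big)).
have c0 : 0 <= M^-1 by rewrite invr_ge0 ltW.
have cb0 : 0 <= M^-1 * #|A|%:R `^ b by rewrite mulr_ge0 ?powR_ge0.
split.
  apply: le_trans (central_step sA A1 b0 b1 c0 (ltW al0) d0 IHF IHG).
  rewrite ler_wpM2r ?sqr_ge0 // [leRHS]mulrCA -[leLHS]mulr1.
  by rewrite ler_wpM2l // ltW.
apply: le_trans (spinal_step sA A1 b0 b1 c0 (ltW al0) d0 IHF IHG).
rewrite ler_wpM2r ?sqr_ge0 // [leRHS]mulrCA mulrAC.
by rewrite ler_wpM2l // ltW.
Qed.

End LowerBound.

Local Open Scope classical_set_scope.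
Local Open Scope ring_scope.

(** * Expected size of the largest common subtree *)

Section Conclusion.
Variable R : realType.

Lemma moment_ge0 (P : probability (real_triple R) R) X b : 0 <= moment P X b.
Proof.
rewrite /moment fine_ge0 // unlock; apply: integral_ge0 => x _.
by rewrite lee_fin powR_ge0.
Qed.

Lemma U_domain_bounds (x : real_triple R) : U_domain x ->
  [/\ 0 <= coord1 x <= 2^-1, 0 <= coord2 x <= 2^-1 & 0 <= coord3 x <= 2^-1].
Proof.
move=> [[x1 x2 x3 s1] [h1 h2 h3]]; rewrite x1 x2 x3 h2 h3 /=; split=> //.
exact: le_trans h2.
Qed.

Lemma V_domain_bounds (x : real_triple R) : V_domain x ->
  [/\ 0 <= coord1 x <= 1, 0 <= coord2 x <= 1 & 0 <= coord3 x <= 1].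
Proof. by move=> [[x1 x2 x3 s1] [h1 h2]]; split; apply/andP; split => //; lra. Qed.

(** Every class is read by the same number of plane trees with n - 1 leaves,
    so the expectation over pairs of classes is one over pairs of plane trees.
    *)
Lemma expected_kappa_ge (n : nat) (L : R) : (1 < n)%N ->
  (forall rho : 'I_n, L * (num_trees n.-1)%:R ^+ 2 <=
     (total_agreement (~: [set rho])%SET finset.set0)%:R) ->
  L <= expected_kappa R n.
Proof.
move=> n1 H; pose rho := Ordinal (ltnW n1).
have := le_trans (H rho) (_ : _ <= (((2 ^ (n - 2)) ^ 2 *
   \sum_(c in tree_classes n) \sum_(c' in tree_classes n) kappa_class c c')%N%:R : R)).
rewrite ler_nat total_agreement_le // => /(_ isT).
have w0 : (0 < num_trees n.-1)%N by apply: num_trees_gt0; lia.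
move: w0; rewrite (card_tree_classes rho n1) muln_gt0 => /andP[p0 t0].
rewrite !natrM !natrX exprMn mulrCA ler_pM2l ?exprn_gt0 ?ltr0n //.
rewrite /expected_kappa ler_pdivlMr ?natrX ?exprn_gt0 ?ltr0n // => h.
apply: le_trans h _; rewrite natr_sum le_eqVlt; apply/orP; left; apply/eqP.
by apply: eq_bigr => c _; rewrite natr_sum.
Qed.

(** The induction needs a positive exponent, while [beta'] may be negative. *)
Lemma intermediate_exponent (beta beta' : R) : 0 < beta -> beta <= 1 -> beta' < beta ->
  exists b : R, [/\ beta' <= b, 0 < b, b < beta & b <= 1].
Proof.
move=> B0 B1 bB; exists (Num.max beta' (beta / 2)).
by rewrite le_max lexx lt_max gt_max ge_max bB /=; split; try apply/orP; try apply/andP; try right; try split; lra.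
Qed.

Lemma size1_le m k l : (k + l <= m)%N -> (size1 m k l <= m)%N.
Proof. by rewrite /size1; lia. Qed.

Lemma size2_le m k l : (k + l <= m)%N -> (size2 m k l <= m)%N.
Proof. by rewrite /size2; lia. Qed.

Lemma size3_le m k l : (k + l <= m)%N -> (size3 m k l <= m)%N.
Proof. by rewrite /size3; lia. Qed.

Lemma coord3_pos (u v : R) : 0 < u -> 0 < v -> u + v < 1 -> 0 < coord3 (chart (u, v)).
Proof. by rewrite /coord3 /=; lra. Qed.

Lemma half_pred (n : nat) : (1 < n)%N -> 2^-1 * n%:R <= n.-1%:R :> R.
Proof. by move=> n1; rewrite ler_pdivrMl // -natrM ler_nat; lia. Qed.

Section Gaps.
Variables (c p q : R) (x : nat -> nat -> nat -> nat) (X : real_triple R -> R).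
Hypothesis qc : catalan_sqrt R @ \oo --> c.
Hypothesis c0 : 0 < c.
Hypothesis q0 : 0 < q.
Hypothesis qp : q <= p.
Hypothesis x_le : forall m k l, (k + l <= m)%N -> (x m k l <= m)%N.
Hypothesis mX : measurable_fun [set: real_triple R] X.
Hypothesis X_pos : forall u v, 0 < u -> 0 < v -> u + v < 1 -> 0 < X (chart (u, v)).
Hypothesis x_cvg : forall u v : R, 0 < u -> 0 < v -> u + v < 1 ->
  (x n (Num.trunc (n%:R * u)) (Num.trunc (n%:R * v)))%:R / n%:R @[n --> \oo] --> X (chart (u, v)).

Let p0 : 0 < p. Proof. exact: lt_le_trans qp. Qed.
Let c20 : 0 < c ^+ 2 / 2. Proof. by rewrite divr_gt0 // exprn_gt0. Qed.

(** All coordinates of the law of [U_law] are at most 1/2. *)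
Lemma U_moment_gap : (forall t, U_domain t -> 0 <= X t <= 2^-1) ->
  2 `^ (p - q) * moment (U_law R) X p <= moment (U_law R) X q.
Proof.
move=> bX.
have [ip _] := U_moment_cvg qc c0 p0 x_le mX X_pos x_cvg.
have [iq _] := U_moment_cvg qc c0 q0 x_le mX X_pos x_cvg.
apply: (le_moment (@measurable_U_domain R) c20 (U_total qc c0) mX ip iq); first exact: powR_ge0.
by move=> t /bX/andP[t0 t1]; exact: powR_gap.
Qed.

Lemma V_moment_gap : (forall t, V_domain t -> 0 <= X t <= 1) ->
  moment (V_law R) X p <= moment (V_law R) X q.
Proof.
move=> bX; rewrite -[leLHS]mul1r.
have [ip _] := V_moment_cvg qc c0 p0 x_le mX X_pos x_cvg.
have [iq _] := V_moment_cvg qc c0 q0 x_le mX X_pos x_cvg.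
apply: (le_moment (@measurable_V_domain R) c20 (V_total qc c0) mX ip iq) => //.
by move=> t /bX/andP[t0 t1]; exact: powR_gap1.
Qed.

End Gaps.

End Conclusion.

Theorem theorem1p1 (R : realType) (alpha beta : R)
    (hbeta : 4464 / 10000 < beta < 4465 / 10000)
    (halpha : 0 < alpha)
    (hU : alpha =
      (1 - moment (U_law R) (@coord1 R) beta ^+ 2
         - moment (U_law R) (@coord2 R) beta ^+ 2)
      / moment (U_law R) (@coord3 R) beta ^+ 2)
    (hV : alpha =
      moment (V_law R) (@coord3 R) beta ^+ 2
      / (1 - moment (V_law R) (@coord1 R) beta ^+ 2
           - moment (V_law R) (@coord2 R) beta ^+ 2))
    (beta' : R) (hbeta' : beta' < beta) :
  (fun n : nat => expected_kappa R n : R^o) =Omega_\oo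
  (fun n : nat => n%:R `^ beta' : R^o).
Proof.
have [B0 B1] : 0 < beta /\ beta <= 1 by clear -hbeta; lra.
have [b [bb' b0 bB b1]] := intermediate_exponent B0 B1 hbeta'.
have [c c0 qc] := catalan_sqrt_cvg R.
have c20 : 0 < c ^+ 2 / 2 by rewrite divr_gt0 // exprn_gt0.
have m1 := @measurable_coord1 R; have m2 := @measurable_coord2 R; have m3 := @measurable_coord3 R.
have s1 := size1_le; have s2 := size2_le; have s3 := size3_le.
have p1 (u v : R) : 0 < u -> 0 < v -> u + v < 1 -> 0 < coord1 (chart (u, v)) by [].
have p2 (u v : R) : 0 < u -> 0 < v -> u + v < 1 -> 0 < coord2 (chart (u, v)) by [].
have p3 := @coord3_pos R.
have z3 := size3_cvg c0.
have [_ cU1] := U_moment_cvg qc c0 b0 s1 m1 p1 (@size1_cvg R).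
have [_ cU2] := U_moment_cvg qc c0 b0 s2 m2 p2 (@size2_cvg R).
have [_ cU3] := U_moment_cvg qc c0 b0 s3 m3 p3 z3.
have [_ cV1] := V_moment_cvg qc c0 b0 s1 m1 p1 (@size1_cvg R).
have [_ cV2] := V_moment_cvg qc c0 b0 s2 m2 p2 (@size2_cvg R).
have [_ cV3] := V_moment_cvg qc c0 b0 s3 m3 p3 z3.
pose l : R := 2 `^ (beta - b).
have l1 : 1 < l.
  have : 1 `^ (beta - b) < 2 `^ (beta - b).
    by apply: gt0_ltr_powR; rewrite ?subr_gt0 ?nnegrE ?ltr1n.
  by rewrite powR1.
have bB' := ltW bB.
have U1 := U_moment_gap qc c0 b0 bB' s1 m1 p1 (@size1_cvg R) (fun x h => let: And3 k _ _ := U_domain_bounds h in k).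
have U2 := U_moment_gap qc c0 b0 bB' s2 m2 p2 (@size2_cvg R) (fun x h => let: And3 _ k _ := U_domain_bounds h in k).
have U3 := U_moment_gap qc c0 b0 bB' s3 m3 p3 z3 (fun x h => let: And3 _ _ k := U_domain_bounds h in k).
have V1 := V_moment_gap qc c0 b0 bB' s1 m1 p1 (@size1_cvg R) (fun x h => let: And3 k _ _ := V_domain_bounds h in k).
have V2 := V_moment_gap qc c0 b0 bB' s2 m2 p2 (@size2_cvg R) (fun x h => let: And3 _ k _ := V_domain_bounds h in k).
have V3 := V_moment_gap qc c0 b0 bB' s3 m3 p3 z3 (fun x h => let: And3 _ _ k := V_domain_bounds h in k).
have [al al0 [LF LG]] := fixed_point_gap halpha l1 hU hV (moment_ge0 _ _ _) (moment_ge0 _ _ _)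
  (moment_ge0 _ _ _) (moment_ge0 _ _ _) (moment_ge0 _ _ _) (moment_ge0 _ _ _) U1 U2 U3 V1 V2 V3.
have sq (f : nat -> R) (t : R) : f @ \oo --> t -> f n ^+ 2 @[n --> \oo] --> t ^+ 2.
  by move=> ft; under eq_fun do rewrite expr2; rewrite expr2; exact: cvgM.
have cF : central_moment b size1 n ^+ 2 + central_moment b size2 n ^+ 2 +
    al * central_moment b size3 n ^+ 2 @[n --> \oo] --> moment (U_law R) (@coord1 R) b ^+ 2 +
    moment (U_law R) (@coord2 R) b ^+ 2 + al * moment (U_law R) (@coord3 R) b ^+ 2.
  by apply: cvgD; [apply: cvgD|apply: cvgMr]; exact: sq.
have cG : al * spinal_moment b size1 n ^+ 2 + al * spinal_moment b size2 n ^+ 2 +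
    spinal_moment b size3 n ^+ 2 @[n --> \oo] --> al * moment (V_law R) (@coord1 R) b ^+ 2 +
    al * moment (V_law R) (@coord2 R) b ^+ 2 + moment (V_law R) (@coord3 R) b ^+ 2.
  by apply: cvgD; [apply: cvgD; apply: cvgMr|]; exact: sq.
have [C C0 HC] := agreement_lower_bound b0 b1 al0 LF LG cF cG.
rewrite eqOmegaE qualifE; apply/asboolP.
exists (C * 2^-1 `^ b); first by rewrite mulr_gt0 // powR_gt0 // invr_gt0.
near=> n.
have n1 : (1 < n)%N by near: n; exists 2%N.
have E : C * n.-1%:R `^ b <= expected_kappa R n.
  apply: expected_kappa_ge => // rho.
  have rA : rho \notin (~: [set rho])%SET by rewrite !inE eqxx.
  have cA : #|(~: [set rho])%SET| = n.-1 by rewrite cardsC1 card_ord.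
  by have [+ _] := HC _ _ _ rA; rewrite cA.
rewrite !ger0_norm ?powR_ge0 //; last by apply: le_trans E; rewrite mulr_ge0 ?powR_ge0 // ltW.
apply: le_trans E; rewrite -mulrA ler_pM2l //.
have n1R : 1 <= n%:R :> R by rewrite ler1n ltnW.
apply: (@le_trans _ _ (2^-1 `^ b * n%:R `^ b)).
  by rewrite ler_wpM2l ?powR_ge0 // ler_powR.
rewrite -powRM ?invr_ge0 //; apply: ge0_ler_powR; rewrite ?nnegrE ?mulr_ge0 ?invr_ge0 ?(ltW b0) //.
exact: half_pred.
Unshelve. all: by end_near. Qed.
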